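(* Let $N\ge 1$, $m>1$, $q\in(0,1)$, $\sigma=\frac{2(1-q)}{m-1}$, and assume $m+q>2$. Then there exist a unique exponent $\beta_*\in(0,\infty)$, with corresponding $\alpha_*=\frac{2}{m-1}\beta_*$, and a unique non-negative radially symmetric self-similar solution in exponential form $$U_*(t,x)=e^{-\alpha_* t}f_*\big(|x|e^{\beta_* t}\big),\qquad (t,x)\in\mathbb{R}\times\mathbb{R}^N,$$ to the equation $\partial_t u-\Delta u^m+|x|^\sigma u^q=0$, where the profile $f_*$ is a solution to $$(f^m)''(\xi)+\frac{N-1}{\xi}(f^m)'(\xi)+\alpha f(\xi)-\beta\xi f'(\xi)-\xi^\sigma f^q(\xi)=0,\qquad \xi>0,$$ with $(\alpha,\beta)=(\alpha_*,\beta_* )$, such that $\mathrm{supp}\, f_*=[1,\xi_0]$ for some $\xi_0\in(1,\infty)$.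
   Context: $N\ge1$ is the space dimension. A self-similar solution in exponential form is a function $u(t,x)=e^{-\alpha t}f(|x|e^{\beta t})$ with $\alpha=\frac{2}{m-1}\beta$, $\beta>0$, whose profile $f$ solves the ordinary differential equation $(f^m)''(\xi)+\frac{N-1}{\xi}(f^m)'(\xi)+\alpha f(\xi)-\beta\xi f'(\xi)-\xi^\sigma f^q(\xi)=0$, $\xi>0$; it is then a (weak) solution of the partial differential equation $\partial_t u-\Delta u^m+|x|^\sigma u^q=0$ on $\mathbb{R}\times\mathbb{R}^N$. A solution (profile) with support $[\xi_*,\xi_0]\subset(0,\infty)$ is a continuous function $f:[0,\infty)\to[0,\infty)$ with $f^m\in C^1([0,\infty))$ such that $f=0$ outside $(\xi_*,\xi_0)$, $f>0$ on $(\xi_*,\xi_0)$, the differential equation holds in the classical sense on $(\xi_*,\xi_0)$, and the contact conditions $(f^m)'(\xi_* )=(f^m)'(\xi_0)=0$ hold at both edges of the support ($f$ has a dead core at $\xi_*$ and an interface at $\xi_0$). *)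

(* Defs.v *)
From HB Require Import structures.
From mathcomp Require Import all_boot all_order all_algebra.
From mathcomp Require Import all_classical all_reals all_analysis.
Set Implicit Arguments.
Unset Strict Implicit.
Unset Printing Implicit Defensive.
Import Order.TTheory GRing.Theory Num.Theory.
Import numFieldNormedType.Exports.
Local Open Scope classical_set_scope.
Local Open Scope ring_scope.

(** Powers of non-negative reals are [powR]; since the exponents [m], [q] and
    [sigma] are positive, [0 `^ m = 0 `^ q = 0 `^ sigma = 0] as expected. *)

(** C^1([0, +oo)): C^1 in the interior, with a derivative that extends
    continuously to 0.  Only the values of [g] on [0, +oo) matter. *)
Definition C1_halfline (R : realType) (g : R -> R) : Prop :=
  {within `[0, +oo[, continuous g} /\
  exists2 dg : R -> R, {within `[0, +oo[, continuous dg} &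
    forall xi : R, 0 < xi -> is_derive xi 1 g (dg xi).

Definition alpha_of (R : realType) (m beta : R) : R := 2 / (m - 1) * beta.

Definition profile_ode (R : realType) (N : nat) (m q sigma alpha beta : R)
    (f : R -> R) (xi : R) : Prop :=
  let fm := fun z : R => f z `^ m in
  [/\ derivable f xi 1,
      derivable fm xi 1,
      derivable (derive1 fm) xi 1 &
      derive1 (derive1 fm) xi + (N%:R - 1) / xi * derive1 fm xi
      + alpha * f xi - beta * xi * derive1 f xi - xi `^ sigma * f xi `^ q = 0].

Record profile_with_support (R : realType) (N : nat)
    (m q sigma alpha beta xis xi0 : R) (f : R -> R) : Prop := {
  profile_ge0 : forall xi, 0 <= xi -> 0 <= f xi ;
  profile_continuous : {within `[0, +oo[, continuous f} ;
  profile_C1 : C1_halfline (fun xi => f xi `^ m) ;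
  profile_out : forall xi, 0 <= xi -> ~~ (xis < xi < xi0) -> f xi = 0 ;
  profile_gt0 : forall xi, xis < xi < xi0 -> 0 < f xi ;
  profile_eq : forall xi, xis < xi < xi0 ->
    profile_ode N m q sigma alpha beta f xi ;
  profile_contact_core : derive1 (fun xi => f xi `^ m) xis = 0 ;
  profile_contact_interface : derive1 (fun xi => f xi `^ m) xi0 = 0
}.

(** The library norm on ['rV[R]_N] is the sup norm; [|x|] in the equation is
    the Euclidean one. *)
Definition enorm (R : realType) (N : nat) (x : 'rV[R]_N) : R :=
  Num.sqrt (\sum_(i < N) x 0 i ^+ 2).

Definition exp_selfsimilar (R : realType) (N : nat) (alpha beta : R)
    (f : R -> R) (t : R) (x : 'rV[R]_N) : R :=
  expR (- alpha * t) * f (enorm x * expR (beta * t)).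

Definition partial (R : realType) (N : nat) (i : 'I_N)
    (g : 'rV[R]_N -> R) (x : 'rV[R]_N) : R :=
  'D_(delta_mx 0 i) g x.

Definition jcontinuous (R : realType) (N : nat)
    (g : R -> 'rV[R]_N -> R) : Prop :=
  continuous (fun p : R * 'rV[R]_N => g p.1 p.2).

Definition spatially_C1 (R : realType) (N : nat)
    (g : R -> 'rV[R]_N -> R) : Prop :=
  forall i : 'I_N,
    (forall t x, derivable (g t) x (delta_mx 0 i)) /\
    jcontinuous (fun t => partial i (g t)).

Record test_function (R : realType) (N : nat)
    (phi : R -> 'rV[R]_N -> R) : Prop := {
  test_continuous : jcontinuous phi ;
  test_derivable_t : forall t x, derivable (phi ^~ x) t 1 ;
  test_C1_t : jcontinuous (fun t x => derive1 (phi ^~ x) t) ;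
  test_C1_x : spatially_C1 phi ;
  test_compact_support : exists A : R, forall t x,
    phi t x != 0 -> `|t| <= A /\ enorm x <= A
}.

(** Lebesgue integral over R^N, as an iterated integral.  It is only applied
    (see [weak_solution]) to continuous compactly supported integrands, for
    which it is the integral against N-dimensional Lebesgue measure. *)
Fixpoint integral_rV (R : realType) (N : nat) : ('rV[R]_N -> R) -> R :=
  match N return ('rV[R]_N -> R) -> R with
  | 0%N => fun g => g 0
  | N'.+1 => fun g =>
      \int[@lebesgue_measure R]_(y in setT)
        integral_rV (fun x : 'rV[R]_N' =>
          g (row_mx (y%:M : 'M[R]_1) x : 'rV[R]_(1 + N')))
  end.

(** Weak solution on R x R^N of  u_t - Lap(u^m) + |x|^sigma u^q = 0. *)
Record weak_solution (R : realType) (N : nat) (m q sigma : R)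
    (u : R -> 'rV[R]_N -> R) : Prop := {
  weak_ge0 : forall t x, 0 <= u t x ;
  weak_continuous : jcontinuous u ;
  weak_spatially_C1 : spatially_C1 (fun t x => u t x `^ m) ;
  weak_identity : forall phi : R -> 'rV[R]_N -> R, test_function phi ->
    \int[@lebesgue_measure R]_(t in setT)
      integral_rV (fun x : 'rV[R]_N =>
        - u t x * derive1 (phi ^~ x) t
        + \sum_(i < N)
            partial i (fun y => u t y `^ m) x * partial i (phi t) x
        + enorm x `^ sigma * u t x `^ q * phi t x) = 0
}.

(* Main.v *)
Require Import Defs.
From mathcomp Require Import all_boot all_order all_algebra.
From mathcomp Require Import all_classical all_reals all_analysis.
From mathcomp Require Import ring lra.
Set Implicit Arguments.
Unset Strict Implicit.
Unset Printing Implicit Defensive.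
Import Order.TTheory GRing.Theory Num.Theory.
Import numFieldNormedType.Exports.
Local Open Scope classical_set_scope.
Local Open Scope ring_scope.

(** Why the theorem holds.

    The equation is invariant under scaling, and in the variables
    [w = xi ^ (- 2 / (m - 1)) f], [Y = d (w ^ m) / d ln xi] the profile
    equation loses its independent variable. In a suitable clock it reads
    [w' = Y], [Y' = (beta - drag w) Y + react w], a planar system with two
    equilibria: the origin, and a point [(weq, 0)] with [react > 0] to its left
    and [react < 0] to its right. A profile with support [[1, xi0]] is an orbit
    in [w > 0] that leaves the origin and comes back to it; the position [1] of
    the dead core only normalises [xi]. So one has to find the [beta] for which
    the arc that leaves the origin upwards, [start_branch], is homoclinic.

    Existence is shooting in [beta]. For small [beta] the flux [Y + k w ^ m]
    stays below its equilibrium value and the arc never comes down ([sh_low]);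
    for large [beta] it overshoots [weq] so far that it falls through [w = 0]
    ([sh_high]). Falling through is an open condition, so the infimum of the
    exponents that do so does not itself ([critical_exponent]). Its trajectory
    is a limit of trajectories with a single rise and a single fall, and it can
    stop neither on the way up nor on the way down: it rises beyond [weq],
    turns, and falls to the origin ([crit_turn], [crit_limit]). It returns along
    the slow direction, [- Y >= c w ^ (m + q - 1)] ([crit_lower]); together with
    the exponential departure this bounds [ln xi] in both directions
    ([clock_bounded]), whence a compact support away from the origin.

    Uniqueness is a comparison of graphs [Y = Y(w)], solutions of
    [dY / dw = beta - drag w + react w / Y]. An orbit from the origin to itself
    consists of one rise and one fall ([single_bump]). On the rise a larger
    [beta] leads to a higher maximum of [w]; the fall, run backwards, is a rise
    with the opposite coefficient, so that a larger [beta] leads to a lower one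
    ([arc_strict]). Hence at most one [beta] is possible, and for that one the
    arcs, and then the clocks along them, coincide ([profile_unique]).

    Finally, [u = e ^ (- alpha t) f(|x| e ^ (beta t))] is a weak solution because
    the flux [grad u ^ m - beta x u] is continuously differentiable across the
    edges of the support, although [u] is not. The remaining part
    [partial_t u - beta div (x u)] of the equation is plain transport, for which
    [u] may be replaced by smooth self-similar functions that approach it
    uniformly ([weak_identity_selfsim]). *)

(** * One-variable calculus *)

Section Calc.
Context {R : realType}.
Implicit Types (f g df : R -> R) (a b c t x y e r : R).

(** [is_derive] specialised to real functions and hidden from type class
    resolution, so that derivatives are built by explicit rules only. *)
Definition isD f x (d : R) : Prop := is_derive x (1:R) f d.

Lemma isD_eq f x a b : isD f x a -> a = b -> isD f x b.
Proof. by move=> h <-. Qed.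
Lemma isD_add f g x a b : isD f x a -> isD g x b ->
  isD (fun t => f t + g t) x (a + b).
Proof. by move=> h1 h2; exact: is_deriveD. Qed.
Lemma isD_opp f x a : isD f x a -> isD (fun t => - f t) x (- a).
Proof. by move=> h1; exact: is_deriveN. Qed.
Lemma isD_sub f g x a b : isD f x a -> isD g x b ->
  isD (fun t => f t - g t) x (a - b).
Proof. by move=> h1 h2; exact: is_deriveB. Qed.
Lemma isD_mul f g x a b : isD f x a -> isD g x b ->
  isD (fun t => f t * g t) x (a * g x + f x * b).
Proof.
rewrite /isD => h1 h2; apply: (is_derive_eq (is_deriveM h1 h2)).
by rewrite /GRing.scale /=; ring.
Qed.
Lemma isD_cst x c : isD (fun _ : R => c) x 0.
Proof. exact: is_derive_cst. Qed.
Lemma isD_id x : isD (fun t : R => t) x 1.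
Proof. exact: is_derive_id. Qed.
Lemma isD_comp f g x a b : isD f (g x) a -> isD g x b ->
  isD (fun t => f (g t)) x (a * b).
Proof. by move=> h1 h2; exact: (@is_derive1_comp _ f g). Qed.
Lemma isD_expR f x a : isD f x a ->
  isD (fun t => expR (f t)) x (expR (f x) * a).
Proof. by move=> h; apply: isD_comp => //; exact: is_derive_expR. Qed.
Lemma isD_powR f x a p : 0 < f x -> isD f x a ->
  isD (fun t => f t `^ p) x (p * f x `^ (p - 1) * a).
Proof.
move=> fx h; apply: (@isD_comp (fun t => t `^ p)) => //.
exact: is_derive1_powR.
Qed.
Lemma isD_inv f x a : f x != 0 -> isD f x a ->
  isD (fun t => (f t)^-1) x (- a / (f x) ^+ 2).
Proof.
rewrite /isD => fx h; apply: (is_derive_eq (is_deriveV fx h)).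
by rewrite /GRing.scale /= -exprVn; ring.
Qed.
Lemma isD_ln f x a : 0 < f x -> isD f x a ->
  isD (fun t => ln (f t)) x (a / f x).
Proof.
move=> fx h; apply: isD_eq; first by apply: (@isD_comp (@ln R)) h; exact: is_derive1_ln.
by rewrite mulrC.
Qed.
Lemma isD_derivable f x a : isD f x a -> derivable f x 1.
Proof. by case. Qed.
Lemma isD_derive1 f x a : isD f x a -> derive1 f x = a.
Proof. by rewrite /isD => h; rewrite derive1E derive_val. Qed.
Lemma isD_unique f x a b : isD f x a -> isD f x b -> a = b.
Proof. by move=> /isD_derive1 <- /isD_derive1 <-. Qed.
Lemma derivable_isD f x : derivable f x 1 -> isD f x (derive1 f x).
Proof. by move=> h; rewrite derive1E; exact: derivableP. Qed.

Lemma isD_near f g x a : isD f x a ->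
  (exists2 e : R, 0 < e & forall y, `|y - x| < e -> f y = g y) -> isD g x a.
Proof.
move=> h [e e0 fg]; apply: near_eq_is_derive h.
by exists e => //= y; rewrite /ball /= distrC => /fg.
Qed.

Lemma isD_sqr f x a : isD f x a ->
  isD (fun t => f t ^+ 2) x (2 * f x * a).
Proof.
move=> h; apply: (isD_near (isD_eq (isD_mul h h) _)); first ring.
by exists 1 => // y _; rewrite expr2.
Qed.
Lemma isD_cont f x a : isD f x a -> {for x, continuous f}.
Proof.
move=> [h _]; apply: differentiable_continuous; exact/derivable1_diffP.
Qed.

Lemma cont_epsP f x : {for x, continuous f} <->
  forall e, 0 < e -> exists2 d, 0 < d & forall y, `|y - x| < d -> `|f y - f x| < e.
Proof.
split.
  move=> /cvgrPdist_lt h e e0; have := h e e0.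
  move=> /nbhs_ballP [d /= d0 hd]; exists d => // y yx.
  by rewrite distrC; apply: hd; rewrite /ball /= distrC.
move=> h; apply/cvgrPdist_lt => e e0; have [d d0 hd] := h e e0.
apply/nbhs_ballP; exists d => // y; rewrite /ball /= => yx.
by rewrite distrC; apply: hd; rewrite distrC.
Qed.

Lemma cont_within f a b : (forall t, a <= t <= b -> {for t, continuous f}) ->
  {within `[a, b], continuous f}.
Proof.
move=> h; apply: continuous_in_subspaceT => t; rewrite inE /= in_itv /= => tab.
exact: h.
Qed.

Lemma cont_gt0 f x : {for x, continuous f} -> 0 < f x ->
  exists2 d, 0 < d & forall y, `|y - x| < d -> 0 < f y.
Proof.
move=> /cont_epsP h fx; have [d d0 hd] := h _ fx; exists d => // y /hd.
by rewrite ltr_norml => /andP[h1 _]; lra.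
Qed.

Lemma isD_refl f x d : isD f (- x) d -> isD (fun t => f (- t)) x (- d).
Proof.
move=> h; apply: isD_eq; first by apply: (@isD_comp f (fun t => - t)) h (isD_opp (isD_id x)).
ring.
Qed.

Lemma mvt f df a b : a < b -> (forall t, a <= t <= b -> isD f t (df t)) ->
  exists2 c, a < c < b & f b - f a = df c * (b - a).
Proof.
move=> ab h; have [||c] := @MVT _ f df a b ab.
- by move=> x; rewrite in_itv /= => /andP[h1 h2]; apply: h; rewrite !ltW.
- by apply: cont_within => t /h; exact: isD_cont.
by rewrite in_itv /= => cab e; exists c.
Qed.

Lemma ndecr f df a b : a <= b -> (forall t, a <= t <= b -> isD f t (df t)) ->
  (forall t, a < t < b -> 0 <= df t) -> f a <= f b.
Proof.
rewrite le_eqVlt => /orP[/eqP -> //|ab] h h0.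
have [c cab e] := mvt ab h; have := h0 c cab; nra.
Qed.
Lemma nincr f df a b : a <= b -> (forall t, a <= t <= b -> isD f t (df t)) ->
  (forall t, a < t < b -> df t <= 0) -> f b <= f a.
Proof.
rewrite le_eqVlt => /orP[/eqP -> //|ab] h h0.
have [c cab e] := mvt ab h; have := h0 c cab; nra.
Qed.
Lemma incr f df a b : a < b -> (forall t, a <= t <= b -> isD f t (df t)) ->
  (forall t, a < t < b -> 0 < df t) -> f a < f b.
Proof.
move=> ab h h0.
have [c cab e] := mvt ab h; have := h0 c cab; nra.
Qed.

Lemma isD_incr_near f x a : isD f x a -> 0 < a ->
  exists2 d, 0 < d & (forall y, x < y < x + d -> f x < f y) /\
                     (forall y, x - d < y < x -> f y < f x).
Proof.
move=> h a0.
have hd : h^-1 *: (f (h + x) - f x) @[h --> (0:R)^'] --> a.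
  have [/cvg_ex[l hl] e] := h.
  have : 'D_1 f x = l.
    by rewrite /derive; apply/cvg_lim => //; apply: cvg_trans hl; apply: near_eq_cvg; near=> k.
  rewrite e => ->; apply: cvg_trans hl; apply: near_eq_cvg; near=> k.
  by rewrite /= /GRing.scale /= mulr1.
move/cvgrPdist_lt : hd => /(_ _ a0) /nbhs_ballP [d /= d0 hd].
have key y : y != x -> `|y - x| < d -> 0 < (y - x)^-1 * (f y - f x).
  move=> yx yd; have := hd (y - x); rewrite /ball /= sub0r normrN subrK => /(_ yd).
  by rewrite subr_eq0 => /(_ yx); rewrite ltr_norml /GRing.scale /= => /andP[_]; lra.
exists d => //; split=> y /andP[h1 h2].
  have yx : y != x by rewrite gt_eqF.
  have yd : `|y - x| < d by rewrite ltr_norml; apply/andP; split; lra.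
  have := key y yx yd; rewrite pmulr_rgt0 ?subr_gt0 ?invr_gt0 ?subr_gt0 //; lra.
have yx : y != x by rewrite lt_eqF.
have yd : `|y - x| < d by rewrite ltr_norml; apply/andP; split; lra.
have := key y yx yd; rewrite nmulr_rgt0 ?invr_lt0 ?subr_lt0 //.
Unshelve. all: by end_near. Qed.

Lemma first_zero f a b : a <= b -> (forall t, a <= t <= b -> {for t, continuous f}) ->
  0 < f a -> f b <= 0 ->
  exists2 t, a < t <= b & f t = 0 /\ forall r, a <= r < t -> 0 < f r.
Proof.
move=> ab fc fa fb.
pose E := [set t | a <= t <= b /\ f t <= 0].
have Eb : E b by split => //; rewrite ab lexx.
have lbE : lbound E a by move=> t [/andP[]].
have hE : has_inf E by split; [exists b | exists a].
pose z := inf E.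
have az : a <= z by apply: lb_le_inf => //; exists b.
have zb : z <= b by apply: ge_inf => //; exists a.
have fz : f z <= 0.
  rewrite leNgt; apply/negP => fz0.
  have [d d0 hd] := cont_gt0 (fc z (introT andP (conj az zb))) fz0.
  have [t Et tz] := inf_adherent d0 hE.
  have zt : z <= t by apply: ge_inf => //; exists a.
  have /hd : `|t - z| < d by rewrite ltr_norml; apply/andP; split; rewrite -/z in tz; lra.
  by case: Et => _; lra.
have pos r : a <= r < z -> 0 < f r.
  move=> /andP[ar rz]; rewrite ltNge; apply/negP => fr.
  have Er : E r by split => //; rewrite ar /= ltW // (lt_le_trans rz).
  have : z <= r by apply: ge_inf => //; exists a.
  lra.
have az' : a < z by rewrite lt_neqAle az andbT; apply/eqP => e; rewrite -e in fz; lra.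
exists z; first by rewrite az'.
split => //; apply/eqP; rewrite eq_le fz /= leNgt; apply/negP => fz0.
have fNc : {for z, continuous (fun t => - f t)}.
  by apply: continuousN; apply: fc; rewrite az zb.
have [|d d0 hd] := cont_gt0 fNc; first by rewrite oppr_gt0.
have := hd (Num.max a (z - d / 2)).
have := pos (Num.max a (z - d / 2)).
rewrite le_max lexx /= gt_max az' /= gtrBl divr_gt0 // => /(_ isT) h1.
have /[swap]/[apply] : `|Num.max a (z - d / 2) - z| < d.
  rewrite ltr_norml; apply/andP; split.
    rewrite ltrBrDr lt_max; apply/orP; right; lra.
  rewrite ltrBlDr gt_max; apply/andP; split; lra.
lra.
Qed.

Lemma contN_refl f x : {for - x, continuous f} -> {for x, continuous (fun t => f (- t))}.
Proof.
move=> h; apply: (@continuous_comp _ _ _ -%R f) => //; exact: opp_continuous.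
Qed.

Lemma last_zero f a b : a <= b -> (forall t, a <= t <= b -> {for t, continuous f}) ->
  f a <= 0 -> 0 < f b ->
  exists2 t, a <= t < b & f t = 0 /\ forall r, t < r <= b -> 0 < f r.
Proof.
move=> ab fc fa fb.
have [||||t tab [ft hr]] := @first_zero (fun t => f (- t)) (- b) (- a).
- by rewrite lerN2.
- move=> t tab; apply: contN_refl; apply: fc.
  by move: tab; rewrite lerNl [t <= _]lerNr andbC.
- by rewrite opprK.
- by rewrite opprK.
exists (- t); first by move: tab => /andP[h1 h2]; apply/andP; split; lra.
split => // r /andP[h1 h2]; rewrite -[r]opprK; apply: hr; apply/andP; split; lra.
Qed.

(** A positive value above [f a] would have been reached by an increase, which
    needs a positive derivative at a positive value. *)
Lemma barrier f df a b : a <= b -> (forall t, a <= t <= b -> isD f t (df t)) ->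
  (forall t, a <= t <= b -> 0 < f t -> df t <= 0) -> 0 < f b -> f b <= f a.
Proof.
move=> ab h h0 fb.
have fc t : a <= t <= b -> {for t, continuous f} by move=> /h; exact: isD_cont.
case: (lerP (f a) 0) => fa.
  have [t /andP[at_ tb] [ft hr]] := last_zero ab fc fa fb.
  have : f b <= f t.
    apply: (@nincr _ df) => [|s /andP[h1 h2]|s /andP[h1 h2]]; first exact: ltW.
      by apply: h; rewrite h2 (le_trans at_ h1).
    apply: h0; first by rewrite (ltW h2) andbT (le_trans at_ (ltW h1)).
    by apply: hr; rewrite h1 (ltW h2).
  lra.
rewrite leNgt; apply/negP => hab.
(* after the last time at which [f] takes the value [f a], [f] is positive *)
have [|||t /andP[at_ tb] [ft hr]] := @last_zero (fun t => f t - f a) a b ab.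
- by move=> t tab; apply: continuousB; [exact: fc|exact: cvg_cst].
- lra.
- lra.
have : f b <= f t.
  apply: (@nincr _ df) => [|s /andP[h1 h2]|s /andP[h1 h2]]; first exact: ltW.
    by apply: h; rewrite h2 (le_trans at_ h1).
  apply: h0; first by rewrite (ltW h2) andbT (le_trans at_ (ltW h1)).
  by have := hr s; rewrite h1 (ltW h2) => /(_ isT); lra.
lra.
Qed.

(** [f] multiplied by [expR (K t)] does not decrease as long as [f] is positive. *)
Lemma pos_pres f df a b K : a <= b -> (forall t, a <= t <= b -> isD f t (df t)) ->
  (forall t, a <= t <= b -> 0 < f t -> - K * f t <= df t) -> 0 < f a -> 0 < f b.
Proof.
move=> ab h h0 fa; rewrite ltNge; apply/negP => fb.
have fc t : a <= t <= b -> {for t, continuous f} by move=> /h; exact: isD_cont.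
have [t /andP[at_ tb] [ft hr]] := first_zero ab fc fa fb.
have : f a * expR (K * a) <= f t * expR (K * t).
  apply: (@ndecr (fun t => f t * expR (K * t)) (fun s => df s * expR (K * s) + f s * (expR (K * s) * (0 * s + K * 1)))).
  - exact: ltW.
  - move=> s /andP[h1 h2]; apply: isD_mul; first by apply: h; rewrite h1 (le_trans h2).
    by apply: isD_expR; apply: isD_mul; [exact: isD_cst|exact: isD_id].
  move=> s /andP[h1 h2].
  have sab : a <= s <= b by rewrite (ltW h1) (le_trans (ltW h2)).
  have fs : 0 < f s by apply: hr; rewrite (ltW h1).
  have := h0 s sab fs; have := expR_gt0 (K * s); nra.
rewrite ft mul0r; have := expR_gt0 (K * a); nra.
Qed.

Lemma pos_pres_back f df a b K : a <= b -> (forall t, a <= t <= b -> isD f t (df t)) ->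
  (forall t, a <= t <= b -> 0 < f t -> df t <= K * f t) -> 0 < f b -> 0 < f a.
Proof.
move=> ab h h0 fb.
rewrite -[a]opprK; apply: (@pos_pres (fun t => f (- t)) (fun t => df (- t) * -1) (- b) (- a) K).
- by rewrite lerN2.
- move=> t /andP[h1 h2]; apply: (@isD_comp f (fun t => - t)); last by apply: isD_opp; exact: isD_id.
  by apply: h; apply/andP; split; lra.
- move=> t /andP[h1 h2] ft.
  have tab : a <= - t <= b by apply/andP; split; lra.
  have := h0 _ tab ft; lra.
- by rewrite opprK.
Qed.

(** Both [f] and [- f] are covered by [pos_pres], in either direction of time. *)
Lemma gronwall0 f df a b K : a <= b -> (forall t, a <= t <= b -> isD f t (df t)) ->
  (forall t, a <= t <= b -> `|df t| <= K * f t) -> (f a = 0 -> f b = 0) /\ (f b = 0 -> f a = 0).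
Proof.
move=> ab h h0.
have hh t : a <= t <= b -> - K * f t <= df t <= K * f t.
  by move=> /h0; rewrite ler_norml mulNr.
have K0 t : a <= t <= b -> 0 <= K * f t by move=> /h0; apply: le_trans.
split=> f0; apply/eqP; rewrite eq_le; apply/andP; split; rewrite leNgt; apply/negP => fx.
- have := @pos_pres_back f df a b K ab h (fun t ht _ => proj2 (andP (hh t ht))) fx; lra.
- have := @pos_pres_back (fun t => - f t) (fun t => - df t) a b (- K) ab.
  have -> : 0 < - f b by lra.
  move=> H; have : 0 < - f a; last lra.
  apply: H => //; first by move=> t ht; apply: isD_opp; exact: h.
  by move=> t ht _; have /andP[h1 h2] := hh t ht; lra.
- have := @pos_pres f df a b K ab h (fun t ht _ => proj1 (andP (hh t ht))) fx; lra.
- have : 0 < - f b; last lra.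
  apply: (@pos_pres (fun t => - f t) (fun t => - df t) a b (- K) ab).
  + by move=> t ht; apply: isD_opp; exact: h.
  + by move=> t ht _; have /andP[h1 h2] := hh t ht; lra.
  + lra.
Qed.

Lemma cont_bounded f a b : a <= b -> (forall t, a <= t <= b -> {for t, continuous f}) ->
  exists2 M, 0 < M & forall t, a <= t <= b -> `|f t| <= M.
Proof.
move=> ab fc.
have [|c _ hc] := @EVT_max _ (fun t => `|f t|) a b ab.
  apply: cont_within => t tab.
  by apply: (@continuous_comp _ _ _ f Num.norm); [exact: fc|exact: norm_continuous].
exists (`|f c| + 1); first by have := normr_ge0 (f c); lra.
move=> t tab; have := hc t; rewrite in_itv /= => /(_ tab); lra.
Qed.

Lemma cont_argmax f a b : a <= b -> (forall t, a <= t <= b -> {for t, continuous f}) ->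
  exists2 c, a <= c <= b & forall t, a <= t <= b -> f t <= f c.
Proof.
move=> ab fc.
have [|c hc1 hc] := @EVT_max _ f a b ab; first exact: cont_within.
exists c => [|t tab]; first by move: hc1; rewrite in_itv.
by apply: hc; rewrite in_itv.
Qed.

Lemma isD_epsP f x l : isD f x l <->
  forall e, 0 < e -> exists2 d, 0 < d &
    forall y, y != x -> `|y - x| < d -> `|f y - f x - l * (y - x)| <= e * `|y - x|.
Proof.
have cvgE : (h^-1 *: (f (h + x) - f x) @[h --> (0:R)^'] --> l) <->
  forall e, 0 < e -> exists2 d, 0 < d &
    forall y, y != x -> `|y - x| < d -> `|f y - f x - l * (y - x)| <= e * `|y - x|.
  split.
    move=> /cvgrPdist_le h e e0; have /nbhs_ballP [d /= d0 hd] := h e e0.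
    exists d => // y yx yd.
    have := hd (y - x); rewrite /ball /= sub0r normrN subrK => /(_ yd).
    have yx0 : y - x != 0 by rewrite subr_eq0.
    move=> /(_ yx0); rewrite /GRing.scale /= => H.
    have -> : f y - f x - l * (y - x) = - ((l - (y - x)^-1 * (f y - f x)) * (y - x)).
      by field.
    by rewrite normrN normrM ler_wpM2r.
  move=> h; apply/cvgrPdist_le => e e0; have [d d0 hd] := h e e0.
  apply/nbhs_ballP; exists d => // z; rewrite /ball /= sub0r normrN => zd z0.
  have := hd (z + x); rewrite addrK -subr_eq0 addrK => /(_ z0 zd).
  have -> : l - z^-1 *: (f (z + x) - f x) = - ((f (z + x) - f x - l * z) / z).
    by rewrite /GRing.scale /=; field.
  by rewrite normrN normrM normfV ler_pdivrMr ?normr_gt0.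
have eqf : (fun h : R => h^-1 *: (f (h *: 1 + x) - f x)) = (fun h => h^-1 *: (f (h + x) - f x)).
  by apply/funext => h; rewrite /GRing.scale /= mulr1.
rewrite -cvgE /isD; split.
  move=> [+ e]; rewrite /derivable /= eqf => c.
  by move: e; rewrite /derive /= eqf => <-.
move=> h; have hc : derivable f x 1 by rewrite /derivable /= eqf; apply/cvg_ex; exists l.
split => //; rewrite /derive /= eqf; exact/cvg_lim.
Qed.

(** The difference quotient at [a] is a value of [df] at a point in between, by
    the mean value theorem on either side. This gives the derivative at the edges
    of the support, where only its limit is known. *)
Lemma isD_extend f df a l r : 0 < r -> {for a, continuous f} ->
  (forall t, t != a -> `|t - a| < r -> isD f t (df t)) ->
  (forall e, 0 < e -> exists2 d, 0 < d & forall t, t != a -> `|t - a| < d -> `|df t - l| <= e) ->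
  isD f a l.
Proof.
move=> r0 fa fD dl; apply/isD_epsP => e e0; have [d d0 hd] := dl e e0.
exists (Num.min d r); first by rewrite lt_min d0.
move=> y ya; rewrite lt_min => /andP[yd yr].
suff [c /andP[ca cd] ->] : exists2 c, (c != a) && (`|c - a| < d) & f y - f a = df c * (y - a).
  by rewrite -mulrBl normrM ler_wpM2r // hd.
have cW u v : u < v -> (forall t, u <= t <= v -> `|t - a| < r) -> {within `[u, v], continuous f}.
  move=> uv huv; apply: cont_within => t /huv tr.
  by have [->//|ta] := eqVneq t a; apply: (isD_cont (fD _ ta tr)).
move: yd yr; rewrite !ltr_norml => /andP[y1 y2] /andP[y3 y4].
have [ay|ay|ay] := ltgtP a y; last by rewrite ay eqxx in ya.
- have [t|t|c] := @MVT _ f df a y ay.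
  + rewrite in_itv /= => /andP[t1 t2]; apply: fD; first by rewrite gt_eqF.
    by rewrite ltr_norml; apply/andP; split; lra.
  + apply: cW => // s /andP[s1 s2]; rewrite ltr_norml; apply/andP; split; lra.
  rewrite in_itv /= => /andP[c1 c2] e1; exists c => //; apply/andP; split.
    by rewrite gt_eqF.
  by rewrite ltr_norml; apply/andP; split; lra.
have [t|t|c] := @MVT _ f df y a ay.
+ rewrite in_itv /= => /andP[t1 t2]; apply: fD; first by rewrite lt_eqF.
  by rewrite ltr_norml; apply/andP; split; lra.
+ apply: cW => // s /andP[s1 s2]; rewrite ltr_norml; apply/andP; split; lra.
rewrite in_itv /= => /andP[c1 c2] e1; exists c; last by lra.
apply/andP; split; first by rewrite lt_eqF.
by rewrite ltr_norml; apply/andP; split; lra.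
Qed.

Lemma ivt f a b w : a <= b -> (forall t, a <= t <= b -> {for t, continuous f}) ->
  f a <= w <= f b -> exists2 t, a <= t <= b & f t = w.
Proof.
move=> ab fc /andP[h1 h2].
have [||c] := @IVT _ f a b w ab; first exact: cont_within.
  by rewrite ge_min h1 le_max h2 orbT.
by rewrite in_itv /= => h <-; exists c.
Qed.

Lemma inv_isD f g x l e : 0 < e -> (forall t, `|t - x| < e -> g (f t) = t) ->
  (forall t, `|t - x| < e -> {for t, continuous f}) -> isD f x l -> l != 0 ->
  isD g (f x) l^-1.
Proof.
move=> e0 gK fc fD l0; apply: (@is_derive_inverse _ f g l x) => //.
  by exists e => //= t; rewrite /ball /= distrC => /gK.
by exists e => //= t; rewrite /ball /= distrC => /fc.
Qed.

Lemma mono_lim f T M : (forall s t, T <= s -> s <= t -> f s <= f t) ->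
  (forall t, T <= t -> f t <= M) ->
  exists l, [/\ l <= M, (forall t, T <= t -> f t <= l) &
   forall e, 0 < e -> exists2 T', T <= T' & forall t, T' <= t -> l - e < f t].
Proof.
move=> mf fM; pose E := [set f t | t in [set t | T <= t]].
have ET : E (f T) by exists T => //=.
have sE : has_sup E by split; [exists (f T)|exists M => _ [t /= Tt <-]; exact: fM].
exists (sup E); split.
- by apply: ge_sup; [exists (f T)|move=> _ [t /= Tt <-]; exact: fM].
- by move=> t Tt; apply: ub_le_sup; [case: sE|exists t].
move=> e e0; have [_ [T' /= TT' <-] h] := sup_adherent e0 sE.
by exists T' => // t T't; apply: (lt_le_trans h); apply: mf.
Qed.

(** Integrals start from a point that depends on [t] and lies to the left of both
    [0] and [t]. The difference of the integrals up to [t] and up to [0] does not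
    depend on that point. *)
Lemma antiderivative (g : R -> R) : continuous g ->
  exists F : R -> R, F 0 = 0 /\ forall t, isD F t (g t).
Proof.
move=> gc.
pose Fc c t := (\int[lebesgue_measure]_(s in `[c, t]) g s)%R.
have FcD c t : c < t -> isD (Fc c) t (g t).
  move=> ct; have [] := @continuous_FTC1_closed _ g c t (t + 1).
  - lra.
  - apply: continuous_compact_integrable; first exact: segment_compact.
    exact: continuous_subspaceT.
  - exact: ct.
  - exact: gc.
  by move=> h1 <-; apply: derivable_isD.
pose F t := Fc (- (`|t| + 1)) t - Fc (- (`|t| + 1)) 0.
have Feq c t : c <= - (`|t| + 1) -> F t = Fc c t - Fc c 0.
  move=> hc.
  pose c' := - (`|t| + 1).
  have t1 : - `|t| <= t <= `|t| by rewrite -ler_norml.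
  have cst u v : c' < u -> u <= v -> Fc c' v - Fc c v = Fc c' u - Fc c u.
    move=> cu uv.
    have hD s : u <= s <= v -> isD (fun s => Fc c' s - Fc c s) s (g s - g s).
      move=> /andP[us _]; have c's : c' < s by apply: lt_le_trans us.
      apply: isD_sub; apply: FcD => //; apply: le_lt_trans hc _; exact: c's.
    apply/eqP; rewrite eq_le; apply/andP; split.
      by apply: (nincr uv hD) => s _; rewrite subrr.
    by apply: (ndecr uv hD) => s _; rewrite subrr.
  have c0 : c' < 0 by rewrite /c'; have := normr_ge0 t; lra.
  have ct : c' < t by rewrite /c'; lra.
  rewrite /F -/c'; case: (lerP 0 t) => t0.
    have := cst 0 t c0 t0; lra.
  have := cst t 0 ct (ltW t0); lra.
exists F; split; first by rewrite /F subrr.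
move=> t; pose c := - (`|t| + 2).
have ct : c < t by rewrite /c; have := ler_norm (- t); rewrite normrN; lra.
apply: (@isD_near (fun s => Fc c s - Fc c 0)).
  by apply: isD_eq; [apply: isD_sub; [exact: FcD|exact: isD_cst]|lra].
exists 1 => // y yt; rewrite (Feq c) // /c.
have := ler_normD (y - t) t; rewrite subrK; lra.
Qed.

Lemma isD_zero_sign_left f x l r : 0 < r -> isD f x l -> f x = 0 ->
  (forall t, x - r < t < x -> f t < 0) -> 0 <= l.
Proof.
move=> r0 fD fx fneg; rewrite leNgt; apply/negP => l0.
have [d d0 [_ hd]] := isD_incr_near (isD_opp fD) ltac:(lra).
pose t := x - Num.min r d / 2.
have m0 : 0 < Num.min r d by rewrite lt_min r0.
have m1 : Num.min r d <= r by rewrite ge_min lexx.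
have m2 : Num.min r d <= d by rewrite ge_min lexx orbT.
have := hd t; have := fneg t.
have -> : x - r < t < x by rewrite /t; apply/andP; split; lra.
have -> : x - d < t < x by rewrite /t; apply/andP; split; lra.
by move=> /(_ isT) h1 /(_ isT); rewrite fx; lra.
Qed.

Lemma isD_zero_sign_right f x l r : 0 < r -> isD f x l -> f x = 0 ->
  (forall t, x < t < x + r -> f t < 0) -> l <= 0.
Proof.
move=> r0 fD fx fneg; rewrite leNgt; apply/negP => l0.
have [d d0 [hd _]] := isD_incr_near fD l0.
pose t := x + Num.min r d / 2.
have m0 : 0 < Num.min r d by rewrite lt_min r0.
have m1 : Num.min r d <= r by rewrite ge_min lexx.
have m2 : Num.min r d <= d by rewrite ge_min lexx orbT.
have := hd t; have := fneg t.
have -> : x < t < x + r by rewrite /t; apply/andP; split; lra.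
have -> : x < t < x + d by rewrite /t; apply/andP; split; lra.
by move=> /(_ isT) h1 /(_ isT); rewrite fx; lra.
Qed.

Lemma pick_right t d r : t < d -> 0 < r -> exists2 s, t < s < d & s < t + r.
Proof.
move=> td r0; exists (t + Num.min r (d - t) / 2); last first.
  have : Num.min r (d - t) <= r by rewrite ge_min lexx.
  lra.
have m0 : 0 < Num.min r (d - t) by rewrite lt_min r0 subr_gt0.
have m2 : Num.min r (d - t) <= d - t by rewrite ge_min lexx orbT.
by apply/andP; split; lra.
Qed.
Lemma pick_left t d r : t < d -> 0 < r -> exists2 s, t < s < d & d - r < s.
Proof.
move=> td r0; have [||s /andP[s1 s2] s3] := @pick_right (- d) (- t) r => //; first lra.
by exists (- s); [apply/andP; split; lra|lra].
Qed.

End Calc.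

(** * Clocks and edges of the support *)

Section Clocks.
Context {R : realType}.
Implicit Types (x y z t e b r : R).

(** The strictly increasing clock [X] attains exactly the values in between its
    bounds. The last two clauses turn limits of [X] at infinity into limits of
    [T] at the ends. *)
Lemma clock_inverse (X dX : R -> R) (lo hi : R) :
  (forall t : R, isD X t (dX t)) -> (forall t : R, 0 < dX t) -> (forall t : R, lo < X t < hi) ->
  (forall e, 0 < e -> exists t : R, X t < lo + e) -> (forall e, 0 < e -> exists t : R, hi - e < X t) ->
  exists T : R -> R, forall x, lo < x < hi -> [/\ X (T x) = x, isD T x (dX (T x))^-1,
    (forall a : R, x < X a -> T x < a) & (forall a : R, X a < x -> a < T x)].
Proof.
move=> XD dX0 Xb Xlo Xhi.
have Xinc s t : s < t -> X s < X t.
  by move=> st; apply: (incr st (fun r _ => XD r)) => r _; exact: dX0.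
have sur x : exists t : R, lo < x < hi -> X t = x.
  case: (boolP (lo < x < hi)) => [/andP[x1 x2]|_]; last by exists 0.
  have [a ha] := Xlo (x - lo) ltac:(by rewrite subr_gt0).
  have [c hc] := Xhi (hi - x) ltac:(by rewrite subr_gt0).
  have ac : a <= c.
    by rewrite leNgt; apply/negP => /Xinc; lra.
  have [||t _ ht] := @ivt _ X a c x ac; last by exists t.
    by move=> t _; exact: isD_cont (XD t).
  by apply/andP; split; lra.
have [T hT] := choice sur.
have Tlt x a : lo < x < hi -> x < X a -> T x < a.
  move=> hx xa; rewrite ltNge; apply/negP; rewrite le_eqVlt => /orP[/eqP ea|/Xinc].
    by move: xa; rewrite ea (hT x hx) ltxx.
  by rewrite (hT x hx) => /(lt_trans xa); rewrite ltxx.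
have Tgt x a : lo < x < hi -> X a < x -> a < T x.
  move=> hx xa; rewrite ltNge; apply/negP; rewrite le_eqVlt => /orP[/eqP ea|/Xinc].
    by move: xa; rewrite -ea (hT x hx) ltxx.
  by rewrite (hT x hx) => /(lt_trans xa); rewrite ltxx.
have TX t : T (X t) = t.
  apply/eqP; rewrite eq_le; apply/andP; split; rewrite leNgt; apply/negP => h.
    by have := Xinc _ _ h; rewrite (hT _ (Xb t)) ltxx.
  by have := Xinc _ _ h; rewrite (hT _ (Xb t)) ltxx.
exists T => x hx; split; [exact: hT| |by move=> a; exact: Tlt|by move=> a; exact: Tgt].
rewrite -{1}(hT x hx); apply: (@inv_isD _ X T (T x) (dX (T x)) 1) => //.
- by move=> t _; exact: isD_cont (XD t).
by rewrite gt_eqF.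
Qed.

(** The quotient [g1 / g2] is constant. As [g2] stays above [1], values of [g1] and
    [g2] that are close make the quotient close to [1]. *)
Lemma clock_unique (g1 g2 phi : R -> R) M : 0 < M ->
  (forall w : R, 0 < w < M -> isD g1 w (g1 w * phi w)) ->
  (forall w : R, 0 < w < M -> 1 < g2 w /\ isD g2 w (g2 w * phi w)) ->
  (forall e, 0 < e -> exists2 w : R, 0 < w < M & `|g1 w - g2 w| < e) ->
  forall w : R, 0 < w < M -> g1 w = g2 w.
Proof.
move=> M0 D1 D2 near.
have rD w : 0 < w < M -> isD (fun w => g1 w * (g2 w)^-1) w 0.
  move=> hw; have [p2 h2] := D2 w hw; have gp : 0 < g2 w by exact: lt_trans p2.
  apply: isD_eq; first exact: isD_mul (D1 w hw) (isD_inv (lt0r_neq0 gp) h2).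
  by rewrite /=; field; rewrite gt_eqF.
have rcst v w : 0 < v < M -> 0 < w < M -> g1 v / g2 v = g1 w / g2 w.
  wlog vw : v w / v <= w.
    by move=> H hv hw; case: (lerP v w) => [/H|/ltW/H h]; [exact|apply/esym/h].
  move=> /andP[v0 _] /andP[_ wM]; apply/eqP; rewrite eq_le.
  have inn r : v <= r <= w -> 0 < r < M by move=> /andP[h1 h2]; rewrite (lt_le_trans v0) // (le_lt_trans h2).
  by rewrite (ndecr vw (fun r hr => rD r (inn r hr))) // (nincr vw (fun r hr => rD r (inn r hr))).
move=> w hw; have [p2 _] := D2 w hw; have gp : 0 < g2 w by exact: lt_trans p2.
suff : g1 w / g2 w = 1 by move=> h; rewrite -[RHS]mul1r -h divfK // gt_eqF.
apply/eqP; rewrite -subr_eq0 -normr_le0 leNgt; apply/negP => e0.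
have [v hv] := near _ e0; have [p3 _] := D2 v hv; have gp3 : 0 < g2 v by exact: lt_trans p3.
rewrite (rcst w v hw hv).
have -> : g1 v / g2 v - 1 = (g1 v - g2 v) / g2 v by field; rewrite gt_eqF.
rewrite normrM normfV (gtr0_norm gp3) ltNge => /negP; apply.
by rewrite ler_pdivrMr // ler_peMr // ltW.
Qed.

Lemma isD_incr_itv (g dg : R -> R) (M : R) : (forall w : R, 0 < w < M -> isD g w (dg w)) ->
  (forall w : R, 0 < w < M -> 0 < dg w) -> forall v w : R, 0 < v -> v < w -> w < M -> g v < g w.
Proof.
move=> D0 dp v w v0 vw wM; have inn r : v <= r <= w -> 0 < r < M.
  by move=> /andP[h1 h2]; rewrite (lt_le_trans v0) // (le_lt_trans h2).
apply: (incr vw (fun r hr => D0 r (inn r hr))) => r /andP[h1 h2]; apply/dp/inn.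
by rewrite !ltW.
Qed.

Lemma near_itv (a c x : R) : a < x < c -> exists2 e : R, 0 < e & forall y, `|y - x| < e -> a < y < c.
Proof.
move=> /andP[x1 x2]; exists (Num.min (x - a) (c - x)); first by rewrite lt_min !subr_gt0 x1.
by move=> y; rewrite lt_min !ltr_norml => /andP[/andP[h1 h2] /andP[h3 h4]]; apply/andP; split; lra.
Qed.

(** For functions that vanish outside [[a, c]]: at the two edges the derivative
    exists because it has a limit, [isD_extend]. *)
Lemma flat_ends (g dg : R -> R) (a c : R) : a < c ->
  (forall x, x != a -> x != c -> isD g x (dg x)) -> dg a = 0 -> dg c = 0 ->
  {for a, continuous g} -> {for c, continuous g} -> {for a, continuous dg} -> {for c, continuous dg} ->
  forall x, isD g x (dg x).
Proof.
move=> ac gD dga dgc ga gc da dc x.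
have ca0 : 0 < c - a by rewrite subr_gt0.
have ends y z : `|z - y| = c - a -> dg y = 0 -> {for y, continuous g} -> {for y, continuous dg} ->
    (forall t, t != y -> `|t - y| < c - a -> isD g t (dg t)) -> isD g y (dg y).
  move=> yz dy gy dgy hD; rewrite dy; apply: (isD_extend ca0 gy hD) => e e0.
  have [d d0 hd] := (cont_epsP dg y).1 dgy e e0.
  by exists d => // t _ /hd; rewrite dy => /ltW.
have [->|xa] := eqVneq x a.
  apply: (ends a c) => //; first by rewrite gtr0_norm.
  move=> t ta tc; apply: gD => //; apply: contraTneq tc => ->; by rewrite gtr0_norm // ltxx.
have [->|xc] := eqVneq x c; last exact: gD.
apply: (ends c a) => //; first by rewrite distrC gtr0_norm.
by move=> t ta tc; apply: gD => //; apply: contraTneq tc => ->; rewrite distrC gtr0_norm // ltxx.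
Qed.

Lemma continuous_halfline (g : R -> R) : (forall x, {for x, continuous g}) ->
  {within `[0, +oo[, continuous g}.
Proof. by move=> h; apply: continuous_subspaceT => x; exact: h. Qed.

Lemma halfline_cont (g : R -> R) x : {within `[0, +oo[, continuous g} -> 0 < x -> {for x, continuous g}.
Proof.
move=> gc x0; have : {within `]0, +oo[, continuous g}.
  by apply: continuous_subspaceW gc => y /=; rewrite !in_itv /= !andbT => /ltW.
by rewrite continuous_open_subspace ?interval_open //; apply; rewrite inE /= in_itv /= x0.
Qed.

Lemma cont_mul (f g : R -> R) : continuous f -> continuous g -> continuous (fun y => f y * g y).
Proof. by move=> fc gc y; apply: continuousM; [exact: fc|exact: gc]. Qed.
Lemma cont_add (f g : R -> R) : continuous f -> continuous g -> continuous (fun y => f y + g y).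
Proof. by move=> fc gc y; apply: continuousD; [exact: fc|exact: gc]. Qed.
Lemma cont_cst (c : R) : continuous (fun _ : R => c).
Proof. by move=> y; exact: cvg_cst. Qed.
Lemma cont_id : continuous (fun y : R => y).
Proof. by move=> y; exact: cvg_id. Qed.
Lemma cont_opp (f : R -> R) : continuous f -> continuous (fun y => - f y).
Proof. by move=> fc y; apply: continuousN; exact: fc. Qed.

End Clocks.

(** The cost of [lra] grows steeply with the number of comparisons in the
    context, while most goals follow from the latest ones: [recent n] moves the
    last [n] into the goal, and [tidy] clears the others. *)
Ltac recent n := lazymatch n with O => idtac | S ?n' =>
  try (match goal with H : ?T |- _ => lazymatch T with
    | is_true (@Order.le _ _ _ _) => revert H
    | is_true (@Order.lt _ _ _ _) => revert H
    | @eq _ _ _ => revert H end end; recent n') end.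
Ltac lra_recent tidy :=
  first [solve [recent 3%N; tidy (); lra] | solve [recent 6%N; tidy (); lra] | solve [recent 11%N; tidy (); lra] | lra].

(** * Arcs in the phase plane *)

Section PhasePlane.
Context {R : realType}.
Variables (G : R -> R) (wB : R).
Hypothesis wB0 : 0 < wB.
Hypothesis Gpos : forall x : R, 0 < x -> x < wB -> 0 < G x.
Hypothesis Gneg : forall x : R, wB < x -> G x < 0.
Hypothesis Gcont : forall x : R, 0 < x -> {for x, continuous G}.
Hypothesis GLip : forall K : R, 0 < K -> exists2 C : R, 0 < C &
  forall x : R, 0 < x -> x <= K -> `|G x| <= C * `|x - wB|.
Implicit Types (Y b rho x y f : R -> R) (c d t w M e lo hi l r : R).
Ltac plra := lra_recent ltac:(fun _ => clear - wB0 Gpos Gneg Gcont GLip).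

(** While [y] is positive, the orbits of [x' = y], [y' = b(x) y + G(x)] are
    graphs over [x], and these solve this scalar equation. *)
Definition phase_arc Y b c M := forall w, c < w < M -> 0 < Y w /\ isD Y w (b w + G w / Y w).
Definition vanish_left Y M := forall e, 0 < e -> exists2 d, 0 < d & forall w, M - d < w < M -> Y w < e.
Definition vanish_right Y c := forall e, 0 < e -> exists2 d, 0 < d & forall w, c < w < c + d -> Y w < e.

Definition lim_right f c l := forall e, 0 < e -> exists2 r, 0 < r & forall t, c < t < c + r -> `|f t - l| < e.
Definition lim_left f d l := forall e, 0 < e -> exists2 r, 0 < r & forall t, d - r < t < d -> `|f t - l| < e.

(** The difference of two arcs solves a linear equation with bounded coefficient
    and a source [b2 - b1] of one sign; its sign is preserved forwards or
    backwards, according to the sign of the source. *)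
Lemma arc_pos_pres Y1 Y2 b1 b2 u v : 0 < u -> u <= v ->
  (forall w, u <= w <= v -> 0 < Y1 w /\ isD Y1 w (b1 w + G w / Y1 w)) ->
  (forall w, u <= w <= v -> 0 < Y2 w /\ isD Y2 w (b2 w + G w / Y2 w)) ->
  ((forall w, u <= w <= v -> b1 w <= b2 w) -> Y1 u < Y2 u -> Y1 v < Y2 v) /\
  ((forall w, u <= w <= v -> b2 w <= b1 w) -> Y1 v < Y2 v -> Y1 u < Y2 u).
Proof.
move=> u0 uv h1 h2.
have hc w : u <= w <= v -> {for w, continuous (fun w => G w / (Y1 w * Y2 w))}.
  move=> hw; have [p1 d1] := h1 w hw; have [p2 d2] := h2 w hw.
  apply: continuousM; first by apply: Gcont; case/andP: hw; plra.
  apply: continuousV; first by rewrite mulf_neq0 // gt_eqF.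
  by apply: continuousM; [exact: isD_cont d1|exact: isD_cont d2].
have [K K0 hK] := cont_bounded uv hc.
pose D w := Y2 w - Y1 w.
pose dD w := (b2 w + G w / Y2 w) - (b1 w + G w / Y1 w).
have hD w : u <= w <= v -> isD D w (dD w).
  by move=> hw; apply: isD_sub; [case: (h2 w hw)|case: (h1 w hw)].
have dDE w : u <= w <= v -> dD w = (b2 w - b1 w) - G w / (Y1 w * Y2 w) * D w.
  move=> hw; have [p1 _] := h1 w hw; have [p2 _] := h2 w hw.
  by rewrite /dD /D; field; rewrite !gt_eqF.
split=> hb.
- rewrite -subr_gt0 -[_ < Y2 v]subr_gt0; apply: (@pos_pres _ D dD u v K uv hD).
  move=> w hw Dw; rewrite dDE //; have := hK w hw; have := hb w hw.
  rewrite ler_norml => hb' /andP[k1 k2]; nra.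
rewrite -subr_gt0 -[_ < Y2 u]subr_gt0; apply: (@pos_pres_back _ D dD u v K uv hD).
move=> w hw Dw; rewrite dDE //; have := hK w hw; have := hb w hw.
rewrite ler_norml => hb' /andP[k1 k2]; nra.
Qed.

(** Beyond [wB], where [G] is negative, the upper arc has the larger slope, so the
    distance of the two does not decrease: the upper arc is still positive
    when the lower one ends. *)
Lemma arc_order Y1 Y2 b1 b2 c M1 M2 w0 : 0 <= c -> wB < M1 -> wB < M2 ->
  phase_arc Y1 b1 c M1 -> phase_arc Y2 b2 c M2 -> (forall w, 0 < w -> b1 w <= b2 w) ->
  vanish_left Y2 M2 -> c < w0 -> w0 < M1 -> w0 < M2 ->
  Y1 w0 < Y2 w0 -> M1 < M2.
Proof.
have wBp := wB0.
move=> c0 M1B M2B A1 A2 hb v2 cw0 w01 w02 Y12; rewrite ltNge; apply/negP => M21.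
have ord w : w0 <= w -> w < M2 -> Y1 w < Y2 w.
  move=> w0w wM; have [|||H _] := @arc_pos_pres Y1 Y2 b1 b2 w0 w _ w0w _ _.
  - plra.
  - by move=> s /andP[s1 s2]; apply: A1; apply/andP; split; plra.
  - by move=> s /andP[s1 s2]; apply: A2; apply/andP; split; plra.
  apply: H => // s /andP[s1 s2]; apply: hb; plra.
pose w1 := (Num.max w0 wB + M2) / 2.
have m1 : w0 <= Num.max w0 wB by rewrite le_max lexx.
have m2 : wB <= Num.max w0 wB by rewrite le_max lexx orbT.
have m3 : Num.max w0 wB < M2 by rewrite gt_max w02.
have w1M : w1 < M2 by rewrite /w1; plra.
have w01' : w0 < w1 by rewrite /w1; plra.
have w1B : wB < w1 by rewrite /w1; plra.
have d1 : 0 < Y2 w1 - Y1 w1 by rewrite subr_gt0; apply: ord => //; exact: ltW.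
have [d d0 hd] := v2 _ d1.
pose w := Num.max ((w1 + M2) / 2) (M2 - d / 2).
have wM : w < M2 by rewrite /w gt_max; apply/andP; split; plra.
have ww1 : w1 < w by rewrite /w lt_max; apply/orP; left; plra.
have wd : M2 - d < w by rewrite /w lt_max; apply/orP; right; plra.
have := hd w; rewrite wM wd => /(_ isT) Yw.
have : Y2 w1 - Y1 w1 <= Y2 w - Y1 w.
  apply: (@ndecr _ (fun w => Y2 w - Y1 w) (fun w => (b2 w + G w / Y2 w) - (b1 w + G w / Y1 w))); first exact: ltW.
    by move=> s /andP[s1 s2]; apply: isD_sub; [apply: (A2 s _).2|apply: (A1 s _).2]; apply/andP; split; plra.
  move=> s /andP[s1 s2].
  have [p1 _] : 0 < Y1 s /\ isD Y1 s (b1 s + G s / Y1 s) by apply: A1; apply/andP; split; plra.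
  have [p2 _] : 0 < Y2 s /\ isD Y2 s (b2 s + G s / Y2 s) by apply: A2; apply/andP; split; plra.
  have Ys : Y1 s < Y2 s by apply: ord; plra.
  have Gs : G s < 0 by apply: Gneg; plra.
  have bs : b1 s <= b2 s by apply: hb; plra.
  have : G s / Y1 s <= G s / Y2 s.
    by rewrite ler_nM2l // lef_pV2 ?posrE // ltW.
  plra.
have [p1 _] : 0 < Y1 w /\ isD Y1 w (b1 w + G w / Y1 w) by apply: A1; apply/andP; split; plra.
plra.
Qed.

(** Before [wB], where [G] is positive, an excess of [Y1] over [Y2] does not grow,
    and at the origin, where [Y1] vanishes, there is none. *)
Lemma arc_from0 Y1 Y2 b1 b2 M1 M2 : phase_arc Y1 b1 0 M1 -> phase_arc Y2 b2 0 M2 ->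
  (forall w, 0 < w -> b1 w <= b2 w) -> vanish_right Y1 0 ->
  forall w, 0 < w -> w < wB -> w < M1 -> w < M2 -> Y1 w <= Y2 w.
Proof.
have wBp := wB0.
move=> A1 A2 hb v1 w w0 wwB wM1 wM2; rewrite leNgt; apply/negP => Y12.
have d1 : 0 < Y1 w - Y2 w by plra.
have [d d0 hd] := v1 _ d1.
pose u := Num.min (w / 2) (d / 2).
have u0 : 0 < u by rewrite /u lt_min; apply/andP; split; plra.
have uw : u < w by rewrite /u gt_min; apply/orP; left; plra.
have ud : u < d by rewrite /u gt_min; apply/orP; right; plra.
have Yu : Y1 u < Y1 w - Y2 w by apply: hd; apply/andP; split; plra.
have : Y1 w - Y2 w <= Y1 u - Y2 u.
  apply: (@barrier _ (fun w => Y1 w - Y2 w) (fun w => (b1 w + G w / Y1 w) - (b2 w + G w / Y2 w))) => //; first exact: ltW.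
    by move=> s /andP[s1 s2]; apply: isD_sub; [apply: (A1 s _).2|apply: (A2 s _).2]; apply/andP; split; plra.
  move=> s /andP[s1 s2] Ys.
  have [p1 _] : 0 < Y1 s /\ isD Y1 s (b1 s + G s / Y1 s) by apply: A1; apply/andP; split; plra.
  have [p2 _] : 0 < Y2 s /\ isD Y2 s (b2 s + G s / Y2 s) by apply: A2; apply/andP; split; plra.
  have Gs : 0 < G s by apply: Gpos; plra.
  have bs : b1 s <= b2 s by apply: hb; plra.
  have : G s / Y1 s <= G s / Y2 s.
    rewrite ler_pM2l // lef_pV2 ?posrE //; plra.
  plra.
have [p2 _] : 0 < Y2 u /\ isD Y2 u (b2 u + G u / Y2 u) by apply: A2; apply/andP; split; plra.
plra.
Qed.

(** [arc_from0] puts the second arc above the first one up to [wB], and they do not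
    coincide, because their slopes differ; [arc_order] carries this on to the
    maxima. *)
Lemma arc_strict Y1 Y2 b1 b2 M1 M2 : wB < M1 -> wB < M2 ->
  phase_arc Y1 b1 0 M1 -> phase_arc Y2 b2 0 M2 ->
  (forall w, 0 < w -> b1 w < b2 w) -> vanish_right Y1 0 ->
  vanish_left Y2 M2 -> M1 < M2.
Proof.
have wBp := wB0.
move=> M1B M2B A1 A2 hb v1 v2.
have hb' w : 0 < w -> b1 w <= b2 w by move=> /hb /ltW.
have le w : 0 < w -> w < wB -> Y1 w <= Y2 w.
  by move=> w0 wwB; apply: (arc_from0 A1 A2 hb') => //; plra.
have [w [w0 wwB ne]] : exists w, [/\ 0 < w, w < wB & Y1 w != Y2 w].
  apply: contrapT => H.
  have eqY w : 0 < w -> w < wB -> Y1 w = Y2 w.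
    by move=> w0 wwB; apply/eqP; apply: contrapT => /negP ne; apply: H; exists w.
  pose w := wB / 2.
  have w0 : 0 < w by rewrite /w; plra.
  have wwB : w < wB by rewrite /w; plra.
  have [p1 d1] : 0 < Y1 w /\ isD Y1 w (b1 w + G w / Y1 w) by apply: A1; apply/andP; split; plra.
  have [p2 d2] : 0 < Y2 w /\ isD Y2 w (b2 w + G w / Y2 w) by apply: A2; apply/andP; split; plra.
  have d2' : isD Y2 w (b1 w + G w / Y1 w).
    apply: isD_near d1 _; exists w => // y; rewrite ltr_norml => /andP[y1 y2].
    by apply: eqY; rewrite /w in y1 y2; plra.
  have := isD_unique d2 d2'; rewrite eqY //; have := hb w w0; plra.
apply: (@arc_order Y1 Y2 b1 b2 0 M1 M2 w) => //; try plra.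
by rewrite lt_neqAle ne le.
Qed.

(** Applied twice, with the roles exchanged: the arc that leaves the origin is
    unique. *)
Lemma arc_unique_le Y1 Y2 b M1 M2 : wB < M1 -> wB < M2 ->
  phase_arc Y1 b 0 M1 -> phase_arc Y2 b 0 M2 -> vanish_right Y1 0 -> vanish_right Y2 0 ->
  forall w, 0 < w -> w < M1 -> w < M2 -> Y1 w <= Y2 w.
Proof.
have wBp := wB0.
move=> M1B M2B A1 A2 v1 v2 w w0 wM1 wM2.
have hb w' : 0 < w' -> b w' <= b w' by [].
case: (ltrP w wB) => wwB; first exact: (arc_from0 A1 A2 hb).
rewrite leNgt; apply/negP => Y21.
have : Y2 (wB / 2) < Y1 (wB / 2).
  apply: (@arc_pos_pres Y2 Y1 b b (wB / 2) w _ _ _ _).2 => //.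
  - plra.
  - plra.
  - by move=> s /andP[s1 s2]; apply: A2; apply/andP; split; plra.
  - by move=> s /andP[s1 s2]; apply: A1; apply/andP; split; plra.
have : Y1 (wB / 2) <= Y2 (wB / 2) by apply: (arc_from0 A1 A2 hb) => //; plra.
plra.
Qed.

(** Otherwise the second arc would be positive at [M1], where the first one, which
    coincides with it, vanishes. *)
Lemma arc_unique_M Y1 Y2 b M1 M2 : wB < M1 -> wB < M2 ->
  phase_arc Y1 b 0 M1 -> phase_arc Y2 b 0 M2 -> vanish_right Y1 0 -> vanish_right Y2 0 ->
  vanish_left Y1 M1 -> M2 <= M1.
Proof.
have wBp := wB0.
move=> M1B M2B A1 A2 v1 v2 vl; rewrite leNgt; apply/negP => M12.
have [p2 d2] : 0 < Y2 M1 /\ isD Y2 M1 (b M1 + G M1 / Y2 M1) by apply: A2; apply/andP; split; plra.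
have [e e0 he] := vl (Y2 M1 / 2) (divr_gt0 p2 (ltr0n _ 2)).
have [d d0 hd] : exists2 d : R, 0 < d & forall w, `|w - M1| < d -> 0 < Y2 w - Y2 M1 / 2.
  apply: (@cont_gt0 _ (fun w => Y2 w - Y2 M1 / 2)); last plra.
  by apply: continuousB; [exact: isD_cont d2|exact: cvg_cst].
pose w := Num.max (M1 - e / 2) (Num.max (M1 - d / 2) wB).
have wM : w < M1 by rewrite /w !gt_max; apply/andP; split; [plra|apply/andP; split; plra].
have we : M1 - e < w by rewrite /w lt_max; apply/orP; left; plra.
have wd : M1 - d < w by rewrite /w !lt_max; apply/orP; right; apply/orP; left; plra.
have wb : wB <= w by rewrite /w !le_max lexx !orbT.
have := he w; rewrite wM we => /(_ isT) h1.
have h2 : 0 < Y2 w - Y2 M1 / 2 by apply: hd; rewrite ltr_norml; apply/andP; split; plra.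
have : Y2 w <= Y1 w by apply: (arc_unique_le M2B M1B A2 A1) => //; plra.
plra.
Qed.

(** The factor [rho] leaves the clock open. It does not affect the graph in the
    phase plane, and orbits are needed in the clock [xi] as well as in one that
    makes the equations regular. *)
Definition orbit b rho x y c d := forall t, c < t < d ->
  [/\ 0 < x t, 0 < rho t, {for t, continuous rho}, isD x t (rho t * y t) &
      isD y t (rho t * (b (x t) * y t + G (x t)))].

(** Where [y] is positive the amplitude [x] increases, and its inverse [g] reads
    the clock off the amplitude. *)
Lemma phase_arc_of_orbit b rho x y c d lo hi : orbit b rho x y c d ->
  (forall t, c < t < d -> 0 < y t) ->
  (forall t, c < t < d -> lo < x t < hi) ->
  (forall e, 0 < e -> exists2 t, c < t < d & x t < lo + e) ->
  (forall e, 0 < e -> exists2 t, c < t < d & hi - e < x t) ->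
  exists g Y : R -> R,
   [/\ (forall t, c < t < d -> g (x t) = t),
       (forall w, lo < w < hi -> [/\ c < g w < d, x (g w) = w, Y w = y (g w) &
                    isD g w (rho (g w) * y (g w))^-1]) &
       phase_arc Y b lo hi].
Proof.
move=> orb ypos xr xlo xhi.
have xinc s t : c < s -> s < t -> t < d -> x s < x t.
  move=> cs st td; apply: (@incr _ x (fun t => rho t * y t)) => //.
    by move=> r /andP[r1 r2]; have [|] := orb r; first by apply/andP; split; plra.
  move=> r /andP[r1 r2]; have rcd : c < r < d by apply/andP; split; plra.
  by have [_ rr _ _ _] := orb r rcd; rewrite mulr_gt0 // ypos.
pose g w := xget 0 [set t | c < t < d /\ x t = w].
have gx t : c < t < d -> g (x t) = t.
  move=> tcd; rewrite /g; case: xgetP => [s _ [/andP[s1 s2] e]|/(_ t)]; last by case.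
  case/andP: tcd => t1 t2; have [st|ts|//] := ltgtP s t.
    by have := xinc s t s1 st t2; plra.
  by have := xinc t s t1 ts s2; plra.
have gw w : lo < w < hi -> c < g w < d /\ x (g w) = w.
  move=> /andP[w1 w2].
  have [s /andP[s1 s2] xs] := xlo (w - lo) ltac:(plra).
  have [t /andP[t1 t2] xt] := xhi (hi - w) ltac:(plra).
  have st : s <= t.
    by rewrite leNgt; apply/negP => ts; have := xinc t s t1 ts s2; plra.
  have [r /andP[r1 r2] xr'] : exists2 r, s <= r <= t & x r = w.
    apply: ivt => //; last by apply/andP; split; plra.
    by move=> r /andP[r1 r2]; have [|_ _ _ /isD_cont] := orb r; first by apply/andP; split; plra.
  have rcd : c < r < d by apply/andP; split; plra.
  by rewrite -xr' gx.
have gD w : lo < w < hi -> isD g w (rho (g w) * y (g w))^-1.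
  move=> hw; have [gcd xg] := gw w hw; have [_ r0 _ xD _] := orb _ gcd.
  rewrite -{1}xg; case/andP: (gcd) => g1 g2.
  apply: (@inv_isD _ x g (g w) _ (Num.min (g w - c) (d - g w))).
  - by rewrite lt_min !subr_gt0 g1.
  - move=> t; rewrite lt_min !ltr_norml => /andP[/andP[t1 _] /andP[_ t2]].
    by apply: gx; apply/andP; split; plra.
  - move=> t; rewrite lt_min !ltr_norml => /andP[/andP[t1 _] /andP[_ t2]].
    by have [|_ _ _ /isD_cont] := orb t; first by apply/andP; split; plra.
  - exact: xD.
  - by rewrite gt_eqF // mulr_gt0 // ypos.
exists g, (fun w => y (g w)); split => //.
  by move=> w hw; have [gcd xg] := gw w hw; split => //; exact: gD.
move=> w hw; have [gcd xg] := gw w hw; split; first exact: ypos.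
have [_ r0 _ _ yD] := orb _ gcd.
apply: isD_eq; first exact: isD_comp yD (gD w hw).
have := ypos _ gcd => yp; rewrite xg; field.
by rewrite !gt_eqF.
Qed.

Lemma vanish_right_of b rho x y c d g Y lo hi : c < d ->
  orbit b rho x y c d -> (forall t, c < t < d -> 0 < y t) ->
  (forall t, c < t < d -> lo < x t < hi) ->
  (forall t, c < t < d -> g (x t) = t) ->
  (forall w, lo < w < hi -> [/\ c < g w < d, x (g w) = w, Y w = y (g w) &
                    isD g w (rho (g w) * y (g w))^-1]) ->
  vanish_right y c -> vanish_right Y lo.
Proof.
move=> cd orb ypos xr gx hg yv e e0; have [de de0 hde] := yv e e0.
pose t := c + Num.min ((d - c) / 2) (de / 2).
have m0 : 0 < Num.min ((d - c) / 2) (de / 2) by rewrite lt_min; apply/andP; split; plra.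
have m1 : Num.min ((d - c) / 2) (de / 2) <= (d - c) / 2 by rewrite ge_min lexx.
have m2 : Num.min ((d - c) / 2) (de / 2) <= de / 2 by rewrite ge_min lexx orbT.
have tcd : c < t < d by rewrite /t; apply/andP; split; plra.
have /andP[xt1 xt2] := xr t tcd.
exists (x t - lo); first plra.
move=> w /andP[w1 w2]; have wlh : lo < w < hi by apply/andP; split; plra.
have [/andP[g1 g2] xg -> _] := hg w wlh.
apply: hde; rewrite g1 /=; suff : g w < t by rewrite /t; plra.
rewrite ltNge; apply/negP => tg.
have : x t <= x (g w).
  apply: (@ndecr _ x (fun t => rho t * y t)) => //.
    by move=> r /andP[r1 r2]; have [|] := orb r; first by case/andP: tcd => ? ?; apply/andP; split; plra.
  move=> r /andP[r1 r2]; have rcd : c < r < d by case/andP: tcd => ? ?; apply/andP; split; plra.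
  by have [_ rr _ _ _] := orb r rcd; rewrite ltW // mulr_gt0 // ypos.
rewrite xg; plra.
Qed.

Lemma vanish_left_of b rho x y c d g Y lo hi : c < d ->
  orbit b rho x y c d -> (forall t, c < t < d -> 0 < y t) ->
  (forall t, c < t < d -> lo < x t < hi) ->
  (forall t, c < t < d -> g (x t) = t) ->
  (forall w, lo < w < hi -> [/\ c < g w < d, x (g w) = w, Y w = y (g w) &
                    isD g w (rho (g w) * y (g w))^-1]) ->
  vanish_left y d -> vanish_left Y hi.
Proof.
move=> cd orb ypos xr gx hg yv e e0; have [de de0 hde] := yv e e0.
pose t := d - Num.min ((d - c) / 2) (de / 2).
have m0 : 0 < Num.min ((d - c) / 2) (de / 2) by rewrite lt_min; apply/andP; split; plra.
have m1 : Num.min ((d - c) / 2) (de / 2) <= (d - c) / 2 by rewrite ge_min lexx.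
have m2 : Num.min ((d - c) / 2) (de / 2) <= de / 2 by rewrite ge_min lexx orbT.
have tcd : c < t < d by rewrite /t; apply/andP; split; plra.
have /andP[xt1 xt2] := xr t tcd.
exists (hi - x t); first plra.
move=> w /andP[w1 w2]; have wlh : lo < w < hi by apply/andP; split; plra.
have [/andP[g1 g2] xg -> _] := hg w wlh.
apply: hde; rewrite g2 andbT; suff : t < g w by rewrite /t; plra.
rewrite ltNge; apply/negP => tg.
have : x (g w) <= x t.
  apply: (@ndecr _ x (fun t => rho t * y t)) => //.
    by move=> r /andP[r1 r2]; have [|] := orb r; first by case/andP: tcd => ? ?; apply/andP; split; plra.
  move=> r /andP[r1 r2]; have rcd : c < r < d by case/andP: tcd => ? ?; apply/andP; split; plra.
  by have [_ rr _ _ _] := orb r rcd; rewrite ltW // mulr_gt0 // ypos.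
rewrite xg; plra.
Qed.

(** * An orbit from the origin to itself has a single bump *)

(** Gronwall for the squared distance to the equilibrium [(wB, 0)], where the
    field vanishes and is Lipschitz by [GLip]. *)
Lemma not_equilibrium b rho x y c d t0 : orbit b rho x y c d ->
  (forall w, 0 < w -> {for w, continuous b}) -> c < t0 < d -> x t0 = wB -> y t0 = 0 ->
  forall t, c < t < d -> x t = wB.
Proof.
move=> orb bc /andP[t01 t02] xt0 yt0.
pose n t := (x t - wB) ^+ 2 + y t ^+ 2.
pose dn t := 2 * (x t - wB) * (rho t * y t) + 2 * y t * (rho t * (b (x t) * y t + G (x t))).
have key u v : c < u -> u <= v -> v < d -> (n u = 0 -> n v = 0) /\ (n v = 0 -> n u = 0).
  move=> cu uv vd.
  have sub r : u <= r <= v -> c < r < d by move=> /andP[r1 r2]; apply/andP; split; plra.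
  have [Kx Kx0 hKx] : exists2 M, 0 < M & forall t, u <= t <= v -> `|x t| <= M.
    by apply: cont_bounded => // r /sub /orb [_ _ _ /isD_cont].
  have [Kr Kr0 hKr] : exists2 M, 0 < M & forall t, u <= t <= v -> `|rho t| <= M.
    by apply: cont_bounded => // r /sub /orb [].
  have [Kb Kb0 hKb] : exists2 M, 0 < M & forall t, u <= t <= v -> `|b (x t)| <= M.
    apply: (@cont_bounded _ (fun t => b (x t))) => // r /sub /orb [xr _ _ /isD_cont xc _].
    by apply: (@continuous_comp _ _ _ x b) => //; exact: bc.
  have [C C0 hC] := GLip Kx0.
  apply: (@gronwall0 _ n dn u v (2 * Kr * (1 + C + Kb)) uv).
    move=> t /sub /orb [xp rp rc xD yD].
    apply: isD_add; apply: isD_sqr => //.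
    by apply: isD_eq; [apply: isD_sub; [exact: xD|exact: isD_cst]|plra].
  move=> t tuv; have [xp rp _ _ _] := orb _ (sub _ tuv).
  have hx : x t <= Kx by apply: le_trans (hKx t tuv); exact: ler_norm.
  have hG := hC _ xp hx.
  have hr : rho t <= Kr by apply: le_trans (hKr t tuv); exact: ler_norm.
  have hb := hKb t tuv.
  have -> : dn t = rho t * (2 * (x t - wB) * y t + 2 * y t * (b (x t) * y t + G (x t))).
    by rewrite /dn; ring.
  rewrite normrM (gtr0_norm rp).
  have : `|2 * (x t - wB) * y t + 2 * y t * (b (x t) * y t + G (x t))| <=
     2 * (1 + C + Kb) * n t.
    have e1 : n t = `|x t - wB| ^+ 2 + `|y t| ^+ 2 by rewrite !real_normK ?num_real.
    rewrite e1; apply: (le_trans (ler_normD _ _)).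
    rewrite !normrM !(ger0_norm (ler0n _ _)).
    have : `|b (x t) * y t + G (x t)| <= Kb * `|y t| + C * `|x t - wB|.
      apply: (le_trans (ler_normD _ _)); rewrite normrM lerD // ler_wpM2r //.
    move: (normr_ge0 (x t - wB)) (normr_ge0 (y t)) (normr_ge0 (b (x t) * y t + G (x t))).
    move: (`|x t - wB|) (`|y t|) (`|b (x t) * y t + G (x t)|) => p r s p0 r0 s0 hs.
    have : r * s <= r * (Kb * r + C * p) by rewrite ler_wpM2l.
    have : 0 <= (p - r) ^+ 2 by exact: sqr_ge0.
    have : 0 <= C * (p - r) ^+ 2 by rewrite mulr_ge0 ?sqr_ge0 // ltW.
    have : 0 <= Kb * p ^+ 2 by rewrite mulr_ge0 ?sqr_ge0 // ltW.
    have : 0 <= C * p ^+ 2 by rewrite mulr_ge0 ?sqr_ge0 // ltW.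
    have : 0 <= C * r ^+ 2 by rewrite mulr_ge0 ?sqr_ge0 // ltW.
    have : 0 <= p ^+ 2 by exact: sqr_ge0.
    have : 0 <= r ^+ 2 by exact: sqr_ge0.
    nra.
  have n0 : 0 <= n t by rewrite addr_ge0 ?sqr_ge0.
  move=> h1; have -> : 2 * Kr * (1 + C + Kb) * n t = Kr * (2 * (1 + C + Kb) * n t) by ring.
  by apply: ler_pM => //; exact: ltW.
have n0 : n t0 = 0 by rewrite /n xt0 yt0 subrr expr0n addr0.
move=> t /andP[t1 t2].
have : n t = 0.
  case: (lerP t0 t) => tt; first exact: (key t0 t t01 tt t2).1.
  exact: (key t t0 t1 (ltW tt) t02).2.
move=> /eqP; rewrite /n paddr_eq0 ?sqr_ge0 // !sqrf_eq0 subr_eq0 => /andP[/eqP -> _] //.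
Qed.

Lemma G_ge0 (x : R) : 0 < x -> 0 <= G x -> x <= wB.
Proof. by move=> x0 Gx; rewrite leNgt; apply/negP => /Gneg; plra. Qed.
Lemma G_le0 (x : R) : 0 < x -> G x <= 0 -> wB <= x.
Proof. by move=> x0 Gx; rewrite leNgt; apply/negP => /(Gpos x0); plra. Qed.

(** Time reversal turns falls into rises; it changes the sign of the coefficient
    [b] but not that of [G]. *)
Lemma orbit_rev b rho x y c d : orbit b rho x y c d ->
  orbit (fun w => - b w) (fun t => rho (- t)) (fun t => x (- t)) (fun t => - y (- t)) (- d) (- c).
Proof.
move=> orb t /andP[t1 t2]; have [|x0 r0 rc xD yD] := orb (- t).
  by apply/andP; split; plra.
split => //.
- exact: contN_refl.
- by apply: isD_eq; [exact: isD_refl xD|ring].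
by apply: isD_eq; [exact: isD_opp (isD_refl yD)|ring].
Qed.

Lemma orbit_sub b rho x y c d c' d' : orbit b rho x y c d -> c <= c' -> d' <= d ->
  orbit b rho x y c' d'.
Proof. by move=> orb cc dd t /andP[t1 t2]; apply: orb; apply/andP; split; plra. Qed.

Lemma cont_lim_right f c : {for c, continuous f} -> lim_right f c (f c).
Proof.
move=> /cont_epsP h e /h [d d0 hd]; exists d => // t /andP[t1 t2]; apply: hd.
by rewrite ltr_norml; apply/andP; split; plra.
Qed.
Lemma cont_lim_left f c : {for c, continuous f} -> lim_left f c (f c).
Proof.
move=> /cont_epsP h e /h [d d0 hd]; exists d => // t /andP[t1 t2]; apply: hd.
by rewrite ltr_norml; apply/andP; split; plra.
Qed.
Lemma lim_right_refl f c l : lim_left f c l -> lim_right (fun t => f (- t)) (- c) l.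
Proof.
by move=> h e /h [d d0 hd]; exists d => // t /andP[t1 t2]; apply: hd; apply/andP; split; plra.
Qed.
Lemma lim_left_refl f c l : lim_right f c l -> lim_left (fun t => f (- t)) (- c) l.
Proof.
by move=> h e /h [d d0 hd]; exists d => // t /andP[t1 t2]; apply: hd; apply/andP; split; plra.
Qed.
Lemma lim_right_opp f c l : lim_right f c l -> lim_right (fun t => - f t) c (- l).
Proof. by move=> h e /h [d d0 hd]; exists d => // t /hd; rewrite -opprB normrN opprK addrC. Qed.
Lemma lim_left_opp f c l : lim_left f c l -> lim_left (fun t => - f t) c (- l).
Proof. by move=> h e /h [d d0 hd]; exists d => // t /hd; rewrite -opprB normrN opprK addrC. Qed.

(** The ends [c] and [d] may be edges of the support, where the orbit has limits
    only. *)
Lemma rising_arc b rho x y c d lo hi : c < d -> orbit b rho x y c d ->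
  (forall t, c < t < d -> 0 < y t) -> lim_right x c lo -> lim_left x d hi ->
  exists g Y : R -> R,
   [/\ (forall t, c < t < d -> lo < x t < hi /\ g (x t) = t),
       (forall w, lo < w < hi -> [/\ c < g w < d, x (g w) = w, Y w = y (g w) &
                    isD g w (rho (g w) * y (g w))^-1]),
       phase_arc Y b lo hi,
       (lim_right y c 0 -> vanish_right Y lo) & (lim_left y d 0 -> vanish_left Y hi)].
Proof.
move=> cd orb ypos xlo xhi.
have xinc s t : c < s -> s < t -> t < d -> x s < x t.
  move=> cs st td; apply: (@incr _ x (fun t => rho t * y t)) => //.
    by move=> r /andP[r1 r2]; have [|] := orb r; first by apply/andP; split; plra.
  move=> r /andP[r1 r2]; have rcd : c < r < d by apply/andP; split; plra.
  by have [_ rr _ _ _] := orb r rcd; rewrite mulr_gt0 // ypos.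
have nearc e0 : 0 < e0 -> exists2 t, c < t < d & t < c + e0.
  move=> e00; exists (c + Num.min e0 (d - c) / 2);
   have m0 : 0 < Num.min e0 (d - c) by rewrite lt_min e00; plra.
    have m2 : Num.min e0 (d - c) <= d - c by rewrite ge_min lexx orbT.
    by apply/andP; split; plra.
  have m1 : Num.min e0 (d - c) <= e0 by rewrite ge_min lexx.
  plra.
have neard e0 : 0 < e0 -> exists2 t, c < t < d & d - e0 < t.
  move=> e00; exists (d - Num.min e0 (d - c) / 2);
   have m0 : 0 < Num.min e0 (d - c) by rewrite lt_min e00; plra.
    have m2 : Num.min e0 (d - c) <= d - c by rewrite ge_min lexx orbT.
    by apply/andP; split; plra.
  have m1 : Num.min e0 (d - c) <= e0 by rewrite ge_min lexx.
  plra.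
have xge t : c < t < d -> lo <= x t.
  move=> /andP[t1 t2]; rewrite leNgt; apply/negP => xt.
  have [e0 e00 he] := xlo (lo - x t) ltac:(plra).
  have [s /andP[s1 s2] s3] := nearc (Num.min e0 (t - c)) ltac:(by rewrite lt_min e00; plra).
  have m1 : Num.min e0 (t - c) <= e0 by rewrite ge_min lexx.
  have m2 : Num.min e0 (t - c) <= t - c by rewrite ge_min lexx orbT.
  have := he s; have -> : c < s < c + e0 by apply/andP; split; plra.
  move=> /(_ isT); rewrite ltr_norml => /andP[h1 h2].
  have := xinc s t s1 ltac:(plra) t2; plra.
have xle t : c < t < d -> x t <= hi.
  move=> /andP[t1 t2]; rewrite leNgt; apply/negP => xt.
  have [e0 e00 he] := xhi (x t - hi) ltac:(plra).
  have [s /andP[s1 s2] s3] := neard (Num.min e0 (d - t)) ltac:(by rewrite lt_min e00; plra).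
  have m1 : Num.min e0 (d - t) <= e0 by rewrite ge_min lexx.
  have m2 : Num.min e0 (d - t) <= d - t by rewrite ge_min lexx orbT.
  have := he s; have -> : d - e0 < s < d by apply/andP; split; plra.
  move=> /(_ isT); rewrite ltr_norml => /andP[h1 h2].
  have := xinc t s t1 ltac:(plra) s2; plra.
have xr t : c < t < d -> lo < x t < hi.
  move=> /andP[t1 t2].
  have := xge ((c + t) / 2) ltac:(apply/andP; split; plra).
  have := xinc ((c + t) / 2) t ltac:(plra) ltac:(plra) t2.
  have := xle ((d + t) / 2) ltac:(apply/andP; split; plra).
  have := xinc t ((d + t) / 2) t1 ltac:(plra) ltac:(plra).
  by move=> *; apply/andP; split; plra.
have [||g [Y [gx hg A]]] := phase_arc_of_orbit orb ypos xr.
- move=> e e0; have [r r0 hr] := xlo e e0; have [s /andP[s1 s2] s3] := nearc r r0.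
  exists s; first by rewrite s1.
  have := hr s; rewrite s1 s3 => /(_ isT); rewrite ltr_norml => /andP[]; plra.
- move=> e e0; have [r r0 hr] := xhi e e0; have [s /andP[s1 s2] s3] := neard r r0.
  exists s; first by rewrite s1.
  have := hr s; rewrite s2 s3 => /(_ isT); rewrite ltr_norml => /andP[]; plra.
exists g, Y; split => //.
- by move=> t tcd; split; [exact: xr|exact: gx].
- move=> h; apply: (vanish_right_of cd orb ypos xr gx hg) => e /h [r r0 hr].
  by exists r => // t /hr; rewrite subr0; apply: le_lt_trans; exact: ler_norm.
move=> h; apply: (vanish_left_of cd orb ypos xr gx hg) => e /h [r r0 hr].
by exists r => // t /hr; rewrite subr0; apply: le_lt_trans; exact: ler_norm.
Qed.

(** Near the end [x] is below [wB], where [y] can cross [0] only upwards. If it were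
    non-negative there it would remain so, and [x] could not tend to [0]. *)
Lemma eventually_falls b rho x y c d t2 : orbit b rho x y c d ->
  lim_left x d 0 -> c < t2 < d -> exists2 t', t2 < t' < d & forall u, t' <= u -> u < d -> y u < 0.
Proof.
move=> orb xv /andP[ct2 t2d].
have {}xv e : 0 < e -> exists2 r, 0 < r & forall t, d - r < t < d -> x t < e.
  by move=> /xv [r r0 hr]; exists r => // t /hr; rewrite subr0; apply: le_lt_trans; exact: ler_norm.
have [r r0 hr] := xv _ wB0.
have [t' /andP[t't2 t'd] t'r] := pick_left t2d r0.
exists t' => [|u u1 u2]; first by rewrite t't2.
have xs t : t' <= t -> t < d -> x t < wB.
  by move=> h1 h2; apply: hr; rewrite h2 (lt_le_trans t'r).
rewrite ltNge; apply/negP => yu.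
have cu : c < u by rewrite (lt_le_trans _ u1) // (lt_trans ct2).
have [xu0 _ _ _ _] := orb u (introT andP (conj cu u2)).
have [r' r'0 hr'] := xv _ xu0.
have [u' /andP[uu' u'd] u'r] := pick_left u2 r'0.
have xuu' : x u' < x u by apply: hr'; rewrite u'r.
have cdi s : u <= s -> s <= u' -> c < s < d.
  by move=> s1 s2; rewrite (lt_le_trans cu s1) (le_lt_trans s2).
have [s /andP[s1 s2] es] : exists2 s, u < s < u' & x u' - x u = (rho s * y s) * (u' - u).
  apply: (@mvt _ x (fun s => rho s * y s)) => // s /andP[s1 s2].
  by have [] := orb s (cdi _ s1 s2).
have [xs0 rs0 _ _ _] := orb s (cdi _ (ltW s1) (ltW s2)).
have ys : y s < 0.
  rewrite ltNge; apply/negP => ys; have : 0 <= rho s * y s * (u' - u).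
    by rewrite !mulr_ge0 ?subr_ge0 // ltW.
  by rewrite -es subr_ge0 leNgt xuu'.
have [||||z' /andP[z'1 z'2] [yz' hneg']] := @last_zero _ (fun t => - y t) u s.
- exact: ltW.
- move=> t /andP[h1 h2]; apply: continuousN.
  by have [_ _ _ _ /isD_cont] := orb t (cdi _ h1 (le_trans h2 (ltW s2))).
- by rewrite oppr_le0.
- by rewrite oppr_gt0.
move/eqP: yz'; rewrite oppr_eq0 => /eqP yz'.
have [xz0 rz0 _ _ yzD] := orb z' (cdi _ z'1 (ltW (lt_trans z'2 s2))).
have : 0 < rho z' * G (x z').
  rewrite mulr_gt0 //; apply: Gpos => //; apply: xs; first exact: le_trans z'1.
  by rewrite (lt_trans z'2) // (lt_trans s2).
have := @isD_zero_sign_right _ y z' _ (s - z') _ yzD yz'.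
rewrite yz' mulr0 add0r subr_gt0 leNgt => H; apply/negP; apply: H => // t /andP[h1 h2].
rewrite addrC subrK in h2.
by have := hneg' t; rewrite h1 (ltW h2) oppr_gt0 => /(_ isT).
Qed.

(** If the orbit turned round, its first fall would end in a minimum below [wB], and
    its last one would start from a maximum no higher than the global one. Run
    backwards these are two arcs of one equation; above that minimum the second one
    is on top, so that by [arc_order] it would reach the higher maximum. *)
Lemma falls_after_max b rho x y c d tM : orbit b rho x y c d ->
  (forall w, 0 < w -> {for w, continuous b}) ->
  c < tM < d -> (forall t, tM <= t < d -> x t <= x tM) -> wB < x tM -> y tM = 0 ->
  lim_left x d 0 -> forall t, tM < t < d -> y t < 0.
Proof.
move=> orb bc tMcd xmax xMB yM0 xv0 z /andP[z1 z2].
have wBp := wB0.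
have neq t : c < t < d -> y t = 0 -> x t <> wB.
  move=> tcd yt xt; have := not_equilibrium orb bc tcd xt yt tMcd; plra.
case/andP: (tMcd) => cM Md.
have [xM0 rM0 _ _ yMD] := orb _ tMcd.
have yc t : c < t < d -> {for t, continuous y} by move=> /orb [_ _ _ _ /isD_cont].
have [dl dl0 [hdl _]] : exists2 dl : R, 0 < dl & (forall s : R, tM < s < tM + dl -> - y tM < - y s) /\
                     (forall s : R, tM - dl < s < tM -> - y s < - y tM).
  apply: (isD_incr_near (isD_opp yMD)).
  rewrite yM0 mulr0 add0r -mulrN mulr_gt0 // oppr_gt0; exact: Gneg.
rewrite ltNge; apply/negP => yz.
have [ta /andP[ta1 taz] tar] := pick_right z1 dl0.
have neg1 t : tM < t -> t <= ta -> y t < 0.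
  move=> h1 h2; have := hdl t; have -> : tM < t < tM + dl by rewrite h1 (le_lt_trans h2).
  by move=> /(_ isT); rewrite yM0; plra.
have [||||t2 /andP[t21 t22] [yt2 hneg]] := @first_zero _ (fun t => - y t) ta z.
- exact: ltW.
- by move=> t /andP[h1 h2]; apply: continuousN; apply: yc; apply/andP; split; plra.
- by rewrite oppr_gt0; apply: neg1.
- by rewrite oppr_le0.
have {}yt2 : y t2 = 0 by plra.
have negM t : tM < t < t2 -> y t < 0.
  move=> /andP[h1 h2]; case: (lerP t ta) => h; first exact: neg1.
  by have := hneg t; rewrite (ltW h) h2 => /(_ isT); plra.
have t2cd : c < t2 < d by apply/andP; split; plra.
have [x20 r20 _ x2D y2D] := orb _ t2cd.
have x2B : x t2 < wB.
  rewrite lt_neqAle; apply/andP; split; first by apply/eqP; exact: neq.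
  apply: G_ge0 => //.
  have := @isD_zero_sign_left _ y t2 _ (t2 - tM) _ y2D yt2.
  rewrite yt2 mulr0 add0r pmulr_rge0 //; apply; first plra.
  by move=> t /andP[h1 h2]; apply: negM; apply/andP; split; plra.
have [t' /andP[t't2 t'd] negE] := eventually_falls orb xv0 t2cd.
have [||||t3 /andP[t31 t32] [yt3 hneg3]] := @last_zero _ (fun t => - y t) t2 t'.
- exact: ltW.
- by move=> t /andP[h1 h2]; apply: continuousN; apply: yc; apply/andP; split; plra.
- by rewrite yt2 oppr0.
- by rewrite oppr_gt0; apply: negE.
have {}yt3 : y t3 = 0 by plra.
have neg3 t : t3 < t < d -> y t < 0.
  move=> /andP[h1 h2]; case: (lerP t t') => h; last by apply: negE => //; exact: ltW.
  by have := hneg3 t; rewrite h1 h => /(_ isT); plra.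
have t3cd : c < t3 < d by apply/andP; split; plra.
have [x30 r30 _ x3D y3D] := orb _ t3cd.
have x3B : wB < x t3.
  rewrite lt_neqAle; apply/andP; split; first by rewrite eq_sym; apply/eqP; exact: neq.
  apply: G_le0 => //.
  have := @isD_zero_sign_right _ y t3 _ (d - t3) _ y3D yt3.
  rewrite yt3 mulr0 add0r pmulr_rle0 //; apply; first plra.
  by move=> t /andP[h1 h2]; apply: neg3; apply/andP; split; plra.
have xdec u v : tM <= u -> u < v -> v < d -> (forall t, u < t < v -> y t < 0) -> x v < x u.
  move=> h1 h2 h3 hn; rewrite -ltrN2.
  apply: (@incr _ (fun t => - x t) (fun t => - (rho t * y t))) => // t /andP[k1 k2].
    by apply: isD_opp; have [] := orb t; first by apply/andP; split; plra.
  have [xt0 rt0 _ _ _] : [/\ 0 < x t, 0 < rho t, {for t, continuous rho}, isD x t (rho t * y t) &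
      isD y t (rho t * (b (x t) * y t + G (x t)))] by apply: orb; apply/andP; split; plra.
  by rewrite -mulrN mulr_gt0 // oppr_gt0; apply: hn; rewrite k1.
(* the two descents, run backwards, are rising arcs *)
have xcont t : c < t < d -> {for t, continuous x} by move=> /orb [_ _ _ /isD_cont].
have O1 := orbit_sub (orbit_rev orb) (_ : - d <= - t2) (_ : - tM <= - c).
have {}O1 := O1 ltac:(plra) ltac:(plra).
have P1 t : - t2 < t < - tM -> 0 < - y (- t).
  by move=> /andP[h1 h2]; rewrite oppr_gt0; apply: negM; apply/andP; split; plra.
have n12 : - t2 < - tM by plra.
have [g1 [Y1 [_ _ A1 V1 _]]] := rising_arc n12 O1 P1
  (lim_right_refl (cont_lim_left (xcont _ t2cd))) (lim_left_refl (cont_lim_right (xcont _ tMcd))).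
have {}V1 : vanish_right Y1 (x t2).
  by apply: V1; rewrite -[0]oppr0 -yt2; apply: lim_right_opp; apply: lim_right_refl; apply: cont_lim_left; apply: yc.
have O2 := orbit_sub (orbit_rev orb) (_ : - d <= - d) (_ : - t3 <= - c).
have {}O2 := O2 ltac:(plra) ltac:(plra).
have P2 t : - d < t < - t3 -> 0 < - y (- t).
  by move=> /andP[h1 h2]; rewrite oppr_gt0; apply: neg3; apply/andP; split; plra.
have n3d : - d < - t3 by plra.
have [g2 [Y2 [_ _ A2 _ V2]]] := rising_arc n3d O2 P2
  (lim_right_refl xv0) (lim_left_refl (cont_lim_right (xcont _ t3cd))).
have {}V2 : vanish_left Y2 (x t3).
  by apply: V2; rewrite -[0]oppr0 -yt3; apply: lim_left_opp; apply: lim_left_refl; apply: cont_lim_right; apply: yc.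
have x3M : x t3 <= x tM by apply: xmax; apply/andP; split; plra.
have [p2 d2] : 0 < Y2 (x t2) /\ isD Y2 (x t2) (- b (x t2) + G (x t2) / Y2 (x t2)).
  by apply: A2; apply/andP; split; plra.
have [e1 e10 he1] := V1 (Y2 (x t2) / 2) ltac:(plra).
have [e2 e20 he2] : exists2 e : R, 0 < e & forall w, `|w - x t2| < e -> 0 < Y2 w - Y2 (x t2) / 2.
  apply: (@cont_gt0 _ (fun w => Y2 w - Y2 (x t2) / 2)); last plra.
  by apply: continuousB; [exact: isD_cont d2|exact: cvg_cst].
have e120 : 0 < Num.min e1 e2 by rewrite lt_min e10.
have [w0 /andP[w0l w0r] w0e] := pick_right (lt_trans x2B x3B) e120.
rewrite -ltrBlDl lt_min in w0e; case/andP: w0e => w0e1 w0e2.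
have h1 : Y1 w0 < Y2 (x t2) / 2 by apply: he1; apply/andP; split; plra.
have h2 : 0 < Y2 w0 - Y2 (x t2) / 2.
  by apply: he2; rewrite ltr_norml; apply/andP; split; plra.
have A2' : phase_arc Y2 (fun w => - b w) (x t2) (x t3).
  by move=> w /andP[k1 k2]; apply: A2; apply/andP; split; plra.
have : x tM < x t3; last by rewrite ltNge x3M.
apply: (@arc_order Y1 Y2 _ _ (x t2) _ _ w0 _ _ _ A1 A2') => //; plra.
Qed.

(** At the global maximum [y = 0] and [x > wB], since [not_equilibrium] rules out
    [x = wB]. [falls_after_max] applies after it, and to the reversed orbit
    before it. *)
Lemma single_bump b rho x y c d : c < d -> orbit b rho x y c d ->
  (forall w, 0 < w -> {for w, continuous b}) -> lim_right x c 0 -> lim_left x d 0 ->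
  exists tM, [/\ c < tM < d, wB < x tM, y tM = 0,
    (forall t, c < t < tM -> 0 < y t) & (forall t, tM < t < d -> y t < 0)].
Proof.
move=> cd orb bc xc xd.
have wBp := wB0.
pose mid := (c + d) / 2.
have midcd : c < mid < d by rewrite /mid; apply/andP; split; plra.
have [xm0 _ _ _ _] := orb _ midcd.
have [r1 r10 hr1] := xc _ xm0; have [r2 r20 hr2] := xd _ xm0.
pose r := Num.min r1 (Num.min r2 ((d - c) / 2)).
have q0 : 0 < r by rewrite !lt_min r10 r20; plra.
have q1 : r <= r1 by rewrite ge_min lexx.
have q2 : r <= r2 by rewrite !ge_min lexx orbT.
have q3 : r <= (d - c) / 2 by rewrite !ge_min lexx !orbT.
have [|tM /andP[tM1 tM2] hM] := @cont_argmax _ x (c + r / 2) (d - r / 2) ltac:(plra).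
  by move=> t /andP[t1 t2]; have [|_ _ _ /isD_cont] := orb t; first by apply/andP; split; plra.
have tMcd : c < tM < d by apply/andP; split; plra.
have xmax t : c < t < d -> x t <= x tM.
  move=> /andP[t1 t2].
  have xmM : x mid <= x tM by apply: hM; rewrite /mid; apply/andP; split; plra.
  case: (ltrP t (c + r / 2)) => h1.
    have := hr1 t; have -> : c < t < c + r1 by apply/andP; split; plra.
    move=> /(_ isT); rewrite subr0 ltr_norml => /andP[]; plra.
  case: (lerP t (d - r / 2)) => h2; first by apply: hM; rewrite h1.
  have := hr2 t; have -> : d - r2 < t < d by apply/andP; split; plra.
  move=> /(_ isT); rewrite subr0 ltr_norml => /andP[]; plra.
have [xM0 rM0 _ xD yD] := orb _ tMcd; case/andP: (tMcd) => t1 t2.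
have yM : y tM = 0.
  apply/eqP; rewrite eq_le; apply/andP; split; rewrite leNgt; apply/negP => yM.
    have [e e0 [he _]] := isD_incr_near xD (mulr_gt0 rM0 yM).
    have [s /andP[s1 s2] s3] := pick_right t2 e0.
    have := he s; rewrite s1 s3 => /(_ isT); apply/negP; rewrite -leNgt.
    by apply: xmax; rewrite (lt_trans t1).
  have [e e0 [_ he]] := isD_incr_near (isD_opp xD) ltac:(rewrite oppr_gt0 pmulr_rlt0 //).
  have [s /andP[s1 s2] s3] := pick_left t1 e0.
  have := he s; rewrite s2 s3 => /(_ isT); rewrite ltrN2; apply/negP; rewrite -leNgt.
  by apply: xmax; rewrite s1 (lt_trans s2).
have xMB : wB < x tM.
  rewrite lt_neqAle; apply/andP; split.
    apply/eqP => e; have eqB := not_equilibrium orb bc tMcd (esym e) yM.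
    have [rr rr0 hrr] := xc _ wB0.
    have [s /andP[s1 s2] s3] := pick_right cd rr0.
    have := hrr s; rewrite s1 s3 => /(_ isT); rewrite eqB ?s1 //.
    by rewrite subr0 gtr0_norm // ltxx.
  apply: G_le0 => //; rewrite leNgt; apply/negP => GM.
  have [|e e0 [he _]] := isD_incr_near yD; first by rewrite yM mulr0 add0r mulr_gt0.
  have [s /andP[s1 s2] s3] := pick_right t2 e0.
  have : x s <= x tM by apply: xmax; rewrite (lt_trans t1).
  apply/negP; rewrite -ltNge; apply: (@incr _ x (fun t => rho t * y t)) => //.
    move=> t /andP[k1 k2]; have [|] // := orb t.
    by rewrite (lt_le_trans t1) // (le_lt_trans k2).
  move=> t /andP[k1 k2].
  have [|_ rt _ _ _] := orb t; first by rewrite (lt_trans t1) // (lt_trans k2).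
  by rewrite mulr_gt0 // -yM; apply: he; rewrite k1 (lt_trans k2).
exists tM; split => //; last first.
  apply: (falls_after_max orb bc tMcd _ xMB yM xd).
  by move=> t /andP[k1 k2]; apply: xmax; apply/andP; split; plra.
move=> t /andP[k1 k2].
have H := @falls_after_max _ _ _ _ _ _ (- tM) (orbit_rev orb) _ _ _ _ _ (lim_left_refl xc) (- t).
rewrite -oppr_lt0 -{1}[t]opprK; apply: H.
- by move=> w /bc; exact: continuousN.
- by apply/andP; split; plra.
- by move=> s /andP[s1 s2]; rewrite opprK; apply: xmax; apply/andP; split; plra.
- by rewrite opprK.
- by rewrite opprK yM oppr0.
by apply/andP; split; plra.
Qed.

End PhasePlane.

(** * Ordinary differential equations *)

Section Picard.
Context {R : realType}.
Implicit Types (t x z e : R).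

(** In the norm weighted by [expR (- k |t|)], integration gains a factor [1 / k]. *)
Lemma isD_exp_bound (F g : R -> R) (D k : R) : 0 < k -> 0 <= D -> F 0 = 0 ->
  (forall t, isD F t (g t)) -> (forall t, `|g t| <= D * expR (k * `|t|)) ->
  forall t, `|F t| <= D / k * expR (k * `|t|).
Proof.
move=> k0 D0; suff pos (F' g' : R -> R) : F' 0 = 0 -> (forall t, isD F' t (g' t)) ->
    (forall t, `|g' t| <= D * expR (k * `|t|)) ->
    forall t, 0 <= t -> `|F' t| <= D / k * expR (k * `|t|).
  move=> F0 FD gb t; case: (lerP 0 t) => t0; first exact: (pos F g).
  have := @pos (fun s => F (- s)) (fun s => - g (- s)) _ _ _ (- t) _.
  rewrite opprK normrN; apply; rewrite ?oppr0 //; last by rewrite oppr_ge0 ltW.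
    by move=> s; apply: isD_refl.
  by move=> s; rewrite normrN -[`|s|]normrN; apply: gb.
move=> F0 FD gb t t0.
have Dk : 0 <= D / k by rewrite divr_ge0 // ltW.
have ED s : isD (fun s => D / k * expR (k * s)) s (D * expR (k * s)).
  apply: isD_eq; first exact: (isD_mul (isD_cst _ _) (isD_expR (isD_mul (isD_cst _ _) (isD_id _)))).
  by rewrite /=; field; rewrite gt_eqF.
have gb' s : 0 < s < t -> - (D * expR (k * s)) <= g' s <= D * expR (k * s).
  by move=> /andP[s0 _]; have := gb s; rewrite (gtr0_norm s0) ler_norml.
have h1 : D / k * expR (k * 0) - F' 0 <= D / k * expR (k * t) - F' t.
  apply: (@ndecr _ (fun s => D / k * expR (k * s) - F' s) (fun s => D * expR (k * s) - g' s) 0 t t0).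
    by move=> s _; apply: isD_sub; [exact: ED|exact: FD].
  by move=> s /gb' /andP[_ h]; rewrite subr_ge0.
have h2 : D / k * expR (k * 0) + F' 0 <= D / k * expR (k * t) + F' t.
  apply: (@ndecr _ (fun s => D / k * expR (k * s) + F' s) (fun s => D * expR (k * s) + g' s) 0 t t0).
    by move=> s _; apply: isD_add; [exact: ED|exact: FD].
  by move=> s /gb' /andP[h _]; rewrite addrC -[_ * _]opprK subr_ge0.
rewrite mulr0 expR0 mulr1 F0 in h1 h2; rewrite (ger0_norm t0) ler_norml.
by apply/andP; split; lra.
Qed.

Lemma half_pow_gt0 n : 0 < (2^-1 : R) ^+ n.
Proof. by rewrite exprn_gt0 // invr_gt0. Qed.

Lemma geometric_limit (u : nat -> R) (c : R) :
  (forall n, `|u n.+1 - u n| <= c * 2^-1 ^+ n) ->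
  exists l, forall n, `|u n - l| <= 2 * c * 2^-1 ^+ n.
Proof.
move=> h.
have h' n : - (c * 2^-1 ^+ n) <= u n.+1 - u n <= c * 2^-1 ^+ n by rewrite -ler_norml.
pose v n := u n - 2 * c * 2^-1 ^+ n; pose w n := u n + 2 * c * 2^-1 ^+ n.
have c0 : 0 <= c.
  by have := le_trans (normr_ge0 _) (h 0%N); rewrite expr0 mulr1.
have vS n : v n <= v n.+1.
  have /andP[h1 h2] := h' n; rewrite /v exprS; move: h1; move: (2^-1 ^+ n) => e; lra.
have wS n : w n.+1 <= w n.
  have /andP[h1 h2] := h' n; rewrite /w exprS; move: h2; move: (2^-1 ^+ n) => e; lra.
have vm n k : v n <= v (n + k)%N.
  by elim: k => [|k IH]; rewrite ?addn0 // addnS (le_trans IH).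
have wm n k : w (n + k)%N <= w n.
  by elim: k => [|k IH]; rewrite ?addn0 // addnS (le_trans _ IH).
have vw n : v n <= w n.
  by rewrite /v /w; have := mulr_ge0 c0 (ltW (half_pow_gt0 n)); move: (2^-1 ^+ n) => e; lra.
have vwnm n k : v n <= w k.
  by apply: (le_trans (vm n k)); apply: (le_trans (vw _)); rewrite addnC.
pose E := [set v n | n in [set: nat]].
have sE : has_sup E by split; [exists (v 0%N), 0%N|exists (w 0%N) => _ [n _ <-]].
exists (sup E) => n.
have h1 : v n <= sup E by apply: ub_le_sup; [case: sE|exists n].
have h2 : sup E <= w n by apply: ge_sup; [case: sE|move=> _ [k _ <-]].
by rewrite ler_norml; move: h1 h2; rewrite /v /w => h1 h2; apply/andP; split; lra.
Qed.

Lemma small_pow_eq0 (a c : R) : (forall n, `|a| <= c * 2^-1 ^+ n) -> a = 0.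
Proof.
move=> h; apply/eqP; rewrite -normr_le0 leNgt; apply/negP => a0.
have c0 : 0 < c.
  by have := lt_le_trans a0 (h 0%N); rewrite expr0 mulr1.
have [n hn] : exists n : nat, c / `|a| < n%:R.
  by exists (Num.truncn (c / `|a|)).+1; rewrite truncnS_gt.
have : (n%:R : R) <= 2 ^+ n by rewrite -natrX ler_nat ltnW // ltn_expl.
have := h n; rewrite exprVn ler_pdivlMr ?exprn_gt0 // => h1 h2.
rewrite ltr_pdivrMr // in hn.
have : n%:R * `|a| <= `|a| * 2 ^+ n by rewrite mulrC ler_wpM2l.
lra.
Qed.

(** Total, so that the Picard iterates are plain functions. *)
Let prim (g : R -> R) : R -> R :=
  if pselect (continuous g) is left gc then sval (cid (antiderivative gc)) else fun=> 0.
Let primP g : continuous g -> prim g 0 = 0 /\ forall t, isD (prim g) t (g t).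
Proof. by move=> gc; rewrite /prim; case: pselect => // gc'; case: cid. Qed.

(** In the norm with weight [expR (- 4 L |t|)] the Picard map is a contraction on
    the whole line. *)
Theorem picard (F1 F2 : R -> R -> R -> R) (L C x0 z0 : R) : 0 < L -> 0 <= C ->
  (forall x z : R -> R, continuous x -> continuous z ->
    continuous (fun t => F1 t (x t) (z t)) /\ continuous (fun t => F2 t (x t) (z t))) ->
  (forall t x z x' z', `|F1 t x z - F1 t x' z'| <= L * (`|x - x'| + `|z - z'|) /\
                       `|F2 t x z - F2 t x' z'| <= L * (`|x - x'| + `|z - z'|)) ->
  (forall t, `|F1 t x0 z0| <= C /\ `|F2 t x0 z0| <= C) ->
  exists x z : R -> R, [/\ x 0 = x0, z 0 = z0,
    (forall t, isD x t (F1 t (x t) (z t))) & (forall t, isD z t (F2 t (x t) (z t)))].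
Proof.
move=> L0 C0 Fc Flip F0.
pose k := 4 * L; have k0 : 0 < k by rewrite mulr_gt0.
pose E t := expR (k * `|t|).
have E1 t : 1 <= E t by rewrite -[1]expR0 ler_expR mulr_ge0 ?normr_ge0 // ltW.
have E0 t : 0 < E t by exact: expR_gt0.
pose step (p : (R -> R) * (R -> R)) : (R -> R) * (R -> R) :=
  (fun t => x0 + prim (fun t => F1 t (p.1 t) (p.2 t)) t,
   fun t => z0 + prim (fun t => F2 t (p.1 t) (p.2 t)) t).
pose X n := iter n step (fun=> x0, fun=> z0).
have Xc n : continuous (X n).1 /\ continuous (X n).2.
  elim: n => [|n [c1 c2]] /=; first by split=> t; exact: cvg_cst.
  have [g1 g2] := Fc _ _ c1 c2.
  have [_ d1] := primP g1; have [_ d2] := primP g2.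
  by split=> t; [exact: isD_cont (isD_add (isD_cst t x0) (d1 t))
                |exact: isD_cont (isD_add (isD_cst t z0) (d2 t))].
pose d n t := `|(X n.+1).1 t - (X n).1 t| + `|(X n.+1).2 t - (X n).2 t|.
pose M := 2 * C / k.
have M0 : 0 <= M by rewrite divr_ge0 ?mulr_ge0 // ltW.
have primB g g' D t : continuous g -> continuous g' -> 0 <= D ->
    (forall t, `|g t - g' t| <= D * E t) -> `|prim g t - prim g' t| <= D / k * E t.
  move=> gc gc' D0 hg; have [p0 pD] := primP gc; have [p0' pD'] := primP gc'.
  apply: (@isD_exp_bound (fun t => prim g t - prim g' t) (fun t => g t - g' t)) => //.
    by rewrite p0 p0' subrr.
  by move=> s; apply: isD_sub.
have dE n t : d n t <= M * 2^-1 ^+ n * E t.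
  elim: n t => [|n IH] t.
    have c1 : continuous (fun _ : R => x0) by move=> s; exact: cvg_cst.
    have c2 : continuous (fun _ : R => z0) by move=> s; exact: cvg_cst.
    have [g1 g2] := Fc _ _ c1 c2.
    have [p1 d1] := primP g1; have [p2 d2] := primP g2.
    rewrite /d /= expr0 mulr1 !(addrC x0) !(addrC z0) !addrK.
    have b1 : `|prim (fun t => F1 t x0 z0) t| <= C / k * E t.
      apply: (@isD_exp_bound _ _ C k k0 C0 p1 d1) => s.
      exact: (le_trans (F0 s).1 (ler_peMr C0 (E1 s))).
    have b2 : `|prim (fun t => F2 t x0 z0) t| <= C / k * E t.
      apply: (@isD_exp_bound _ _ C k k0 C0 p2 d2) => s.
      exact: (le_trans (F0 s).2 (ler_peMr C0 (E1 s))).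
    by rewrite /M; move: b1 b2; move: (prim _ t) (prim _ t) => ? ?; lra.
  have [c1 c2] := Xc n; have [c1' c2'] := Xc n.+1.
  have [g1 g2] := Fc _ _ c1 c2; have [g1' g2'] := Fc _ _ c1' c2'.
  have D0 := mulr_ge0 (ltW L0) (mulr_ge0 M0 (ltW (half_pow_gt0 n))).
  have lip s : L * d n s <= L * (M * 2^-1 ^+ n) * E s.
    by rewrite -mulrA ler_wpM2l ?IH // ltW.
  have b1 : `|(X n.+2).1 t - (X n.+1).1 t| <= L * (M * 2^-1 ^+ n) / k * E t.
    rewrite /= opprD addrACA subrr add0r; apply: primB => // s.
    by apply: le_trans (lip s); exact: (Flip _ _ _ _ _).1.
  have b2 : `|(X n.+2).2 t - (X n.+1).2 t| <= L * (M * 2^-1 ^+ n) / k * E t.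
    rewrite /= opprD addrACA subrr add0r; apply: primB => // s.
    by apply: le_trans (lip s); exact: (Flip _ _ _ _ _).2.
  rewrite /d exprS; apply: (le_trans (lerD b1 b2)).
  have -> : L * (M * 2^-1 ^+ n) / k = M * (2^-1 ^+ n) / 4.
    by rewrite /k; field; rewrite gt_eqF.
  lra.
have lim1 t : exists l, forall n, `|(X n).1 t - l| <= 2 * (M * E t) * 2^-1 ^+ n.
  apply: geometric_limit => n; apply: le_trans (_ : d n t <= _).
    by rewrite /d lerDl.
  by apply: (le_trans (dE n t)); rewrite mulrAC.
have lim2 t : exists l, forall n, `|(X n).2 t - l| <= 2 * (M * E t) * 2^-1 ^+ n.
  apply: geometric_limit => n; apply: le_trans (_ : d n t <= _).
    by rewrite /d lerDr.
  by apply: (le_trans (dE n t)); rewrite mulrAC.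
pose x t := sval (cid (lim1 t)); pose z t := sval (cid (lim2 t)).
have hx t n : `|(X n).1 t - x t| <= 2 * (M * E t) * 2^-1 ^+ n by rewrite /x; case: cid.
have hz t n : `|(X n).2 t - z t| <= 2 * (M * E t) * 2^-1 ^+ n by rewrite /z; case: cid.
have lcont (Xn : nat -> R -> R) (y : R -> R) : (forall n, continuous (Xn n)) ->
    (forall t n, `|Xn n t - y t| <= 2 * (M * E t) * 2^-1 ^+ n) -> continuous y.
  move=> Xnc hy t; apply/cont_epsP => e e0.
  pose K := 2 * (M * expR (k * (`|t| + 1))) + 1.
  have K0 : 0 < K.
    by rewrite /K; have := mulr_ge0 M0 (ltW (expR_gt0 (k * (`|t| + 1)))); lra.
  have [n hn] : exists n, K * 2^-1 ^+ n < e / 3.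
    apply: contrapT => H; have : e / 3 = 0; last by lra.
    apply: (@small_pow_eq0 _ K) => n; rewrite ger0_norm; last lra.
    by rewrite leNgt; apply/negP => h; apply: H; exists n.
  have near s : `|s - t| < 1 -> `|Xn n s - y s| < e / 3.
    move=> st; apply: le_lt_trans hn; apply: (le_trans (hy s n)).
    rewrite ler_wpM2r //.
    rewrite /K; suff : M * E s <= M * expR (k * (`|t| + 1)).
      by move: (M * _) (M * _) => ? ?; lra.
    rewrite ler_wpM2l // ler_expR ler_wpM2l ?(ltW k0) //.
    have := ler_normD (s - t) t; rewrite subrK => h; apply: (le_trans h).
    by rewrite addrC lerD2l ltW.
  have /cont_epsP /(_ (e / 3)) [|r r0 hr] := Xnc n t; first lra.
  exists (Num.min r 1); first by rewrite lt_min r0 ltr01.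
  move=> s; rewrite lt_min => /andP[sr s1].
  have h1 := near s s1; have h2 := near t; rewrite subrr normr0 ltr01 in h2.
  have {}h2 := h2 isT; have h3 := hr s sr.
  rewrite !ltr_norml in h1 h2 h3 *; apply/andP; split; lra.
have xc : continuous x by apply: (lcont (fun n => (X n).1)) => // n; have [] := Xc n.
have zc : continuous z by apply: (lcont (fun n => (X n).2)) => // n; have [] := Xc n.
have [g1 g2] := Fc _ _ xc zc.
have [p1 d1] := primP g1; have [p2 d2] := primP g2.
have close t n : `|(X n).1 t - x t| + `|(X n).2 t - z t| <= 4 * M * 2^-1 ^+ n * E t.
  by have h1 := hx t n; have h2 := hz t n; lra.
have D0 n : 0 <= L * (4 * M * 2^-1 ^+ n).
  exact: (mulr_ge0 (ltW L0) (mulr_ge0 (mulr_ge0 (ler0n _ 4) M0) (ltW (half_pow_gt0 n)))).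
have lip t n : L * (`|(X n).1 t - x t| + `|(X n).2 t - z t|) <= L * (4 * M * 2^-1 ^+ n) * E t.
  by rewrite -mulrA ler_wpM2l ?close // ltW.
have xE : x = fun t => x0 + prim (fun t => F1 t (x t) (z t)) t.
  apply/funext => t; apply/eqP; rewrite -subr_eq0; apply/eqP.
  apply: (@small_pow_eq0 _ (2 * M * E t + L * (4 * M) / k * E t)) => n.
  have [c1 c2] := Xc n; have [g1n g2n] := Fc _ _ c1 c2.
  have h1 := hx t n.+1.
  have h2 : `|prim (fun t => F1 t ((X n).1 t) ((X n).2 t)) t - prim (fun t => F1 t (x t) (z t)) t|
     <= L * (4 * M * 2^-1 ^+ n) / k * E t.
    apply: primB => // s; apply: le_trans (lip s n); exact: (Flip _ _ _ _ _).1.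
  have -> : x t - (x0 + prim (fun t => F1 t (x t) (z t)) t) =
     (prim (fun t => F1 t ((X n).1 t) ((X n).2 t)) t - prim (fun t => F1 t (x t) (z t)) t)
     - ((X n.+1).1 t - x t) by rewrite /=; ring.
  apply: (le_trans (ler_normB _ _)); apply: (le_trans (lerD h2 h1)).
  rewrite exprS; have := mulr_ge0 (mulr_ge0 M0 (ltW (E0 t))) (ltW (half_pow_gt0 n)).
  have -> : L * (4 * M * 2^-1 ^+ n) / k * E t = L * (4 * M) / k * E t * 2^-1 ^+ n by ring.
  by move: (2^-1 ^+ n) (E t) (L * (4 * M) / k) => a b c; lra.
have zE : z = fun t => z0 + prim (fun t => F2 t (x t) (z t)) t.
  apply/funext => t; apply/eqP; rewrite -subr_eq0; apply/eqP.
  apply: (@small_pow_eq0 _ (2 * M * E t + L * (4 * M) / k * E t)) => n.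
  have [c1 c2] := Xc n; have [g1n g2n] := Fc _ _ c1 c2.
  have h1 := hz t n.+1.
  have h2 : `|prim (fun t => F2 t ((X n).1 t) ((X n).2 t)) t - prim (fun t => F2 t (x t) (z t)) t|
     <= L * (4 * M * 2^-1 ^+ n) / k * E t.
    apply: primB => // s; apply: le_trans (lip s n); exact: (Flip _ _ _ _ _).2.
  have -> : z t - (z0 + prim (fun t => F2 t (x t) (z t)) t) =
     (prim (fun t => F2 t ((X n).1 t) ((X n).2 t)) t - prim (fun t => F2 t (x t) (z t)) t)
     - ((X n.+1).2 t - z t) by rewrite /=; ring.
  apply: (le_trans (ler_normB _ _)); apply: (le_trans (lerD h2 h1)).
  rewrite exprS; have := mulr_ge0 (mulr_ge0 M0 (ltW (E0 t))) (ltW (half_pow_gt0 n)).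
  have -> : L * (4 * M * 2^-1 ^+ n) / k * E t = L * (4 * M) / k * E t * 2^-1 ^+ n by ring.
  by move: (2^-1 ^+ n) (E t) (L * (4 * M) / k) => a b c; lra.
exists x, z; split.
- by rewrite xE p1 addr0.
- by rewrite zE p2 addr0.
- by move=> t; rewrite {1}xE; apply: isD_eq; [exact: isD_add (isD_cst _ _) (d1 t)|rewrite add0r].
by move=> t; rewrite {1}zE; apply: isD_eq; [exact: isD_add (isD_cst _ _) (d2 t)|rewrite add0r].
Qed.

(** Gronwall for the squared distance. Velocities are given along the two
    solutions, so that solutions of different equations can be compared. *)
Lemma ode_dependence (f1 f2 f1' f2' x z x' z' : R -> R) (L e T : R) : 0 < L -> 0 <= e ->
  (forall t, isD x t (f1 t)) -> (forall t, isD z t (f2 t)) ->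
  (forall t, isD x' t (f1' t)) -> (forall t, isD z' t (f2' t)) ->
  (forall t, 0 <= t <= T -> `|f1 t - f1' t| <= L * (`|x t - x' t| + `|z t - z' t|) + e) ->
  (forall t, 0 <= t <= T -> `|f2 t - f2' t| <= L * (`|x t - x' t| + `|z t - z' t|) + e) ->
  `|x 0 - x' 0| <= e -> `|z 0 - z' 0| <= e ->
  forall t, 0 <= t <= T ->
   (x t - x' t) ^+ 2 + (z t - z' t) ^+ 2 <= 4 * e ^+ 2 * expR ((4 * L + 1) * t).
Proof.
move=> L0 e0 xD zD xD' zD' h1 h2 hx0 hz0 t /andP[t0 tT].
pose n t := (x t - x' t) ^+ 2 + (z t - z' t) ^+ 2.
pose dn t := 2 * (x t - x' t) * (f1 t - f1' t) + 2 * (z t - z' t) * (f2 t - f2' t).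
have nD s : isD n s (dn s) by apply: isD_add; apply: isD_sqr; apply: isD_sub.
have dnb s : 0 <= s <= T -> dn s <= (4 * L + 1) * n s + 2 * e ^+ 2.
  move=> sT.
  have nE : n s = `|x s - x' s| ^+ 2 + `|z s - z' s| ^+ 2 by rewrite !real_normK ?num_real.
  apply: (le_trans (ler_norm _)); apply: (le_trans (ler_normD _ _)).
  rewrite !normrM !(ger0_norm (ler0n _ _)) nE.
  move: (h1 s sT) (h2 s sT) (normr_ge0 (x s - x' s)) (normr_ge0 (z s - z' s)).
  move: (`|x s - x' s|) (`|z s - z' s|) (`|f1 s - f1' s|) (`|f2 s - f2' s|) => p r a b ha hb p0 r0.
  have k1 : p * a <= p * (L * (p + r) + e) by rewrite ler_wpM2l.
  have k2 : r * b <= r * (L * (p + r) + e) by rewrite ler_wpM2l.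
  have k3 : 0 <= L * (p - r) ^+ 2 by rewrite mulr_ge0 ?sqr_ge0 // ltW.
  have k4 : 0 <= (p - e) ^+ 2 by exact: sqr_ge0.
  have k5 : 0 <= (r - e) ^+ 2 by exact: sqr_ge0.
  nra.
have n0 : n 0 <= 2 * e ^+ 2.
  rewrite /n -(real_normK (num_real (x 0 - x' 0))) -(real_normK (num_real (z 0 - z' 0))).
  have := ler_pXn2r (ltn0Sn 1) (_ : `|x 0 - x' 0| \in Num.nneg) (_ : e \in Num.nneg).
  rewrite !nnegrE normr_ge0 e0 => /(_ isT isT) E1.
  have := ler_pXn2r (ltn0Sn 1) (_ : `|z 0 - z' 0| \in Num.nneg) (_ : e \in Num.nneg).
  rewrite !nnegrE normr_ge0 e0 => /(_ isT isT) E2.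
  by move: hx0 hz0; rewrite -E1 -E2; lra.
pose K := 4 * L + 1; have K0 : 1 <= K by rewrite /K; lra.
have : (n t + 2 * e ^+ 2) * expR (- K * t) <= (n 0 + 2 * e ^+ 2) * expR (- K * 0).
  apply: (@nincr _ (fun s => (n s + 2 * e ^+ 2) * expR (- K * s))
     (fun s => (dn s - K * (n s + 2 * e ^+ 2)) * expR (- K * s))) => //.
    move=> s _; apply: isD_eq; first exact: (isD_mul (isD_add (nD s) (isD_cst _ _))
      (isD_expR (isD_mul (isD_cst _ _) (isD_id _)))).
    by rewrite /=; ring.
  move=> s /andP[s0 st]; rewrite mulr_le0_ge0 ?expR_ge0 //.
  have sT : 0 <= s <= T by rewrite (ltW s0) (le_trans (ltW st)).
  have := dnb s sT; have : 0 <= 2 * e ^+ 2 by rewrite mulr_ge0 ?sqr_ge0.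
  rewrite -/K => k1 k2; have : 0 <= (K - 1) * (2 * e ^+ 2) by rewrite mulr_ge0 // subr_ge0.
  lra.
rewrite mulr0 expR0 mulr1 mulNr expRN ler_pdivrMr ?expR_gt0 // => h.
have n1 : 0 <= 2 * e ^+ 2 by rewrite mulr_ge0 ?sqr_ge0.
apply: (@le_trans _ _ ((n 0 + 2 * e ^+ 2) * expR (K * t))).
  by apply: le_trans h; rewrite /n lerDl.
by rewrite ler_wpM2r ?expR_ge0 //; lra.
Qed.

End Picard.

(** * Powers and clamping *)

Section Powers.
Context {R : realType}.
Implicit Types (x y K p c : R).

Lemma pwD x r s : 0 < x -> x `^ (r + s) = x `^ r * x `^ s.
Proof. by move=> x0; rewrite powRD // (gt_eqF x0) implybT. Qed.
Lemma pw_lt p x y : 0 < p -> 0 <= x -> x < y -> x `^ p < y `^ p.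
Proof.
move=> p0 x0 xy; apply: gt0_ltr_powR => //; rewrite nnegrE // ltW //.
exact: le_lt_trans xy.
Qed.
Lemma pw_le p x y : 0 <= p -> 0 <= x -> x <= y -> x `^ p <= y `^ p.
Proof.
move=> p0 x0 xy; apply: ge0_ler_powR => //; rewrite nnegrE //.
exact: le_trans xy.
Qed.
Lemma pw_cont p x : 0 < x -> {for x, continuous (fun t : R => t `^ p)}.
Proof. by move=> x0; apply: isD_cont; apply: isD_powR => //; exact: isD_id. Qed.

Lemma powR_lip p K x y : 1 <= p -> 0 <= x <= K -> 0 <= y <= K ->
  `|x `^ p - y `^ p| <= p * K `^ (p - 1) * `|x - y|.
Proof.
move=> p1; wlog xy : x y / x <= y => [H hx hy|].
  case: (leP x y) => xy; first exact: H.
  by rewrite distrC [`|x - y|]distrC; apply: H => //; exact: ltW.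
move=> /andP[x0 xK] /andP[y0 yK].
have p0 : 0 < p by lra.
have [->|yx] := eqVneq y x; first by rewrite !subrr normr0 mulr0.
have {xy}yx : x < y by rewrite lt_neqAle eq_sym yx.
have yp : 0 < y by exact: le_lt_trans yx.
rewrite [`|x `^ p - _|]distrC [`|x - y|]distrC.
rewrite (ger0_norm (_ : 0 <= y - x)) ?subr_ge0 ?(ltW yx) //.
rewrite ger0_norm ?subr_ge0; last by apply: pw_le => //; exact: ltW.
have Kp : y `^ (p - 1) <= K `^ (p - 1) by apply: pw_le => //; lra.
have [x00|xn0] := eqVneq x 0.
  rewrite x00 powR0 ?gt_eqF // !subr0 -(mulr_powRB1 y0 p0) mulrC.
  apply: ler_wpM2r => //; apply: (le_trans Kp).
  by rewrite ler_peMl // powR_ge0.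
have xp : 0 < x by rewrite lt_neqAle eq_sym xn0.
have [c /andP[c1 c2] ->] := @mvt _ (fun t => t `^ p) (fun t => p * t `^ (p - 1) * 1) x y yx
  (fun t ht => isD_powR p (lt_le_trans xp (proj1 (andP ht))) (isD_id t)).
rewrite mulr1 ler_wpM2r ?subr_ge0 ?(ltW yx) // ler_wpM2l ?(ltW p0) //.
apply: le_trans Kp; apply: pw_le; lra.
Qed.

Lemma lip_cont (f : R -> R) (L : R) : 0 < L -> (forall x y, `|f x - f y| <= L * `|x - y|) ->
  continuous f.
Proof.
move=> L0 h t; apply/cont_epsP => e e0; exists (e / L); first by rewrite divr_gt0.
move=> y yt; apply: (le_lt_trans (h y t)).
by rewrite mulrC -ltr_pdivlMr.
Qed.

Lemma cont_max (f g : R -> R) t : {for t, continuous f} -> {for t, continuous g} ->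
  {for t, continuous (fun s => Num.max (f s) (g s))}.
Proof.
move=> fc gc.
have -> : (fun s => Num.max (f s) (g s)) = (fun s => (f s + g s + `|f s - g s|) / 2).
  by apply/funext => s; rewrite maxr_absE.
apply: continuousM; last exact: cvg_cst.
apply: continuousD; first exact: continuousD.
by apply: (@continuous_comp _ _ _ (fun s => f s - g s) Num.norm); [exact: continuousB|exact: norm_continuous].
Qed.

Lemma max_lip c x y : `|Num.max x c - Num.max y c| <= `|x - y|.
Proof.
wlog xy : x y / y <= x => [H|].
  by case: (leP y x) => xy; [exact: H|rewrite distrC [`|x - y|]distrC; apply: H; exact: ltW].
rewrite (ger0_norm (_ : 0 <= x - y)) ?subr_ge0 //.
by case: (leP x c) => h1; case: (leP y c) => h2; rewrite ler_norml; apply/andP; split; lra.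
Qed.

Definition clamp K x := Num.min (Num.max x 0) K.
Lemma clamp_ge0 K x : 0 <= K -> 0 <= clamp K x.
Proof. by move=> K0; rewrite /clamp le_min K0 le_max lexx orbT. Qed.
Lemma clamp_le K x : clamp K x <= K.
Proof. by rewrite /clamp ge_min lexx orbT. Qed.
Lemma clamp_id K x : 0 <= x <= K -> clamp K x = x.
Proof. by move=> /andP[x0 xK]; rewrite /clamp; rewrite (max_l x0) (min_l xK). Qed.
Lemma clamp_neg K x : 0 <= K -> x <= 0 -> clamp K x = 0.
Proof. by move=> K0 x0; rewrite /clamp (max_r x0) (min_l K0). Qed.
Lemma clamp_lip K x y : `|clamp K x - clamp K y| <= `|x - y|.
Proof.
wlog xy : x y / x <= y => [H|].
  case: (leP x y) => xy; first exact: H.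
  by rewrite distrC [`|x - y|]distrC; apply: H; exact: ltW.
rewrite distrC [`|x - y|]distrC (ger0_norm (_ : 0 <= y - x)) ?subr_ge0 //.
rewrite /clamp; case: (leP x 0) => hx; case: (leP y 0) => hy;
 (case: (leP 0 K) => hK || idtac); (case: (leP x K) => hxK || idtac);
 (case: (leP y K) => hyK || idtac); rewrite ler_norml; apply/andP; split; lra.
Qed.

Lemma pw_small (p e : R) : 0 < p -> 0 < e ->
  exists2 d : R, 0 < d & forall x : R, 0 <= x -> x <= d -> x `^ p <= e.
Proof.
move=> p0 e0; exists (e `^ p^-1); first exact: powR_gt0.
move=> x x0 xd; apply: (le_trans (pw_le (ltW p0) x0 xd)).
by rewrite -powRrM mulVf ?powRr1 ?(ltW e0) // gt_eqF.
Qed.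

Lemma pw_large (p c : R) : 0 < p -> exists2 x : R, 1 <= x & c <= x `^ p.
Proof.
move=> p0; pose d := Num.max 1 c; have d1 : 1 <= d by rewrite le_max lexx.
have d0 : 0 < d by lra.
exists (d `^ p^-1).
  have := @pw_le p^-1 1 d ltac:(by rewrite invr_ge0 ltW) ler01 d1; by rewrite powR1.
by rewrite -powRrM mulVf ?powRr1 ?(ltW d0) ?le_max ?lexx ?orbT // gt_eqF.
Qed.

End Powers.

(** * The planar system *)

Fact model_key : unit. Proof. exact: tt. Qed.

Set Default Proof Using "All".
Section Model.
Context {R : realType}.
Variables (m q k k' : R).
Hypotheses (hm : 1 < m) (hq0 : 0 < q) (hq1 : q < 1) (hmq : 2 < m + q) (hk : 0 < k) (hk' : 0 < k').
Ltac params := move: (hm) (hq0) (hq1) (hmq) (hk) (hk') => ? ? ? ? ? ?.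
Ltac mlra := lra_recent ltac:(fun _ => clear - hm hq0 hq1 hmq hk hk').
Implicit Types (w x y K beta : R).

(** The planar system is [w' = Y], [Y' = (beta - drag w) Y + react w]. It comes from
    the profile equation with [k = 2 m / (m - 1)] and [k' = k + N - 2], in the
    clock [tau] with [d ln xi = m w ^ (m - 1) d tau]. The coefficients are
    locked, to be used through the properties proved here. *)
Definition Afr : R := locked_with model_key (k + k').
Definition Bre : R := locked_with model_key (k * k').
Definition drag : R -> R := locked_with model_key (fun w => Afr * m * w `^ (m - 1)).
Definition react : R -> R := locked_with model_key
  (fun w => m * (w `^ (m + q - 1) - Bre * w `^ (2 * m - 1))).
Lemma AfrE : Afr = k + k'. Proof. by rewrite /Afr unlock. Qed.
Lemma BreE : Bre = k * k'. Proof. by rewrite /Bre unlock. Qed.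
Lemma dragE w : drag w = Afr * m * w `^ (m - 1). Proof. by rewrite /drag unlock. Qed.
Lemma react_def w : react w = m * (w `^ (m + q - 1) - Bre * w `^ (2 * m - 1)).
Proof. by rewrite /react unlock. Qed.
Lemma A_gt0 : 0 < Afr. Proof. by rewrite AfrE addr_gt0. Qed.
Lemma B_gt0 : 0 < Bre. Proof. by rewrite BreE mulr_gt0. Qed.
(** The positive zero of [react]. *)
Definition weq := Bre `^ (- (m - q)^-1).

Lemma weq_gt0 : 0 < weq. Proof. by rewrite powR_gt0 // B_gt0. Qed.
Lemma weq_pow : Bre * weq `^ (m - q) = 1.
Proof.
params; rewrite /weq -powRrM mulNr mulVf; last by rewrite gt_eqF //; mlra.
by rewrite powRN powRr1 ?mulfV ?gt_eqF ?B_gt0 // ltW ?B_gt0.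
Qed.
Lemma reactE w : 0 < w -> react w = m * w `^ (m + q - 1) * (1 - Bre * w `^ (m - q)).
Proof.
move=> w0; rewrite react_def (_ : 2 * m - 1 = (m + q - 1) + (m - q)); last ring.
by rewrite (pwD (m + q - 1) (m - q) w0); ring.
Qed.
Lemma react_gt0 w : 0 < w -> w < weq -> 0 < react w.
Proof.
params => w0 ww; rewrite reactE // mulr_gt0 //; first by rewrite mulr_gt0 ?powR_gt0 //; mlra.
rewrite subr_gt0 -weq_pow ltr_pM2l ?B_gt0 //; apply: pw_lt => //; [mlra|exact: ltW].
Qed.
Lemma react_lt0 w : weq < w -> react w < 0.
Proof.
params => ww; have w0 := lt_trans weq_gt0 ww.
rewrite reactE // pmulr_rlt0 //; last by rewrite mulr_gt0 ?powR_gt0 //; mlra.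
rewrite subr_lt0 -weq_pow ltr_pM2l ?B_gt0 //; apply: pw_lt => //; [mlra|exact: ltW weq_gt0].
Qed.
Lemma react_weq : react weq = 0.
Proof. by rewrite reactE ?weq_gt0 // weq_pow subrr mulr0. Qed.
Lemma react0 : react 0 = 0.
Proof. by params; rewrite react_def !powR0 ?gt_eqF //; mlra. Qed.
Lemma react_ge0 w : 0 <= w -> w <= weq -> 0 <= react w.
Proof.
rewrite le_eqVlt => /orP[/eqP <- _|w0]; first by rewrite react0.
rewrite le_eqVlt => /orP[/eqP -> |ww]; first by rewrite react_weq.
by rewrite ltW // react_gt0.
Qed.
Lemma react_le w : 0 <= w -> react w <= m * w `^ (m + q - 1).
Proof.
params => w0; rewrite react_def ler_pM2l; last mlra.
by rewrite gerBl mulr_ge0 ?powR_ge0 // ltW ?B_gt0.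
Qed.
Lemma react_cont w : 0 < w -> {for w, continuous react}.
Proof.
have -> : react = (fun w => m * (w `^ (m + q - 1) - Bre * w `^ (2 * m - 1))) by apply/funext => x; exact: react_def.
move=> w0; apply: continuousM; first exact: cvg_cst.
apply: continuousB; first exact: pw_cont.
by apply: continuousM; [exact: cvg_cst|exact: pw_cont].
Qed.
Lemma drag_cont w : 0 < w -> {for w, continuous drag}.
Proof.
have -> : drag = (fun w => Afr * m * w `^ (m - 1)) by apply/funext => x; exact: dragE.
by move=> w0; apply: continuousM; [exact: cvg_cst|exact: pw_cont].
Qed.
Lemma drag_ge0 w : 0 <= drag w.
Proof. by params; have := A_gt0; rewrite dragE => A0; rewrite !mulr_ge0 ?powR_ge0 //; mlra. Qed.
Lemma drag_lt w x : 0 <= w -> w < x -> drag w < drag x.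
Proof.
params => w0 wx; rewrite !dragE ltr_pM2l; last by rewrite mulr_gt0 ?A_gt0 //; mlra.
apply: pw_lt => //; mlra.
Qed.
Lemma drag_le w x : 0 <= w -> w <= x -> drag w <= drag x.
Proof.
move=> w0; rewrite le_eqVlt => /orP[/eqP -> //|wx]; rewrite ltW //; exact: drag_lt.
Qed.
(** [drag] is a derivative, so that [Y + A w ^ m - beta w] has the derivative
    [react w], free of [Y]. *)
Lemma drag_prim w : 0 < w -> isD (fun w => Afr * w `^ m) w (drag w).
Proof.
move=> w0; apply: isD_eq; first exact: isD_mul (isD_cst _ _) (isD_powR m w0 (isD_id w)).
by rewrite dragE /=; ring.
Qed.

Definition Lreact K := m * ((m + q - 1) * K `^ (m + q - 1 - 1) + Bre * ((2 * m - 1) * K `^ (2 * m - 1 - 1))).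
Lemma Lreact_gt0 K : 0 < K -> 0 < Lreact K.
Proof.
params => K0; rewrite /Lreact mulr_gt0 //; first mlra.
by rewrite addr_gt0 // !mulr_gt0 ?powR_gt0 ?B_gt0 //; mlra.
Qed.
Lemma react_lip K x y : 0 <= x <= K -> 0 <= y <= K ->
  `|react x - react y| <= Lreact K * `|x - y|.
Proof.
params => hx hy; rewrite !react_def /Lreact -mulrBr normrM gtr0_norm; last mlra.
rewrite -mulrA ler_pM2l; last mlra.
have -> : forall a b c d : R, a - Bre * b - (c - Bre * d) = (a - c) - Bre * (b - d) by move=> *; ring.
apply: (le_trans (ler_normB _ _)); rewrite [leRHS]mulrDl; apply: lerD.
  by apply: powR_lip => //; mlra.
rewrite normrM (gtr0_norm B_gt0) -mulrA ler_pM2l ?B_gt0 //.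
by apply: powR_lip => //; mlra.
Qed.
Lemma react_lip_weq K : 0 < K -> exists2 C, 0 < C &
  forall x, 0 < x -> x <= K -> `|react x| <= C * `|x - weq|.
Proof.
move=> K0; have M0 : 0 < Num.max K weq by rewrite lt_max K0.
exists (Lreact (Num.max K weq)) => [|x x0 xK]; first exact: Lreact_gt0.
have := @react_lip (Num.max K weq) x weq; rewrite react_weq subr0; apply.
  by rewrite (ltW x0) le_max xK.
by rewrite (ltW weq_gt0) le_max lexx orbT.
Qed.

(** The phase-plane equation is singular at the origin, where [h] vanishes and
    [react w / h] depends on [h] with slope of order [w ^ (m + q - 3)]. In the
    variable [t], [w = t ^ p] with [p = 2 + 1 / (m + q - 2)], the Jacobian
    [p t ^ (p - 1)] outweighs this slope, since [p - 1 + p (m + q - 3) =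
    2 (m + q - 2)] is positive. This is where [m + q > 2] is essential. The lower
    bound [beta w / 2] is first built into the equation and then recovered. *)
Lemma start_branch beta w2 : 0 < beta -> 0 < w2 -> w2 <= weq -> drag w2 <= beta / 2 ->
  exists h : R -> R, vanish_right h 0 /\
   forall w, 0 < w < w2 -> beta / 2 * w <= h w /\ isD h w (beta - drag w + react w / h w).
Proof.
params => b0 w20 w2B dw2.
pose dl := m + q - 2; have dl0 : 0 < dl by rewrite /dl; mlra.
pose p := 2 + dl^-1; have p2 : 2 < p by rewrite /p ltrDl invr_gt0.
have p0 : 0 < p by mlra.
have pn0 : p != 0 by rewrite gt_eqF.
pose t2 := w2 `^ p^-1; have t20 : 0 < t2 by rewrite powR_gt0.
have t2p : t2 `^ p = w2 by rewrite /t2 -powRrM mulVf // powRr1 // ltW.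
pose F t h := let s := clamp t2 t in let u := s `^ p in
  p * s `^ (p - 1) * (beta - drag u + react u / Num.max h (beta / 2 * u)).
have b2 : 0 < beta / 2 by mlra.
have uP s : 0 < s -> s <= t2 -> 0 < s `^ p /\ s `^ p <= w2.
  move=> s0 st; split; first by rewrite powR_gt0.
  by rewrite -t2p; apply: pw_le => //; exact: ltW.
pose C1 := beta + m * w2 `^ dl / (beta / 2).
have QP u h : 0 < u -> u <= w2 -> `|beta - drag u + react u / Num.max h (beta / 2 * u)| <= C1.
  move=> u0 uw.
  have M0 : 0 < Num.max h (beta / 2 * u) by rewrite lt_max mulr_gt0 // orbT.
  have r0 : 0 <= react u by apply: react_ge0; [exact: ltW|exact: le_trans w2B].
  have d0 := drag_ge0 u.
  have d1 : drag u <= drag w2 by apply: drag_le => //; exact: ltW.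
  have q0 : 0 <= react u / Num.max h (beta / 2 * u) by rewrite divr_ge0 // ltW.
  have q1 : react u / Num.max h (beta / 2 * u) <= m * w2 `^ dl / (beta / 2).
    rewrite ler_pdivrMr //.
    apply: (@le_trans _ _ (m * w2 `^ dl / (beta / 2) * (beta / 2 * u))); last first.
      rewrite ler_wpM2l ?le_max ?lexx ?orbT // divr_ge0 ?mulr_ge0 ?powR_ge0 //; mlra.
    rewrite mulrA divfK ?gt_eqF // -mulrA; apply: (le_trans (react_le (ltW u0))).
    rewrite ler_pM2l; last mlra.
    have -> : m + q - 1 = dl + 1 by rewrite /dl; ring.
    rewrite (pwD _ _ u0) powRr1 ?(ltW u0) // ler_wpM2r ?(ltW u0) //.
    by apply: pw_le => //; exact: ltW.
  by rewrite /C1 ler_norml; apply/andP; split; mlra.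
pose C2 := p * t2 `^ (p - 2) * C1.
have C10 : 0 < C1 by rewrite /C1 ltr_wpDr // divr_ge0 ?mulr_ge0 ?powR_ge0 //; mlra.
have C20 : 0 < C2 by rewrite /C2 !mulr_gt0 // powR_gt0.
have clP t : clamp t2 t = 0 \/ 0 < clamp t2 t <= t2.
  have := clamp_ge0 t (ltW t20); rewrite le_eqVlt => /orP[/eqP <-|h]; first by left.
  by right; rewrite h clamp_le.
have FB t h : `|F t h| <= C2 * clamp t2 t.
  rewrite /F /=; have [->|/andP[s0 st]] := clP t.
    by rewrite powR0 ?mulr0 ?mul0r ?normr0 // gt_eqF //; mlra.
  have [u0 uw] := uP _ s0 st.
  have := QP _ h u0 uw; move: (beta - drag _ + _) => Q hQ.
  rewrite normrM ger0_norm; last by rewrite mulr_ge0 ?powR_ge0 // ltW.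
  have -> : p - 1 = (p - 2) + 1 by ring.
  rewrite (pwD _ _ s0) powRr1 ?(ltW s0) // /C2.
  have k1 : clamp t2 t `^ (p - 2) <= t2 `^ (p - 2) by apply: pw_le => //; [mlra|exact: ltW].
  have -> : p * t2 `^ (p - 2) * C1 * clamp t2 t = p * (t2 `^ (p - 2) * (clamp t2 t * C1)) by ring.
  rewrite -!mulrA ler_pM2l // ler_pM ?powR_ge0 //; first by rewrite mulr_ge0 // (ltW s0).
  by rewrite ler_pM2l.
have clc : continuous (clamp t2).
  by apply: (@lip_cont _ (clamp t2) 1) => // x y; rewrite mul1r clamp_lip.
have Fc (g : R -> R) : continuous g -> continuous (fun t => F t (g t)).
  move=> gc t; have [c0|/andP[s0 st]] := clP t.
    apply/cont_epsP => e e0; exists (e / C2); first by rewrite divr_gt0.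
    move=> y yt; have Ft0 : F t (g t) = 0.
      by apply/eqP; rewrite -normr_le0; apply: (le_trans (FB t (g t))); rewrite c0 mulr0.
    rewrite Ft0 subr0; apply: (le_lt_trans (FB y (g y))).
    rewrite mulrC -ltr_pdivlMr //; apply: le_lt_trans yt.
    have := clamp_lip t2 y t; rewrite c0 subr0; apply: le_trans; exact: ler_norm.
  have [u0 uw] := uP _ s0 st.
  have pc (r : R) : {for t, continuous (fun t => clamp t2 t `^ r)}.
    by apply: (@continuous_comp _ _ _ (clamp t2) (fun s => s `^ r)); [exact: clc|exact: pw_cont].
  apply: (@continuousM _ _ (fun t => p * clamp t2 t `^ (p - 1))
    (fun t => beta - drag (clamp t2 t `^ p) + react (clamp t2 t `^ p) / Num.max (g t) (beta / 2 * clamp t2 t `^ p))).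
    by apply: continuousM; [exact: cvg_cst|exact: pc].
  apply: (@continuousD _ _ _ (fun t => beta - drag (clamp t2 t `^ p))
    (fun t => react (clamp t2 t `^ p) / Num.max (g t) (beta / 2 * clamp t2 t `^ p))).
    apply: (@continuousB _ _ _ (fun=> beta) (fun t => drag (clamp t2 t `^ p))); first exact: cvg_cst.
    by apply: (@continuous_comp _ _ _ (fun t => clamp t2 t `^ p) drag); [exact: pc|exact: drag_cont].
  apply: (@continuousM _ _ (fun t => react (clamp t2 t `^ p)) (fun t => (Num.max (g t) (beta / 2 * clamp t2 t `^ p))^-1)).
    by apply: (@continuous_comp _ _ _ (fun t => clamp t2 t `^ p) react); [exact: pc|exact: react_cont].
  apply: (@continuousV _ _ (fun t => Num.max (g t) (beta / 2 * clamp t2 t `^ p))).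
    by rewrite gt_eqF // lt_max mulr_gt0 // orbT.
  apply: cont_max; first exact: gc.
  by apply: continuousM; [exact: cvg_cst|exact: pc].
pose L := 4 * p * m / beta ^+ 2 * t2 `^ (2 * dl) + 1.
have L0 : 0 < L.
  by rewrite /L ltr_wpDl // !mulr_ge0 ?powR_ge0 ?invr_ge0 ?sqr_ge0 //; mlra.
have Flip t x x' : `|F t x - F t x'| <= L * `|x - x'|.
  rewrite /F /=; have [->|/andP[s0 st]] := clP t.
    rewrite powR0; last by rewrite gt_eqF //; mlra.
    by rewrite mulr0 !mul0r subrr normr0 mulr_ge0 // ltW.
  have [u0 uw] := uP _ s0 st; set s := clamp t2 t in s0 st u0 uw *; set u := s `^ p in u0 uw *.
  have cu0 : 0 < beta / 2 * u by rewrite mulr_gt0.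
  set cu := beta / 2 * u in cu0 *.
  have [M0 M0'] : 0 < Num.max x cu /\ 0 < Num.max x' cu by rewrite !lt_max cu0 !orbT.
  have -> : p * s `^ (p - 1) * (beta - drag u + react u / Num.max x cu) -
    p * s `^ (p - 1) * (beta - drag u + react u / Num.max x' cu) =
    (p * (s `^ (p - 1) * react u)) * ((Num.max x' cu - Num.max x cu) / (Num.max x cu * Num.max x' cu)).
    by field; rewrite !gt_eqF.
  have r0 : 0 <= react u by apply: react_ge0; [exact: ltW|exact: le_trans w2B].
  have P0 := mulr_ge0 (ltW p0) (mulr_ge0 (powR_ge0 s (p - 1)) r0).
  rewrite normrM ger0_norm //.
  have e1 : `|(Num.max x' cu - Num.max x cu) / (Num.max x cu * Num.max x' cu)| <= `|x - x'| / cu ^+ 2.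
    rewrite normrM normfV (gtr0_norm (mulr_gt0 M0 M0')) ler_pM ?invr_ge0 //.
    - by rewrite ltW // mulr_gt0.
    - by rewrite [`|x - x'|]distrC max_lip.
    - rewrite lef_pV2 ?posrE ?mulr_gt0 ?exprn_gt0 // expr2.
      by rewrite ler_pM ?(ltW cu0) // le_max lexx orbT.
  have e2 : s `^ (p - 1) * react u / cu ^+ 2 <= 4 * m / beta ^+ 2 * t2 `^ (2 * dl).
    rewrite ler_pdivrMr ?exprn_gt0 //.
    apply: (@le_trans _ _ (s `^ (p - 1) * (m * u `^ (m + q - 1)))).
      by rewrite ler_wpM2l ?powR_ge0 // react_le // ltW.
    have -> : 4 * m / beta ^+ 2 * t2 `^ (2 * dl) * cu ^+ 2 = m * (t2 `^ (2 * dl) * u ^+ 2).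
      by rewrite /cu; field; rewrite gt_eqF.
    rewrite mulrCA ler_pM2l; last mlra.
    have -> : u `^ (m + q - 1) = u `^ (dl - 1) * u ^+ 2.
      by rewrite -powR_mulrn ?(ltW u0) // -(pwD _ _ u0) /dl; congr (_ `^ _); ring.
    rewrite mulrA ler_wpM2r ?sqr_ge0 // /u -powRrM -(pwD _ _ s0).
    have -> : p - 1 + p * (dl - 1) = 2 * dl.
      by rewrite /p; field; rewrite gt_eqF.
    by apply: pw_le => //; [mlra|exact: ltW].
  apply: (@le_trans _ _ (p * (s `^ (p - 1) * react u) * (`|x - x'| / cu ^+ 2))).
    exact: ler_wpM2l e1.
  have -> : p * (s `^ (p - 1) * react u) * (`|x - x'| / cu ^+ 2) =
     p * (s `^ (p - 1) * react u / cu ^+ 2) * `|x - x'| by field; rewrite gt_eqF.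
  rewrite ler_wpM2r // /L; apply: (@le_trans _ _ (p * (4 * m / beta ^+ 2 * t2 `^ (2 * dl)))).
    by rewrite ler_pM2l.
  by rewrite (_ : p * _ = 4 * p * m / beta ^+ 2 * t2 `^ (2 * dl)) ?lerDl //; field; rewrite gt_eqF.
have [|||t|H [z [H0 _ HD _]]] := @picard _ (fun t x _ => F t x) (fun _ _ _ => 0) L (C2 * t2) 0 0 L0.
- by rewrite mulr_ge0 // ltW.
- by move=> x z xc zc; split; [exact: Fc|move=> t; exact: cvg_cst].
- move=> t x z x' z'; split.
    by apply: (le_trans (Flip _ _ _)); rewrite ler_wpM2l ?(ltW L0) // lerDl.
  by rewrite subrr normr0; exact: (mulr_ge0 (ltW L0) (addr_ge0 (normr_ge0 _) (normr_ge0 _))).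
- split; last by rewrite normr0 mulr_ge0 // ltW.
  by apply: (le_trans (FB _ _)); rewrite ler_wpM2l ?clamp_le // ltW.
pose h w := H (w `^ p^-1).
pose hM w := Num.max (h w) (beta / 2 * w).
have pi0 : 0 < p^-1 by rewrite invr_gt0.
have hD w : 0 < w < w2 -> isD h w (beta - drag w + react w / hM w).
  move=> /andP[w0 ww2].
  have s0 : 0 < w `^ p^-1 by rewrite powR_gt0.
  have st : w `^ p^-1 <= t2 by apply: pw_le => //; exact: ltW.
  have sp : (w `^ p^-1) `^ p = w by rewrite -powRrM mulVf // powRr1 // ltW.
  apply: isD_eq; first exact: isD_comp (HD _) (isD_powR p^-1 w0 (isD_id w)).
  rewrite /F /= clamp_id ?(ltW s0) // sp -/(h w) -/(hM w) -powRrM.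
  move: (beta - _ + _) => Q.
  have -> : p * w `^ (p^-1 * (p - 1)) * Q * (p^-1 * w `^ (p^-1 - 1) * 1) =
     w `^ (p^-1 * (p - 1)) * w `^ (p^-1 - 1) * Q by field.
  rewrite -(pwD _ _ w0) (_ : p^-1 * (p - 1) + (p^-1 - 1) = 0); last by field.
  by rewrite powRr0 mul1r.
have hv e : 0 < e -> exists2 d, 0 < d & forall w, 0 < w < d -> `|h w| < e.
  move=> e0; have /cont_epsP /(_ e e0) [d d0 hd] := isD_cont (HD 0).
  exists (d `^ p) => [|w /andP[w0 wd]]; first by rewrite powR_gt0.
  have := hd (w `^ p^-1); rewrite H0 !subr0; apply.
  rewrite ger0_norm ?powR_ge0 //.
  have : w `^ p^-1 < (d `^ p) `^ p^-1 by apply: pw_lt => //; exact: ltW.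
  by rewrite -powRrM mulfV // powRr1 // ltW.
have hge w : 0 < w < w2 -> beta / 2 * w <= h w.
  move=> /andP[w0 ww2]; rewrite leNgt; apply/negP => hw.
  have g0 : 0 < beta / 2 * w - h w by rewrite subr_gt0.
  have [d d0 hd] := hv ((beta / 2 * w - h w) / 2) ltac:(mlra).
  pose bb := Num.min (d / 2) ((beta / 2 * w - h w) / beta).
  have bb0 : 0 < bb by rewrite lt_min !divr_gt0.
  have [v /andP[v0 vw] vb] := pick_right w0 bb0; rewrite add0r lt_min in vb.
  case/andP: vb => vb1 vb2.
  have hv' := hd v ltac:(apply/andP; split; mlra).
  rewrite ltr_pdivlMr // in vb2.
  have : beta / 2 * w - h w <= beta / 2 * v - h v.
    apply: (@nincr _ (fun w => beta / 2 * w - h w) (fun w => beta / 2 - (beta - drag w + react w / hM w)) v w (ltW vw)).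
      move=> s /andP[s1 s2]; apply: isD_sub; last by apply: hD; apply/andP; split; mlra.
      by apply: isD_eq; [exact: isD_mul (isD_cst _ _) (isD_id _)|rewrite /=; mlra].
    move=> s /andP[s1 s2].
    have s0 : 0 < s by mlra.
    have r0 : 0 <= react s by apply: react_ge0; mlra.
    have d2 : drag s <= drag w2 by apply: drag_le; mlra.
    have M0 : 0 < hM s by rewrite /hM lt_max mulr_gt0 // orbT.
    have := divr_ge0 r0 (ltW M0); mlra.
  by move: hv'; rewrite ltr_norml => /andP[k1 k2]; mlra.
exists h; split.
  move=> e e0; have [d d0 hd] := hv e e0; exists d => // w; rewrite add0r => /hd.
  by apply: le_lt_trans; exact: ler_norm.
move=> w hw; have hw' := hge w hw; split => //.
by have := hD w hw; rewrite /hM (max_l hw').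
Qed.

(** The unstable direction at the origin is [h = beta w]. Half its slope is enough
    to single out the arc. *)
Definition is_start beta w2 (h : R -> R) := vanish_right h 0 /\
   forall w, 0 < w < w2 -> beta / 2 * w <= h w /\ isD h w (beta - drag w + react w / h w).

(** The line of slope [lam] is a barrier from above once [lam] absorbs the
    reaction term. *)
Lemma start_upper beta w2 lam h : 0 < beta -> w2 <= weq -> is_start beta w2 h -> 0 < lam ->
  beta + m * w2 `^ (m + q - 2) / lam <= lam -> forall w, 0 < w < w2 -> h w <= lam * w.
Proof.
params => b0 w2B [hv hD] l0 hlam w /andP[w0 ww2]; rewrite leNgt; apply/negP => hw.
have g0 : 0 < h w - lam * w by rewrite subr_gt0.
have [d d0 hd] := hv _ g0.
have [v /andP[v0 vw] vd] := pick_right w0 d0.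
have hv' := hd v; rewrite v0 vd in hv'; have {}hv' := hv' isT.
have : h w - lam * w <= h v - lam * v.
  apply: (@barrier _ (fun w => h w - lam * w) (fun w => beta - drag w + react w / h w - lam) v w (ltW vw)) => //.
    move=> s /andP[s1 s2]; apply: isD_sub; first by apply: (hD s _).2; rewrite (lt_le_trans v0) // (le_lt_trans s2).
    by apply: isD_eq; [exact: isD_mul (isD_cst _ _) (isD_id _)|rewrite /=; mlra].
  move=> s /andP[s1 s2]; rewrite subr_gt0 => hs.
  have s0 : 0 < s by exact: lt_le_trans s1.
  have sw2 : s <= w2 by rewrite (le_trans s2) // ltW.
  have ls0 : 0 < lam * s by exact: mulr_gt0.
  have hs0 : 0 < h s by exact: lt_trans hs.
  have k1 : react s / h s <= m * w2 `^ (m + q - 2) / lam.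
    rewrite ler_pdivrMr // (le_trans (react_le (ltW s0))) //.
    have -> : m + q - 1 = (m + q - 2) + 1 by ring.
    rewrite (pwD _ _ s0) powRr1 ?(ltW s0) //.
    apply: (@le_trans _ _ (m * w2 `^ (m + q - 2) / lam * (lam * s))); last first.
      by apply: ler_wpM2l; [rewrite divr_ge0 ?mulr_ge0 ?powR_ge0 ?(ltW l0) //; mlra|exact: ltW].
    have -> : m * w2 `^ (m + q - 2) / lam * (lam * s) = m * w2 `^ (m + q - 2) * s by field; rewrite gt_eqF.
    rewrite mulrA ler_wpM2r ?(ltW s0) // ler_wpM2l //; first mlra.
    by apply: pw_le => //; [mlra|exact: ltW].
  have := drag_ge0 s; move: (react s / h s) k1 => Q k1 k2; mlra.
have lv := mulr_gt0 l0 v0; mlra.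
Qed.

(** As [react w / h] decreases in [h], an excess over [|beta - beta'| w] cannot
    grow. This controls the initial values of the shooting. *)
Lemma start_dep beta beta' w2 h h' : 0 < beta -> 0 < beta' -> w2 <= weq ->
  is_start beta w2 h -> is_start beta' w2 h' ->
  forall w, 0 < w < w2 -> h w - h' w <= `|beta - beta'| * w.
Proof.
move=> b0 b'0 w2B [hv hD] [hv' hD'] w /andP[w0 ww2]; rewrite leNgt; apply/negP => hw.
set D := `|beta - beta'| in hw *; have D0 : 0 <= D by exact: normr_ge0.
have Dge : beta - beta' <= D by exact: ler_norm.
have g0 : 0 < h w - h' w - D * w by rewrite subr_gt0.
have [d d0 hd] := hv _ g0.
have [v /andP[v0 vw] vd] := pick_right w0 d0.
have hv1 := hd v; rewrite v0 vd in hv1; have {}hv1 := hv1 isT.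
have int s : v <= s -> s <= w -> 0 < s < w2 by move=> s1 s2; rewrite (lt_le_trans v0) // (le_lt_trans s2).
have : h w - h' w - D * w <= h v - h' v - D * v.
  apply: (@barrier _ (fun w => h w - h' w - D * w) (fun w => beta - drag w + react w / h w
    - (beta' - drag w + react w / h' w) - D) v w (ltW vw)) => //.
    move=> s /andP[s1 s2]; apply: isD_sub.
      by apply: isD_sub; [exact: (hD s (int s s1 s2)).2|exact: (hD' s (int s s1 s2)).2].
    by apply: isD_eq; [exact: isD_mul (isD_cst _ _) (isD_id _)|rewrite /=; mlra].
  move=> s /andP[s1 s2] hs.
  have [h1 _] := hD s (int s s1 s2); have [h2 _] := hD' s (int s s1 s2).
  have /andP[s0 sw2] := int s s1 s2.
  have h'0 : 0 < h' s by apply: lt_le_trans h2; rewrite mulr_gt0 // divr_gt0.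
  have hh : h' s <= h s by have := mulr_ge0 D0 (ltW s0); mlra.
  have : react s / h s <= react s / h' s.
    apply: ler_wpM2l; first by apply: react_ge0; [exact: ltW|rewrite (le_trans (ltW sw2))].
    by rewrite lef_pV2 ?posrE //; exact: lt_le_trans hh.
  by move: (react s / h s) (react s / h' s) => Q1 Q2; mlra.
have [h2 _] := hD' v (int v (lexx _) (ltW vw)).
have := mulr_ge0 D0 (ltW v0); have : 0 <= beta' / 2 * v by rewrite mulr_ge0 ?divr_ge0 // ltW.
mlra.
Qed.

(** * Trajectories *)

(** The Lienard form [w' = Z + beta w - A w ^ m], [Z' = react w] has no product of
    the unknowns, so that clamping [w] to [[0, K]] makes it globally
    Lipschitz. *)
Definition speed beta K (w Z : R -> R) t := Z t + beta * w t - Afr * clamp K (w t) `^ m.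
Definition traj beta K (w Z : R -> R) :=
  (forall t, isD w t (speed beta K w Z t)) /\ (forall t, isD Z t (react (clamp K (w t)))).

Definition Lsys bhi K := 1 + bhi + Afr * (m * K `^ (m - 1)) + Lreact K.
Lemma Lsys_gt0 bhi K : 0 < bhi -> 0 < K -> 0 < Lsys bhi K.
Proof.
params => b0 K0; rewrite /Lsys; have := Lreact_gt0 K0.
have : 0 <= Afr * (m * K `^ (m - 1)) by rewrite !mulr_ge0 ?powR_ge0 ?(ltW A_gt0) //; mlra.
mlra.
Qed.

Lemma clampm_lip K x y : 0 < K ->
  `|Afr * clamp K x `^ m - Afr * clamp K y `^ m| <= Afr * (m * K `^ (m - 1)) * `|x - y|.
Proof.
params => K0; rewrite -mulrBr normrM (gtr0_norm A_gt0) -mulrA ler_pM2l ?A_gt0 //.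
apply: (@le_trans _ _ (m * K `^ (m - 1) * `|clamp K x - clamp K y|)).
  by apply: powR_lip; rewrite ?clamp_ge0 ?clamp_le ?(ltW K0) //; mlra.
by rewrite ler_wpM2l ?clamp_lip // mulr_ge0 ?powR_ge0 //; mlra.
Qed.

Lemma clampr_lip K x y : 0 < K ->
  `|react (clamp K x) - react (clamp K y)| <= Lreact K * `|x - y|.
Proof.
move=> K0; apply: (@le_trans _ _ (Lreact K * `|clamp K x - clamp K y|)).
  by apply: react_lip; rewrite ?clamp_ge0 ?clamp_le ?(ltW K0).
by rewrite ler_wpM2l ?clamp_lip // ltW // Lreact_gt0.
Qed.

Lemma traj_exists beta K w0 Z0 : 0 < beta -> 0 < K ->
  exists w Z : R -> R, [/\ traj beta K w Z, w 0 = w0 & Z 0 = Z0].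
Proof.
params => b0 K0.
have L0 := Lsys_gt0 b0 K0.
have P0 : 0 <= Afr * (m * K `^ (m - 1)) by rewrite !mulr_ge0 ?powR_ge0 ?(ltW A_gt0) //; mlra.
have LK := Lreact_gt0 K0.
have mc : continuous (fun x => Afr * clamp K x `^ m).
  apply: (@lip_cont _ _ (Afr * (m * K `^ (m - 1)) + 1)); first mlra.
  move=> x y; apply: (le_trans (clampm_lip x y K0)); rewrite ler_wpM2r //; mlra.
have rc : continuous (fun x => react (clamp K x)).
  by apply: (@lip_cont _ _ (Lreact K)) => // x y; exact: clampr_lip.
have [||||w [Z [w00 Z00 wD ZD]]] := @picard _ (fun t w z => z + beta * w - Afr * clamp K w `^ m)
   (fun t w z => react (clamp K w)) (Lsys beta K)
   (`|Z0 + beta * w0 - Afr * clamp K w0 `^ m| + `|react (clamp K w0)|) w0 Z0 L0.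
- by rewrite addr_ge0.
- move=> x z xc zc; split=> t.
    apply: (@continuousB _ _ _ (fun t => z t + beta * x t) (fun t => Afr * clamp K (x t) `^ m)).
      apply: (@continuousD _ _ _ z (fun t => beta * x t)); first exact: zc.
      by apply: continuousM; [exact: cvg_cst|exact: xc].
    by apply: (@continuous_comp _ _ _ x (fun x => Afr * clamp K x `^ m)); [exact: xc|exact: mc].
  by apply: (@continuous_comp _ _ _ x (fun x => react (clamp K x))); [exact: xc|exact: rc].
- move=> t x z x' z'; split.
    have -> : z + beta * x - Afr * clamp K x `^ m - (z' + beta * x' - Afr * clamp K x' `^ m) =
      (z - z') + beta * (x - x') - (Afr * clamp K x `^ m - Afr * clamp K x' `^ m) by ring.
    apply: (le_trans (ler_normB _ _)); have := clampm_lip x x' K0; move: (`|_ - _|) => a ha.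
    have : `|z - z' + beta * (x - x')| <= `|z - z'| + beta * `|x - x'|.
      by apply: (le_trans (ler_normD _ _)); rewrite normrM (gtr0_norm b0).
    move: (`|z - z' + _|) (`|z - z'|) (`|x - x'|) ha (normr_ge0 (z - z')) (normr_ge0 (x - x')) => b c d ha c0 d0 hb.
    have e1 := mulr_ge0 (ltW LK) c0; have e2 := mulr_ge0 (ltW LK) d0.
    have e3 := mulr_ge0 P0 c0; have e4 := mulr_ge0 (ltW b0) c0.
    by rewrite /Lsys; move: ha e3; move: (Afr * _) => Q; nra.
  apply: (le_trans (clampr_lip x x' K0)).
  move: (`|z - z'|) (`|x - x'|) (normr_ge0 (z - z')) (normr_ge0 (x - x')) => c d c0 d0.
  have e1 := mulr_ge0 (ltW LK) c0; have e3 := mulr_ge0 P0 (addr_ge0 d0 c0); have e4 := mulr_ge0 (ltW b0) (addr_ge0 d0 c0).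
  by rewrite /Lsys; move: e3; move: (Afr * _) => Q; nra.
- by move=> t; rewrite lerDl lerDr.
by exists w, Z.
Qed.

Section OneTrajectory.
Variables (beta K : R) (w Z : R -> R).
Hypotheses (b0 : 0 < beta) (K0 : 0 < K) (HT : traj beta K w Z).
Let Y := speed beta K w Z.
Let wD t : isD w t (Y t) := HT.1 t.
Let ZD t : isD Z t (react (clamp K (w t))) := HT.2 t.
Let wc : forall t : R, {for t, continuous w}.
Proof. by move=> t; exact: isD_cont (wD t). Qed.
Arguments wc : clear implicits.
Ltac tlra := lra_recent ltac:(fun _ => clear - hm hq0 hq1 hmq hk hk' HT b0 K0 Y wD ZD wc).

Lemma speedD t : 0 < w t < K -> isD Y t ((beta - drag (w t)) * Y t + react (w t)).
Proof.
move=> /andP[w0 wK].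
have [d1 d10 hd1] := cont_gt0 (wc t) w0.
have [d2 d20 hd2] : exists2 d : R, 0 < d & forall s, `|s - t| < d -> 0 < K - w s.
  apply: (@cont_gt0 _ (fun s => K - w s)); last by rewrite subr_gt0.
  by apply: continuousB; [exact: cvg_cst|exact: wc].
apply: (@isD_near _ (fun s => Z s + beta * w s - Afr * w s `^ m)).
  apply: isD_eq.
    apply: isD_sub; first exact: isD_add (ZD t) (isD_mul (isD_cst _ beta) (wD t)).
    exact: isD_comp (drag_prim w0) (wD t).
  by rewrite clamp_id ?(ltW w0) ?(ltW wK) //=; ring.
exists (Num.min d1 d2) => [|s]; first by rewrite lt_min d10.
rewrite lt_min => /andP[/hd1 s1 /hd2 s2].
by rewrite /Y /speed clamp_id // (ltW s1) /=; tlra.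
Qed.

Lemma speed_cont t : {for t, continuous Y}.
Proof.
have P0 : 0 <= Afr * (m * K `^ (m - 1)).
  by params; rewrite !mulr_ge0 ?powR_ge0 ?(ltW A_gt0) //; tlra.
apply: (@continuousB _ _ _ (fun t => Z t + beta * w t) (fun t => Afr * clamp K (w t) `^ m)).
  apply: (@continuousD _ _ _ Z (fun t => beta * w t)); first exact: isD_cont (ZD t).
  by apply: continuousM; [exact: cvg_cst|exact: wc].
apply: (@continuous_comp _ _ _ w (fun x => Afr * clamp K x `^ m)); first exact: wc.
apply: (@lip_cont _ _ (Afr * (m * K `^ (m - 1)) + 1)); first tlra.
move=> x y; apply: (le_trans (clampm_lip x y K0)); rewrite ler_wpM2r //; tlra.
Qed.

(** The origin is an equilibrium: it is not reached in finite time. *)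
Lemma not_origin s t : 0 < w s -> ~ (w t = 0 /\ Z t = 0).
Proof.
params => ws [wt Zt].
pose n r := w r ^+ 2 + Z r ^+ 2.
pose dn r := 2 * w r * Y r + 2 * Z r * react (clamp K (w r)).
pose Q := Afr * (m * K `^ (m - 1)); have Q0 : 0 <= Q.
  by rewrite !mulr_ge0 ?powR_ge0 ?(ltW A_gt0) //; tlra.
have LK := Lreact_gt0 K0.
have nD r : isD n r (dn r) by apply: isD_add; apply: isD_sqr; [exact: wD|exact: ZD].
have bd r : `|dn r| <= (2 * (1 + beta + Q + Lreact K)) * n r.
  have nE : n r = `|w r| ^+ 2 + `|Z r| ^+ 2 by rewrite !real_normK ?num_real.
  apply: (le_trans (ler_normD _ _)); rewrite !normrM !(ger0_norm (ler0n _ _)) nE.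
  have h1 : `|Y r| <= `|Z r| + beta * `|w r| + Q * `|w r|.
    rewrite /Y /speed; apply: (le_trans (ler_normB _ _)); apply: lerD.
      by apply: (le_trans (ler_normD _ _)); rewrite normrM (gtr0_norm b0).
    by have := @clampm_lip K (w r) 0 K0; rewrite (clamp_neg (ltW K0) (lexx 0)) powR0 ?mulr0 ?subr0 // gt_eqF //; tlra.
  have h2 : `|react (clamp K (w r))| <= Lreact K * `|w r|.
    by have := @clampr_lip K (w r) 0 K0; rewrite (clamp_neg (ltW K0) (lexx 0)) react0 !subr0.
  move: (`|w r|) (`|Z r|) (`|Y r|) (`|react _|) (normr_ge0 (w r)) (normr_ge0 (Z r)) h1 h2 => p z y g p0 z0 h1 h2.
  have k1 : p * y <= p * (z + beta * p + Q * p) by rewrite ler_wpM2l.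
  have k2 : z * g <= z * (Lreact K * p) by rewrite ler_wpM2l.
  have k3 : 0 <= (p - z) ^+ 2 by exact: sqr_ge0.
  have k4 : 0 <= Lreact K * (p - z) ^+ 2 by rewrite mulr_ge0 ?sqr_ge0 // ltW.
  have k5 := mulr_ge0 Q0 (sqr_ge0 z); have k6 := mulr_ge0 (ltW b0) (sqr_ge0 z).
  have k7 := mulr_ge0 (ltW LK) (sqr_ge0 z); have k8 := mulr_ge0 (ltW LK) (sqr_ge0 p).
  have k9 := sqr_ge0 p; have k10 := sqr_ge0 z.
  nra.
have nt : n t = 0 by rewrite /n wt Zt expr0n addr0.
have : n s = 0.
  case: (leP s t) => st.
    exact: (@gronwall0 _ n dn s t _ st (fun r _ => nD r) (fun r _ => bd r)).2.
  exact: (@gronwall0 _ n dn t s _ (ltW st) (fun r _ => nD r) (fun r _ => bd r)).1.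
by rewrite /n => /eqP; rewrite paddr_eq0 ?sqr_ge0 // sqrf_eq0 (gt_eqF ws).
Qed.

Lemma speed_at_le0 t : w t <= 0 -> Y t = Z t + beta * w t.
Proof.
by params => wt; rewrite /Y /speed (clamp_neg (ltW K0) wt) powR0 ?mulr0 ?subr0 // gt_eqF //; tlra.
Qed.

(** Below [w = 0] the clamped reaction vanishes, hence [Z] keeps the negative value
    it had at the crossing, and at a return to [w = 0] the speed would be [Z]. *)
Lemma stays_negative s t0 t : s < t0 -> (forall r, s <= r < t0 -> 0 < w r) -> w t0 = 0 ->
  t0 < t -> w t < 0.
Proof.
move=> st0 wpos wt0 t0t.
have Y0 : Y t0 <= 0.
  have := @isD_zero_sign_left _ (fun r => - w r) t0 (- Y t0) (t0 - s).
  rewrite oppr_ge0; apply; rewrite ?wt0 ?oppr0 ?subr_gt0 //; first exact: isD_opp (wD t0).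
  by move=> r /andP[r1 r2]; rewrite oppr_lt0; apply: wpos; rewrite r2 andbT; tlra.
have YZ : Y t0 = Z t0 by rewrite speed_at_le0 ?wt0 // mulr0 addr0.
have ws : 0 < w s by apply: wpos; rewrite lexx.
have {}Y0 : Z t0 < 0.
  rewrite lt_neqAle -YZ Y0 andbT YZ; apply/eqP => Zt0; exact: (not_origin ws (conj wt0 Zt0)).
have [d d00 [hd _]] := isD_incr_near (isD_opp (wD t0)) ltac:(rewrite oppr_gt0 YZ; exact: Y0).
have [s1 /andP[s11 s12] s1d] := pick_right t0t d00.
have ws1 r : t0 < r -> r <= s1 -> w r < 0.
  by move=> h1 h2; have := hd r; rewrite h1 (le_lt_trans h2 s1d) => /(_ isT); rewrite wt0; tlra.
rewrite ltNge; apply/negP => wt.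
have [||||t' /andP[t'1 t'2] [wt' hneg]] := @first_zero _ (fun r => - w r) s1 t.
- exact: ltW.
- by move=> r _; apply: continuousN; exact: wc.
- by rewrite oppr_gt0; apply: ws1.
- by rewrite oppr_le0.
have {}wt' : w t' = 0 by tlra.
have neg r : t0 < r < t' -> w r < 0.
  move=> /andP[r1 r2]; case: (lerP r s1) => h; first exact: ws1.
  by have := hneg r; rewrite (ltW h) r2 => /(_ isT); tlra.
have t0t' : t0 < t' by exact: lt_trans t'1.
have ZE : Z t' <= Z t0.
  apply: (@nincr _ Z (fun r => react (clamp K (w r)))) => //; first exact: ltW.
  by move=> r /neg /ltW wr; rewrite (clamp_neg (ltW K0) wr) react0.
have := @isD_zero_sign_left _ w t' (Y t') (t' - t0).
rewrite speed_at_le0 ?wt' // mulr0 addr0 => H.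
have : 0 <= Z t'; last tlra.
apply: H; rewrite ?subr_gt0 //.
  by have := wD t'; rewrite speed_at_le0 ?wt' // mulr0 addr0.
by move=> r /andP[r1 r2]; apply: neg; rewrite r2 andbT; tlra.
Qed.

Definition tends_to l := forall e, 0 < e -> exists T, forall t, T <= t -> `|w t - l| < e.

(** By the mean value theorem, since increments over unit intervals tend to [0]. *)
Lemma slow_time l e : tends_to l -> 0 < e ->
  exists T0, forall T, T0 <= T -> exists2 t, T < t < T + 1 & `|Y t| < e.
Proof.
move=> wl e0; have [T0 hT0] := wl (e / 2) ltac:(tlra).
exists T0 => T T0T; have [||c /andP[c1 c2] ec] := @mvt _ w Y T (T + 1).
- by rewrite ltrDl.
- by move=> t _; exact: wD.
exists c; first by rewrite c1.
have h1 := hT0 T T0T; have h2 := hT0 (T + 1) ltac:(tlra).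
have -> : Y c = (w (T + 1) - l) - (w T - l) by rewrite (addrC T) addrK mulr1 (addrC 1) in ec; tlra.
apply: (le_lt_trans (ler_normB _ _)); tlra.
Qed.

(** Between two slow times the change of [Z] is small, as [w] hardly moves, but it
    is also the integral of a quantity close to [react l]. *)
Lemma limit_equilibrium l : tends_to l -> 0 <= l <= K -> react l = 0.
Proof.
move=> wl lK; apply/eqP; rewrite -normr_le0 leNgt; apply/negP; set r := `|react l| => r0.
pose Q := Afr * (m * K `^ (m - 1)); have Q0 : 0 <= Q.
  by params; rewrite !mulr_ge0 ?powR_ge0 ?(ltW A_gt0) //; tlra.
have LK := Lreact_gt0 K0.
pose C := Lreact K + 3 + 2 * beta + 2 * Q.
have C0 : 0 < C by have := b0; rewrite /C; tlra.
pose e := r / (2 * C); have e0 : 0 < e by rewrite divr_gt0 // mulr_gt0.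
have eC : C * e = r / 2 by rewrite /e; field; rewrite gt_eqF.
have [T0 hT0] := slow_time wl e0; have [T2 hT2] := wl _ e0.
pose T := Num.max T0 T2.
have TT0 : T0 <= T by rewrite le_max lexx.
have TT2 : T2 <= T by rewrite le_max lexx orbT.
have [ta /andP[a1 a2] Ya] := hT0 T TT0.
have [tb /andP[b1 b2] Yb] := hT0 (T + 2) ltac:(tlra).
have [|c /andP[c1 c2] ec] := @mvt _ Z (fun t => react (clamp K (w t))) ta tb ltac:(tlra).
  by move=> t _; exact: ZD.
have wa := hT2 ta ltac:(tlra); have wb := hT2 tb ltac:(tlra); have wcc := hT2 c ltac:(tlra).
have rc : `|react (clamp K (w c)) - react l| <= Lreact K * e.
  have := @clampr_lip K (w c) l K0; rewrite (clamp_id lK) => h; apply: (le_trans h).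
  by rewrite ler_wpM2l // ltW.
have wab : `|w tb - w ta| <= 2 * e.
  have -> : w tb - w ta = (w tb - l) - (w ta - l) by ring.
  apply: (le_trans (ler_normB _ _)); tlra.
have ZE : Z tb - Z ta = (Y tb - Y ta) - beta * (w tb - w ta)
     + (Afr * clamp K (w tb) `^ m - Afr * clamp K (w ta) `^ m).
  by rewrite /Y /speed; ring.
have Zb : `|Z tb - Z ta| <= 2 * e + beta * (2 * e) + Q * (2 * e).
  rewrite ZE; apply: (le_trans (ler_normD _ _)); apply: lerD.
    apply: (le_trans (ler_normB _ _)); apply: lerD.
      apply: (le_trans (ler_normB _ _)); tlra.
    by rewrite normrM (gtr0_norm b0) ler_pM2l.
  by apply: (le_trans (clampm_lip _ _ K0)); rewrite ler_wpM2l.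
have rl : r <= `|react (clamp K (w c))| + Lreact K * e.
  have -> : r = `|react (clamp K (w c)) - (react (clamp K (w c)) - react l)| by rewrite opprB addrC subrK.
  by apply: (le_trans (ler_normB _ _)); rewrite lerD2l.
have : `|react (clamp K (w c))| <= `|Z tb - Z ta|.
  rewrite ec normrM ler_peMr // ger0_norm; tlra.
move: rl Zb eC r0 e0; rewrite /C; move: (`|react _|) (`|Z tb - Z ta|) => u v; nra.
Qed.

Lemma limit_of_monotone T : (forall t, T <= t -> 0 < w t < K) ->
  (forall t, T <= t -> 0 <= Y t) \/ (forall t, T <= t -> Y t <= 0) ->
  exists l, [/\ 0 <= l <= K, tends_to l, react l = 0,
    ((forall t, T <= t -> 0 <= Y t) -> forall t, T <= t -> w t <= l) &
    ((forall t, T <= t -> Y t <= 0) -> forall t, T <= t -> l <= w t)].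
Proof.
move=> wK; case=> Ys.
  have mono s t : T <= s -> s <= t -> w s <= w t.
    move=> Ts st; apply: (ndecr st (fun r _ => wD r)) => r /andP[r1 r2]; apply: Ys; tlra.
  have [|l [lK wl hl]] := mono_lim mono (M := K).
    by move=> t /wK /andP[_ /ltW].
  have l0 : 0 <= l by have := wl T (lexx _); have /andP[h _] := wK T (lexx _); tlra.
  have tl : tends_to l.
    move=> e e0; have [T' TT' hT'] := hl e e0; exists T' => t T't.
    have := hT' t T't; have := wl t ltac:(tlra).
    by rewrite ltr_norml => h1 h2; apply/andP; split; tlra.
  have l0K : 0 <= l <= K by rewrite l0.
  exists l; split => //; first exact: (limit_equilibrium tl l0K).
  move=> Y0 t Tt; have : w t <= w T.
    apply: (nincr Tt (fun r _ => wD r)) => r /andP[r1 r2]; apply: Y0; tlra.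
  move=> wtT; have wtT' := mono T t (lexx _) Tt.
  rewrite leNgt; apply/negP => wtl; have [T' TT' hT'] := hl (l - w t) ltac:(tlra).
  have h1 := hT' (Num.max T' t) ltac:(by rewrite le_max lexx).
  have : w (Num.max T' t) <= w T.
    apply: (nincr _ (fun r _ => wD r)) => [|r /andP[r1 r2]]; last by apply: Y0; tlra.
    by rewrite le_max TT'.
  tlra.
have mono s t : T <= s -> s <= t -> w t <= w s.
  move=> Ts st; apply: (nincr st (fun r _ => wD r)) => r /andP[r1 r2]; apply: Ys; tlra.
have [||l [lK wl hl]] := @mono_lim _ (fun t => - w t) T 0.
- by move=> s t Ts st; rewrite lerN2; exact: mono.
- by move=> t /wK /andP[/ltW h _]; rewrite oppr_le0.
have tl : tends_to (- l).
  move=> e e0; have [T' TT' hT'] := hl e e0; exists T' => t T't.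
  have := hT' t T't; have := wl t ltac:(tlra).
  by rewrite ltr_norml => h1 h2; apply/andP; split; tlra.
have l0K : 0 <= - l <= K.
  by have := wl T (lexx _); have /andP[_ h] := wK T (lexx _) => h'; apply/andP; split; tlra.
exists (- l); split => //; first exact: (limit_equilibrium tl l0K).
  move=> Y0 t Tt; have wtT : w T <= w t.
    apply: (ndecr Tt (fun r _ => wD r)) => r /andP[r1 r2]; apply: Y0; tlra.
  have wtT' := mono T t (lexx _) Tt.
  rewrite leNgt; apply/negP => wtl; have [T' TT' hT'] := hl (w t + l) ltac:(tlra).
  have h1 := wl (Num.max T' t) ltac:(by rewrite le_max TT').
  have h2 := hT' (Num.max T' t) ltac:(by rewrite le_max lexx).
  have : w T <= w (Num.max T' t).
    apply: (ndecr _ (fun r _ => wD r)) => [|r /andP[r1 r2]]; last by apply: Y0; tlra.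
    by rewrite le_max TT'.
  tlra.
by move=> _ t Tt; have := wl t Tt; tlra.
Qed.

(** The distance to the start branch solves a linear equation. On the branch [w']
    lies between two multiples of [w], so that backwards [w] decreases but does
    not vanish. *)
Lemma follows_start w2 h : w2 <= weq -> w2 < K -> is_start beta w2 h ->
  0 < w 0 -> w 0 < w2 -> Y 0 = h (w 0) ->
  forall t, t <= 0 -> [/\ 0 < w t, w t <= w 0 & Y t = h (w t)].
Proof.
params => w2B w2K hst w00 w0w2 Y0; have [hv hD] := hst.
pose dl := m + q - 2.
pose lam := beta + 1 + m * w2 `^ dl.
have b0' := b0.
have P0 : 0 <= m * w2 `^ dl by rewrite mulr_ge0 ?powR_ge0 //; tlra.
have l1 : 1 <= lam by rewrite /lam; tlra.
have l0 : 0 < lam by tlra.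
have hl : forall w, 0 < w < w2 -> h w <= lam * w.
  apply: (@start_upper beta w2 lam h b0 w2B hst l0).
  have : m * w2 `^ (m + q - 2) / lam <= m * w2 `^ dl by rewrite ler_pdivrMr // ler_peMr.
  by rewrite /lam; move: (m * _ / _) => *; tlra.
have hpos x : 0 < x < w2 -> 0 < h x.
  move=> hx; have [h1 _] := hD x hx; apply: lt_le_trans h1.
  by case/andP: hx => x0 _; rewrite mulr_gt0 // divr_gt0.
have eqY s : s <= 0 -> (forall r, s <= r <= 0 -> 0 < w r < w2) -> Y s = h (w s).
  move=> s0 ws.
  pose D r := Y r - h (w r).
  pose dD r := - (react (w r) / h (w r)) * D r.
  have DD r : s <= r <= 0 -> isD D r (dD r).
    move=> hr; have wr := ws r hr; have [_ dh] := hD _ wr.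
    have hp := hpos _ wr; case/andP: wr => wr1 wr2.
    apply: isD_eq; first apply: isD_sub.
    - by apply: speedD; rewrite wr1 (lt_trans wr2).
    - exact: isD_comp dh (wD r).
    by rewrite /dD /D; field; rewrite gt_eqF.
  pose M := m * w2 `^ dl / (beta / 2).
  have M0 : 0 <= M by rewrite divr_ge0 // divr_ge0 // ltW.
  have bd r : s <= r <= 0 -> 0 <= react (w r) / h (w r) <= M.
    move=> hr; have wr := ws r hr; have hp := hpos _ wr; have [h1 _] := hD _ wr.
    case/andP: wr => wr1 wr2; apply/andP; split.
      rewrite divr_ge0 ?(ltW hp) //; apply: react_ge0; first exact: ltW.
      by rewrite (le_trans (ltW wr2)).
    rewrite ler_pdivrMr //; apply: (le_trans (react_le (ltW wr1))).
    apply: (@le_trans _ _ (M * (beta / 2 * w r))); last exact: ler_wpM2l.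
    have -> : m + q - 1 = dl + 1 by rewrite /dl; ring.
    rewrite (pwD _ _ wr1) powRr1 ?(ltW wr1) // /M.
    have -> : m * w2 `^ dl / (beta / 2) * (beta / 2 * w r) = m * w2 `^ dl * w r.
      by field; rewrite gt_eqF.
    rewrite mulrA ler_wpM2r ?(ltW wr1) // ler_wpM2l //; first tlra.
    by apply: pw_le; [rewrite /dl; tlra|exact: ltW|exact: ltW].
  have : D s ^+ 2 = 0.
    apply: (@gronwall0 _ (fun r => D r ^+ 2) (fun r => 2 * D r * dD r) s 0 (2 * M) s0 _ _).2.
    - by move=> r hr; apply: isD_sqr; exact: DD.
    - move=> r hr; have /andP[k1 k2] := bd r hr.
      have -> : 2 * D r * dD r = - (2 * (react (w r) / h (w r)) * D r ^+ 2) by rewrite /dD; ring.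
      move: (react (w r) / h (w r)) k1 k2 => c k1 k2.
      rewrite normrN ger0_norm; last exact: (mulr_ge0 (mulr_ge0 (ler0n _ 2) k1) (sqr_ge0 _)).
      by apply: ler_wpM2r; [exact: sqr_ge0|exact: ler_wpM2l].
    by rewrite /D Y0 subrr expr0n.
  by move/eqP; rewrite sqrf_eq0 subr_eq0 => /eqP.
have gc t : {for t, continuous (fun t => w t * (w2 - w t))}.
  by apply: continuousM; [exact: wc|apply: continuousB; [exact: cvg_cst|exact: wc]].
have g0 : 0 < w 0 * (w2 - w 0) by rewrite mulr_gt0 // subr_gt0.
have inc s : s <= 0 -> (forall r, s < r <= 0 -> 0 < w r < w2) -> w s <= w 0.
  move=> s0 ws; apply: (ndecr s0 (fun r _ => wD r)) => r /andP[r1 r2].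
  have hr r' : r <= r' <= 0 -> 0 < w r' < w2.
    by move=> /andP[k1 k2]; apply: ws; rewrite k2 andbT (lt_le_trans r1).
  by rewrite eqY ?(ltW r2) //; apply: ltW; apply: hpos; apply: hr; rewrite lexx ltW.
have wpos t : t <= 0 -> 0 < w t * (w2 - w t).
  move=> t0; rewrite ltNge; apply/negP => gt.
  have [z /andP[z1 z2] [gz hz]] := last_zero t0 (fun r _ => gc r) gt g0.
  have ws r : z < r <= 0 -> 0 < w r < w2.
    move=> /andP[r1 r2].
    have ws' : forall r', r <= r' <= 0 -> w r' != 0 /\ w r' != w2.
      move=> r' /andP[k1 k2]; have := hz r'; rewrite k2 (lt_le_trans r1 k1) => /(_ isT) H.
      by split; apply/eqP => E; move: H; rewrite E ?mul0r ?subrr ?mulr0 ltxx.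
    apply/andP; split.
      rewrite ltNge; apply/negP => wr.
      have [y /andP[y1 y2] [wy _]] := last_zero r2 (fun r _ => wc r) wr w00.
      by have [] := ws' y ltac:(by rewrite y1 ltW); rewrite wy eqxx.
    rewrite ltNge; apply/negP => wr.
    have [|||y /andP[y1 y2] [wy _]] := @last_zero _ (fun r => w2 - w r) r 0 r2.
    - by move=> r' _; apply: continuousB; [exact: cvg_cst|exact: wc].
    - by rewrite subr_le0.
    - by rewrite subr_gt0.
    by have [_] := ws' y ltac:(by rewrite y1 ltW); move/eqP: wy; rewrite subr_eq0 eq_sym => ->.
  have wz0 := inc z (ltW z2) ws.
  have : 0 < w z.
    apply: (@pos_pres_back _ w Y z 0 lam (ltW z2) (fun r _ => wD r)) => //.
    move=> r /andP[r1 r2] wr.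
    have hr r' : r <= r' <= 0 -> 0 < w r' < w2.
      move=> /andP[k1 k2]; have [zr'|r'z|ezr] := ltgtP z r'; first by apply: ws; rewrite zr'.
        by have := le_trans r1 k1; rewrite leNgt r'z.
      have er : r = z by apply/eqP; rewrite eq_le r1 andbT ezr.
      by rewrite -ezr -{1}er wr (le_lt_trans wz0 w0w2).
    by rewrite eqY //; apply: hl; apply: hr; rewrite lexx.
  move=> wz; move/eqP: gz; rewrite mulf_eq0 (gt_eqF wz) /= subr_eq0 => /eqP; tlra.
move=> t t0.
have pos r : r <= 0 -> 0 < w r < w2.
  move=> r0; apply/andP; split.
    rewrite ltNge; apply/negP => wr.
    have [y /andP[y1 y2] [wy _]] := last_zero r0 (fun r _ => wc r) wr w00.
    by have := wpos y (ltW y2); rewrite wy mul0r ltxx.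
  rewrite ltNge; apply/negP => wr.
  have [|||y /andP[y1 y2] [wy _]] := @last_zero _ (fun r => w2 - w r) r 0 r0.
  - by move=> r' _; apply: continuousB; [exact: cvg_cst|exact: wc].
  - by rewrite subr_le0.
  - by rewrite subr_gt0.
  by have := wpos y (ltW y2); rewrite wy mulr0 ltxx.
split; first by case/andP: (pos t t0).
  by apply: inc => // r /andP[_ r0]; exact: pos.
by apply: eqY => // r /andP[_ r0]; exact: pos.
Qed.

Lemma tends0_at_minus_infty w2 h : w2 <= weq -> w2 < K -> is_start beta w2 h ->
  0 < w 0 -> w 0 < w2 -> Y 0 = h (w 0) ->
  forall t, t <= 0 -> w t <= w 0 * expR (beta / 2 * t).
Proof.
move=> w2B w2K hst w00 w0w2 Y0 t t0; have F := follows_start w2B w2K hst w00 w0w2 Y0.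
have [_ hD] := hst.
have : w t * expR (- (beta / 2) * t) <= w 0 * expR (- (beta / 2) * 0).
  apply: (@ndecr _ (fun s => w s * expR (- (beta / 2) * s)) (fun s => (Y s - beta / 2 * w s) * expR (- (beta / 2) * s))) => //.
    move=> s _; apply: isD_eq.
      exact: isD_mul (wD s) (isD_expR (isD_mul (isD_cst _ _) (isD_id _))).
    by rewrite /=; ring.
  move=> s /andP[_ s0]; have [k1 k2 ->] := F s (ltW s0).
  rewrite mulr_ge0 ?expR_ge0 // subr_ge0; apply: (hD _ _).1.
  by rewrite k1 (le_lt_trans k2).
by rewrite mulr0 expR0 mulr1 mulNr expRN ler_pdivrMr ?expR_gt0.
Qed.

(** The trajectory arrives at [weq] with a speed bounded by [C0 + (beta + G0) weq].
    Beyond, [Z] decreases, and at [w = K] the term [A K ^ m] would make the speed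
    negative. Hence the clamping is not felt. *)
Lemma below_clamp C0 G0 : 1 <= C0 -> 0 <= G0 -> (forall x, 0 < x -> react x <= G0) ->
  weq < K -> C0 + (beta + G0) * weq + Afr * weq `^ m + beta * K < Afr * K `^ m ->
  0 < w 0 -> w 0 < weq -> Y 0 <= C0 -> forall t, 0 <= t -> w t < K.
Proof.
move=> C01 G00 hG weqK hK w00 w0e Y0 t t0; have b0' := b0.
have weq0 := weq_gt0.
rewrite ltNge; apply/negP => wt.
have [|||tK /andP[tK0 tKt] [wtK hlt]] := @first_zero _ (fun r => K - w r) 0 t t0.
- by move=> r _; apply: continuousB; [exact: cvg_cst|exact: wc].
- by rewrite subr_gt0 (lt_trans w0e).
- by rewrite subr_le0.
have {}wtK : w tK = K by tlra.
have {}hlt r : 0 <= r -> r < tK -> w r < K.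
  by move=> r0 r1; rewrite -subr_gt0; apply: hlt; rewrite r0.
have [|||tb /andP[tb0 tbK] [wtb hgt]] := @last_zero _ (fun r => w r - weq) 0 tK (ltW tK0).
- by move=> r _; apply: continuousB; [exact: wc|exact: cvg_cst].
- by rewrite subr_le0 ltW.
- by rewrite wtK subr_gt0.
have {}wtb : w tb = weq by tlra.
have {}hgt r : tb < r -> r <= tK -> weq < w r.
  by move=> r0 r1; rewrite -subr_gt0; apply: hgt; rewrite r0.
have wpos r : 0 <= r -> r <= tb -> 0 < w r.
  move=> r0 rtb; rewrite ltNge; apply/negP => wr.
  have [z /andP[z0 zr] [wz hz]] := first_zero r0 (fun r _ => wc r) w00 wr.
  have [ztb|tbz|ez] := ltgtP z tb.
  - by have := stays_negative z0 hz wz ztb; rewrite wtb; tlra.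
  - by have := le_trans zr rtb; rewrite leNgt tbz.
  - by rewrite -ez wz in wtb; tlra.
pose lam := beta + G0.
have Ytb : Y tb <= C0 + lam * weq.
  rewrite leNgt; apply/negP => H.
  have := @barrier _ (fun r => Y r - lam * w r - C0)
    (fun r => (beta - drag (w r)) * Y r + react (w r) - lam * Y r) 0 tb tb0.
  rewrite wtb => B; have : Y tb - lam * weq - C0 <= Y 0 - lam * w 0 - C0.
    apply: B.
    - move=> r /andP[r0 rtb]; have hw : 0 < w r < K by rewrite wpos // hlt // (le_lt_trans rtb).
      apply: isD_eq; first exact: isD_sub (isD_sub (speedD hw) (isD_mul (isD_cst _ lam) (wD r))) (isD_cst _ C0).
      by rewrite /=; ring.
    - move=> r /andP[r0 rtb] hr; have wr := wpos r r0 rtb.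
      have lw : 0 <= lam * w r by rewrite mulr_ge0 ?(ltW wr) // addr_ge0 // ltW.
      have Y1 : 1 <= Y r by tlra.
      have := hG _ wr; have := mulr_ge0 (drag_ge0 (w r)) (le_trans ler01 Y1).
      have : G0 <= G0 * Y r by rewrite ler_peMr.
      rewrite /lam; tlra.
    - tlra.
  have : 0 <= lam * w 0 by rewrite mulr_ge0 ?(ltW w00) // addr_ge0 // ltW.
  tlra.
have ZE : Z tK <= Z tb.
  apply: (nincr (ltW tbK) (fun r _ => ZD r)) => r /andP[r1 r2].
  have wr := hgt r r1 (ltW r2); have wrK := hlt r (le_trans tb0 (ltW r1)) r2.
  by rewrite clamp_id ?(ltW wrK) ?andbT ?(ltW (lt_trans weq0 wr)) // ltW // react_lt0.
have YK : Y tK = Z tK + beta * K - Afr * K `^ m.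
  by rewrite /Y /speed wtK clamp_id // (ltW K0) lexx.
have Yb : Y tb = Z tb + beta * weq - Afr * weq `^ m.
  by rewrite /Y /speed wtb clamp_id // !ltW.
have : 0 <= Y tK.
  apply: (@isD_zero_sign_left _ (fun r => w r - K) tK (Y tK) tK tK0).
  - by apply: isD_eq; [exact: isD_sub (wD tK) (isD_cst _ K)|rewrite subr0].
  - by rewrite wtK subrr.
  by move=> r /andP[r1 r2]; rewrite subr_lt0; apply: hlt => //; tlra.
rewrite YK; rewrite Yb /lam in Ytb.
have k1 : 0 <= (beta + G0) * weq by rewrite mulr_ge0 ?addr_ge0 // ltW.
have k2 : 0 <= beta * weq by rewrite mulr_ge0 // ltW.
tlra.
Qed.

Lemma traj_orbit c d : (forall t, c < t < d -> 0 < w t < K) ->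
  orbit react (fun x => beta - drag x) (fun=> 1) w Y c d.
Proof.
move=> hw t tcd; have wt := hw t tcd; split.
- by case/andP: wt.
- exact: ltr01.
- exact: cvg_cst.
- by apply: isD_eq; [exact: wD|rewrite mul1r].
- by rewrite mul1r; exact: speedD.
Qed.

Lemma damping_cont b x : 0 < x -> {for x, continuous (fun x => b - drag x)}.
Proof. by move=> x0; apply: continuousB; [exact: cvg_cst|exact: drag_cont]. Qed.

Lemma no_equilibrium c d s t : (forall r, c < r < d -> 0 < w r < K) -> c < s < d -> c < t < d ->
  w s <> weq -> ~ (w t = weq /\ Y t = 0).
Proof.
move=> hw scd tcd ws [wt Yt]; apply: ws.
exact: (not_equilibrium react_lip_weq (traj_orbit hw) (@damping_cont beta) tcd wt Yt scd).
Qed.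

(** In the clock [expR t] the infinite past ends at [0], and [single_bump] applies. *)
Lemma loop_of_crossing w2 h t0 : w2 <= weq -> w2 < K -> is_start beta w2 h ->
  0 < w 0 -> w 0 < w2 -> Y 0 = h (w 0) -> 0 < t0 -> w t0 = 0 ->
  (forall t, 0 <= t -> t < t0 -> 0 < w t < K) ->
  exists tM, [/\ tM < t0, weq < w tM, (forall t, t < tM -> 0 < Y t) &
    (forall t, tM < t < t0 -> Y t < 0)].
Proof.
move=> w2B w2K hst w00 w0w2 Y0 t00 wt0 wpos.
have F := follows_start w2B w2K hst w00 w0w2 Y0.
have T := tends0_at_minus_infty w2B w2K hst w00 w0w2 Y0.
have wpos' t : t < t0 -> 0 < w t < K.
  case: (lerP t 0) => [tn _|tp]; last exact: wpos (ltW tp).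
  by have [k1 k2 _] := F t tn; rewrite k1 (le_lt_trans k2) // (lt_trans w0w2).
pose d := expR t0.
have lnD u : 0 < u -> isD (@ln R) u u^-1.
  by move=> u0; apply: isD_eq; [exact: isD_ln u0 (isD_id u)|rewrite mul1r].
have lnlt u : 0 < u -> u < d -> ln u < t0.
  by move=> u0 ud; rewrite -(expRK t0) ltr_ln // posrE // expR_gt0.
have orb : orbit react (fun x => beta - drag x) (fun u => u^-1) (fun u => w (ln u)) (fun u => Y (ln u)) 0 d.
  move=> u /andP[u0 ud]; have hw := wpos' _ (lnlt u u0 ud); split.
  - by case/andP: hw.
  - by rewrite invr_gt0.
  - by apply: continuousV; [rewrite gt_eqF|exact: cvg_id].
  - by apply: isD_eq; [exact: isD_comp (wD _) (lnD u u0)|rewrite mulrC].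
  - by apply: isD_eq; [exact: isD_comp (speedD hw) (lnD u u0)|rewrite mulrC].
have xc : lim_right (fun u => w (ln u)) 0 0.
  move=> e e0; pose s := Num.min 0 (ln (e / w 0) * (2 / beta)).
  have sb : s <= ln (e / w 0) * (2 / beta) by rewrite ge_min lexx orbT.
  have s0 : s <= 0 by rewrite ge_min lexx.
  exists (expR s); first exact: expR_gt0.
  move=> u /andP[u0]; rewrite add0r => us.
  have lus : ln u < s by rewrite -(expRK s) ltr_ln // posrE expR_gt0.
  have lu0 : ln u <= 0 by rewrite (le_trans (ltW lus)).
  have [k1 _ _] := F _ lu0; rewrite subr0 (gtr0_norm k1).
  apply: (le_lt_trans (T _ lu0)); rewrite mulrC -ltr_pdivlMr //.
  rewrite -[ltRHS]lnK ?posrE ?divr_gt0 // ltr_expR.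
  have b20 : 0 < beta / 2 by rewrite divr_gt0.
  apply: (@lt_le_trans _ _ (beta / 2 * s)); first by rewrite ltr_pM2l.
  apply: (@le_trans _ _ (beta / 2 * (ln (e / w 0) * (2 / beta)))); first by rewrite ler_pM2l.
  by rewrite le_eqVlt; apply/orP; left; apply/eqP; field; rewrite gt_eqF.
have xd : lim_left (fun u => w (ln u)) d 0.
  rewrite -wt0 -(expRK t0); apply: (@cont_lim_left _ (fun u => w (ln u))).
  exact: isD_cont (isD_comp (wD _) (lnD _ (expR_gt0 t0))).
have [tM [tMd xM _ up down]] := single_bump weq_gt0 react_gt0 react_lt0 react_cont react_lip_weq
  (expR_gt0 t0) orb (@damping_cont beta) xc xd.
case/andP: tMd => tM0 tMd; exists (ln tM); split => //.
- exact: lnlt.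
- move=> t tt; rewrite -(expRK t); apply: up; rewrite expR_gt0 /=.
  by rewrite -(lnK (_ : tM \in Num.pos)) ?posrE // ltr_expR.
move=> t /andP[t1 t2]; rewrite -(expRK t); apply: down.
by rewrite -(lnK (_ : tM \in Num.pos)) ?posrE // !ltr_expR t1.
Qed.

End OneTrajectory.

(** With [w = y weq], [y >= 1], the two sides are multiples of [y ^ (m - 1) - 1] and of
    [y ^ (m + q - 1) (y ^ (m - q) - 1)]. *)
Lemma drag_react : exists2 c : R, 0 < c & forall w : R, weq <= w -> drag w - drag weq <= c * - react w.
Proof.
params; have weq0 := weq_gt0; have A0 := A_gt0.
exists (Afr * weq `^ (- q)); first by rewrite mulr_gt0 // powR_gt0.
move=> w ww; have w0 := lt_le_trans weq0 ww.
pose y := w / weq; have y1 : 1 <= y by rewrite ler_pdivlMr // mul1r.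
have y0 : 0 < y by mlra.
have wE : w = y * weq by rewrite /y divfK // gt_eqF.
have e1 : w `^ (m - 1) = y `^ (m - 1) * weq `^ (m - 1) by rewrite {1}wE powRM ?ltW.
have e2 : Bre * w `^ (m - q) = y `^ (m - q).
  by rewrite {1}wE powRM ?ltW // mulrCA weq_pow mulr1.
have e3 : weq `^ (m + q - 1) = weq `^ (m - 1) * weq `^ q.
  by rewrite -pwD //; congr (_ `^ _); ring.
have e4 : weq `^ (- q) * weq `^ q = 1 by rewrite -pwD // addNr powRr0.
have e5 : weq `^ (m + q - 1) <= w `^ (m + q - 1) by apply: pw_le; rewrite ?(ltW weq0) //; mlra.
have e6 : y `^ (m - 1) <= y `^ (m - q) by apply: ler_powR => //; mlra.
have e7 : 1 <= y `^ (m - q) by rewrite -[1](powRr0 y); apply: ler_powR => //; mlra.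
rewrite !dragE reactE // e2 e1.
have p0 : 0 < weq `^ (m - 1) by exact: powR_gt0.
have -> : Afr * m * (y `^ (m - 1) * weq `^ (m - 1)) - Afr * m * weq `^ (m - 1) =
  (Afr * m * weq `^ (m - 1)) * (y `^ (m - 1) - 1) by ring.
apply: (@le_trans _ _ ((Afr * m * weq `^ (m - 1)) * (y `^ (m - q) - 1))).
  rewrite ler_wpM2l ?lerD2r //; first by rewrite !mulr_ge0 ?(ltW A0) ?(ltW p0) //; mlra.
have -> : Afr * m * weq `^ (m - 1) * (y `^ (m - q) - 1) =
  Afr * weq `^ (- q) * (m * weq `^ (m + q - 1) * (y `^ (m - q) - 1)).
  transitivity ((weq `^ (- q) * weq `^ q) * (Afr * m * weq `^ (m - 1) * (y `^ (m - q) - 1))).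
    by rewrite e4 mul1r.
  by rewrite e3; ring.
rewrite ler_wpM2l ?mulr_ge0 ?(ltW A0) ?powR_ge0 //.
rewrite -mulrN opprB ler_wpM2r ?subr_ge0 // ler_wpM2l //; mlra.
Qed.

Lemma small_react : exists2 ws : R, 0 < ws & ws <= 1 /\
  forall w : R, 0 < w -> w <= ws -> m / 2 * w `^ (m + q - 1) <= react w.
Proof.
params; have weq0 := weq_gt0; have B0 := B_gt0.
pose y : R := 2^-1 `^ ((m - q)^-1); have y0 : 0 < y by rewrite powR_gt0 // invr_gt0.
have yE : y `^ (m - q) = 2^-1.
  by rewrite /y -powRrM mulVf ?powRr1 ?invr_ge0 // subr_eq0 gt_eqF //; mlra.
exists (Num.min 1 (weq * y)); first by rewrite lt_min ltr01 mulr_gt0.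
split; first by rewrite ge_min lexx.
move=> w w0; rewrite le_min => /andP[w1 wy].
rewrite reactE // [leLHS](_ : _ = m * w `^ (m + q - 1) * 2^-1); last by ring.
rewrite ler_wpM2l ?mulr_ge0 ?powR_ge0 ?(ltW (lt_trans ltr01 hm)) //.
suff : Bre * w `^ (m - q) <= 2^-1 by mlra.
have -> : 2^-1 = Bre * (weq `^ (m - q) * y `^ (m - q)) :> R by rewrite mulrA weq_pow mul1r yE.
rewrite ler_wpM2l ?(ltW B0) // -powRM ?(ltW weq0) ?(ltW y0) //.
by apply: pw_le => //; [mlra|exact: ltW].
Qed.

(** * Shooting *)

(** Started on the start branch, the trajectories come from the origin; by
    [sh_below] those that stay positive solve the system without clamp. *)
Record shooting blo bhi w2 K (h w Z : R -> R -> R) : Prop := Shooting {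
  sh_lo : 0 < blo; sh_w2 : 0 < w2; sh_w2B : w2 <= weq; sh_K : weq < K;
  sh_h : forall b, blo <= b <= bhi -> is_start b w2 (h b);
  sh_traj : forall b, blo <= b <= bhi -> traj b K (w b) (Z b);
  sh_w0 : forall b, blo <= b <= bhi -> w b 0 = w2 / 2;
  sh_Y0 : forall b, blo <= b <= bhi -> speed b K (w b) (Z b) 0 = h b (w2 / 2);
  sh_below : forall b, blo <= b <= bhi -> forall t, 0 <= t -> w b t < K
}.

Section Shooting.
Variables (blo bhi w2 K : R) (h w Z : R -> R -> R).
Hypothesis HS : shooting blo bhi w2 K h w Z.
Implicit Types (b t e : R).
Let Y b := speed b K (w b) (Z b).
Let inr b := blo <= b <= bhi.

Let blo0 : 0 < blo := sh_lo HS.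
Let w20 : 0 < w2 := sh_w2 HS.
Let K0 : 0 < K := lt_trans weq_gt0 (sh_K HS).
Let w2K : w2 < K := le_lt_trans (sh_w2B HS) (sh_K HS).
Lemma sh_b_gt0 b : inr b -> 0 < b.
Proof. by move=> /andP[h1 _]; exact: lt_le_trans blo0 h1. Qed.
Lemma sh_w0_bounds b : inr b -> 0 < w b 0 /\ w b 0 < w2.
Proof. by move=> hb; rewrite (sh_w0 HS hb); have := w20; split; mlra. Qed.
Lemma sh_Y0E b : inr b -> Y b 0 = h b (w b 0).
Proof. by move=> hb; rewrite /Y (sh_Y0 HS hb) (sh_w0 HS hb). Qed.
Lemma sh_wD b : inr b -> forall t, isD (w b) t (Y b t).
Proof. by move=> hb; exact: (sh_traj HS hb).1. Qed.
Lemma sh_wcont b : inr b -> forall t, {for t, continuous (w b)}.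
Proof. by move=> hb t; exact: isD_cont (sh_wD hb t). Qed.
Lemma sh_Ycont b : inr b -> forall t, {for t, continuous (Y b)}.
Proof. by move=> hb t; exact: (speed_cont (sh_b_gt0 hb) K0 (sh_traj HS hb)). Qed.

Arguments sh_wD : clear implicits.
Arguments sh_wcont : clear implicits.
Arguments sh_Ycont : clear implicits.

Ltac slra := lra_recent ltac:(fun _ => clear - hm hq0 hq1 hmq hk hk' HS Y inr blo0 w20 K0 w2K).

Lemma sh_past b t : inr b -> t <= 0 ->
  [/\ 0 < w b t, w b t < K, Y b t = h b (w b t) & b / 2 * w b t <= Y b t].
Proof.
move=> hb t0; have [k1 k2] := sh_w0_bounds hb.
have [h1 h2 h3] := follows_start (sh_b_gt0 hb) K0 (sh_traj HS hb) (sh_w2B HS) w2K (sh_h HS hb) k1 k2 (sh_Y0E hb) t0.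
split => //; first by rewrite (le_lt_trans h2) // (lt_trans k2).
by rewrite [Y b t]h3; apply: ((sh_h HS hb).2 _ _).1; rewrite h1 (le_lt_trans h2).
Qed.

Lemma sh_loop b s : inr b -> 0 <= s -> w b s < 0 -> exists t0 tM, [/\ 0 < t0, w b t0 = 0,
  (forall t, t < t0 -> 0 < w b t < K), (tM < t0 /\ (forall t, t < tM -> 0 < Y b t)) &
   (forall t, tM < t < t0 -> Y b t < 0)].
Proof.
move=> hb s0 ws; have [k1 k2] := sh_w0_bounds hb.
have [t0 /andP[t00 t0s] [wt0 hpos]] := first_zero s0 (fun r _ => sh_wcont b hb r) k1 (ltW ws).
have pos t : 0 <= t -> t < t0 -> 0 < w b t < K.
  by move=> t1 t2; rewrite hpos ?t1 // (sh_below HS hb).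
have [tM [M1 _ M3 M4]] := loop_of_crossing (sh_b_gt0 hb) K0 (sh_traj HS hb) (sh_w2B HS) w2K (sh_h HS hb) k1 k2
  (sh_Y0E hb) t00 wt0 pos.
exists t0, tM; split => // t tt0; case: (lerP t 0) => [/(sh_past hb)[-> ->]//|t1].
by apply: pos => //; exact: ltW.
Qed.

(** The equations and the initial values depend on the exponent in a Lipschitz way,
    the latter by [start_dep]. *)
Lemma sh_dependence b0 T e : inr b0 -> 0 <= T -> 0 < e ->
  exists2 d, 0 < d & forall b, inr b -> `|b - b0| < d -> forall t, 0 <= t <= T ->
    `|w b t - w b0 t| < e /\ `|Y b t - Y b0 t| < e.
Proof.
move=> hb0 T0 e0.
have bhi0 : 0 < bhi by case/andP: hb0 => k1 k2; exact: lt_le_trans blo0 (le_trans k1 k2).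
have [M M0 hM] := cont_bounded T0 (fun t _ => sh_wcont b0 hb0 t).
pose Q := Afr * (m * K `^ (m - 1)); have Q0 : 0 <= Q.
  by params; rewrite !mulr_ge0 ?powR_ge0 ?(ltW A_gt0) //; slra.
have LK := Lreact_gt0 K0.
pose L := Lsys bhi K; have L0 : 0 < L := Lsys_gt0 bhi0 K0.
pose M' := M + 2 * w2; have M'0 : 0 < M' by have := w20; rewrite /M'; slra.
pose C := 1 + bhi + Q; have C1 : 1 <= C by rewrite /C; slra.
have C0 : 0 < C by slra.
pose e1 := e / (2 * C); have e10 : 0 < e1 by rewrite divr_gt0 // mulr_gt0.
pose E := expR ((4 * L + 1) * T).
have E1 : 1 <= E by rewrite -[1]expR0 ler_expR mulr_ge0 //; slra.
have E0 : 0 < E by slra.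
pose d := Num.min (e / (2 * M')) (e1 / (4 * (M' * E))).
have d0 : 0 < d by rewrite lt_min !divr_gt0 ?mulr_gt0.
exists d => // b hb; rewrite lt_min => /andP[bd1 bd2] t tT.
rewrite ltr_pdivlMr ?mulr_gt0 // in bd1; rewrite ltr_pdivlMr ?mulr_gt0 // in bd2.
set D := `|b - b0| in bd1 bd2; have D0 : 0 <= D by exact: normr_ge0.
pose ep := D * M'; have ep0 : 0 <= ep by rewrite mulr_ge0 // ltW.
have bb : 0 < b := sh_b_gt0 hb; have bhb : b <= bhi by case/andP: hb.
have Zw0 : `|Z b 0 - Z b0 0| <= ep.
  have e2 c : inr c -> Z c 0 = h c (w2 / 2) - c * (w2 / 2) + Afr * clamp K (w2 / 2) `^ m.
    by move=> hc; have := sh_Y0 HS hc; rewrite /speed (sh_w0 HS hc) => <-; ring.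
  rewrite !e2 //.
  have -> : h b (w2 / 2) - b * (w2 / 2) + Afr * clamp K (w2 / 2) `^ m -
     (h b0 (w2 / 2) - b0 * (w2 / 2) + Afr * clamp K (w2 / 2) `^ m) =
     (h b (w2 / 2) - h b0 (w2 / 2)) - (b - b0) * (w2 / 2) by ring.
  have w2i : 0 < w2 / 2 < w2 by have := w20; move=> ?; apply/andP; split; slra.
  have k1 := start_dep bb (sh_b_gt0 hb0) (sh_w2B HS) (sh_h HS hb) (sh_h HS hb0) w2i.
  have k2 := start_dep (sh_b_gt0 hb0) bb (sh_w2B HS) (sh_h HS hb0) (sh_h HS hb) w2i.
  rewrite distrC in k2; rewrite -/D in k1 k2.
  apply: (le_trans (ler_normB _ _)).
  have k3 : `|h b (w2 / 2) - h b0 (w2 / 2)| <= D * (w2 / 2).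
    by rewrite ler_norml; apply/andP; split; move: k1 k2; move: (D * (w2 / 2)) => *; slra.
  have k4 : `|(b - b0) * (w2 / 2)| = D * (w2 / 2) by rewrite normrM (gtr0_norm (_ : 0 < w2 / 2)) //; case/andP: w2i.
  rewrite k4 /ep /M'; have := mulr_ge0 D0 (ltW w20); have := mulr_ge0 D0 (ltW M0); slra.
have tT' : 0 <= t <= T by [].
have n4 := @ode_dependence _ (Y b) (fun t => react (clamp K (w b t))) (Y b0) (fun t => react (clamp K (w b0 t)))
   (w b) (Z b) (w b0) (Z b0) L ep T L0 ep0 (sh_wD b hb) (sh_traj HS hb).2 (sh_wD b0 hb0) (sh_traj HS hb0).2.
have fdiff s : 0 <= s <= T -> `|Y b s - Y b0 s| <= `|Z b s - Z b0 s| + bhi * `|w b s - w b0 s| + D * M + Q * `|w b s - w b0 s|.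
  move=> hs; have -> : Y b s - Y b0 s = (Z b s - Z b0 s + b * (w b s - w b0 s) + (b - b0) * w b0 s)
     - (Afr * clamp K (w b s) `^ m - Afr * clamp K (w b0 s) `^ m) by rewrite /Y /speed; ring.
  apply: (le_trans (ler_normB _ _)); apply: lerD; last exact: clampm_lip.
  apply: (le_trans (ler_normD _ _)); apply: lerD.
    by apply: (le_trans (ler_normD _ _)); rewrite lerD2l normrM (gtr0_norm bb) ler_wpM2r.
  by rewrite normrM -/D ler_wpM2l // hM.
have epM : D * M <= ep by rewrite /ep /M'; have := mulr_ge0 D0 (ltW w20); slra.
have {}n4 : (w b t - w b0 t) ^+ 2 + (Z b t - Z b0 t) ^+ 2 <= 4 * ep ^+ 2 * expR ((4 * L + 1) * t).
  apply: n4 => //.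
  - move=> s hs; apply: (le_trans (fdiff s hs)).
    move: (`|Z b s - _|) (`|w b s - _|) (normr_ge0 (Z b s - Z b0 s)) (normr_ge0 (w b s - w b0 s)) => p r p0 r0.
    have e2 := mulr_ge0 (ltW bhi0) p0; have e3 := mulr_ge0 Q0 p0.
    have e4 := mulr_ge0 (ltW LK) p0; have e5 := mulr_ge0 (ltW LK) r0.
    by rewrite /L /Lsys -/Q; slra.
  - move=> s hs; apply: (le_trans (clampr_lip _ _ K0)).
    move: (`|Z b s - _|) (`|w b s - _|) (normr_ge0 (Z b s - Z b0 s)) (normr_ge0 (w b s - w b0 s)) => p r p0 r0.
    have e2 := mulr_ge0 (ltW bhi0) p0; have e3 := mulr_ge0 Q0 p0.
    have e4 := mulr_ge0 (ltW LK) p0; have e5 := mulr_ge0 (ltW bhi0) r0.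
    have e6 := mulr_ge0 Q0 r0.
    by rewrite /L /Lsys -/Q; slra.
  by rewrite !(sh_w0 HS) // subrr normr0.
have small : 4 * ep ^+ 2 * expR ((4 * L + 1) * t) < e1 ^+ 2.
  apply: (@le_lt_trans _ _ (4 * ep ^+ 2 * (E * E))).
    apply: ler_wpM2l; first by rewrite mulr_ge0 ?sqr_ge0.
    apply: (@le_trans _ _ E); last by rewrite ler_peMr // ltW.
    rewrite ler_expR ler_wpM2l //; [slra|by case/andP: tT].
  have -> : 4 * ep ^+ 2 * (E * E) = (2 * (ep * E)) ^+ 2 by ring.
  rewrite ltr_pXn2r // ?nnegrE ?(ltW e10) ?mulr_ge0 ?(ltW E0) ?(ltW M'0) //.
  have : 0 <= ep * E by rewrite mulr_ge0 // ltW.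
  move: bd2; rewrite /ep; have -> : D * (4 * (M' * E)) = 4 * (D * M' * E) by ring.
  slra.
have hw1 : `|w b t - w b0 t| < e1.
  rewrite -(ltr_pXn2r (ltn0Sn 1)) ?nnegrE ?(ltW e10) // real_normK ?num_real //.
  by apply: le_lt_trans small; apply: le_trans n4; rewrite lerDl sqr_ge0.
have hZ1 : `|Z b t - Z b0 t| < e1.
  rewrite -(ltr_pXn2r (ltn0Sn 1)) ?nnegrE ?(ltW e10) // real_normK ?num_real //.
  by apply: le_lt_trans small; apply: le_trans n4; rewrite lerDr sqr_ge0.
have e1C : C * e1 = e / 2 by rewrite /e1; field; rewrite gt_eqF.
have e1e : e1 <= e / 2 by rewrite -e1C ler_peMl // ltW.
split; first slra.
apply: (le_lt_trans (fdiff t tT)).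
have k1 : bhi * `|w b t - w b0 t| <= bhi * e1 by rewrite ler_wpM2l // ltW.
have k2 : Q * `|w b t - w b0 t| <= Q * e1 by rewrite ler_wpM2l // ltW.
have k3 : D * M <= D * M' by rewrite ler_wpM2l // /M'; have := w20; slra.
have k4 : (D * M') * 2 < e by rewrite -mulrA [M' * 2]mulrC.
by move: e1C; rewrite /C; slra.
Qed.

Lemma sh_stays_pos b : inr b -> (forall t, 0 <= t -> 0 <= w b t) -> forall t, 0 < w b t < K.
Proof.
move=> hb nn t; case: (lerP t 0) => [/(sh_past hb)[-> ->]//|t0].
rewrite (sh_below HS hb (ltW t0)) andbT ltNge; apply/negP => wt.
have [z /andP[z0 zt] [wz hz]] := first_zero (ltW t0) (fun r _ => sh_wcont b hb r) (sh_w0_bounds hb).1 wt.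
have := stays_negative (sh_b_gt0 hb) K0 (sh_traj HS hb) z0 hz wz (_ : z < z + 1).
by rewrite ltrDl ltr01 => /(_ isT); rewrite ltNge nn // addr_ge0 // ltW.
Qed.

(** * The critical exponent *)

(** A trajectory that does not cross, next to trajectories that do. From the latter
    it inherits the single loop, and they keep it from settling at [weq]. *)
Definition critical bs := [/\ inr bs, (forall t, 0 <= t -> 0 <= w bs t) &
    forall d, 0 < d -> exists b, [/\ inr b, `|b - bs| < d & exists2 t, 0 <= t & w b t < 0]].

(** Crossing [w = 0] is an open condition by [sh_dependence], so the infimum of the
    exponents that cross does not cross. *)
Lemma critical_exponent : inr blo -> inr bhi -> (forall t, 0 <= t -> 0 <= w blo t) ->
  (exists2 t, 0 <= t & w bhi t < 0) ->
  exists bs, critical bs.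
Proof.
move=> hlo hhi lonc [thi thi0 hic].
pose E := [set b | inr b /\ exists2 t, 0 <= t & w b t < 0].
have Ehi : E bhi by split => //; exists thi.
have hE : has_inf E by split; [exists bhi|exists blo => b [/andP[]]].
pose bs := inf E.
have bs1 : blo <= bs by apply: lb_le_inf => //; [exists bhi|move=> b [/andP[]]].
have bs2 : bs <= bhi by apply: ge_inf => //; case: hE.
have hbs : inr bs by rewrite /inr bs1.
have approx d : 0 < d -> exists b, [/\ inr b, `|b - bs| < d & exists2 t, 0 <= t & w b t < 0].
  move=> d0; have [b [hb hc] bd] := inf_adherent d0 hE; exists b; split => //.
  have : bs <= b by apply: ge_inf => //; case: hE.
  by rewrite -/bs in bd => bsb; rewrite ger0_norm ?subr_ge0 //; slra.
exists bs; split => // t t0; rewrite leNgt; apply/negP => wt.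
have bsn : blo < bs.
  rewrite lt_neqAle bs1 andbT; apply/eqP => eb.
  by have := lonc t t0; rewrite eb leNgt wt.
have e0 : 0 < - w bs t by rewrite oppr_gt0.
have [d d0 hd] := sh_dependence hbs t0 e0.
pose b := Num.max blo (bs - d / 2).
have b1 : blo <= b by rewrite le_max lexx.
have b2 : bs - d / 2 <= b by rewrite le_max lexx orbT.
have b3 : b < bs by rewrite gt_max bsn /=; slra.
have hb : inr b by rewrite /inr b1 (le_trans (ltW b3)).
have bd : `|b - bs| < d by rewrite ltr_norml; apply/andP; split; slra.
have [h1 _] := hd b hb bd t ltac:(by rewrite t0 lexx).
have : bs <= b; last by rewrite leNgt b3.
apply: ge_inf; first by case: hE.
split => //; exists t => //; rewrite ltr_norml in h1; case/andP: h1; slra.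
Qed.

Lemma crit_pos bs : critical bs -> forall t, 0 < w bs t < K.
Proof. by move=> [hb nn _]; exact: sh_stays_pos. Qed.

Lemma crit_no_equilibrium bs t : critical bs -> ~ (w bs t = weq /\ Y bs t = 0).
Proof.
move=> hc; have [hb _ _] := hc.
have [k1 k2] := sh_w0_bounds hb.
pose c := - (`|t| + 1); pose d := `|t| + 1.
have h1 := ler_norm t; have h2 := ler_norm (- t); rewrite normrN in h2.
have h3 := normr_ge0 t.
apply: (@no_equilibrium bs K (w bs) (Z bs) (sh_b_gt0 hb) K0 (sh_traj HS hb) c d 0 t).
- by move=> r _; exact: crit_pos.
- by rewrite /c /d; apply/andP; split; slra.
- by rewrite /c /d; apply/andP; split; slra.
by move=> e; have := sh_w2B HS; rewrite -e; slra.
Qed.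

Lemma crit_min bs t : critical bs -> 0 <= t -> exists2 c, 0 < c & forall s, 0 <= s <= t -> c <= w bs s.
Proof.
move=> hc t0; have [hb _ _] := hc.
have [|z zt hz] := @cont_argmax _ (fun r => - w bs r) 0 t t0.
  by move=> r _; apply: continuousN; exact: (sh_wcont bs hb r).
exists (w bs z); first by case/andP: (crit_pos hc z).
by move=> s /hz; rewrite lerN2.
Qed.

(** A crossing trajectory nearby would have the same two signs, against
    [sh_loop]. *)
Lemma crit_no_return bs s t : critical bs -> 0 <= s -> s < t -> Y bs s < 0 -> 0 < Y bs t -> False.
Proof.
move=> hc s0 st Ys Yt; have [hb _ ap] := hc.
have t0 : 0 <= t by rewrite (le_trans s0) // ltW.
have [c c0 hcm] := crit_min hc t0.
pose e := Num.min c (Num.min (- Y bs s) (Y bs t)).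
have e0 : 0 < e by rewrite !lt_min c0 oppr_gt0 Ys.
have ec : e <= c by rewrite ge_min lexx.
have es : e <= - Y bs s by rewrite !ge_min lexx orbT.
have et : e <= Y bs t by rewrite !ge_min lexx !orbT.
have [d d0 hd] := sh_dependence hb t0 e0.
have [b [hb' bd [u u0 wu]]] := ap d d0.
have {}hd := hd b hb' bd.
have [t1 [tM [t10 wt1 wp [tM1 up] down]]] := sh_loop hb' u0 wu.
have tt1 : t < t1.
  rewrite ltNge; apply/negP => t1t.
  have := hd t1 ltac:(by rewrite (ltW t10)); rewrite wt1 => -[+ _].
  have := hcm t1 ltac:(by rewrite (ltW t10)).
  by rewrite ltr_norml => h1 /andP[h2 h3]; slra.
have [_ h1] := hd s ltac:(by rewrite s0 ltW); have [_ h2] := hd t ltac:(by rewrite t0 lexx).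
rewrite !ltr_norml in h1 h2; case/andP: h1 => h11 h12; case/andP: h2 => h21 h22.
have tMs : tM <= s by rewrite leNgt; apply/negP => /up; move: h11 h12 es; slra.
have := down t; rewrite (le_lt_trans tMs st) tt1 => /(_ isT); move: h21 h22 et; slra.
Qed.

Lemma pot_exists : exists F : R -> R, F 0 = 0 /\ forall t, isD F t (react (clamp K t)).
Proof.
apply: (antiderivative (g := fun x => react (clamp K x))).
by apply: (@lip_cont _ _ (Lreact K)) => [|x y]; [exact: Lreact_gt0|exact: clampr_lip].
Qed.
Definition potential : R -> R := sval (cid pot_exists).
Lemma potentialD t : isD potential t (react (clamp K t)).
Proof. by rewrite /potential; case: cid => F []. Qed.

(** Where [b < drag w] the energy [Y ^ 2 / 2 - potential w] decreases. A trajectory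
    that has fallen into the well of [weq] stays there and does not reach [w = 0];
    neither do those nearby. *)
Lemma crit_not_trapped bs w0 s : critical bs -> 0 < w0 -> w0 < weq -> bs < drag w0 -> 0 <= s ->
  w0 < w bs s -> Y bs s ^+ 2 / 2 - potential (w bs s) < - potential w0 -> False.
Proof.
move=> hc w00 w0e bw0 s0 ws Hs; have [hb _ ap] := hc.
have [c c0 hcm] := crit_min hc s0.
pose g := - potential w0 - (Y bs s ^+ 2 / 2 - potential (w bs s)); have g0 : 0 < g by rewrite subr_gt0.
have /cont_epsP /(_ (g / 2)) [|r1 r10 hr1] := isD_cont (potentialD (w bs s)); first slra.
have /cont_epsP /(_ (g / 2)) [|r2 r20 hr2] := isD_cont (isD_sqr (isD_id (Y bs s))); first slra.
pose e := Num.min (Num.min c (w bs s - w0)) (Num.min r1 r2).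
have e0 : 0 < e by rewrite !lt_min c0 r10 r20 subr_gt0 ws.
have ec : e <= c by rewrite !ge_min lexx.
have ew : e <= w bs s - w0 by rewrite !ge_min lexx orbT.
have er1 : e <= r1 by rewrite !ge_min lexx !orbT.
have er2 : e <= r2 by rewrite !ge_min lexx !orbT.
have [d d0 hd] := sh_dependence hb s0 e0.
have dd0 : 0 < Num.min d (drag w0 - bs) by rewrite lt_min d0 subr_gt0.
have [b [hb' bd [u u0 wu]]] := ap _ dd0.
move: bd; rewrite lt_min => /andP[bd bd2].
have bw : b < drag w0 by move: bd2; rewrite ltr_norml => /andP[_]; slra.
have {}hd := hd b hb' bd.
have [t1 [tM [t10 wt1 wp _ _]]] := sh_loop hb' u0 wu.
have st1 : s < t1.
  rewrite ltNge; apply/negP => t1t.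
  have := hd t1 ltac:(by rewrite (ltW t10)); rewrite wt1 => -[+ _].
  have := hcm t1 ltac:(by rewrite (ltW t10)).
  by rewrite ltr_norml => h1 /andP[h2 h3]; slra.
have [h1 h2] := hd s ltac:(by rewrite s0 lexx).
have h3 := hr1 _ (lt_le_trans h1 er1); have h4 := hr2 _ (lt_le_trans h2 er2).
rewrite !ltr_norml in h1 h3 h4; case/andP: h1 => h11 h12; case/andP: h3 => h31 h32; case/andP: h4 => h41 h42.
have wbs : 0 < w b s - w0 by move: h11 h12 ew; slra.
have [||t /andP[t2 t3] [wt hgt]] := @first_zero _ (fun r => w b r - w0) s t1 (ltW st1) _ wbs.
- by move=> r _; apply: continuousB; [exact: (sh_wcont b hb' r)|exact: cvg_cst].
- by rewrite wt1 sub0r oppr_le0 ltW.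
have {}wt : w b t = w0 by slra.
have tt1 : t < t1.
  by rewrite lt_neqAle t3 andbT; apply/eqP => e1; rewrite e1 wt1 in wt; move: w00; slra.
have wint r : s <= r <= t -> w0 <= w b r /\ 0 < w b r < K.
  move=> /andP[r1' r2']; split; last by apply: wp; rewrite (le_lt_trans r2').
  case: (ltrP r t) => rt; first by have := hgt r; rewrite r1' rt => /(_ isT); slra.
  have -> : r = t by apply/eqP; rewrite eq_le r2'.
  by rewrite wt.
have : Y b t ^+ 2 / 2 - potential (w b t) <= Y b s ^+ 2 / 2 - potential (w b s).
  apply: (@nincr _ (fun r => Y b r ^+ 2 / 2 - potential (w b r)) (fun r => (b - drag (w b r)) * Y b r ^+ 2) s t (ltW t2)).
    move=> r hr; have [_ wr] := wint r hr.
    apply: isD_eq.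
      apply: isD_sub; last exact: isD_comp (potentialD _) (sh_wD b hb' r).
      exact: isD_mul (isD_sqr (speedD (sh_b_gt0 hb') K0 (sh_traj HS hb') wr)) (isD_cst _ _).
    by case/andP: wr => wr1 wr2; rewrite clamp_id ?(ltW wr1) ?(ltW wr2) // -/(Y b) /=; field.
  move=> r /andP[r1' r2']; have [wr1 _] := wint r ltac:(by rewrite !ltW).
  rewrite mulr_le0_ge0 ?sqr_ge0 // subr_le0 (le_trans (ltW bw)) // drag_le // ltW //.
rewrite wt; have := sqr_ge0 (Y b t).
by rewrite /g in h31 h32 h41 h42; slra.
Qed.

(** At a late slow time the trajectory would be in the well. *)
Lemma crit_not_weq bs : critical bs -> bs < drag weq -> tends_to (w bs) weq -> False.
Proof.
move=> hc bw tw; have [hb _ _] := hc; have weq0 := weq_gt0.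
have [d d0 hd] : exists2 d : R, 0 < d & forall x, `|x - weq| < d -> 0 < drag x - bs.
  apply: (@cont_gt0 _ (fun x => drag x - bs)); last by rewrite subr_gt0.
  by apply: continuousB; [exact: drag_cont|exact: cvg_cst].
have [w0 /andP[w00 w0e] w0d] := pick_left weq0 d0.
have bw0 : bs < drag w0.
  by rewrite -subr_gt0; apply: hd; rewrite ltr_norml; apply/andP; split; slra.
have weqK := sh_K HS.
have potw : potential w0 < potential weq.
  apply: (incr w0e (fun t _ => potentialD t)) => t /andP[t1 t2].
  have t0 := lt_trans w00 t1.
  by rewrite clamp_id ?(ltW t0) ?(ltW (lt_trans t2 weqK)) // react_gt0.
pose g := potential weq - potential w0; have g0 : 0 < g by rewrite subr_gt0.
have /cont_epsP /(_ (g / 2)) [|r1 r10 hr1] := isD_cont (potentialD weq); first slra.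
pose e := Num.min 1 g; have e0 : 0 < e by rewrite lt_min ltr01.
have e1 : e <= 1 by rewrite ge_min lexx.
have eg : e <= g by rewrite ge_min lexx orbT.
have [T0 hT0] := slow_time (sh_b_gt0 hb) K0 (sh_traj HS hb) tw e0.
have [T1 hT1] := tw _ r10.
have [T2 hT2] := tw (weq - w0) ltac:(slra).
pose T := Num.max (Num.max T0 T1) (Num.max T2 0).
have TT0 : T0 <= T by rewrite !le_max lexx.
have TT1 : T1 <= T by rewrite !le_max lexx orbT.
have TT2 : T2 <= T by rewrite !le_max lexx !orbT.
have TT3 : 0 <= T by rewrite !le_max lexx !orbT.
have [s /andP[s1 s2] Ys] := hT0 T TT0.
have h1 := hr1 _ (hT1 s ltac:(slra)); have h2 := hT2 s ltac:(slra).
rewrite !ltr_norml in h1 h2; case/andP: h1 => h11 h12; case/andP: h2 => h21 h22.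
apply: (crit_not_trapped hc w00 w0e bw0 (_ : 0 <= s)); [slra|slra|].
have : Y bs s ^+ 2 < e ^+ 2.
  by rewrite -(real_normK (num_real (Y bs s))) ltr_pXn2r // ?nnegrE // ltW.
have : e ^+ 2 <= e by rewrite expr2 ler_piMr // ltW.
rewrite /g in h11 h12 eg; slra.
Qed.

(** If [w] rose for ever it would tend to [weq] from below. For [bs < drag weq] this
    is excluded by [crit_not_weq]; otherwise [Y] does not decrease, and cannot have
    slow times. After the turn, [crit_no_return] excludes a second rise. *)
Lemma crit_turn bs : critical bs -> exists t1, [/\ 0 < t1, weq < w bs t1,
  (forall t, t < t1 -> 0 < Y bs t) & forall t, t1 < t -> Y bs t < 0].
Proof.
move=> hc; have [hb _ _] := hc; have hpos := crit_pos hc; have weq0 := weq_gt0.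
have b0 := sh_b_gt0 hb.
have YD t : isD (Y bs) t ((bs - drag (w bs t)) * Y bs t + react (w bs t)).
  exact: (speedD b0 K0 (sh_traj HS hb) (hpos t)).
have Ypast t : t <= 0 -> 0 < Y bs t.
  move=> /(sh_past hb)[h1 _ _ h2]; apply: lt_le_trans h2.
  by rewrite mulr_gt0 // divr_gt0.
have [t t0 Yt] : exists2 t, 0 <= t & Y bs t <= 0.
  apply: contrapT => H.
  have Yp t : 0 <= t -> 0 < Y bs t.
    by move=> t0; rewrite ltNge; apply/negP => Yt; apply: H; exists t.
  have [||l [/andP[l0 lK] tl rl up _]] := limit_of_monotone b0 K0 (sh_traj HS hb) (T := 0).
  - by move=> t _; exact: hpos.
  - by left => t /Yp /ltW.
  have wl : forall t, 0 <= t -> w bs t <= l by apply: up => t /Yp /ltW.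
  have lw : l = weq.
    have lp : 0 < l by apply: lt_le_trans (wl 0 (lexx _)); exact: (sh_w0_bounds hb).1.
    have [h1|h1|//] := ltgtP l weq; first by have := react_gt0 lp h1; rewrite rl ltxx.
    by have := react_lt0 h1; rewrite rl ltxx.
  rewrite lw in tl wl.
  case: (ltrP bs (drag weq)) => bw; first exact: crit_not_weq tl.
  have [T0 hT0] := slow_time b0 K0 (sh_traj HS hb) tl (Yp 0 (lexx _)).
  pose T := Num.max T0 0.
  have TT0 : T0 <= T by rewrite le_max lexx.
  have TT1 : 0 <= T by rewrite le_max lexx orbT.
  have [s /andP[s1 s2] Ys] := hT0 T TT0.
  have s0 : 0 <= s by slra.
  have : Y bs 0 <= Y bs s.
    apply: (ndecr s0 (fun t _ => YD t)) => r /andP[r1 r2].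
    have [/andP[wr1 wr2] wr3] := (hpos r, wl r (ltW r1)).
    apply: addr_ge0; last by apply: react_ge0 wr3; exact: ltW.
    by rewrite mulr_ge0 ?(ltW (Yp _ (ltW r1))) // subr_ge0 (le_trans _ bw) // drag_le // ltW.
  by rewrite ltr_norml in Ys; case/andP: Ys => _; rewrite -/(Y bs); slra.
have [t1 /andP[t10 t1t] [Yt1 hY]] := first_zero t0 (fun r _ => sh_Ycont bs hb r) (Ypast 0 (lexx _)) Yt.
have Yp s : s < t1 -> 0 < Y bs s.
  by case: (lerP s 0) => [/Ypast //|s0 s1]; apply: hY; rewrite (ltW s0).
have YD0 s : Y bs s = 0 -> isD (Y bs) s (react (w bs s)).
  by move=> Ys; apply: isD_eq; [exact: YD|rewrite Ys mulr0 add0r].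
have wne s : Y bs s = 0 -> w bs s <> weq.
  by move=> Ys ws; exact: (crit_no_equilibrium hc (conj ws Ys)).
have rle : 0 <= - react (w bs t1).
  apply: (@isD_zero_sign_left _ (fun r => - Y bs r) t1 _ t1 t10); rewrite ?Yt1 ?oppr0 //.
    exact: isD_opp (YD0 _ Yt1).
  by move=> s /andP[_ s1]; rewrite oppr_lt0; exact: Yp.
have w1 : weq < w bs t1.
  rewrite lt_neqAle; apply/andP; split; first by rewrite eq_sym; apply/eqP; exact: wne.
  rewrite leNgt; apply/negP => wlt; have := react_gt0 (_ : 0 < w bs t1) wlt.
  by case/andP: (hpos t1) => -> _ /(_ isT); slra.
have r1 := react_lt0 w1.
have [d d0 [hd _]] := isD_incr_near (isD_opp (YD0 _ Yt1)) ltac:(by rewrite oppr_gt0).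
have Yaft s : t1 < s -> s < t1 + d -> Y bs s < 0.
  by move=> s1 s2; have := hd s; rewrite s1 s2 Yt1 => /(_ isT); slra.
have Yle s : t1 < s -> Y bs s <= 0.
  move=> s1; rewrite leNgt; apply/negP => Ys.
  have [r /andP[r11 r12] r13] := pick_right s1 d0.
  by apply: (@crit_no_return bs r s) => //; [slra|exact: Yaft].
exists t1; split => // s s1; rewrite lt_neqAle Yle // andbT; apply/eqP => Ys.
have [wlt|wgt|/(wne _ Ys) //] := ltgtP (w bs s) weq.
- have rp : 0 < react (w bs s) by apply: react_gt0 => //; case/andP: (hpos s).
  have [d' d'0 [hd' _]] := isD_incr_near (YD0 _ Ys) rp.
  have ss1 : s < s + 1 by rewrite ltrDl.
  have [r /andP[r11 r12] r13] := pick_right ss1 d'0.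
  by have := hd' r; rewrite r11 r13 Ys => /(_ isT); rewrite ltNge Yle // (lt_trans s1).
have rn := react_lt0 wgt.
have [d' d'0 [_ hd']] := isD_incr_near (isD_opp (YD0 _ Ys)) ltac:(by rewrite oppr_gt0).
have [r /andP[r11 r12] r13] := pick_left s1 d'0.
have := hd' r; rewrite r12 r13 Ys oppr0 oppr_lt0 => /(_ isT).
by rewrite ltNge Yle.
Qed.

(** Else the fall would stop at [weq]. For [bs < drag weq] this is excluded by
    [crit_not_weq]; otherwise the reaction outweighs the excess of [drag], by
    [drag_react], and keeps the speed away from [0]. *)
Lemma crit_limit bs : critical bs -> tends_to (w bs) 0.
Proof.
move=> hc; have [hb _ _] := hc; have hpos := crit_pos hc; have weq0 := weq_gt0.
have b0 := sh_b_gt0 hb.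
have [t1 [t10 w1 _ Yn]] := crit_turn hc.
have T1 : t1 < t1 + 1 by rewrite ltrDl.
have Yle t : t1 + 1 <= t -> Y bs t <= 0 by move=> h1; apply/ltW/Yn; exact: lt_le_trans h1.
have [||l [/andP[l0 lK] tl rl _ lo]] := limit_of_monotone b0 K0 (sh_traj HS hb) (T := t1 + 1).
- by move=> t _; exact: hpos.
- by right => t; exact: Yle.
have {}lo := lo Yle.
have [h1|h1|lw] := ltgtP l weq; last first.
- rewrite lw in tl lo.
  case: (ltrP bs (drag weq)) => bw; first by case: (crit_not_weq hc bw tl).
  exfalso; have [c c0 hcc] := drag_react.
  pose v0 := Num.min (- Y bs (t1 + 1)) c^-1.
  have v00 : 0 < v0 by rewrite lt_min oppr_gt0 Yn //= invr_gt0.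
  have v01 : v0 <= - Y bs (t1 + 1) by rewrite ge_min lexx.
  have v02 : c * v0 <= 1 by rewrite -ler_pdivlMl // mulr1 ge_min lexx orbT.
  have YD t : isD (Y bs) t ((bs - drag (w bs t)) * Y bs t + react (w bs t)).
    exact: (speedD b0 K0 (sh_traj HS hb) (hpos t)).
  have big t : t1 + 1 <= t -> v0 <= - Y bs t.
    move=> ht; rewrite leNgt; apply/negP => hlt.
    suff : v0 + Y bs t <= v0 + Y bs (t1 + 1) by slra.
    apply: (@barrier _ (fun s => v0 + Y bs s) (fun s => 0 + ((bs - drag (w bs s)) * Y bs s + react (w bs s)))
       (t1 + 1) t ht); last by slra.
       by move=> s _; exact: isD_add (isD_cst _ _) (YD s).
    move=> s /andP[s1 _] Ys; rewrite add0r.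
    have ws := lo s s1; have dr := hcc _ ws; have Yn' := Yle s s1.
    have rn : 0 <= - react (w bs s).
      move: ws; rewrite le_eqVlt => /orP[/eqP <-|/react_lt0]; first by rewrite react_weq oppr0.
      by rewrite oppr_ge0 => /ltW.
    apply: (@le_trans _ _ (- (c * - react (w bs s)) * Y bs s + react (w bs s))).
      rewrite lerD2r ler_wnM2r //; move: (c * - _) dr => u; slra.
    have : - react (w bs s) * (c * - Y bs s) <= - react (w bs s).
      rewrite ler_piMr // (le_trans _ v02) // ler_pM2l //; slra.
    move: (react _) (Y bs s) => u v; rewrite [X in X <= _ -> _](_ : _ = - (c * - u) * v); last by ring.
    slra.
  have [T0 hT0] := slow_time b0 K0 (sh_traj HS hb) tl v00.
  have [s /andP[s1 s2] Ys] := hT0 (Num.max T0 (t1 + 1)) ltac:(by rewrite le_max lexx).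
  have : v0 <= - Y bs s by apply: big; apply: le_trans (ltW s1); rewrite le_max lexx orbT.
  by move: Ys; rewrite ltr_norml -/(Y bs) => /andP[]; slra.
- by have := react_lt0 h1; rewrite rl ltxx.
suff <- : l = 0 by [].
apply/eqP; rewrite eq_le l0 andbT leNgt; apply/negP => lp.
by have := react_gt0 lp h1; rewrite rl ltxx.
Qed.

(** After a slow time with small [w], [Z] increases and the other terms of [Y] are
    small. *)
Lemma crit_speed0 bs : critical bs -> forall e, 0 < e -> exists T, forall t, T <= t -> `|Y bs t| < e.
Proof.
move=> hc e e0; have [hb _ _] := hc; have hpos := crit_pos hc; have weq0 := weq_gt0.
have b0 := sh_b_gt0 hb; have A0 := A_gt0.
have [t1 [t10 w1 _ Yn]] := crit_turn hc.
have tl := crit_limit hc.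
pose C := bs + Afr; have C0 : 0 < C by rewrite addr_gt0.
pose d := Num.min (Num.min 1 weq) (e / 4 / C).
have d0 : 0 < d by rewrite !lt_min ltr01 weq0 !divr_gt0.
have d1 : d <= 1 by rewrite !ge_min lexx.
have d2 : d <= weq by rewrite !ge_min lexx orbT.
have d3 : d * C <= e / 4 by rewrite -ler_pdivlMr // !ge_min lexx !orbT.
have [T2 hT2] := tl d d0.
have e20 : 0 < e / 2 by slra.
have [T0 hT0] := slow_time b0 K0 (sh_traj HS hb) tl e20.
pose T := Num.max (Num.max T0 T2) t1.
have TT0 : T0 <= T by rewrite !le_max lexx.
have TT2 : T2 <= T by rewrite !le_max lexx orbT.
have TT1 : t1 <= T by rewrite !le_max lexx orbT.
have [s /andP[s1 s2] Ys] := hT0 T TT0.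
exists (T + 1) => t tT.
have st : s <= t by apply: ltW; exact: lt_le_trans tT.
have wd r : s <= r -> 0 < w bs r < d.
  move=> sr; have := hT2 r ltac:(slra).
  by have /andP[p _] := hpos r; rewrite p subr0 gtr0_norm.
have cl r : clamp K (w bs r) = w bs r.
  by have /andP[p1 p2] := hpos r; apply: clamp_id; rewrite !ltW.
have zmon : Z bs s <= Z bs t.
  apply: (ndecr st (fun r _ => (sh_traj HS hb).2 r)) => r /andP[r1 _].
  rewrite cl; have /andP[p1 p2] := wd r (ltW r1).
  by apply: react_ge0; [exact: ltW|slra].
have wm r : s <= r -> 0 <= Afr * w bs r `^ m <= Afr * d.
  move=> sr; have /andP[p1 p2] := wd r sr; rewrite mulr_ge0 ?powR_ge0 ?(ltW A0) //=.
  rewrite ler_wpM2l ?(ltW A0) // (le_trans _ (ltW p2)) //.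
  by apply: ge1r_powR; [rewrite p1 /=; slra|exact: ltW hm].
have YE r : Y bs r = Z bs r + bs * w bs r - Afr * w bs r `^ m by rewrite /Y /speed cl.
have Yt : Y bs t < 0 by apply: Yn; slra.
rewrite ltr_norml (lt_trans Yt e0) andbT.
have /andP[q1 q2] := wm t st; have /andP[q3 q4] := wm s (lexx _).
have /andP[p1 p2] := wd s (lexx _); have /andP[p3 p4] := wd t st.
have p5 : bs * w bs s <= bs * d by rewrite ler_wpM2l ?ltW.
have p6 : 0 <= bs * w bs t by rewrite mulr_ge0 ?ltW.
move: Ys; rewrite -/(Y bs) ltr_norml => /andP[Ys _].
move: d3; rewrite /C mulrDr (mulrC d bs) (mulrC d Afr) => d3.
rewrite YE; rewrite YE in Ys.
move: (Z bs t) (Z bs s) zmon Ys q1 q2 q3 q4 p5 p6 d3 => a1 a2.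
move: (Afr * _ `^ _) (Afr * _ `^ _) (bs * _) (bs * w bs t) (Afr * d) (bs * d) => a3 a4 a5 a6 a7 a8.
slra.
Qed.

(** Otherwise [- Y - w] would be negative and non-increasing from some time on,
    although [- Y] is positive and [w] tends to [0]. *)
Lemma crit_lower bs : critical bs -> exists2 c, 0 < c &
  exists T, forall t, T <= t -> c * w bs t `^ (m + q - 1) <= - Y bs t.
Proof.
move=> hc; have [hb _ _] := hc; have hpos := crit_pos hc.
have b0 := sh_b_gt0 hb.
have [t1 [t10 w1 _ Yn]] := crit_turn hc.
have tl := crit_limit hc; have [ws ws0 [ws1 hws]] := small_react.
pose r := m + q - 1; have r1 : 1 < r by params; rewrite /r; slra.
have D0 : 0 < bs + r + 1 by slra.
pose c := Num.min 1 (m / 2 / (bs + r + 1)).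
have c0 : 0 < c by params; rewrite lt_min ltr01 !divr_gt0 //; slra.
have c1 : c <= 1 by rewrite ge_min lexx.
have c2 : c * (bs + r + 1) <= m / 2 by rewrite -ler_pdivlMr // ge_min lexx orbT.
have [T2 hT2] := tl ws ws0.
exists c => //; pose T := Num.max T2 (t1 + 1).
have TT2 : T2 <= T by rewrite le_max lexx.
have TT1 : t1 + 1 <= T by rewrite le_max lexx orbT.
exists T => t0 tT; rewrite leNgt; apply/negP => hlt.
have wd t : t0 <= t -> 0 < w bs t <= ws.
  move=> sr; have := hT2 t ltac:(slra).
  by have /andP[p _] := hpos t; rewrite p subr0 gtr0_norm // => /ltW.
have YD t : isD (Y bs) t ((bs - drag (w bs t)) * Y bs t + react (w bs t)).
  exact: (speedD b0 K0 (sh_traj HS hb) (hpos t)).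
have neg t : t0 <= t -> Y bs t < 0 by move=> h1; apply: Yn; slra.
have key t : t0 <= t -> 0 < c * w bs t `^ r + Y bs t -> (bs + r + 1) * - Y bs t <= react (w bs t).
  move=> ht hh; have /andP[p1 p2] := wd t ht; apply: le_trans (hws _ p1 p2).
  apply: (@le_trans _ _ ((bs + r + 1) * (c * w bs t `^ r))).
    rewrite ler_wpM2l ?(ltW D0) //; slra.
  by rewrite mulrA (mulrC _ c) ler_wpM2r ?powR_ge0.
have fD t : t0 <= t -> isD (fun t => c * w bs t `^ r + Y bs t) t
    (c * (r * w bs t `^ (r - 1) * Y bs t) + ((bs - drag (w bs t)) * Y bs t + react (w bs t))).
  move=> ht; have /andP[p1 p2] := wd t ht; apply: isD_add (YD t).
  apply: isD_eq; first exact: isD_mul (isD_cst _ c) (isD_powR r p1 (sh_wD bs hb t)).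
  by rewrite mul0r add0r.
have pers t : t0 <= t -> 0 < c * w bs t `^ r + Y bs t.
  move=> ht; apply: (@pos_pres _ _ _ t0 t 0 ht (fun s hs => fD s (andP hs).1)); last by rewrite -/r in hlt; slra.
  move=> s /andP[s1 _] hs; rewrite oppr0 mul0r.
  have k1 := key s s1 hs; have /andP[p1 p2] := wd s s1; have k2 := neg s s1.
  have k3 : w bs s `^ (r - 1) <= 1.
    have := @pw_le _ (r - 1) (w bs s) 1 ltac:(slra) (ltW p1) ltac:(slra); by rewrite powR1.
  have k4 : c * (r * w bs s `^ (r - 1) * Y bs s) >= r * Y bs s.
    rewrite mulrA ler_wnM2r ?(ltW k2) // mulrCA ler_piMr //; first slra.
    by rewrite mulr_ile1 ?powR_ge0 // ltW.
  have k5 : 0 <= - drag (w bs s) * Y bs s by rewrite mulNr -mulrN mulr_ge0 ?drag_ge0 //; slra.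
  move: k1 k4 k5 k2; move: (react _) (c * (_ * _ * _)) (drag _) => u v d; move: (Y bs s) => yy; nra.
pose g t := - Y bs t - w bs t.
have gdec s t : t0 <= s -> s <= t -> g t <= g s.
  move=> hs hst; apply: (nincr hst (fun u _ => isD_sub (isD_opp (YD u)) (sh_wD bs hb u))) => u /andP[u1 _].
  have hu := le_trans hs (ltW u1); have k1 := key u hu (pers u hu); have k2 := neg u hu.
  have k5 : 0 <= - drag (w bs u) * Y bs u by rewrite mulNr -mulrN mulr_ge0 ?drag_ge0 //; slra.
  have k6 : 0 <= r * - Y bs u by rewrite mulr_ge0 //; slra.
  move: k1 k5 k6; move: (react _) (drag _) => u' v; move: (Y bs u) => yy; nra.
have g0 : g t0 < 0.
  have /andP[p1 p2] := wd t0 (lexx _); rewrite /g subr_lt0 (lt_le_trans hlt) //.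
  apply: (@le_trans _ _ (1 * w bs t0)); last by rewrite mul1r.
  apply: ler_pM; rewrite ?powR_ge0 ?(ltW c0) //.
  by apply: ge1r_powR; [rewrite p1 (le_trans p2)|exact: ltW].
have e0 : 0 < - g t0 / 2 by rewrite divr_gt0 // oppr_gt0.
have [T3 hT3] := tl _ e0; pose t := Num.max t0 T3.
have h1 : t0 <= t by rewrite le_max lexx.
have h2 := hT3 t ltac:(by rewrite le_max lexx orbT).
have h3 := gdec t0 t (lexx _) h1; have h4 := neg t h1.
rewrite ltr_norml in h2; case/andP: h2 => _.
by rewrite /g in h3 e0 *; slra.
Qed.

(** * Small and large exponents *)

(** The function [t ^ q - (q B / m) t ^ m] increases up to [weq]. *)
Lemma react_slope x : 0 < x -> x <= weq ->
  q * Bre / m * (weq `^ m - x `^ m) <= weq `^ q - x `^ q.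
Proof.
params; move=> x0 xw.
have := @ndecr _ (fun t => t `^ q - q * Bre / m * t `^ m)
  (fun t => q * t `^ (q - 1) * (1 - Bre * t `^ (m - q))) x weq xw.
have tw t : x <= t <= weq -> 0 < t by move=> /andP[h1 _]; exact: lt_le_trans h1.
move=> hh; suff : x `^ q - q * Bre / m * x `^ m <= weq `^ q - q * Bre / m * weq `^ m.
  by rewrite mulrBr; slra.
apply: hh => t ht.
  have t0 := tw t ht; apply: isD_eq.
    apply: isD_sub; first exact: isD_powR t0 (isD_id t).
    exact: isD_mul (isD_cst _ _) (isD_powR m t0 (isD_id t)).
  have -> : t `^ (m - 1) = t `^ (q - 1) * t `^ (m - q) by rewrite -pwD //; congr (_ `^ _); ring.
  by field; rewrite gt_eqF //; slra.
have /andP[h1 h2] := ht; have t0 : 0 < t by exact: lt_trans h1.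
rewrite !mulr_ge0 ?powR_ge0 //; first slra.
rewrite subr_ge0 -weq_pow ler_wpM2l ?(ltW B_gt0) //; apply: pw_le; rewrite ?(ltW t0) ?(ltW h2) //; slra.
Qed.

(** The quantity [P = Y + k w ^ m], which is the flux [xi ^ (1 - k) (f ^ m)'], stays
    below its value at the equilibrium. As long as it does, [w] is below [weq],
    and [Y] stays positive. *)
Lemma sh_low w3 : inr blo -> 0 < w3 -> m * w3 `^ (m + q - 2) <= 1 / 2 ->
  w3 + k * w3 `^ m < k * weq `^ m -> blo <= 1 / 2 -> blo * k < q * Bre * w3 `^ (m - 1) ->
  w2 <= w3 -> forall t, 0 <= t -> 0 <= w blo t.
Proof.
params; move=> hb w30 w3d w3P bl1 bl2 w23.
have m0 : 0 <= m by slra.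
have m0' : 0 < m by slra.
have m1 : 0 <= m - 1 by slra.
have dl0 : 0 <= m + q - 2 by slra.
have q00 : 0 <= q by exact: ltW.
have b0 := sh_b_gt0 hb; have weq0 := weq_gt0; have B0 := B_gt0.
set b := blo in hb b0 bl1 bl2 *.
have [wp0 wlt0] := sh_w0_bounds hb.
pose P t := Y b t + k * w b t `^ m; pose kM := k * weq `^ m.
have hst : is_start b w2 (h b) := sh_h HS hb.
have w2i : 0 < w b 0 < w2 by rewrite wp0.
have Y0l : b / 2 * w b 0 <= Y b 0 by rewrite sh_Y0E //; exact: (hst.2 _ w2i).1.
have Y0p : 0 < Y b 0 by apply: lt_le_trans Y0l; rewrite !mulr_gt0.
have Y0u : Y b 0 <= w b 0.
  rewrite sh_Y0E // -[leRHS]mul1r; apply: start_upper hst _ _ _ w2i => //; first exact: sh_w2B HS.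
  rewrite divr1; have : m * w2 `^ (m + q - 2) <= m * w3 `^ (m + q - 2); last by slra.
  by rewrite ler_wpM2l ?pw_le ?(ltW w20) //; slra.
have low (x : R) : 0 <= x -> x <= w3 -> x + k * x `^ m < kM.
  move=> x0 x3; apply: le_lt_trans w3P; apply: lerD => //.
  by rewrite ler_wpM2l ?pw_le //; slra.
suff Yp t : 0 <= t -> 0 < Y b t.
  move=> t t0; apply: ltW; apply: (lt_le_trans wp0); apply: (ndecr t0 (fun r _ => sh_wD b hb r)) => r /andP[r1 _].
  exact/ltW/Yp/ltW.
move=> t0; rewrite ltNge; apply/negP => Yt.
pose F r := Num.min (Y b r) (kM - P r).
have mpos s : 0 < w b s -> {for s, continuous P}.
  move=> ws; apply: continuousD; first exact: (sh_Ycont b hb s).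
  exact: isD_cont (isD_mul (isD_cst s k) (isD_powR m ws (sh_wD b hb s))).
have [z /andP[z0 zt] [Yz hz]] := first_zero t0 (fun r _ => sh_Ycont b hb r) Y0p Yt.
have wz r : 0 <= r <= z -> w b 0 <= w b r.
  move=> /andP[r0 rz]; apply: (ndecr r0 (fun s _ => sh_wD b hb s)) => s /andP[s1 s2].
  by apply/ltW/hz; rewrite (ltW s1) (lt_le_trans s2).
have wmon r s : 0 <= r -> r <= s -> s <= z -> w b r <= w b s.
  move=> r0 rs sz; apply: (ndecr rs (fun s _ => sh_wD b hb s)) => u /andP[u1 u2].
  by apply/ltW/hz; rewrite (le_trans r0 (ltW u1)) (lt_le_trans u2).
have wpos r : 0 <= r <= z -> 0 < w b r < K.
  by move=> hr; rewrite (lt_le_trans wp0 (wz r hr)) (sh_below HS hb) //; case/andP: hr.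
have YD r : 0 <= r <= z -> isD (Y b) r ((b - drag (w b r)) * Y b r + react (w b r)).
  by move=> /wpos; exact: (speedD b0 K0 (sh_traj HS hb)).
have PD r : 0 <= r <= z -> isD P r (b * Y b r + m * w b r `^ (m - 1) * (w b r `^ q - k' * P r)).
  move=> hr; have /andP[wr _] := wpos r hr; apply: isD_eq.
    exact: isD_add (YD r hr) (isD_mul (isD_cst _ k) (isD_powR m wr (sh_wD b hb r))).
  rewrite dragE react_def AfrE BreE /P.
  have -> : w b r `^ (m + q - 1) = w b r `^ (m - 1) * w b r `^ q by rewrite -pwD //; congr (_ `^ _); ring.
  have -> : w b r `^ (2 * m - 1) = w b r `^ (m - 1) * w b r `^ m by rewrite -pwD //; congr (_ `^ _); ring.
  by rewrite -/(Y b); ring.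
have P0 : P 0 < kM.
  apply: le_lt_trans (low (w b 0) (ltW wp0) _); last by rewrite (le_trans (ltW wlt0)).
  by rewrite /P lerD2r.
(* [k w ^ m <= P] when [Y] is non-negative *)
have weqP s : 0 <= s <= z -> P s <= kM -> 0 <= Y b s -> w b s <= weq.
  move=> hs Ps Ys; rewrite leNgt; apply/negP => wl.
  have : kM < k * w b s `^ m by rewrite /kM ltr_pM2l // pw_lt // ?ltW //; slra.
  by rewrite /P in Ps; slra.
have Pz : forall s, 0 <= s <= z -> P s < kM.
  move=> s /andP[s0 sz]; rewrite ltNge; apply/negP => Ps.
  have zc r : 0 <= r <= s -> {for r, continuous (fun r => kM - P r)}.
    move=> /andP[r0 rs]; apply: continuousB; first exact: cvg_cst.
    by apply: mpos; have /andP[] := wpos r ltac:(by rewrite r0 (le_trans rs)).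
  have [||y /andP[y0 ys] [Py hy]] := first_zero s0 zc; [by rewrite subr_gt0|by rewrite subr_le0|].
  have {}Py : P y = kM by slra.
  have yz : y <= z := le_trans ys sz.
  have hyz : 0 <= y <= z by rewrite (ltW y0).
  have inc r : 0 <= r <= y -> 0 <= r <= z by move=> /andP[-> r2]; exact: le_trans yz.
  have Yy r : 0 <= r <= y -> 0 <= Y b r.
    move=> /andP[r1 r2]; have := le_trans r2 yz; rewrite le_eqVlt => /orP[/eqP ->|rz]; first by rewrite Yz.
    by apply/ltW/hz; rewrite r1.
  (* While [w <= w3], [Y] is at most [w], and then [P] is below [kM] by the choice
     of [w3]. Beyond, [P' >= 0] at the first contact is impossible, because
     [b Y = b k (weq ^ m - w ^ m)] is too small to balance [react_slope]. *)
  case: (lerP (w b y) w3) => wy3.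
    have : Y b y <= w b y.
      rewrite leNgt; apply/negP => hlt.
      have : Y b y - w b y <= Y b 0 - w b 0; last by move: hlt Y0u; slra.
      apply: (@barrier _ (fun r => Y b r - w b r) _ 0 y (ltW y0) (fun r hr => isD_sub (YD r (inc r hr)) (sh_wD b hb r))); last by slra.
      move=> r hr; rewrite subr_gt0 => hlr; have /andP[wr _] := wpos r (inc r hr).
      have wr3 : w b r <= w3.
        by apply: le_trans wy3; apply: wmon => //; case/andP: hr.
      have h1 : react (w b r) <= w b r / 2.
        apply: (le_trans (react_le (ltW wr))).
        have -> : m * w b r `^ (m + q - 1) = w b r * (m * w b r `^ (m + q - 2)).
          rewrite mulrCA; congr (_ * _); rewrite -{2}(powRr1 (ltW wr)) -pwD //; congr (_ `^ _); ring.
        rewrite ler_wpM2l ?(ltW wr) // (le_trans _ (_ : m * w3 `^ (m + q - 2) <= _)) //; last by move: w3d; slra.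
        by rewrite ler_wpM2l ?pw_le ?(ltW wr) //; slra.
      have h2 := drag_ge0 (w b r).
      have h3 : 0 <= drag (w b r) * Y b r by rewrite mulr_ge0 ?Yy.
      have h4 : b * Y b r <= 1 / 2 * Y b r by rewrite ler_wpM2r ?Yy.
      by rewrite mulrBl; slra.
    have := low (w b y) (ltW (andP (wpos y hyz)).1) wy3; rewrite -Py /P; slra.
  have /andP[wy _] := wpos y hyz; have wye := weqP y hyz ltac:(by rewrite Py) (Yy y ltac:(by rewrite lexx ltW)).
  have Ye : Y b y = k * (weq `^ m - w b y `^ m) by rewrite mulrBr -/kM -Py /P; ring.
  have Peq : 0 <= b * Y b y + m * w b y `^ (m - 1) * (w b y `^ q - k' * P y).
    apply: (@isD_zero_sign_left _ (fun r => P r - kM) y _ y y0).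
    - by apply: isD_eq; [exact: isD_sub (PD y hyz) (isD_cst _ _)|rewrite subr0].
    - by rewrite Py subrr.
    by move=> r /andP[r1 r2]; have := hy r; rewrite r2; rewrite subrr in r1; rewrite (ltW r1) => /(_ isT); slra.
  have kk : k' * P y = weq `^ q.
    rewrite Py /kM mulrA (mulrC k') -BreE.
    have -> : weq `^ m = weq `^ (m - q) * weq `^ q by rewrite -pwD //; congr (_ `^ _); ring.
    by rewrite mulrA weq_pow mul1r.
  have wlt : w b y < weq.
    rewrite lt_neqAle wye andbT; apply/eqP => e.
    have [d d0 hd] := cont_gt0 (sh_wcont b hb y) wy.
    apply: (@no_equilibrium b K (w b) (Z b) b0 K0 (sh_traj HS hb) (-1) (y + d) 0 y).
    - move=> r /andP[r1 r2]; case: (lerP r 0) => [/(sh_past hb)[-> ->]//|r0].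
      rewrite (sh_below HS hb (ltW r0)) andbT; case: (lerP r y) => ry.
        by have /andP[] := wpos r ltac:(by rewrite (ltW r0) (le_trans ry)).
      by apply: hd; rewrite gtr0_norm ?subr_gt0 // ltrBlDl.
    - by rewrite ltrN10 addr_gt0.
    - by rewrite (lt_trans (@ltrN10 R) y0) ltrDl.
    - by have := sh_w2B HS; move: wlt0; slra.
    by split => //; rewrite -/(Y b) Ye e subrr mulr0.
  have sl := react_slope wy wye; rewrite kk Ye in Peq.
  have dpos : 0 < weq `^ m - w b y `^ m by rewrite subr_gt0 pw_lt // ?ltW //; slra.
  have up1 : b * (k * (weq `^ m - w b y `^ m)) < q * Bre * w b y `^ (m - 1) * (weq `^ m - w b y `^ m).
    rewrite mulrA ltr_pM2r // (lt_le_trans bl2) //.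
    by rewrite ler_wpM2l ?pw_le ?(ltW w30) ?(ltW wy3) // ?mulr_ge0 ?(ltW B0) //; slra.
  have up2 : m * w b y `^ (m - 1) * (q * Bre / m * (weq `^ m - w b y `^ m)) <=
      m * w b y `^ (m - 1) * (weq `^ q - w b y `^ q).
    by rewrite ler_wpM2l // mulr_ge0 ?powR_ge0 //; slra.
  have up3 : m * w b y `^ (m - 1) * (q * Bre / m * (weq `^ m - w b y `^ m)) =
     q * Bre * w b y `^ (m - 1) * (weq `^ m - w b y `^ m).
    by field; rewrite gt_eqF.
  rewrite up3 in up2; move: up1 up2 Peq; rewrite !mulrBr; slra.
have : 0 < Y b z; last by rewrite Yz ltxx.
apply: (@pos_pres _ _ _ 0 z (drag weq) (ltW z0) YD) => // r hr Yr.
have /andP[wr _] := wpos r hr.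
have wre := weqP r hr (ltW (Pz r hr)) (ltW Yr).
rewrite mulrBl -addrA mulNr; have := react_ge0 (ltW wr) wre.
have : drag (w b r) * Y b r <= drag weq * Y b r by rewrite ler_wpM2r ?(ltW Yr) // drag_le // ltW.
have : 0 <= b * Y b r by rewrite mulr_ge0 // ltW.
slra.
Qed.

(** For a large exponent [Y] exceeds [(b / 4) w] up to twice [weq]. Falling back from
    beyond, the trajectory is repelled at the same rate from [w = wd], so that it
    reaches [w = 0] in finite time. *)
Lemma sh_high wd : inr bhi -> weq *+ 2 = wd -> drag wd <= bhi / 4 -> 1 <= bhi ->
  8 * (Lreact wd * wd) <= bhi * weq -> exists2 t, 0 <= t & w bhi t < 0.
Proof.
move=> hb wdE bw b1 bL; apply: contrapT => H.
have nn t : 0 <= t -> 0 <= w bhi t by move=> t0; rewrite leNgt; apply/negP => ?; apply: H; exists t.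
have hpos := sh_stays_pos hb nn.
set b := bhi in hb bw b1 bL nn hpos.
have b0 := sh_b_gt0 hb; have weq0 := weq_gt0.
have wd2 : weq < wd by rewrite -wdE mulr2n ltrDl.
have wd0 : 0 < wd := lt_trans weq0 wd2.
have LK := Lreact_gt0 wd0; have LW : 0 < Lreact wd * wd by rewrite mulr_gt0.
have [wp0 wlt0] := sh_w0_bounds hb.
have bL2 : Lreact wd * wd <= b / 2 * (b / 4 * weq).
  have : b * weq <= b * (b * weq) by rewrite ler_peMl // mulr_ge0 ?ltW.
  have -> : b / 2 * (b / 4 * weq) = b * (b * weq) / 8 by field.
  by move: (b * (b * weq)) (b * weq) (Lreact wd * wd) bL => *; slra.
have rb x : 0 < x -> x <= wd -> `|react x| <= Lreact wd * wd.
  move=> x0 x1; rewrite -[react x]subr0 -react0.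
  apply: (le_trans (react_lip (K := wd) _ _)); rewrite ?lexx ?(ltW x0) ?(ltW wd0) //.
  by rewrite subr0 gtr0_norm // ler_wpM2l // ltW.
have YD t : isD (Y b) t ((b - drag (w b t)) * Y b t + react (w b t)).
  exact: (speedD b0 K0 (sh_traj HS hb) (hpos t)).
have hst : is_start b w2 (h b) := sh_h HS hb.
have w2i : 0 < w b 0 < w2 by rewrite wp0.
have Y0l : b / 4 * w b 0 < Y b 0.
  apply: (@lt_le_trans _ _ (b / 2 * w b 0)); last by rewrite sh_Y0E //; exact: (hst.2 _ w2i).1.
  by rewrite ltr_pM2r //; slra.
have dw x : 0 <= x -> x <= wd -> drag x <= b / 4 by move=> x0 x1; exact: le_trans (drag_le x0 x1) bw.
have limit_big T : (forall t, T <= t -> 0 <= Y b t) \/ (forall t, T <= t -> Y b t <= 0) ->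
   (forall t, T <= t -> wd <= w b t) -> False.
  move=> hm' hbig; have [|l [/andP[l0 lK] tl rl _ _]] := limit_of_monotone b0 K0 (sh_traj HS hb) (T := T) _ hm'.
    by move=> t _; exact: hpos.
  have lw : wd <= l.
    rewrite leNgt; apply/negP => lw; have [T1 hT1] := tl (wd - l) ltac:(slra).
    have := hT1 (Num.max T1 T) ltac:(by rewrite le_max lexx).
    have := hbig (Num.max T1 T) ltac:(by rewrite le_max lexx orbT).
    by rewrite ltr_norml => h1 /andP[_ h2]; slra.
  by have := react_lt0 (lt_le_trans wd2 lw); rewrite rl ltxx.
(* up to [wd] the speed exceeds [(b / 4) w], since [react >= - (b / 2) Y] there *)
have psi t : 0 <= t -> (forall s, 0 <= s <= t -> w b s <= wd) -> 0 < Y b t - b / 4 * w b t.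
  move=> t0 hs; apply: (@pos_pres _ (fun r => Y b r - b / 4 * w b r) _ 0 t 0 t0
    (fun r _ => isD_sub (YD r) (isD_mul (isD_cst r (b / 4)) (sh_wD b hb r)))); last by rewrite subr_gt0.
  move=> r hr hp; rewrite oppr0 !mul0r add0r.
  have /andP[wr _] := hpos r; have wrd := hs r hr.
  have dd := dw _ (ltW wr) wrd.
  have Yr : 0 < Y b r by apply: lt_trans (_ : b / 4 * w b r < _); [rewrite mulr_gt0 // divr_gt0|slra].
  suff h1 : - react (w b r) <= b / 2 * Y b r.
    have : (b / 4) * Y b r <= (b - drag (w b r) - b / 2) * Y b r by rewrite ler_wpM2r ?(ltW Yr) //; slra.
    by rewrite !mulrBl -/(Y b); slra.
  case: (lerP (w b r) weq) => wre.
    apply: (@le_trans _ _ 0); first by rewrite oppr_le0 react_ge0 // ltW.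
    by rewrite mulr_ge0 ?ltW // divr_gt0.
  apply: (le_trans (ler_norm _)); rewrite normrN; apply: (le_trans (rb _ wr wrd)); apply: (le_trans bL2).
  rewrite ler_wpM2l ?divr_ge0 ?(ltW b0) //; apply: (@le_trans _ _ (b / 4 * w b r)); last slra.
  by rewrite ler_wpM2l ?(ltW wre) // divr_ge0 // ltW.
have [ta ta0 wta] : exists2 ta, 0 <= ta & wd <= w b ta.
  apply: contrapT => Hn.
  have low t : 0 <= t -> w b t <= wd by move=> t0; rewrite leNgt; apply/negP => ?; apply: Hn; exists t => //; exact: ltW.
  have Yl t : 0 <= t -> b / 4 * w b t < Y b t.
    by move=> t0; rewrite -subr_gt0; apply: psi => // s /andP[s0 _]; exact: low.
  have Yp t : 0 <= t -> 0 < Y b t.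
    move=> t0; apply: lt_trans (Yl t t0); have /andP[wr _] := hpos t; by rewrite mulr_gt0 // divr_gt0.
  pose v := b / 4 * w b 0; have v0 : 0 < v by rewrite mulr_gt0 // divr_gt0.
  have mon t : 0 <= t -> w b 0 <= w b t.
    by move=> t0; apply: (ndecr t0 (fun r _ => sh_wD b hb r)) => r /andP[r1 _]; exact/ltW/Yp/ltW.
  pose t := wd / v; have t0 : 0 <= t by rewrite divr_ge0 ?ltW.
  have : w b 0 - v * 0 <= w b t - v * t.
    apply: (@ndecr _ (fun r => w b r - v * r) _ 0 t t0 (fun r _ => isD_sub (sh_wD b hb r) (isD_mul (isD_cst r v) (isD_id r)))).
    move=> r /andP[r1 _]; rewrite mul0r add0r mulr1 subr_ge0.
    apply: (@le_trans _ _ (b / 4 * w b r)); last exact/ltW/Yl/ltW.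
    by rewrite ler_wpM2l ?mon ?(ltW r1) // divr_ge0 // ltW.
  have -> : v * t = wd by rewrite /t mulrC divfK // gt_eqF.
  by have := low t t0; rewrite mulr0 subr0; slra.
have [ta' /andP[ta'0 _] [wta' lowa]] : exists2 s, 0 < s <= ta & wd - w b s = 0 /\ forall r, 0 <= r < s -> 0 < wd - w b r.
  apply: (@first_zero _ (fun r => wd - w b r) 0 ta ta0); last by rewrite subr_le0.
    by move=> r _; apply: continuousB; [exact: cvg_cst|exact: (sh_wcont b hb r)].
  have := sh_w2B HS; slra.
have lowa' s : 0 <= s <= ta' -> w b s <= wd.
  move=> /andP[s0]; rewrite le_eqVlt => /orP[/eqP ->|s1]; first by slra.
  by have := lowa s; rewrite s0 s1 => /(_ isT); slra.
have Ya s : 0 <= s <= ta' -> 0 < Y b s.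
  move=> /andP[s0 s1]; have := psi s s0 (fun r hr => lowa' r ltac:(by case/andP: hr => -> /le_trans ->)).
  by have /andP[wr _] := hpos s; have : 0 < b / 4 * w b s by [rewrite mulr_gt0 // divr_gt0]; slra.
(* beyond [wd] there is no equilibrium to converge to: [w] turns and comes back *)
have [tc tc0 Ytc] : exists2 t, ta' <= t & Y b t <= 0.
  apply: contrapT => Hn.
  have Yp t : ta' <= t -> 0 < Y b t by move=> ht; rewrite ltNge; apply/negP => ?; apply: Hn; exists t.
  apply: (limit_big ta'); first by left => t /Yp /ltW.
  move=> t ht; have -> : wd = w b ta' by slra.
  by apply: (ndecr ht (fun r _ => sh_wD b hb r)) => r /andP[r1 _]; exact/ltW/Yp/ltW.
have [tb /andP[tb0 _] [Ytb hY]] := first_zero tc0 (fun r _ => sh_Ycont b hb r) (Ya ta' ltac:(by rewrite lexx ltW)) Ytc.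
have wtb : wd < w b tb.
  have -> : wd = w b ta' by slra.
  by apply: (incr tb0 (fun r _ => sh_wD b hb r)) => r /andP[r1 r2]; apply: hY; rewrite r2 ltW.
have rtb : react (w b tb) < 0 by apply: react_lt0; exact: lt_trans wtb.
have nYD : isD (fun r => - Y b r) tb (- react (w b tb)).
  by apply: isD_eq; [exact: isD_opp (YD tb)|rewrite Ytb mulr0 add0r].
have [|d d0 [hd _]] := isD_incr_near nYD; first by rewrite oppr_gt0.
have wb0 : 0 < w b tb - wd by rewrite subr_gt0.
have [d' d'0 hd'] : exists2 d : R, 0 < d & forall y, `|y - tb| < d -> 0 < w b y - wd.
  by apply: (@cont_gt0 _ (fun r => w b r - wd)) wb0; apply: continuousB; [exact: (sh_wcont b hb tb)|exact: cvg_cst].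
have d00 : 0 < Num.min d d' by rewrite lt_min d0.
have tbd : tb < tb + Num.min d d' by rewrite ltrDl.
have [t1 /andP[t11 t12] _] := pick_right tbd d00.
have Yt1 : Y b t1 < 0.
  have := hd t1; rewrite t11 (lt_le_trans t12) ?lerD2l ?ge_min ?lexx // => /(_ isT); rewrite Ytb; slra.
have wt1 : 0 < w b t1 - wd.
  apply: hd'; rewrite gtr0_norm ?subr_gt0 // ltrBlDl (lt_le_trans t12) //.
  by rewrite lerD2l ge_min lexx orbT.
have fall t : t1 <= t -> (forall s, t1 <= s <= t -> wd <= w b s) -> Y b t < 0.
  move=> ht hs; rewrite -oppr_gt0.
  apply: (@pos_pres _ (fun r => - Y b r) _ t1 t (drag K) ht (fun r _ => isD_opp (YD r))); last by rewrite oppr_gt0.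
  move=> r hr Yr; have /andP[w1 w2'] := hpos r.
  have := react_lt0 (lt_le_trans wd2 (hs r hr)).
  have : drag (w b r) * - Y b r <= drag K * - Y b r by rewrite ler_wpM2r ?(ltW Yr) // drag_le // ltW.
  have : 0 <= b * - Y b r by rewrite mulr_ge0 ?(ltW b0) // ltW.
  by move: (react _) (drag (w b r)) (drag K) (Y b r) => a1 a2 a3 a4; first [slra|nra].
have [te te0 wte] : exists2 t, t1 <= t & w b t - wd <= 0.
  apply: contrapT => Hn.
  have big t : t1 <= t -> wd <= w b t by move=> ht; rewrite leNgt; apply/negP => ?; apply: Hn; exists t => //; slra.
  apply: (limit_big t1) => //; right => t ht; apply/ltW/fall => // s /andP[s1 _]; exact: big.
have [|tf /andP[tf0 _] [wtf hw]] := @first_zero _ (fun r => w b r - wd) t1 te te0 _ wt1 wte.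
  by move=> r _; apply: continuousB; [exact: (sh_wcont b hb r)|exact: cvg_cst].
have Ytf : Y b tf < 0.
  apply: fall; first exact: ltW.
  move=> s /andP[s1]; rewrite le_eqVlt => /orP[/eqP ->|s2]; first by slra.
  by have := hw s; rewrite s1 s2 => /(_ isT); slra.
(* below [wd], [- Y] exceeds [(b / 4) (wd - w)], by the same comparison; the excess
   [chi] does not decrease and bounds the speed of the fall from below *)
pose chi t := - Y b t - b / 4 * (wd - w b t).
have chiD t : isD chi t (- ((b - drag (w b t)) * Y b t + react (w b t)) + b / 4 * Y b t).
  apply: isD_eq; first exact: isD_sub (isD_opp (YD t)) (isD_mul (isD_cst t (b / 4)) (isD_sub (isD_cst t wd) (sh_wD b hb t))).
  by rewrite /= -/(Y b); ring.
have chi0 : 0 < chi tf by rewrite /chi (_ : wd - w b tf = 0) ?mulr0; slra.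
have wle t : tf <= t -> (forall s, tf <= s < t -> 0 < chi s) -> w b t <= wd.
  move=> ht hs; rewrite -subr_ge0 -(pmulr_rge0 _ (expR_gt0 (- (b / 4) * t))).
  apply: (@le_trans _ _ (expR (- (b / 4) * tf) * (wd - w b tf))); first by rewrite -opprB wtf oppr0 mulr0.
  apply: (@ndecr _ (fun r => expR (- (b / 4) * r) * (wd - w b r)) (fun r => expR (- (b / 4) * r) * chi r) tf t ht).
    move=> r _; apply: isD_eq.
      exact: isD_mul (isD_expR (isD_mul (isD_cst r (- (b / 4))) (isD_id r))) (isD_sub (isD_cst r wd) (sh_wD b hb r)).
    by rewrite /chi -/(Y b); ring.
  by move=> r /andP[r1 r2]; rewrite mulr_ge0 ?expR_ge0 // ltW // hs // r2 ltW.
have chiinc t : tf <= t -> 0 < chi t -> w b t <= wd -> 0 <= - ((b - drag (w b t)) * Y b t + react (w b t)) + b / 4 * Y b t.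
  move=> ht hc hw'; have /andP[wr _] := hpos t.
  have Yn : b / 4 * (wd - w b t) < - Y b t by rewrite /chi in hc; slra.
  have Vp : 0 < - Y b t.
    by apply: le_lt_trans Yn; rewrite mulr_ge0 ?subr_ge0 // divr_ge0 // ltW.
  have dd := dw _ (ltW wr) hw'.
  suff h1 : react (w b t) <= b / 2 * - Y b t.
    have : (b / 4) * - Y b t <= (b - drag (w b t) - b / 2) * - Y b t by rewrite ler_wpM2r ?(ltW Vp) //; slra.
    by rewrite !mulrBl !mulrN; slra.
  case: (lerP (w b t) weq) => wre; last first.
    apply: (@le_trans _ _ 0); first exact: ltW (react_lt0 wre).
    by rewrite mulr_ge0 ?(ltW Vp) // divr_ge0 // ltW.
  apply: (le_trans (ler_norm _)); apply: (le_trans (rb _ wr hw')); apply: (le_trans bL2).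
  rewrite ler_wpM2l ?divr_ge0 ?(ltW b0) //; apply: (@le_trans _ _ (b / 4 * (wd - w b t))); last slra.
  by rewrite ler_wpM2l ?divr_ge0 ?(ltW b0) //; rewrite -wdE mulr2n; slra.
have chige t : tf <= t -> (forall s, tf <= s < t -> 0 < chi s) -> chi tf <= chi t.
  move=> ht hs; apply: (ndecr ht (fun r _ => chiD r)) => r /andP[r1 r2].
  apply: chiinc; [exact: ltW|by apply: hs; rewrite r2 ltW|].
  apply: wle; first exact: ltW.
  by move=> s /andP[s1 s2]; apply: hs; rewrite s1 (lt_trans s2).
have chip t : tf <= t -> 0 < chi t.
  move=> ht; rewrite ltNge; apply/negP => hc.
  have [z /andP[z0 _] [cz hz]] := first_zero ht (fun r _ => isD_cont (chiD r)) chi0 hc.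
  by have := chige z (ltW z0) hz; rewrite cz; slra.
have Vl t : tf <= t -> chi tf <= - Y b t.
  move=> ht; have h1 := chige t ht (fun s hs => chip s (andP hs).1).
  have h2 := wle t ht (fun s hs => chip s (andP hs).1).
  have h3 : 0 <= b / 4 * (wd - w b t) by rewrite mulr_ge0 ?subr_ge0 // divr_ge0 // ltW.
  by apply: (le_trans h1); rewrite /chi; slra.
pose t := tf + wd / chi tf.
have ht : tf <= t by rewrite lerDl divr_ge0 ?ltW.
have : w b t + chi tf * t <= w b tf + chi tf * tf.
  apply: (@nincr _ (fun r => w b r + chi tf * r) _ tf t ht (fun r _ => isD_add (sh_wD b hb r) (isD_mul (isD_cst r (chi tf)) (isD_id r)))).
  by move=> r /andP[r1 _]; rewrite mul0r add0r mulr1 -/(Y b); have := Vl r (ltW r1); slra.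
have -> : chi tf * t = chi tf * tf + wd by rewrite /t; field; rewrite gt_eqF.
by have /andP[wr _] := hpos t; slra.
Qed.

End Shooting.

(** * The homoclinic connection *)

(** The choices in their order: [w3] and then [blo] so small that [sh_low] applies,
    [w2] below [w3] so small that the start branch exists for all exponents from
    [blo] on, [bhi] for [sh_high], and last the clamp [K], which by [below_clamp] is
    out of reach for all exponents in between. *)
Lemma shooting_exists : exists (blo bhi w2 K : R) (h w Z : R -> R -> R), [/\ shooting blo bhi w2 K h w Z, blo <= bhi,
   (forall t, 0 <= t -> 0 <= w blo t) & exists2 t, 0 <= t & w bhi t < 0].
Proof.
params; have weq0 := weq_gt0; have B0 := B_gt0; have A0 := A_gt0.
have m0 : 0 < m by mlra.
have dl0 : 0 < m + q - 2 by mlra.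
have m1 : 0 < m - 1 by mlra.
have wm0 : 0 < weq `^ m by exact: powR_gt0.
have [d1 d10 hd1] := @pw_small _ (m + q - 2) (1 / 2 / m) dl0 ltac:(by rewrite !divr_gt0).
have [d2 d20 hd2] := @pw_small _ m (weq `^ m / 2) m0 ltac:(by rewrite divr_gt0).
pose w3 := Num.min (Num.min d1 d2) (k * weq `^ m / 4).
have w30 : 0 < w3 by rewrite !lt_min d10 d20 !mulr_gt0.
have w31 : w3 <= d1 by rewrite !ge_min lexx.
have w32 : w3 <= d2 by rewrite !ge_min lexx orbT.
have w33 : w3 <= k * weq `^ m / 4 by rewrite !ge_min lexx !orbT.
have w3a : m * w3 `^ (m + q - 2) <= 1 / 2.
  by rewrite mulrC -ler_pdivlMr //; apply: hd1; rewrite ?(ltW w30).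
have w3b : w3 + k * w3 `^ m < k * weq `^ m.
  have h1 : k * w3 `^ m <= k * (weq `^ m / 2) by rewrite ler_pM2l // hd2 // ltW.
  have h2 : 0 < k * weq `^ m by rewrite mulr_gt0.
  by rewrite mulrA in h1; mlra.
have w3p : 0 < q * Bre * w3 `^ (m - 1) by rewrite !mulr_gt0 // powR_gt0.
pose blo := Num.min (1 / 2) (q * Bre * w3 `^ (m - 1) / k / 2).
have bl0 : 0 < blo by rewrite lt_min !divr_gt0.
have bl1 : blo <= 1 / 2 by rewrite ge_min lexx.
have bl2 : blo * k < q * Bre * w3 `^ (m - 1).
  rewrite -ltr_pdivlMr //; apply: (@le_lt_trans _ _ (q * Bre * w3 `^ (m - 1) / k / 2)).
    by rewrite ge_min lexx orbT.
  have : 0 < q * Bre * w3 `^ (m - 1) / k by rewrite divr_gt0.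
  by mlra.
have Am : 0 < Afr * m by rewrite mulr_gt0.
have [d3 d30 hd3] := @pw_small _ (m - 1) (blo / 2 / (Afr * m)) m1 ltac:(by rewrite !divr_gt0).
pose w2 := Num.min (Num.min w3 weq) d3.
have w20 : 0 < w2 by rewrite /w2 lt_min d30 andbT lt_min w30 weq0.
have w21 : w2 <= w3 by rewrite /w2 ge_min ge_min lexx.
have w22 : w2 <= weq by rewrite /w2 ge_min ge_min lexx orbT.
have w23 : w2 <= d3 by rewrite /w2 ge_min lexx orbT.
have w2d : drag w2 <= blo / 2.
  by rewrite dragE mulrC -ler_pdivlMr // hd3 // ltW.
pose wd := weq *+ 2; have wd0 : 0 < wd by rewrite pmulrn_lgt0.
have LW : 0 < Lreact wd * wd by rewrite mulr_gt0 // Lreact_gt0.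
pose bhi := Num.max (Num.max 1 blo) (Num.max (4 * drag wd) (8 * (Lreact wd * wd) / weq)).
have bh1 : 1 <= bhi by rewrite !le_max lexx.
have bh2 : blo <= bhi by rewrite !le_max lexx orbT.
have bh3 : drag wd <= bhi / 4.
  by rewrite ler_pdivlMr // mulrC !le_max lexx !orbT.
have bh4 : 8 * (Lreact wd * wd) <= bhi * weq by rewrite -ler_pdivrMr // !le_max lexx !orbT.
pose lam := bhi + 1 + m * w2 `^ (m + q - 2).
have mw2 : 0 <= m * w2 `^ (m + q - 2) by rewrite mulr_ge0 ?powR_ge0 // ltW.
have lam1 : 1 <= lam by rewrite /lam; mlra.
pose C0 := 1 + lam * w2.
have C01 : 1 <= C0 by rewrite lerDl mulr_ge0 ?(ltW w20) //; mlra.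
pose G0 := m * weq `^ (m + q - 1).
have G00 : 0 <= G0 by rewrite mulr_ge0 ?powR_ge0 // ltW.
have Gmax x : 0 < x -> react x <= G0.
  move=> x0; case: (lerP x weq) => xw.
    apply: (le_trans (react_le (ltW x0))); rewrite ler_pM2l //; apply: pw_le; rewrite ?(ltW x0) //; mlra.
  exact: le_trans (ltW (react_lt0 xw)) G00.
pose C1 := C0 + (bhi + G0) * weq + Afr * weq `^ m + bhi + 1.
have [K1 K11 hK1] := @pw_large _ (m - 1) (C1 / Afr) m1.
pose K := Num.max K1 (weq + 1).
have K1K : K1 <= K by rewrite le_max lexx.
have weqK : weq < K by rewrite lt_max ltrDl ltr01 orbT.
have K01 : 1 <= K by mlra.
have K00 : 0 < K by mlra.
have hK b : blo <= b <= bhi -> C0 + (b + G0) * weq + Afr * weq `^ m + b * K < Afr * K `^ m.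
  move=> /andP[b1 b2].
  have -> : Afr * K `^ m = (Afr * K `^ (m - 1)) * K.
    by rewrite -mulrA -{3}(powRr1 (ltW K00)) -pwD // subrK.
  have h1 : C1 <= Afr * K `^ (m - 1).
    rewrite mulrC -ler_pdivrMr //; apply: (le_trans hK1); apply: pw_le => //; mlra.
  have h2 : C1 * K <= Afr * K `^ (m - 1) * K by rewrite ler_pM2r.
  apply: lt_le_trans h2.
  have h3 : (b + G0) * weq <= (bhi + G0) * weq by rewrite ler_pM2r // lerD2r.
  have h4 : b * K <= bhi * K by rewrite ler_pM2r.
  pose D := C0 + (bhi + G0) * weq + Afr * weq `^ m.
  have D0 : 0 <= D.
    have C00 : 0 <= C0 by move: C01; mlra.
    have bG : 0 <= bhi + G0 by move: bh1 G00; mlra.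
    have e1 := mulr_ge0 bG (ltW weq0); have e2 := mulr_ge0 (ltW A0) (ltW wm0).
    exact: addr_ge0 (addr_ge0 C00 e1) e2.
  have h5 : D <= D * K by rewrite ler_peMr.
  have -> : C1 * K = D * K + bhi * K + K by rewrite /C1 -/D; ring.
  rewrite /D in h5 *; mlra.
have hstart b : exists p : (R -> R) * (R -> R) * (R -> R), blo <= b <= bhi ->
    [/\ is_start b w2 p.1.1, traj b K p.1.2 p.2, p.1.2 0 = w2 / 2 & speed b K p.1.2 p.2 0 = p.1.1 (w2 / 2)].
  case: (boolP (blo <= b <= bhi)) => hb; last by exists (id, id, id).
  have /andP[b1 b2] := hb; have b0 : 0 < b by exact: lt_le_trans b1.
  have [|h hh] := start_branch b0 w20 w22; first by apply: (le_trans w2d); mlra.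
  have [w [Z [h1 h2 h3]]] := traj_exists (w2 / 2) (h (w2 / 2) - b * (w2 / 2) + Afr * clamp K (w2 / 2) `^ m) b0 K00.
  by exists (h, w, Z) => _ /=; split => //; rewrite /speed h2 h3; ring.
have [p hp] := choice hstart.
have w2i : 0 < w2 / 2 < w2 by apply/andP; split; move: w20; mlra.
have HS : shooting blo bhi w2 K (fun b => (p b).1.1) (fun b => (p b).1.2) (fun b => (p b).2).
  have bp b : blo <= b <= bhi -> 0 < b by move=> /andP[b1 _]; exact: lt_le_trans b1.
  split => //; try by move=> b /hp[].
  move=> b hb; have [h1 h2 h3 h4] := hp b hb.
  apply: (below_clamp (bp b hb) K00 h2 C01 G00 Gmax weqK (hK b hb)).
  - by rewrite h3; case/andP: w2i.
  - by rewrite h3; apply: lt_le_trans w22; case/andP: w2i.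
  rewrite h4; apply: (@le_trans _ _ (lam * (w2 / 2))).
    apply: (start_upper (bp b hb) w22 h1 _ _ w2i); first mlra.
    have : m * w2 `^ (m + q - 2) / lam <= m * w2 `^ (m + q - 2).
      by rewrite ler_pdivrMr ?ler_peMr //; mlra.
    by case/andP: hb => b1 b2; rewrite /lam; mlra.
  have : 0 <= lam * w2 by rewrite mulr_ge0 ?(ltW w20) //; mlra.
  by rewrite /C0 mulrA; mlra.
exists blo, bhi, w2, K, (fun b => (p b).1.1), (fun b => (p b).1.2), (fun b => (p b).2).
have hlo : blo <= blo <= bhi by rewrite lexx.
have hhi : blo <= bhi <= bhi by rewrite lexx bh2.
split => //; first exact: (sh_low HS hlo w30 w3a w3b bl1 bl2 w21).
exact: (sh_high HS hhi erefl bh3 bh1 bh4).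
Qed.

(** The trajectory of the critical exponent. The rates at its two ends are what
    bounds the logarithm of [xi] along it. *)
Theorem homoclinic : exists (b : R) (w Y : R -> R), [/\ 0 < b,
  (forall t : R, [/\ 0 < w t, isD w t (Y t) & isD Y t ((b - drag (w t)) * Y t + react (w t))]),
  (exists w0 : R, forall t : R, t <= 0 -> w t <= w0 * expR (b / 2 * t) /\ `|Y t| <= w0 * expR (b / 2 * t)),
  (forall e : R, 0 < e -> exists T : R, forall t : R, T <= t -> w t < e /\ `|Y t| < e) &
  exists2 c : R, 0 < c & exists T : R, forall t : R, T <= t -> c * w t `^ (m + q - 1) <= - Y t].
Proof.
have [blo [bhi [w2 [K [h [w [Z [HS bb lo hi]]]]]]]] := shooting_exists.
have hlo : blo <= blo <= bhi by rewrite lexx.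
have hhi : blo <= bhi <= bhi by rewrite lexx bb.
have [b hc] := critical_exponent HS hlo hhi lo hi.
have [hb _ _] := hc.
have b0 : 0 < b by case/andP: hb => h1 _; exact: lt_le_trans (sh_lo HS) h1.
have K0 : 0 < K := lt_trans weq_gt0 (sh_K HS).
have hpos := crit_pos HS hc.
have w20 := sh_w2 HS; have w2B := sh_w2B HS.
have w2i : 0 < w b 0 < w2 by rewrite (sh_w0 HS hb); apply/andP; split; mlra.
have w2K : w2 < K := le_lt_trans w2B (sh_K HS).
have Y0E : speed b K (w b) (Z b) 0 = h b (w b 0) by rewrite (sh_Y0 HS hb) (sh_w0 HS hb).
exists b, (w b), (speed b K (w b) (Z b)); split => //.
- move=> t; have ht := hpos t; split; first by case/andP: ht.
    exact: (sh_traj HS hb).1.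
  exact: (speedD b0 K0 (sh_traj HS hb) ht).
- params; pose lam := b + 1 + m * w2 `^ (m + q - 2).
  have mw2 : 0 <= m * w2 `^ (m + q - 2) by rewrite mulr_ge0 ?powR_ge0 //; mlra.
  have lam1 : 1 <= lam by rewrite /lam; mlra.
  have lam0 : 0 < lam by mlra.
  exists (lam * w b 0) => t t0.
  have [h1 h2 h3 h4] := sh_past HS hb t0.
  have /andP[p1 p2] := w2i.
  have h5 := tends0_at_minus_infty b0 K0 (sh_traj HS hb) w2B w2K (sh_h HS hb) p1 p2 Y0E t0.
  have wl : w b t < w2.
    have := (follows_start b0 K0 (sh_traj HS hb) w2B w2K (sh_h HS hb) p1 p2 Y0E t0).
    by case=> _ h6 _; exact: le_lt_trans p2.
  have h7 : h b (w b t) <= lam * w b t.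
    apply: (start_upper b0 w2B (sh_h HS hb) lam0); last by rewrite h1.
    have : m * w2 `^ (m + q - 2) / lam <= m * w2 `^ (m + q - 2).
      by rewrite ler_pdivrMr ?ler_peMr //; mlra.
    by rewrite /lam; mlra.
  have h8 : lam * w b t <= lam * w b 0 * expR (b / 2 * t) by rewrite -mulrA ler_pM2l.
  split.
    by apply: (le_trans _ h8); rewrite ler_peMl // ltW.
  rewrite ger0_norm; first by rewrite h3; exact: le_trans h7 h8.
  by apply: le_trans h4; rewrite mulr_ge0 ?divr_ge0 ?ltW.
- move=> e e0; have [T1 hT1] := crit_speed0 HS hc e0; have [T2 hT2] := crit_limit HS hc e0.
  exists (Num.max T1 T2) => t; rewrite ge_max => /andP[t1 t2]; split; last exact: hT1.
  have /andP[p1 _] := hpos t; by have := hT2 t t2; rewrite subr0 gtr0_norm.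
have [c c0 [T hT]] := crit_lower HS hc.
by exists c => //; exists T => t /hT.
Qed.

End Model.
Unset Default Proof Using.

(** * From the connection to the profile *)

Section Profile.
Context {R : realType}.
Variables (N : nat) (m q sigma : R).
Hypotheses (hN : (1 <= N)%N) (hm : 1 < m) (hq0 : 0 < q) (hq1 : q < 1)
  (hsigma : sigma = 2 * (1 - q) / (m - 1)) (hmq : 2 < m + q).
Implicit Types (x y z t e b r : R).

Let p : R := 2 / (m - 1).
Let k : R := p + 2.
Let k' : R := k + N%:R - 2.
Let m1 : 0 < m - 1. Proof. by rewrite subr_gt0. Qed.
Let m0 : 0 < m. Proof. by move: (hm) => ?; lra. Qed.
Let p0 : 0 < p. Proof. by rewrite divr_gt0. Qed.
Let hk : 0 < k. Proof. by move: (p0) => ?; rewrite /k; lra. Qed.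
Let N1 : 1 <= N%:R :> R. Proof. by rewrite ler1n. Qed.
Let hk' : 0 < k'. Proof. by move: (p0) (N1) => ? ?; rewrite /k' /k; lra. Qed.
Let pm : p * (m - 1) = 2. Proof. by rewrite /p divfK // gt_eqF. Qed.
Let mp : m * p = k. Proof. by rewrite /k -pm; ring. Qed.

Let drg := drag m k k'.
Let rct := react m q k k'.
Let drgE w : drg w = (k + k') * m * w `^ (m - 1).
Proof. by rewrite /drg (dragE hm hq0 hq1 hmq hk hk') (AfrE hm hq0 hq1 hmq hk hk'). Qed.
Let rctE w : 0 < w -> rct w = m * w `^ (m - 1) * (w `^ q - k * k' * w `^ m).
Proof.
move=> w0; rewrite /rct (react_def hm hq0 hq1 hmq hk hk') (BreE hm hq0 hq1 hmq hk hk').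
have -> : w `^ (m + q - 1) = w `^ (m - 1) * w `^ q by rewrite -pwD //; congr (_ `^ _); ring.
have -> : w `^ (2 * m - 1) = w `^ (m - 1) * w `^ m by rewrite -pwD //; congr (_ `^ _); ring.
by ring.
Qed.

(** [S] is [ln xi]. In the past its derivative decays exponentially. In the future
    it is at most a multiple of the derivative of [- w ^ (1 - q)], because the
    return is along [- Y >= c w ^ (m + q - 1)]. *)
Lemma clock_bounded b (w Y S : R -> R) w0 c T : 0 < b -> (forall t, 0 < w t) -> (forall t, isD w t (Y t)) ->
  (forall t, isD S t (m * w t `^ (m - 1))) ->
  (forall t, t <= 0 -> w t <= w0 * expR (b / 2 * t)) ->
  0 < c -> (forall t, T <= t -> c * w t `^ (m + q - 1) <= - Y t) ->
  exists lo hi : R, [/\ (forall t, lo < S t < hi),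
    (forall e, 0 < e -> exists t, S t < lo + e) & (forall e, 0 < e -> exists t, hi - e < S t)].
Proof.
move=> b0 wp wD SD wlo c0 whi.
have dS0 t : 0 < m * w t `^ (m - 1) by rewrite mulr_gt0 // powR_gt0.
have Sinc s t : s < t -> S s < S t.
  by move=> st; apply: (incr st (fun r _ => SD r)) => r _.
have Smon s t : s <= t -> S s <= S t.
  by rewrite le_eqVlt => /orP[/eqP ->//|/Sinc/ltW].
have w00 : 0 < w0.
  by have := lt_le_trans (wp 0) (wlo 0 (lexx _)); rewrite mulr0 expR0 mulr1.
pose c1 := m * w0 `^ (m - 1); pose l := b / 2 * (m - 1).
have l0 : 0 < l by rewrite mulr_gt0 // divr_gt0.
have c10 : 0 < c1 by rewrite mulr_gt0 // powR_gt0.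
have Slow t : S 0 - c1 / l <= S t.
  case: (lerP 0 t) => t0.
    apply: le_trans (Smon _ _ t0); rewrite gerBl divr_ge0 ?ltW //.
  have : S 0 - c1 / l * expR (l * 0) <= S t - c1 / l * expR (l * t).
    apply: (@nincr _ (fun r => S r - c1 / l * expR (l * r)) (fun r => m * w r `^ (m - 1) - c1 * expR (l * r)) t 0 (ltW t0)).
      move=> r _; apply: isD_eq.
        exact: isD_sub (SD r) (isD_mul (isD_cst r (c1 / l)) (isD_expR (isD_mul (isD_cst r l) (isD_id r)))).
      by rewrite /=; field; rewrite gt_eqF.
    move=> r /andP[_ r0]; rewrite subr_le0 /c1 -mulrA ler_pM2l //.
    have -> : expR (l * r) = expR (b / 2 * r) `^ (m - 1).
      by rewrite -expRM /l; congr expR; ring.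
    rewrite -powRM ?expR_ge0 ?(ltW w00) //.
    by apply: pw_le; [exact: ltW|exact: ltW|exact/wlo/ltW].
  rewrite mulr0 expR0 mulr1; have : 0 < c1 / l * expR (l * t) by rewrite mulr_gt0 ?expR_gt0 // divr_gt0.
  lra.
pose C := m / ((1 - q) * c).
have C0 : 0 < C by rewrite divr_gt0 // mulr_gt0 // subr_gt0.
have Shi t : T <= t -> S t <= S T + C * w T `^ (1 - q).
  move=> Tt; have : S t + C * w t `^ (1 - q) <= S T + C * w T `^ (1 - q).
    apply: (@nincr _ (fun r => S r + C * w r `^ (1 - q))
      (fun r => m * w r `^ (m - 1) + C * ((1 - q) * w r `^ (1 - q - 1) * Y r)) T t Tt).
      move=> r _; apply: isD_eq.
        exact: isD_add (SD r) (isD_mul (isD_cst r C) (isD_powR (1 - q) (wp r) (wD r))).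
      by rewrite mul0r add0r.
    move=> r /andP[r1 _]; have := whi r (ltW r1).
    have -> : w r `^ (m + q - 1) = w r `^ (m - 1) * w r `^ q by rewrite -pwD //; congr (_ `^ _); ring.
    have e1 : w r `^ (1 - q - 1) * w r `^ q = 1 by rewrite -pwD // (_ : 1 - q - 1 + q = 0) ?powRr0 //; ring.
    have u0 : 0 < w r `^ (1 - q - 1) by rewrite powR_gt0.
    move: (w r `^ (m - 1)) (w r `^ q) (w r `^ (1 - q - 1)) e1 u0 => u v s sv s0 h.
    have -> : C * ((1 - q) * s * Y r) = - (m / c * (s * - Y r)).
      by rewrite /C; field; rewrite !gt_eqF // subr_gt0.
    rewrite subr_le0; have -> : m * u = m / c * (s * (c * (u * v))).
      have -> : s * (c * (u * v)) = c * u * (s * v) by ring.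
      by rewrite sv; field; rewrite gt_eqF.
    by rewrite !ler_pM2l // divr_gt0.
  have : 0 <= C * w t `^ (1 - q) by rewrite mulr_ge0 ?powR_ge0 ?ltW.
  lra.
have [hi [_ hi1 hi2]] := @mono_lim _ S T _ (fun s t _ st => Smon s t st) Shi.
have [lo [_ lo1 lo2]] := @mono_lim _ (fun t => - S (- t)) 0 (- (S 0 - c1 / l))
   (fun s t _ st => ltac:(by rewrite lerN2; apply: Smon; rewrite lerN2)) (fun t _ => ltac:(by rewrite lerN2; exact: Slow)).
have hi3 t : S t <= hi.
  apply: (@le_trans _ _ (S (Num.max t T))); first by apply: Smon; rewrite le_max lexx.
  by apply: hi1; rewrite le_max lexx orbT.
have lo3 t : - lo <= S t.
  apply: (@le_trans _ _ (S (Num.min t 0))); last by apply: Smon; rewrite ge_min lexx.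
  rewrite lerNl; have := lo1 (- Num.min t 0); rewrite opprK; apply.
  by rewrite oppr_ge0 ge_min lexx orbT.
exists (- lo), hi; split.
- move=> t; have tt : t < t + 1 by rewrite ltrDl.
  have tt' : t - 1 < t by rewrite gtrBl.
  by rewrite (le_lt_trans (lo3 _) (Sinc _ _ tt')) (lt_le_trans (Sinc _ _ tt) (hi3 _)).
- by move=> e e0; have [s _ hs] := lo2 e e0; exists (- s); have := hs s (lexx _); lra.
by move=> e e0; have [s _ hs] := hi2 e e0; exists s; exact: hs.
Qed.

(** [f xi = xi ^ p w], where the constant of integration in [ln xi] puts the dead
    core at [1]. *)
Theorem profile_exists : exists (b xi0 : R) (f : R -> R), [/\ 0 < b, 1 < xi0 &
  profile_with_support N m q sigma (alpha_of m b) b 1 xi0 f].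
Proof.
have [b [w [Y [b0 HwY [w0 hlo] hhi [c c0 [T hT]]]]]] := homoclinic hm hq0 hq1 hmq hk hk'.
have wp t : 0 < w t by case: (HwY t).
have wD t : isD w t (Y t) by case: (HwY t).
have YD t : isD Y t ((b - drg (w t)) * Y t + rct (w t)) by case: (HwY t).
have w1D t : isD (fun t => m * w t `^ (m - 1)) t (m * ((m - 1) * w t `^ (m - 1 - 1) * Y t)).
  by apply: isD_eq; [exact: isD_mul (isD_cst t m) (isD_powR (m - 1) (wp t) (wD t))|rewrite mul0r add0r].
have [|S [_ SD]] := @antiderivative _ (fun t => m * w t `^ (m - 1)).
  by move=> t; exact: isD_cont (w1D t).
have [lo [hi [Sb Slo Shi]]] := @clock_bounded b w Y S w0 c T b0 wp wD SD (fun t (ht : t <= 0) => (hlo t ht).1) c0 hT.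
pose X t := expR (S t - lo); pose xi0 := expR (hi - lo).
pose dX t := X t * (m * w t `^ (m - 1)).
have XD t : isD X t (dX t).
  by apply: isD_eq; [exact: isD_expR (isD_sub (SD t) (isD_cst t lo))|rewrite subr0].
have dX0 t : 0 < dX t by rewrite !mulr_gt0 ?expR_gt0 // powR_gt0.
have Xb t : 1 < X t < xi0.
  have /andP[s1 s2] := Sb t.
  by rewrite -expR0 !ltr_expR subr_gt0 s1 ltrD2r.
have Xlo e : 0 < e -> exists t, X t < 1 + e.
  move=> e0; have [d d0 hd] := (cont_epsP expR 0).1 (@continuous_expR R 0) e e0.
  have [t ht] := Slo d d0; exists t; have /andP[s1 s2] := Sb t.
  have := hd (S t - lo); rewrite subr0 gtr0_norm ?subr_gt0 // ltrBlDl => /(_ ht).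
  by rewrite expR0 ltr_norml => /andP[_]; rewrite /X; lra.
have Xhi e : 0 < e -> exists t, xi0 - e < X t.
  move=> e0; have [d d0 hd] := (cont_epsP expR (hi - lo)).1 (@continuous_expR R (hi - lo)) e e0.
  have [t ht] := Shi d d0; exists t; have /andP[s1 s2] := Sb t.
  have := hd (S t - lo); have -> : S t - lo - (hi - lo) = - (hi - S t) by ring.
  rewrite normrN gtr0_norm ?subr_gt0 //; have -> : hi - S t < d by lra.
  by move=> /(_ isT); rewrite ltr_norml => /andP[]; rewrite -/(X t) -/xi0; lra.
have [Tm hTm] := clock_inverse XD dX0 Xb Xlo Xhi.
have xi1 : 1 < xi0 by have /andP[h1 h2] := Xb 0; exact: lt_trans h2.
have ends e : 0 < e -> exists2 d, 0 < d & forall x, 1 < x < xi0 -> x < 1 + d \/ xi0 - d < x ->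
    w (Tm x) < e /\ `|Y (Tm x)| < e.
  move=> e0; have [T2 hT2] := hhi e e0.
  have w00 : 0 < w0.
    by have := lt_le_trans (wp 0) (hlo 0 (lexx _)).1; rewrite mulr0 expR0 mulr1.
  pose T1 := - (2 / b * (w0 / e)).
  have T10 : T1 <= 0 by rewrite oppr_le0 mulr_ge0 // divr_ge0 // ltW.
  have hT1 t : t <= T1 -> w0 * expR (b / 2 * t) < e.
    move=> tT; apply: (@le_lt_trans _ _ (w0 * expR (b / 2 * T1))).
      by rewrite ler_pM2l // ler_expR ler_pM2l // divr_gt0.
    have -> : b / 2 * T1 = - (w0 / e) by rewrite /T1; field; rewrite !gt_eqF.
    rewrite expRN ltr_pdivrMr ?expR_gt0 // -ltr_pdivrMl //.
    have := @expR_ge1Dx R (w0 / e); rewrite mulrC; lra.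
  have /andP[x1 x2] := Xb T1; have /andP[x3 x4] := Xb T2.
  exists (Num.min (X T1 - 1) (xi0 - X T2)); first by rewrite lt_min !subr_gt0 x1.
  move=> x hx [xd|xd]; have [_ _ h3 h4] := hTm x hx.
    have xT : x < X T1 by apply: (lt_le_trans xd); rewrite addrC -lerBrDr ge_min lexx.
    have tT := ltW (h3 _ xT); have [h5 h6] := hlo _ (le_trans tT T10).
    by split; [exact: le_lt_trans h5 (hT1 _ tT)|exact: le_lt_trans h6 (hT1 _ tT)].
  apply: hT2; apply/ltW/h4; apply: le_lt_trans xd.
  by rewrite lerBrDr addrC -lerBrDr ge_min lexx orbT.
pose fs x := if 1 < x < xi0 then x `^ p * w (Tm x) else 0.
pose dg x := if 1 < x < xi0 then x `^ (k - 1) * (k * w (Tm x) `^ m + Y (Tm x)) else 0.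
have ins x : 1 < x < xi0 -> [/\ 0 < x, X (Tm x) = x &
   isD (fun y => w (Tm y)) x (Y (Tm x) / (x * (m * w (Tm x) `^ (m - 1)))) /\
   isD (fun y => Y (Tm y)) x (((b - drg (w (Tm x))) * Y (Tm x) + rct (w (Tm x))) / (x * (m * w (Tm x) `^ (m - 1))))].
  move=> hx; have [h1 h2 _ _] := hTm x hx; rewrite /dX h1 in h2; split => //.
    by case/andP: hx => h3 _; exact: lt_trans h3.
  by split; [exact: isD_comp (wD _) h2|exact: isD_comp (YD _) h2].
have fsin x : 1 < x < xi0 -> fs x = x `^ p * w (Tm x) by rewrite /fs => ->.
have fs0 x : 1 < x < xi0 -> 0 < fs x.
  by move=> hx; have [x0 _ _] := ins x hx; rewrite fsin // mulr_gt0 // powR_gt0.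
have fsout x : ~~ (1 < x < xi0) -> fs x = 0 by rewrite /fs => /negbTE ->.
have dgout x : ~~ (1 < x < xi0) -> dg x = 0 by rewrite /dg => /negbTE ->.
have end1 : ~~ (1 < (1 : R) < xi0) by rewrite ltxx.
have end2 : ~~ (1 < xi0 < xi0) by rewrite ltxx andbF.
have fsD x : 1 < x < xi0 ->
    isD fs x (x `^ (p - 1) * (p * w (Tm x) + Y (Tm x) / (m * w (Tm x) `^ (m - 1)))).
  move=> hx; have [x0 _ [h1 _]] := ins x hx; have [e e0 he] := near_itv hx.
  have u0 : 0 < w (Tm x) `^ (m - 1) by exact: powR_gt0.
  apply: isD_near (_ : isD (fun y => y `^ p * w (Tm y)) x _) _; last first.
    by exists e => // y /he hy; rewrite fsin.
  apply: isD_eq; first exact: isD_mul (isD_powR p x0 (isD_id x)) h1.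
  have -> : x `^ p = x `^ (p - 1) * x by rewrite -{3}(powRr1 (ltW x0)) -pwD // subrK.
  by field; rewrite !gt_eqF.
have fm1 x : 1 < x < xi0 -> fs x `^ (m - 1) = x ^+ 2 * w (Tm x) `^ (m - 1).
  move=> hx; have [x0 _ _] := ins x hx.
  by rewrite fsin // powRM ?powR_ge0 ?(ltW (wp _)) // -powRrM pm -powR_mulrn ?ltW.
have fmD x : 1 < x < xi0 -> isD (fun y => fs y `^ m) x (dg x).
  move=> hx; have [x0 _ _] := ins x hx.
  have u0 : 0 < w (Tm x) `^ (m - 1) by exact: powR_gt0.
  apply: isD_eq; first exact: isD_powR m (fs0 x hx) (fsD x hx).
  rewrite fm1 // /dg hx.
  have -> : w (Tm x) `^ m = w (Tm x) `^ (m - 1) * w (Tm x).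
    by rewrite -{3}(powRr1 (ltW (wp (Tm x)))) -pwD // subrK.
  have -> : x `^ (k - 1) = x `^ (p - 1) * x ^+ 2.
    by rewrite -powR_mulrn ?ltW // -pwD //; congr (_ `^ _); rewrite /k; ring.
  by rewrite -mp; field; rewrite !gt_eqF.
have dgD x : 1 < x < xi0 -> isD dg x (x `^ p * ((k - 1) * (k * w (Tm x) `^ m + Y (Tm x)) +
    (k * (m * w (Tm x) `^ (m - 1) * Y (Tm x)) + ((b - drg (w (Tm x))) * Y (Tm x) + rct (w (Tm x)))) / (m * w (Tm x) `^ (m - 1)))).
  move=> hx; have [x0 _ [h1 h2]] := ins x hx; have [e e0 he] := near_itv hx.
  have u0 : 0 < w (Tm x) `^ (m - 1) by exact: powR_gt0.
  apply: isD_near (_ : isD (fun y => y `^ (k - 1) * (k * w (Tm y) `^ m + Y (Tm y))) x _) _; last first.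
    by exists e => // y /he hy; rewrite /dg hy.
  apply: isD_eq.
    exact: isD_mul (isD_powR (k - 1) x0 (isD_id x)) (isD_add (isD_mul (isD_cst x k) (isD_powR m (wp _) h1)) h2).
  have -> : x `^ (k - 1) = x `^ p * x.
    by rewrite -{3}(powRr1 (ltW x0)) -pwD //; congr (_ `^ _); rewrite /k; ring.
  have -> : x `^ (k - 1 - 1) = x `^ p by congr (_ `^ _); rewrite /k; ring.
  by field; rewrite !gt_eqF.
have outD (g : R -> R) x : (forall y, ~~ (1 < y < xi0) -> g y = g 1) -> x < 1 \/ xi0 < x -> isD g x 0.
  move=> hg hx; apply: isD_near (isD_cst x (g 1)) _; case: hx => hx.
    exists (1 - x); first by rewrite subr_gt0.
    move=> y hy; rewrite hg //; apply/nandP; left; rewrite -leNgt.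
    by move: hy; rewrite ltr_norml => /andP[_]; lra.
  exists (x - xi0); first by rewrite subr_gt0.
  move=> y hy; rewrite hg //; apply/nandP; right; rewrite -leNgt.
  by move: hy; rewrite ltr_norml => /andP[]; lra.
have trich x : x != 1 -> x != xi0 -> 1 < x < xi0 \/ (x < 1 \/ xi0 < x).
  move=> h1 h2; case: (ltgtP x 1) h1 => // h3 _; first by right; left.
  by case: (ltgtP x xi0) h2 => // h4 _; [left|right; right].
(* at the edges both [w] and [Y] tend to [0], and [w ^ m <= w] for small [w] *)
have edge (g : R -> R) (C : R) z : 0 < C -> (forall y, ~~ (1 < y < xi0) -> g y = 0) ->
    (forall y, 1 < y < xi0 -> w (Tm y) <= 1 -> `|g y| <= C * (w (Tm y) + `|Y (Tm y)|)) ->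
    z = 1 \/ z = xi0 -> {for z, continuous g}.
  move=> C0 gout gin hz; apply/cont_epsP => e e0.
  have gz : g z = 0 by apply: gout; case: hz => ->.
  pose e1 := Num.min 1 (e / (2 * C)).
  have e10 : 0 < e1 by rewrite lt_min ltr01 divr_gt0 // mulr_gt0.
  have e11 : e1 <= 1 by rewrite ge_min lexx.
  have e12 : e1 * (2 * C) <= e by rewrite -ler_pdivlMr ?mulr_gt0 // ge_min lexx orbT.
  have [d d0 hd] := ends e1 e10; exists d => // y yz; rewrite gz subr0.
  case: (boolP (1 < y < xi0)) => hy; last by rewrite gout // normr0.
  have [|h1 h2] := hd y hy.
    by move: yz; rewrite ltr_norml => /andP[h1 h2]; case: hz => ez; rewrite ez in h1 h2; [left|right]; lra.
  apply: (le_lt_trans (gin y hy _)); first exact: ltW (lt_le_trans h1 e11).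
  have : C * (w (Tm y) + `|Y (Tm y)|) < C * (e1 + e1) by rewrite ltr_pM2l // ltrD.
  lra.
have wm_le y : w (Tm y) <= 1 -> w (Tm y) `^ m <= w (Tm y).
  by move=> h1; apply: ge1r_powR; rewrite ?wp // ltW.
have fscE z : z = 1 \/ z = xi0 -> {for z, continuous fs}.
  apply: (edge fs (xi0 `^ p)) => //; first by rewrite powR_gt0 // (lt_trans ltr01).
  move=> y hy _; have [y0 _ _] := ins y hy; rewrite fsin // gtr0_norm ?mulr_gt0 ?powR_gt0 //.
  apply: ler_pM; rewrite ?powR_ge0 ?(ltW (wp _)) ?lerDl //.
  by apply: pw_le; [exact: ltW|exact: ltW|case/andP: hy => _ /ltW].
have fmcE z : z = 1 \/ z = xi0 -> {for z, continuous (fun x => fs x `^ m)}.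
  apply: (edge (fun x => fs x `^ m) (xi0 `^ k)); first by rewrite powR_gt0 // (lt_trans ltr01).
    by move=> y hy; rewrite fsout // powR0 // gt_eqF.
  move=> y hy w1; have [y0 _ _] := ins y hy; rewrite fsin // ger0_norm ?powR_ge0 //.
  rewrite powRM ?powR_ge0 ?(ltW (wp _)) // -powRrM (mulrC p) mp.
  apply: ler_pM; rewrite ?powR_ge0 //.
    by apply: pw_le; [exact: ltW|exact: ltW|case/andP: hy => _ /ltW].
  by apply: (le_trans (wm_le y w1)); rewrite lerDl.
have dgcE z : z = 1 \/ z = xi0 -> {for z, continuous dg}.
  apply: (edge dg (xi0 `^ (k - 1) * (k + 1))) => //.
    by rewrite mulr_gt0 ?addr_gt0 // powR_gt0 // (lt_trans ltr01).
  move=> y hy w1; have [y0 _ _] := ins y hy; rewrite /dg hy normrM (ger0_norm (powR_ge0 _ _)) -mulrA.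
  have k1 : 0 <= k - 1 by have := p0; rewrite /k; lra.
  apply: ler_pM; rewrite ?powR_ge0 //.
    by apply: pw_le => //; [exact: ltW|case/andP: hy => _ /ltW].
  apply: (le_trans (ler_normD _ _)).
  rewrite normrM (gtr0_norm hk) (ger0_norm (powR_ge0 _ _)).
  have h1 : k * w (Tm y) `^ m <= k * w (Tm y) by rewrite ler_pM2l // wm_le.
  have h2 : 0 <= k * `|Y (Tm y)| by rewrite mulr_ge0 // ltW.
  by have := wp (Tm y); lra.
have gD x : isD (fun y => fs y `^ m) x (dg x).
  apply: (flat_ends xi1) => //; [|exact: dgout|exact: dgout|by apply: fmcE; left|by apply: fmcE; right|
     by apply: dgcE; left|by apply: dgcE; right].
  move=> y y1 y2; case: (trich y y1 y2) => hy; first exact: fmD.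
  have -> : dg y = 0.
    apply: dgout; apply/nandP; rewrite -!leNgt.
    by case: hy => /ltW hy; [left|right].
  by apply: outD hy => z hz; rewrite !fsout.
have fsc x : {for x, continuous fs}.
  have [->|x1] := eqVneq x 1; first by apply: fscE; left.
  have [->|x2] := eqVneq x xi0; first by apply: fscE; right.
  case: (trich x x1 x2) => hx; first exact: isD_cont (fsD x hx).
  by apply: isD_cont; apply: outD hx => y hy; rewrite !fsout.
have dgc x : {for x, continuous dg}.
  have [->|x1] := eqVneq x 1; first by apply: dgcE; left.
  have [->|x2] := eqVneq x xi0; first by apply: dgcE; right.
  case: (trich x x1 x2) => hx; first exact: isD_cont (dgD x hx).
  by apply: isD_cont; apply: outD hx => y hy; rewrite !dgout.
have dfm : derive1 (fun y => fs y `^ m) = dg by apply/funext => x; exact: isD_derive1 (gD x).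
exists b, xi0, fs; split => //; split.
- move=> x _; case: (boolP (1 < x < xi0)) => [/fs0/ltW//|hx]; by rewrite fsout.
- exact: continuous_halfline.
- split; first by apply: continuous_halfline => x; exact: isD_cont (gD x).
  by exists dg => [|x _]; [exact: continuous_halfline|exact: gD].
- by move=> x _; exact: fsout.
- exact: fs0.
- move=> x hx; have [x0 _ _] := ins x hx.
  have u0 : 0 < w (Tm x) `^ (m - 1) by exact: powR_gt0.
  split; [exact: isD_derivable (fsD x hx)|exact: isD_derivable (gD x)| |].
    by rewrite dfm; exact: isD_derivable (dgD x hx).
  rewrite dfm (isD_derive1 (dgD x hx)) (isD_derive1 (fsD x hx)) fsin // /dg hx drgE rctE //.
  have -> : x `^ sigma * (x `^ p * w (Tm x)) `^ q = x `^ p * w (Tm x) `^ q.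
    rewrite powRM ?powR_ge0 ?(ltW (wp _)) // -powRrM mulrA -pwD //; congr (_ `^ _ * _).
    by rewrite hsigma /p; field; rewrite gt_eqF.
  have -> : w (Tm x) `^ m = w (Tm x) `^ (m - 1) * w (Tm x).
    by rewrite -{3}(powRr1 (ltW (wp (Tm x)))) -pwD // subrK.
  have -> : x `^ (k - 1) = x `^ p * x.
    by rewrite -{3}(powRr1 (ltW x0)) -pwD //; congr (_ `^ _); rewrite /k; ring.
  have -> : x `^ p = x `^ (p - 1) * x by rewrite -{3}(powRr1 (ltW x0)) -pwD // subrK.
  by rewrite /alpha_of -/p /k' /k; field; rewrite !gt_eqF.
- by rewrite dfm dgout.
- by rewrite dfm dgout.
Qed.

(** * Uniqueness of the profile *)

(** The change of variables that makes the profile equation autonomous, and the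
    speed of the planar system in the clock [xi]. *)
Definition orb_x (f : R -> R) t := f t * t `^ (- p).
Definition orb_y (f : R -> R) t :=
  t `^ (1 - k) * derive1 (fun z => f z `^ m) t - k * (t `^ (- k) * f t `^ m).
Definition orb_rho (f : R -> R) t := (t * (m * orb_x f t `^ (m - 1)))^-1.

Let invVM (x y : R) : (x^-1 * y)^-1 = x / y.
Proof. by rewrite invfM invrK. Qed.

Section OneProfile.
Variables (b xi0 : R) (f : R -> R).
Hypotheses (x1 : 1 < xi0)
  (HP : profile_with_support N m q sigma (alpha_of m b) b 1 xi0 f).

Lemma profile_orbit : orbit rct (fun x => b - drg x) (orb_rho f) (orb_x f) (orb_y f) 1 xi0.
Proof.
move=> t ht; have [h1 h2 h3 ode] := profile_eq HP ht.
have t0 : 0 < t by case/andP: ht => h _; exact: lt_trans h.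
have f0 : 0 < f t := profile_gt0 HP ht.
set fm := (fun z => f z `^ m) in h2 h3 ode *.
have fD := derivable_isD h1; set F := derive1 f t in fD ode.
have fmD := derivable_isD h2; have dfmD := derivable_isD h3.
set D2 := derive1 (derive1 fm) t in dfmD ode.
have eF : derive1 fm t = m * f t `^ (m - 1) * F by exact: isD_unique fmD (isD_powR m f0 fD).
pose a := t `^ (- p); have a0 : 0 < a by rewrite powR_gt0.
pose x := orb_x f t; have xE : x = f t * a by [].
have xx0 : 0 < x by rewrite mulr_gt0.
pose u := x `^ (m - 1); have u0 : 0 < u by rewrite powR_gt0.
have e1 : t `^ (1 - k) = a / t.
  by rewrite /a -(powR_inv1 (ltW t0)) -pwD //; congr (_ `^ _); rewrite /k; ring.
have e2 : t `^ (- k) = a / t ^+ 2.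
  rewrite /a -powR_mulrn ?(ltW t0) // -powRN -pwD //; congr (_ `^ _); rewrite /k; ring.
have e3 : t `^ (- p - 1) = a / t.
  by rewrite /a -(powR_inv1 (ltW t0)) -pwD //.
have e4 : t `^ (1 - k - 1) = a / t ^+ 2 by rewrite -e2; congr (_ `^ _); ring.
have e5 : t `^ (- k - 1) = a / t ^+ 3.
  rewrite /a -powR_mulrn ?(ltW t0) // -powRN -pwD //; congr (_ `^ _); rewrite /k; ring.
have e6 : f t `^ (m - 1) = u * t ^+ 2.
  rewrite /u xE powRM ?(ltW f0) ?(ltW a0) // /a -powRrM mulNr pm -mulrA.
  by rewrite -powR_mulrn ?(ltW t0) // -pwD // addNr powRr0 mulr1.
have e7 : f t `^ m = u * t ^+ 2 * f t by rewrite -e6 -{3}(powRr1 (ltW f0)) -pwD // subrK.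
have e8 : x `^ m = u * x by rewrite /u -{3}(powRr1 (ltW xx0)) -pwD // subrK.
have e9 : t `^ sigma * f t `^ q = x `^ q / a.
  rewrite xE powRM ?(ltW f0) ?(ltW a0) // /a -powRrM mulrC -mulrA; congr (_ * _).
  rewrite -powRN opprK -pwD //; congr (_ `^ _).
  by rewrite hsigma /p; field; rewrite gt_eqF.
have xD : isD (orb_x f) t (orb_rho f t * orb_y f t).
  apply: isD_eq; first exact: isD_mul fD (isD_powR (- p) t0 (isD_id t)).
  rewrite /orb_rho /orb_y -/x -/u -/fm eF e1 e2 e3 e6 e7 -mp -/a.
  by field; rewrite !gt_eqF.
have rD : isD (fun r => r * (m * orb_x f r `^ (m - 1))) t _ :=
  isD_mul (isD_id t) (isD_mul (isD_cst t m) (isD_powR (m - 1) xx0 xD)).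
have rn : t * (m * orb_x f t `^ (m - 1)) != 0 by rewrite gt_eqF // !mulr_gt0.
have iD := @isD_inv _ (fun r => r * (m * orb_x f r `^ (m - 1))) t _ rn rD.
split; [exact: xx0|by rewrite invr_gt0 !mulr_gt0|exact: isD_cont iD|exact: xD|].
have D2E : D2 = - ((N%:R - 1) / t * derive1 fm t) - alpha_of m b * f t + b * t * F + t `^ sigma * f t `^ q.
  by move: ode; move: (_ / t * _) => v; lra.
apply: isD_eq.
  exact: isD_sub (isD_mul (isD_powR (1 - k) t0 (isD_id t)) dfmD)
     (isD_mul (isD_cst t k) (isD_mul (isD_powR (- k) t0 (isD_id t)) fmD)).
have e7' : fm t = u * t ^+ 2 * f t by [].
rewrite -/D2 D2E /orb_rho /orb_y -/x -/u -/fm drgE rctE // -/u e8 eF e1 e2 e4 e5 e6 e7' e9 e7.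
rewrite /alpha_of -/p xE /k' /k /p.
by field; rewrite !gt_eqF.
Qed.

Lemma profile_lim : [/\ lim_right (orb_x f) 1 0, lim_left (orb_x f) xi0 0,
  lim_right (orb_y f) 1 0 & lim_left (orb_y f) xi0 0].
Proof.
have x00 : 0 < xi0 by exact: lt_trans x1.
have [fmc [dg dgc dgD]] := profile_C1 HP.
have dgE t : 0 < t -> derive1 (fun z => f z `^ m) t = dg t by move=> /dgD; exact: isD_derive1.
have f1 : f 1 = 0 by apply: (profile_out HP) => //; rewrite ltxx.
have f2 : f xi0 = 0 by apply: (profile_out HP); rewrite ?ltxx ?andbF // ltW.
have d1 : dg 1 = 0 by rewrite -dgE //; exact: profile_contact_core HP.
have d2 : dg xi0 = 0 by rewrite -dgE //; exact: profile_contact_interface HP.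
have xc t : 0 < t -> {for t, continuous (orb_x f)}.
  move=> t0; apply: continuousM; last exact: pw_cont.
  exact: halfline_cont (profile_continuous HP) t0.
pose y t := t `^ (1 - k) * dg t - k * (t `^ (- k) * f t `^ m).
have yc t : 0 < t -> {for t, continuous y}.
  move=> t0; apply: continuousB.
    by apply: continuousM; [exact: pw_cont|exact: halfline_cont dgc t0].
  apply: continuousM; first exact: cvg_cst.
  by apply: continuousM; [exact: pw_cont|exact: halfline_cont fmc t0].
have yE t : 0 < t -> orb_y f t = y t by move=> t0; rewrite /orb_y dgE.
have z1 : orb_x f 1 = 0 by rewrite /orb_x f1 mul0r.
have z2 : orb_x f xi0 = 0 by rewrite /orb_x f2 mul0r.
have m0' : m != 0 by rewrite gt_eqF.
have y1 : y 1 = 0 by rewrite /y d1 f1 powR0 // !mulr0 subr0.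
have y2 : y xi0 = 0 by rewrite /y d2 f2 powR0 // !mulr0 subr0.
split.
- by rewrite -z1; apply/cont_lim_right/xc.
- by rewrite -z2; apply/cont_lim_left/xc.
- move=> e e0; have [r r0 hr] := cont_lim_right (yc 1 ltr01) e0; exists r => // t ht.
  by rewrite yE; [rewrite -y1; exact: hr|case/andP: ht => h _; exact: lt_trans h].
move=> e e0; have [r r0 hr] := cont_lim_left (yc xi0 x00) e0; exists (Num.min r xi0).
  by rewrite lt_min r0.
move=> t /andP[h1 h2]; have h3 : xi0 - r < t by apply: le_lt_trans h1; rewrite lerD2l lerN2 ge_min lexx.
have h4 : 0 < t by apply: le_lt_trans h1; rewrite subr_ge0 ge_min lexx orbT.
by rewrite yE // -y2; apply: hr; rewrite h3.
Qed.

(** [single_bump] cuts the orbit at its maximum, and the fall is run backwards. The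
    logarithmic derivative of the clock [xi] with respect to the amplitude is
    determined by the arc alone. *)
Lemma profile_arcs : exists (tM M : R) (g gr Y Yr : R -> R),
  [/\ 1 < tM < xi0, weq m q k k' < M, orb_x f tM = M,
   [/\ (forall t, 1 < t < tM -> 0 < orb_x f t < M /\ g (orb_x f t) = t),
       (forall w, 0 < w < M -> [/\ 1 < g w < tM, orb_x f (g w) = w &
                    isD g w (g w * (m * w `^ (m - 1) / Y w))]),
       phase_arc rct Y (fun x => b - drg x) 0 M, vanish_right Y 0 & vanish_left Y M] &
   [/\ (forall t, tM < t < xi0 -> 0 < orb_x f t < M /\ gr (orb_x f t) = t),
       (forall w, 0 < w < M -> [/\ tM < gr w < xi0, orb_x f (gr w) = w &
                    isD gr w (gr w * (- (m * w `^ (m - 1) / Yr w)))]),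
       phase_arc rct Yr (fun x => - (b - drg x)) 0 M, vanish_right Yr 0 & vanish_left Yr M]].
Proof.
have O := profile_orbit; have [l1 l2 l3 l4] := profile_lim.
have bc x : 0 < x -> {for x, continuous (fun x => b - drg x)}.
  by move=> x0; apply: continuousB; [exact: cvg_cst|exact: (drag_cont hm hq0 hq1 hmq hk hk')].
have [tM [/andP[t1 t2] wM yM yp yn]] := single_bump (weq_gt0 hm hq0 hq1 hmq hk hk')
  (react_gt0 hm hq0 hq1 hmq hk hk') (react_lt0 hm hq0 hq1 hmq hk hk')
  (react_cont hm hq0 hq1 hmq hk hk') (react_lip_weq hm hq0 hq1 hmq hk hk') x1 O bc l1 l2.
have tMi : 1 < tM < xi0 by rewrite t1.
have [xM0 _ _ xDM yDM] := O tM tMi.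
pose M := orb_x f tM.
have Mp : 0 < M by exact: xM0.
have O1 : orbit rct (fun x => b - drg x) (orb_rho f) (orb_x f) (orb_y f) 1 tM.
  exact: orbit_sub O (lexx _) (ltW t2).
have O2 : orbit rct (fun x => b - drg x) (orb_rho f) (orb_x f) (orb_y f) tM xi0.
  exact: orbit_sub O (ltW t1) (lexx _).
have [g [Y [g1 g2 g3 g4 g5]]] := rising_arc t1 O1 yp l1 (cont_lim_left (isD_cont xDM)).
have O3 := orbit_rev O2.
have nt2 : - xi0 < - tM by rewrite ltrN2.
have yn' t : - xi0 < t < - tM -> 0 < - orb_y f (- t).
  by move=> /andP[h1 h2]; rewrite oppr_gt0; apply: yn; rewrite ltrNr h2 ltrNl.
have [gr [Yr [r1 r2 r3 r4 r5]]] := rising_arc nt2 O3 yn' (lim_right_refl l2)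
   (lim_left_refl (cont_lim_right (isD_cont xDM))).
exists tM, M, g, (fun w => - gr w), Y, Yr; split => //; split.
- exact: g1.
- move=> w hw; have [h1 h2 h3 h4] := g2 w hw; split => //.
  have gp : 0 < g w by case/andP: h1 => h _; exact: lt_trans h.
  apply: isD_eq h4 _; rewrite /orb_rho h2 h3.
  by rewrite invVM -mulrA.
- exact: g3.
- exact: g4 l3.
- by apply: g5; rewrite -yM; exact: cont_lim_left (isD_cont yDM).
- move=> t /andP[h1 h2]; have [|h3 h4] := r1 (- t); first by rewrite !ltrN2 h2.
  by rewrite opprK in h3 h4; rewrite h4 opprK.
- move=> w hw; have [h1 h2 h3 h4] := r2 w hw; split => //.
    by case/andP: h1 => h5 h6; rewrite ltrNr h6 ltrNl.
  apply: isD_eq (isD_opp h4) _; rewrite /orb_rho h2 h3.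
  by rewrite invVM mulrN -mulrA.
- exact: r3.
- by apply: r4; rewrite -[0]oppr0; exact: lim_right_opp (lim_right_refl l4).
by apply: r5; rewrite -[0]oppr0 -yM; apply/lim_left_opp/lim_left_refl/cont_lim_right/isD_cont/yDM.
Qed.

End OneProfile.

(** On the rise a larger exponent leads to a higher maximum. The fall run backwards
    has the opposite coefficient, so that there it leads to a lower one. For equal
    exponents the arcs coincide; the clocks then agree on the rise, as they both
    start from [1], and on the fall, as they both start from the common [tM]. *)
Theorem profile_unique b1 b2 xi1 xi2 (f1 f2 : R -> R) : 1 < xi1 -> 1 < xi2 ->
  profile_with_support N m q sigma (alpha_of m b1) b1 1 xi1 f1 ->
  profile_with_support N m q sigma (alpha_of m b2) b2 1 xi2 f2 ->
  b1 = b2 /\ forall x, 0 <= x -> f1 x = f2 x.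
Proof.
have noteq c1 c2 z1 z2 (g1 g2 : R -> R) : 1 < z1 -> 1 < z2 ->
    profile_with_support N m q sigma (alpha_of m c1) c1 1 z1 g1 ->
    profile_with_support N m q sigma (alpha_of m c2) c2 1 z2 g2 -> c1 < c2 -> False.
  move=> z11 z21 P1 P2 c12.
  have [t1 [M1 [? [? [Y1 [Y1' [_ m1' _ [_ _ a1 v1 u1] [_ _ a1' v1' u1']]]]]]]] := profile_arcs z11 P1.
  have [t2 [M2 [? [? [Y2 [Y2' [_ m2' _ [_ _ a2 v2 u2] [_ _ a2' v2' u2']]]]]]]] := profile_arcs z21 P2.
  have s1 : M1 < M2.
    apply: (arc_strict (weq_gt0 hm hq0 hq1 hmq hk hk')
      (react_gt0 hm hq0 hq1 hmq hk hk') (react_lt0 hm hq0 hq1 hmq hk hk')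
      (react_cont hm hq0 hq1 hmq hk hk') m1' m2' a1 a2 _ v1 u2) => w _.
    by rewrite ltrD2r.
  have s2 : M2 < M1.
    apply: (arc_strict (weq_gt0 hm hq0 hq1 hmq hk hk')
      (react_gt0 hm hq0 hq1 hmq hk hk') (react_lt0 hm hq0 hq1 hmq hk hk')
      (react_cont hm hq0 hq1 hmq hk hk') m2' m1' a2' a1' _ v2' u1') => w _.
    by rewrite ltrN2 ltrD2r.
  by have := lt_trans s1 s2; rewrite ltxx.
move=> x11 x21 P1 P2.
have bb : b1 = b2.
  by have [h|h|//] := ltgtP b1 b2; case: (noteq _ _ _ _ _ _ x11 x21 P1 P2 h) || case: (noteq _ _ _ _ _ _ x21 x11 P2 P1 h).
split => //; rewrite -bb in P2.
have [t1 [M1 [g1 [h1 [Y1 [Z1 [T1 m1' xM1 [A1 B1 a1 v1 u1] [A1' B1' a1' v1' u1']]]]]]]] := profile_arcs x11 P1.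
have [t2 [M2 [g2 [h2 [Y2 [Z2 [T2 m2' xM2 [A2 B2 a2 v2 u2] [A2' B2' a2' v2' u2']]]]]]]] := profile_arcs x21 P2.
have w0 := weq_gt0 hm hq0 hq1 hmq hk hk'.
have gp := react_gt0 hm hq0 hq1 hmq hk hk'.
have gc := react_cont hm hq0 hq1 hmq hk hk'.
have MM : M2 = M1.
  apply/eqP; rewrite eq_le.
  by rewrite (arc_unique_M w0 gp gc m1' m2' a1 a2 v1 v2 u1) (arc_unique_M w0 gp gc m2' m1' a2 a1 v2 v1 u2).
move: m2' xM2 B2 A2 a2 u2 B2' A2' a2' u2'; rewrite MM => m2' xM2 B2 A2 a2 u2 B2' A2' a2' u2'.
pose M := M1; have M0 : 0 < M := lt_trans w0 m1'.
have YY w : 0 < w < M -> Y1 w = Y2 w.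
  move=> /andP[h3 h4]; apply/eqP; rewrite eq_le.
  by rewrite (arc_unique_le w0 gp gc m1' m2' a1 a2 v1 v2 h3 h4 h4) (arc_unique_le w0 gp gc m2' m1' a2 a1 v2 v1 h3 h4 h4).
have ZZ w : 0 < w < M -> Z1 w = Z2 w.
  move=> /andP[h3 h4]; apply/eqP; rewrite eq_le.
  by rewrite (arc_unique_le w0 gp gc m1' m2' a1' a2' v1' v2' h3 h4 h4) (arc_unique_le w0 gp gc m2' m1' a2' a1' v2' v1' h3 h4 h4).
have mw w : 0 < w -> 0 < m * w `^ (m - 1) by move=> h; rewrite mulr_gt0 // powR_gt0.
have mid (u v : R) : u < v -> exists2 t : R, u < t < v & True.
  by move=> uv; exists ((u + v) / 2) => //; apply/andP; split; lra.
(* both clocks tend to [1] as [w] tends to [0] *)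
have gg w : 0 < w < M -> g1 w = g2 w.
  apply: (clock_unique (phi := fun w => m * w `^ (m - 1) / Y1 w) M0).
  - by move=> v hv; have [_ _] := B1 v hv.
  - move=> v hv; have [/andP[k1 _] _ k2] := B2 v hv; split => //.
    by rewrite (YY v hv).
  move=> e e0.
  have lim (g Y xx : R -> R) tt : 1 < tt ->
      (forall t, 1 < t < tt -> 0 < xx t < M /\ g (xx t) = t) ->
      (forall w : R, 0 < w < M -> [/\ 1 < g w < tt, xx (g w) = w & isD g w (g w * (m * w `^ (m - 1) / Y w))]) ->
      (forall w : R, 0 < w < M -> 0 < Y w) ->
      exists2 w : R, 0 < w < M & forall v : R, 0 < v -> v < w -> 1 < g v < 1 + e.
    move=> tt1 A B Yp; have tte : 1 < Num.min tt (1 + e) by rewrite lt_min tt1 ltrDl.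
    have [t /andP[k1 +] _] := mid _ _ tte; rewrite lt_min => /andP[k2 k3].
    have [k4 k5] := A t ltac:(by rewrite k1); exists (xx t) => // v v0 vx.
    have [_ xM] := andP k4.
    have [/andP[k6 _] _ _] := B v ltac:(by rewrite v0 (lt_trans vx)).
    rewrite k6 /=; apply: lt_trans k3; rewrite -[X in _ < X]k5.
    have gD r : 0 < r < M -> isD g r (g r * (m * r `^ (m - 1) / Y r)) by move=> /B[].
    apply: (isD_incr_itv gD) v0 vx xM => r hr; have [/andP[k7 _] _ _] := B r hr.
    have /andP[r0 _] := hr.
    by apply: mulr_gt0; [exact: lt_trans k7|apply: divr_gt0; [exact: mw|exact: Yp]].
  have [wa ha la] := lim g1 Y1 (orb_x f1) t1 (andP T1).1 A1 B1 (fun w hw => (a1 w hw).1).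
  have [wb hb lb] := lim g2 Y2 (orb_x f2) t2 (andP T2).1 A2 B2 (fun w hw => (a2 w hw).1).
  have [v /andP[v0 +] _] := mid 0 (Num.min wa wb) ltac:(by rewrite lt_min; case/andP: ha => -> _; case/andP: hb => ->).
  rewrite lt_min => /andP[va vb]; exists v; first by rewrite v0 (lt_trans va) //; case/andP: ha.
  by have /andP[? ?] := la v v0 va; have /andP[? ?] := lb v v0 vb; rewrite ltr_norml; apply/andP; split; lra.
have tle (s1 s2 : R) (xx yy g h : R -> R) :
    (forall t, 1 < t < s1 -> 0 < xx t < M /\ g (xx t) = t) ->
    (forall w : R, 0 < w < M -> 1 < h w < s2) -> (forall w : R, 0 < w < M -> g w = h w) -> 1 < s1 -> s1 <= s2.
  move=> A B E s11; rewrite leNgt; apply/negP => ss.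
  case: (lerP s2 1) => s21.
    have [t ht _] := mid _ _ s11; have [k1 _] := A t ht; have /andP[k2 k3] := B _ k1.
    by have := lt_trans k2 k3; rewrite ltNge s21.
  have [k1 k2] := A s2 ltac:(by rewrite s21).
  by have /andP[_] := B _ k1; rewrite -(E _ k1) k2 ltxx.
have tt : t1 = t2.
  apply/eqP; rewrite eq_le; apply/andP; split.
    apply: (tle t1 t2 (orb_x f1) (orb_x f2) g1 g2 A1 _ gg (andP T1).1) => w hw; by have [] := B2 w hw.
  apply: (tle t2 t1 (orb_x f2) (orb_x f1) g2 g1 A2 _ _ (andP T2).1) => w hw; first by have [] := B1 w hw.
  by rewrite gg.
rewrite -tt in T2 xM2 A2 B2 A2' B2'.
(* both clocks tend to [t1] as [w] tends to the maximum *)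
have hh w : 0 < w < M -> h1 w = h2 w.
  apply: (clock_unique (phi := fun w => - (m * w `^ (m - 1) / Z1 w)) M0).
  - by move=> v hv; have [_ _] := B1' v hv.
  - move=> v hv; have [/andP[k1 _] _ k2] := B2' v hv; split; first exact: lt_trans (andP T1).1 k1.
    by rewrite (ZZ v hv).
  move=> e e0.
  have lim (g Y xx : R -> R) z : t1 < z ->
      (forall t, t1 < t < z -> 0 < xx t < M /\ g (xx t) = t) ->
      (forall w : R, 0 < w < M -> [/\ t1 < g w < z, xx (g w) = w & isD g w (g w * - (m * w `^ (m - 1) / Y w))]) ->
      (forall w : R, 0 < w < M -> 0 < Y w) ->
      exists2 w : R, 0 < w < M & forall v : R, w < v -> v < M -> t1 < g v < t1 + e.
    move=> tt1 A B Yp; have tte : t1 < Num.min z (t1 + e) by rewrite lt_min tt1 ltrDl.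
    have [t /andP[k1 +] _] := mid _ _ tte; rewrite lt_min => /andP[k2 k3].
    have [k4 k5] := A t ltac:(by rewrite k1); exists (xx t) => // v xv vM.
    have [x0 _] := andP k4.
    have [/andP[k6 _] _ _] := B v ltac:(by rewrite vM (lt_trans x0)).
    rewrite k6 /=; apply: lt_trans k3; rewrite -[X in _ < X]k5 -ltrN2.
    have gD r : 0 < r < M -> isD (fun r => - g r) r (- (g r * - (m * r `^ (m - 1) / Y r))).
      by move=> /B[_ _]; exact: isD_opp.
    apply: (isD_incr_itv gD) x0 xv vM => r hr; have [/andP[k7 _] _ _] := B r hr.
    have t10 := lt_trans (lt_trans ltr01 (andP T1).1) k7.
    have /andP[r0 _] := hr; rewrite mulrN opprK.
    by apply: mulr_gt0 => //; apply: divr_gt0; [exact: mw|exact: Yp].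
  have [wa ha la] := lim h1 Z1 (orb_x f1) xi1 (andP T1).2 A1' B1' (fun w hw => (a1' w hw).1).
  have [wb hb lb] := lim h2 Z2 (orb_x f2) xi2 (andP T2).2 A2' B2' (fun w hw => (a2' w hw).1).
  have [v /andP[+ vM] _] := mid (Num.max wa wb) M ltac:(by rewrite gt_max; case/andP: ha => _ ->; case/andP: hb => _ ->).
  rewrite gt_max => /andP[va vb]; exists v; first by rewrite vM (lt_trans _ va) //; case/andP: ha.
  by have /andP[? ?] := la v va vM; have /andP[? ?] := lb v vb vM; rewrite ltr_norml; apply/andP; split; lra.
have zle (z1 z2 : R) (xx g h : R -> R) : t1 < z1 -> t1 < z2 ->
    (forall t, t1 < t < z1 -> 0 < xx t < M /\ g (xx t) = t) ->
    (forall w : R, 0 < w < M -> t1 < h w < z2) -> (forall w : R, 0 < w < M -> g w = h w) -> z1 <= z2.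
  move=> k1 k2 A B E; rewrite leNgt; apply/negP => zz.
  have [k3 k4] := A z2 ltac:(by rewrite k2).
  by have /andP[_] := B _ k3; rewrite -(E _ k3) k4 ltxx.
have zz : xi1 = xi2.
  apply/eqP; rewrite eq_le; apply/andP; split.
    apply: (zle _ _ (orb_x f1) h1 h2 (andP T1).2 (andP T2).2 A1' _ hh) => w hw; by have [] := B2' w hw.
  apply: (zle _ _ (orb_x f2) h2 h1 (andP T2).2 (andP T1).2 A2') => w hw; first by have [] := B1' w hw.
  by rewrite hh.
rewrite -zz in P2 T2 A2' B2'.
have xeq t : 1 < t < xi1 -> orb_x f1 t = orb_x f2 t.
  move=> /andP[k1 k2]; have [k3|k3|->] := ltgtP t t1; last by rewrite xM1 xM2.
    have [k4 k5] := A1 t ltac:(by rewrite k1); have [_ k6 _] := B2 _ k4.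
    by move: k6; rewrite -(gg _ k4) k5.
  have [k4 k5] := A1' t ltac:(by rewrite k2 k3); have [_ k6 _] := B2' _ k4.
  by move: k6; rewrite -(hh _ k4) k5.
move=> x xx0; case: (boolP (1 < x < xi1)) => hx; last by rewrite (profile_out P1) // (profile_out P2).
have x0 : 0 < x by case/andP: hx => h _; exact: lt_trans h.
by have := xeq x hx; rewrite /orb_x => /(mulIf (lt0r_neq0 (powR_gt0 (- p) x0))).
Qed.
End Profile.

(** * Iterated integrals of compactly supported functions *)

Section IteratedIntegral.
Context {R : realType}.
Implicit Types (h g : R -> R) (A M e y : R).
Notation mu := (@lebesgue_measure R).

Definition support_in h A := forall y, h y != 0 -> `|y| <= A.

Lemma integrable_segment h A : continuous h -> mu.-integrable `[- A, A] (EFin \o h).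
Proof.
move=> hc; apply: continuous_compact_integrable; first exact: segment_compact.
exact: continuous_subspaceT.
Qed.

Lemma line_integral h A : support_in h A ->
  \int[mu]_(y in setT) h y = \int[mu]_(y in `[- A, A]) h y.
Proof.
move=> hs; rewrite [RHS]Rintegral_mkcond; congr Rintegral; apply/funext => y.
rewrite patchE; case: ifPn => //; rewrite notin_setE /= in_itv /= => hy.
apply/eqP; apply/negPn/negP => /hs; rewrite ler_norml => ay; exact: hy.
Qed.

Lemma line_linear g h A a : continuous g -> continuous h -> support_in g A -> support_in h A ->
  \int[mu]_(y in setT) (a * g y + h y) = a * \int[mu]_(y in setT) g y + \int[mu]_(y in setT) h y.
Proof.
move=> gc hc gs hs; rewrite (line_integral gs) (line_integral hs).
rewrite (@line_integral (fun y => a * g y + h y) A); last first.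
  move=> y; apply: contraNT => hy.
  have /eqP -> : g y == 0 by apply/negPn/negP => /gs; exact/negP.
  by rewrite mulr0 add0r; apply/negPn/negP => /hs; exact/negP.
have mD : measurable (`[- A, A]%classic : set (measurableTypeR R)) by exact: measurable_itv.
rewrite -RintegralZl //; last exact: integrable_segment.
rewrite -RintegralD //; last exact: integrable_segment.
apply: integrable_segment => y; apply: continuousM; [exact: cvg_cst|exact: gc].
Qed.

Lemma line_bound h A M : 0 <= A -> continuous h -> support_in h A -> (forall y, `|h y| <= M) ->
  `|\int[mu]_(y in setT) h y| <= 2 * A * M.
Proof.
move=> A0 hc hs hM; rewrite (line_integral hs).
have mD : measurable (`[- A, A]%classic : set (measurableTypeR R)) by exact: measurable_itv.
have hi := integrable_segment A hc.
have h1 := le_normr_Rintegral mD hi.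
apply: (le_trans h1).
have cc (c : R) : mu.-integrable `[- A, A] (EFin \o (fun=> c)).
  by apply: integrable_segment => y; exact: cvg_cst.
have ni : mu.-integrable `[- A, A] (EFin \o (fun y => `|h y|)).
  by apply: integrable_segment => y; apply: continuous_comp; [exact: hc|exact: norm_continuous].
apply: le_trans; first exact: (le_Rintegral mD ni (cc M) (fun y _ => hM y)).
rewrite Rintegral_cst //= lebesgue_measure_itv /= lte_fin.
case: ifPn => hA; last by rewrite mulr0 mulr_ge0 ?mulr_ge0 // (le_trans _ (hM 0)).
by rewrite /= opprK mulrC [A + A](_ : _ = 2 * A) //; ring.
Qed.

Lemma line_derivative h (h' : R -> R) A : 0 <= A -> (forall y, isD h y (h' y)) -> continuous h' ->
  support_in h A -> support_in h' A -> \int[mu]_(y in setT) h' y = 0.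
Proof.
move=> A0 hD hc hs hs'; pose A1 := A + 1.
have A1p : A < A1 by rewrite ltrDl.
have wide g : support_in g A -> support_in g A1 by move=> gs y /gs /le_trans; apply; exact: ltW.
rewrite (line_integral (wide _ hs')) /Rintegral.
have A11 : - A1 < A1 by lra.
have hcont y : {for y, continuous h} by exact: isD_cont (hD y).
rewrite (@continuous_FTC2 _ h' h (- A1) A1 A11) /=.
- have z y : A < `|y| -> h y = 0.
    by move=> hy; apply/eqP/negPn/negP => /hs; rewrite leNgt hy.
  by rewrite !z ?subrr // ?normrN gtr0_norm //; lra.
- exact: continuous_subspaceT.
- split.
  + by move=> y _; exact: isD_derivable (hD y).
  + by apply: cvg_at_right_filter; exact: hcont.
  + by apply: cvg_at_left_filter; exact: hcont.
by move=> y _; exact: isD_derive1 (hD y).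
Qed.

(** Uniformly continuous functions on [R^n] supported in the box of half-side
    [A]. Uniformity passes to slices with the same modulus, so that Fubini-type
    inductions need no topology. *)
Definition box_function n (A : R) (g : 'rV[R]_n -> R) : Prop :=
  (forall e, 0 < e -> exists2 d : R, 0 < d & forall x x' : 'rV[R]_n,
     (forall i, `|x 0 i - x' 0 i| < d) -> `|g x - g x'| <= e) /\
  (forall x, g x != 0 -> forall i, `|x 0 i| <= A).

Definition slice n (g : 'rV[R]_(1 + n) -> R) y (x : 'rV[R]_n) : R := g (row_mx (y%:M : 'M[R]_1) x).

Lemma row_mx_lshift n y (x : 'rV[R]_n) i : (row_mx (y%:M : 'M[R]_1) x) 0 (lshift n i) = y.
Proof. by rewrite row_mxEl ord1 mxE eqxx mulr1n. Qed.

Lemma slice_dist n y y' (x x' : 'rV[R]_n) d : `|y - y'| < d -> (forall i, `|x 0 i - x' 0 i| < d) ->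
  forall i, `|(row_mx (y%:M : 'M[R]_1) x) 0 i - (row_mx (y'%:M : 'M[R]_1) x') 0 i| < d.
Proof.
move=> yd xd i; case: (split_ordP i) => j ->; first by rewrite !row_mx_lshift.
by rewrite !row_mxEr.
Qed.

Lemma slice_box n A (g : 'rV[R]_(1 + n) -> R) y : box_function A g -> box_function A (slice g y).
Proof.
move=> [gu gs]; split.
  move=> e e0; have [d d0 hd] := gu e e0; exists d => // x x' xd.
  by apply: hd; apply: slice_dist => //; rewrite subrr normr0.
by move=> x /gs h i; have := h (rshift 1 i); rewrite row_mxEr.
Qed.

Lemma box_lin n A a (g h : 'rV[R]_n -> R) : box_function A g -> box_function A h ->
  box_function A (fun x => a * g x + h x).
Proof.
move=> [gu gs] [hu hs]; split; last first.
  move=> x hx i; case: (eqVneq (g x) 0) => [g0|/gs //]; apply: hs.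
  by move: hx; rewrite g0 mulr0 add0r.
move=> e e0; have a1 : 0 < `|a| + 1 by rewrite ltr_wpDl.
have [|d d0 hd] := gu (e / 2 / (`|a| + 1)); first by rewrite !divr_gt0.
have [|d' d'0 hd'] := hu (e / 2); first by rewrite divr_gt0.
exists (Num.min d d'); first by rewrite lt_min d0.
move=> x x' xd; have -> : a * g x + h x - (a * g x' + h x') = a * (g x - g x') + (h x - h x') by ring.
apply: (le_trans (ler_normD _ _)).
have h1 : `|g x - g x'| <= e / 2 / (`|a| + 1) by apply: hd => i; apply: lt_le_trans (xd i) _; rewrite ge_min lexx.
have h2 : `|h x - h x'| <= e / 2 by apply: hd' => i; apply: lt_le_trans (xd i) _; rewrite ge_min lexx orbT.
rewrite normrM; suff : `|a| * `|g x - g x'| <= e / 2 by lra.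
rewrite ler_pdivlMr // in h1; rewrite mulrC; apply: le_trans h1.
by rewrite ler_wpM2l // lerDl.
Qed.

Definition linear_on n A := forall a (g h : 'rV[R]_n -> R), box_function A g -> box_function A h ->
  integral_rV (fun x => a * g x + h x) = a * integral_rV g + integral_rV h.
Definition bounded_on n A := forall (g : 'rV[R]_n -> R) M, box_function A g -> (forall x, `|g x| <= M) ->
  `|integral_rV g| <= (2 * A) ^+ n * M.

(** Slices over close points are uniformly close, so their integrals are close by
    linearity and the sup bound. *)
Lemma inner_continuous_of n A (g : 'rV[R]_(1 + n) -> R) : 0 <= A -> linear_on n A -> bounded_on n A ->
  box_function A g ->
  continuous (fun y => integral_rV (slice g y)) /\ support_in (fun y => integral_rV (slice g y)) A.
Proof.
move=> A0 IL IB gb; split.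
  move=> y; apply/cont_epsP => e e0.
  pose c := (2 * A) ^+ n + 1; have c0 : 0 < c by rewrite ltr_wpDl // exprn_ge0 // mulr_ge0.
  have [|d d0 hd] := gb.1 (e / 2 / c); first by rewrite !divr_gt0.
  exists d => // y' yd.
  have by1 := slice_box y gb; have by2 := slice_box y' gb.
  have -> : integral_rV (slice g y') - integral_rV (slice g y) =
      integral_rV (fun x => (-1) * slice g y x + slice g y' x).
    by rewrite (IL (-1) _ _ by1 by2) mulN1r addrC.
  apply: (@le_lt_trans _ _ ((2 * A) ^+ n * (e / 2 / c))).
    apply: (IB _ _ (box_lin (-1) by1 by2)) => x.
    rewrite mulN1r addrC; apply: hd; apply: slice_dist => // i.
    by rewrite subrr normr0.
  apply: (@le_lt_trans _ _ (c * (e / 2 / c))).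
    by rewrite ler_wpM2r ?lerDl // !divr_ge0 // ltW.
  by rewrite mulrC divfK ?gt_eqF //; lra.
move=> y hy; rewrite leNgt; apply/negP => Ay; move/eqP: hy; apply.
have z x : slice g y x = 0.
  apply/eqP/negPn/negP => /gb.2 /(_ (lshift n ord0)); rewrite row_mx_lshift leNgt; exact/negP/negPn.
have := IB (slice g y) 0 (slice_box y gb).
rewrite mulr0 => h; apply/eqP; rewrite -normr_le0; apply: h => x; by rewrite z normr0.
Qed.

(** Linearity and the sup bound are proved together: the bound, applied to
    differences of slices, gives the continuity of the inner integral. *)
Lemma integral_lin_bound n A : 0 <= A -> linear_on n A /\ bounded_on n A.
Proof.
move=> A0; elim: n => [|n [IL IB]].
  by split=> [//|g M _ gM]; rewrite /= expr0 mul1r.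
split.
  move=> a g h gb hb.
  have [gc gs] := inner_continuous_of A0 IL IB gb; have [hc hs] := inner_continuous_of A0 IL IB hb.
  rewrite -[RHS](line_linear a gc hc gs hs); apply: eq_Rintegral => y _.
  exact: (IL a _ _ (slice_box y gb) (slice_box y hb)).
move=> g M gb gM; have [gc gs] := inner_continuous_of A0 IL IB gb.
have -> : (2 * A) ^+ n.+1 * M = 2 * A * ((2 * A) ^+ n * M) by rewrite exprS mulrA.
apply: (line_bound A0 gc gs) => y; apply: (IB _ _ (slice_box y gb)) => x; exact: gM.
Qed.

Lemma inner_continuous n A (g : 'rV[R]_(1 + n) -> R) : 0 <= A -> box_function A g ->
  continuous (fun y => integral_rV (slice g y)) /\ support_in (fun y => integral_rV (slice g y)) A.
Proof. by move=> A0; have [IL IB] := integral_lin_bound n A0; exact: inner_continuous_of. Qed.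

Definition upd n (x : 'rV[R]_n) j y : 'rV[R]_n := \row_i (if i == j then y else x 0 i).
Definition partial_along n j (g g' : 'rV[R]_n -> R) :=
  forall x y, isD (fun y => g (upd x j y)) y (g' (upd x j y)).

Lemma upd_row_mx0 n (x : 'rV[R]_n) y0 y : upd (row_mx (y0%:M : 'M[R]_1) x) (lshift n ord0) y = row_mx (y%:M : 'M[R]_1) x.
Proof.
apply/rowP => i; rewrite mxE; case: (split_ordP i) => j ->.
  by rewrite !row_mx_lshift ord1 eqxx.
by rewrite !row_mxEr; case: eqP => // /eqP; rewrite eq_sym eq_lrshift.
Qed.

Lemma upd_row_mxS n (x : 'rV[R]_n) y0 i y : upd (row_mx (y0%:M : 'M[R]_1) x) (rshift 1 i) y = row_mx (y0%:M : 'M[R]_1) (upd x i y).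
Proof.
apply/rowP => l; rewrite mxE; case: (split_ordP l) => j ->.
  by rewrite !row_mx_lshift; case: eqP => // /eqP; rewrite eq_lrshift.
by rewrite !row_mxEr mxE eq_rshift.
Qed.

(** For the outer coordinate, difference quotients converge uniformly, so that the
    derivative of the inner integral is the inner integral of the derivative, and
    [line_derivative] applies. For an inner coordinate the inner integral
    vanishes, by induction. *)
Lemma integral_partial n A j (g g' : 'rV[R]_n -> R) : 0 <= A -> box_function A g -> box_function A g' ->
  partial_along j g g' -> integral_rV g' = 0.
Proof.
move=> A0; elim: n j g g' => [[]//|n IH] j g g' gb gb' gD.
have [gc gs] := inner_continuous A0 gb; have [gc' gs'] := inner_continuous A0 gb'.
change (\int[mu]_(y in setT) integral_rV (slice g' y) = 0).
case: (@split_ordP 1 n j) gD => i -> gD; last first.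
  have -> : (fun y => integral_rV (slice g' y)) = (fun y => 0 * 0 : R).
    apply/funext => y; rewrite mul0r; apply: (IH i (slice g y) (slice g' y)); [exact: slice_box|exact: slice_box|].
    by move=> x z; have := gD (row_mx (y%:M : 'M[R]_1) x) z; rewrite /slice upd_row_mxS; under eq_fun do rewrite upd_row_mxS.
  rewrite (_ : (fun=> _) = (fun _ : R => 0 * (0 : R) + 0)); last by apply/funext => y; rewrite addr0.
  rewrite (@line_linear (fun=> 0) (fun=> 0) A 0) ?mul0r ?add0r; try by move=> y; rewrite eqxx.
  - by rewrite Rintegral_cst // mul0r.
  - by move=> y; exact: cvg_cst.
  - by move=> y; exact: cvg_cst.
rewrite ord1 in gD.
have [IL IB] := integral_lin_bound n A0.
apply: (line_derivative A0 _ gc' gs gs') => y; apply/isD_epsP => e e0.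
pose c := (2 * A) ^+ n + 1; have c0 : 0 < c by rewrite ltr_wpDl // exprn_ge0 // mulr_ge0.
have [|d d0 hd] := gb'.1 (e / c); first by rewrite !divr_gt0.
exists d => // z zy zd.
have b1 := slice_box y gb'; have b2 := slice_box y gb; have b4 := slice_box z gb.
have b3 := box_lin (-1) b2 b4.
have -> : integral_rV (slice g z) - integral_rV (slice g y) - integral_rV (slice g' y) * (z - y) =
   integral_rV (fun x => (- (z - y)) * slice g' y x + ((-1) * slice g y x + slice g z x)).
  rewrite (IL _ _ _ b1 b3) (IL _ _ _ b2 b4); ring.
apply: (@le_trans _ _ ((2 * A) ^+ n * (e / c * `|z - y|))).
  apply: (IB _ _ (box_lin (- (z - y)) b1 b3)) => x.
  have sD s : isD (fun s => slice g s x) s (slice g' s x).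
    by have := gD (row_mx (y%:M : 'M[R]_1) x) s; rewrite /slice upd_row_mx0; under eq_fun do rewrite upd_row_mx0.
  have [s sz hs] : exists2 s : R, `|s - y| < d & slice g z x - slice g y x = slice g' s x * (z - y).
    move: zy; rewrite neq_lt => /orP[zy|yz].
      have [s /andP[s1 s2] hs] := mvt zy (fun s _ => sD s); exists s; last by rewrite -[LHS]opprB hs; ring.
      by rewrite ltr0_norm ?subr_lt0 //; move: zd; rewrite ltr0_norm ?subr_lt0 //; lra.
    have [s /andP[s1 s2] hs] := mvt yz (fun s _ => sD s); exists s => //.
    by rewrite gtr0_norm ?subr_gt0 //; move: zd; rewrite gtr0_norm ?subr_gt0 //; lra.
  have -> : - (z - y) * slice g' y x + (-1 * slice g y x + slice g z x) = (slice g' s x - slice g' y x) * (z - y).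
    by transitivity (- (z - y) * slice g' y x + (slice g z x - slice g y x)); [ring|rewrite hs; ring].
  rewrite normrM ler_wpM2r //; apply: hd; apply: slice_dist => // i'.
  by rewrite subrr normr0.
rewrite mulrA ler_wpM2r //; apply: (@le_trans _ _ (c * (e / c))).
  by rewrite ler_wpM2r ?lerDl // divr_ge0 // ltW.
by rewrite mulrC divfK // gt_eqF.
Qed.

Lemma continuous_sum (T : topologicalType) (I : Type) (r : seq I) (f : I -> T -> R) :
  (forall i, continuous (f i)) -> continuous (fun x => \sum_(i <- r) f i x).
Proof.
move=> fc; elim: r => [|i r IH] x.
  by under eq_fun do rewrite big_nil; exact: cvg_cst.
by under eq_fun do rewrite big_cons; apply: continuousD; [exact: fc|exact: IH].
Qed.

(** Heine-Cantor on the box. *)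
Lemma continuous_box n A (g : 'rV[R]_n -> R) : continuous g ->
  (forall x, g x != 0 -> forall i, `|x 0 i| <= A) -> box_function A g.
Proof.
move=> gc gs; split => // e e0.
pose K := [set x : 'rV[R]_n | forall i, (`[- A, A]%classic : set R) (x ord0 i)].
have cK : compact K.
  exact: (@rV_compact R n (fun=> `[- A, A]%classic) (fun=> @segment_compact R (- A) A)).
have e20 : 0 < e / 2 by rewrite divr_gt0.
have [d d0 hd] : exists2 d : R, 0 < d & forall x, K x -> forall x' : 'rV[R]_n,
    (forall i, `|x 0 i - x' 0 i| < d) -> `|g x - g x'| <= e.
  have := (compact_near_coveringP K).1 cK R (0 : R)^'+
    (fun d x => forall x' : 'rV[R]_n, (forall i, `|x 0 i - x' 0 i| < d) -> `|g x - g x'| <= e) _.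
  case=> [x0 _|r /= r0 hr].
    have /nbhs_ballP [r /= r0 hr] : nbhs x0 [set x | `|g x0 - g x| < e / 2].
      by apply: (@cvgr_dist_lt _ _ _ _ _ g (g x0) (gc x0)).
    have r20 : 0 < r / 2 by rewrite divr_gt0.
    exists (ball x0 (r / 2), [set d | d < r / 2]) => /=.
      by split; [exact: nbhsx_ballx|exact: nbhs_right_lt].
    move=> [x d] /= [xb dr] x' xx'.
    have h1 : `|g x0 - g x| < e / 2.
      by apply: hr; split => // i j; apply: lt_trans (xb.2 i j) _; lra.
    have h2 : `|g x0 - g x'| < e / 2.
      apply: hr; split => // i j; rewrite [i]ord1 /ball /=.
      have -> : x0 0 j - x' 0 j = (x0 0 j - x 0 j) + (x 0 j - x' 0 j) by ring.
      apply: (le_lt_trans (ler_normD _ _)).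
      have := xb.2 0 j; have := xx' j; rewrite /ball /=; lra.
    have -> : g x - g x' = (g x0 - g x') - (g x0 - g x) by ring.
    by apply: (le_trans (ler_normB _ _)); lra.
  exists (r / 2); first by rewrite divr_gt0.
  move=> x Kx x' xx'; apply: (hr (r / 2)) => //=; last by rewrite divr_gt0.
  by rewrite sub0r normrN gtr0_norm ?divr_gt0 //; lra.
have inK x : g x != 0 -> K x.
  by move=> /gs h i /=; rewrite in_itv /= -ler_norml; exact: h.
exists d => // x x' xx'.
case: (eqVneq (g x) 0) => [gx0|/inK/hd]; last exact.
case: (eqVneq (g x') 0) => [->|/inK/hd h]; first by rewrite gx0 subrr normr0 ltW.
by rewrite distrC; apply: h => i; rewrite distrC.
Qed.

Lemma box_bounded n A (g : 'rV[R]_n -> R) : continuous g ->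
  (forall x, g x != 0 -> forall i, `|x 0 i| <= A) -> exists2 M : R, 0 < M & forall x, `|g x| <= M.
Proof.
move=> gc gs.
pose K := [set x : 'rV[R]_n | forall i, (`[- A, A]%classic : set R) (x ord0 i)].
have cK : compact K.
  exact: (@rV_compact R n (fun=> `[- A, A]%classic) (fun=> @segment_compact R (- A) A)).
have := (compact_near_coveringP K).1 cK R (0 : R)^'+ (fun d x => `|g x| <= d^-1) _.
case=> [x0 _|r /= r0 hr].
  pose c := `|g x0| + 1; have c0 : 0 < c by rewrite ltr_wpDl.
  exists ([set x | `|g x0 - g x| < 1], [set d | 0 < d < c^-1]) => /=.
    split; first by apply: (@cvgr_dist_lt _ _ _ _ _ g (g x0) (gc x0)).
    near=> d; apply/andP; split; near: d; [exact: nbhs_right_gt|].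
    by apply: nbhs_right_lt; rewrite invr_gt0.
  move=> [x d] /= [xb /andP[d0 dc]].
  apply: (@le_trans _ _ c); last by rewrite -[c]invrK lef_pV2 ?posrE ?invr_gt0 // ltW.
  have -> : g x = g x0 - (g x0 - g x) by ring.
  by apply: (le_trans (ler_normB _ _)); rewrite lerD2l ltW.
exists (r / 2)^-1; first by rewrite invr_gt0 divr_gt0.
move=> x; case: (eqVneq (g x) 0) => [->|/gs h]; first by rewrite normr0 invr_ge0 divr_ge0 // ltW.
apply: (hr (r / 2)) => //=.
- by rewrite sub0r normrN gtr0_norm ?divr_gt0 //; lra.
- by rewrite divr_gt0.
by move=> i /=; rewrite in_itv /= -ler_norml; exact: h.
Unshelve. all: by end_near.
Qed.

Lemma upd_same n (x : 'rV[R]_n) j : upd x j (x 0 j) = x.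
Proof. by apply/rowP => i; rewrite mxE; case: eqP => // ->. Qed.

Lemma upd_coord n (x : 'rV[R]_n) j y : (upd x j y) 0 j = y.
Proof. by rewrite mxE eqxx. Qed.

(** Where the partial derivative is not [0], the function does not vanish identically
    on the coordinate line near the point. *)
Lemma support_partial n j A (g g' : 'rV[R]_n -> R) : partial_along j g g' ->
  (forall x, g x != 0 -> forall i, `|x 0 i| <= A) -> forall x, g' x != 0 -> forall i, `|x 0 i| <= A.
Proof.
move=> gD gs x gx i; rewrite leNgt; apply/negP => Ai; move/eqP: gx; apply.
have g0 (z : 'rV[R]_n) : A < `|z 0 i| -> g z = 0.
  by move=> hz; apply/eqP/negPn/negP => /gs /(_ i); rewrite leNgt hz.
have xD := gD x (x 0 j); rewrite upd_same in xD.
apply: (isD_unique xD); apply: isD_near (isD_cst (x 0 j) 0) _.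
case: (eqVneq i j) => [ij|ij]; last first.
  by exists 1 => // y _; rewrite g0 // mxE (negbTE ij).
rewrite -ij in xD *; exists (`|x 0 i| - A); first by rewrite subr_gt0.
move=> y hy; rewrite g0 // upd_coord.
have := lerB_dist (x 0 i) y; rewrite distrC; lra.
Qed.

(** A space closed under linear combinations and, by [null_limit], under uniform
    limits; it contains all partial derivatives. *)
Definition null n A (g : 'rV[R]_n -> R) := box_function A g /\ integral_rV g = 0.

Lemma null_lin n A a (g h : 'rV[R]_n -> R) : 0 <= A -> null A g -> null A h -> null A (fun x => a * g x + h x).
Proof.
move=> A0 [gb g0] [hb h0]; split; first exact: box_lin.
by rewrite ((integral_lin_bound n A0).1 a _ _ gb hb) g0 h0 mulr0 addr0.
Qed.

Lemma null0 n A : 0 <= A -> null A (fun _ : 'rV[R]_n => 0).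
Proof.
move=> A0; have b0 : box_function A (fun _ : 'rV[R]_n => 0).
  by split=> [e e0|x]; [exists 1 => // x x' _; rewrite subrr normr0 ltW|rewrite eqxx].
split => //; apply/eqP; rewrite -normr_le0.
by have := (integral_lin_bound n A0).2 _ 0 b0 (fun=> _); rewrite mulr0; apply; rewrite normr0.
Qed.

Lemma null_sum n A (I : Type) (r : seq I) (g : I -> 'rV[R]_n -> R) : 0 <= A ->
  (forall i, null A (g i)) -> null A (fun x => \sum_(i <- r) g i x).
Proof.
move=> A0 gn; elim: r => [|i r IH].
  by under eq_fun do rewrite big_nil; exact: null0.
have := null_lin 1 A0 (gn i) IH; congr null; apply/funext => x.
by rewrite big_cons mul1r.
Qed.

Lemma null_partial n A j (g g' : 'rV[R]_n -> R) : 0 <= A -> continuous g -> continuous g' ->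
  (forall x, g x != 0 -> forall i, `|x 0 i| <= A) -> partial_along j g g' -> null A g'.
Proof.
move=> A0 gc gc' gs gD; have gb := continuous_box gc gs.
have gb' := continuous_box gc' (support_partial gD gs).
by split => //; exact: (integral_partial A0 gb gb' gD).
Qed.

(** The sup bound makes the integral continuous for uniform convergence on the box. *)
Lemma null_limit n A (g : 'rV[R]_n -> R) : 0 <= A -> box_function A g ->
  (forall e, 0 < e -> exists2 h, null A h & forall x, `|g x - h x| <= e) -> integral_rV g = 0.
Proof.
move=> A0 gb happ; apply/eqP; rewrite -normr_le0 leNgt; apply/negP => p0.
have [IL IB] := integral_lin_bound n A0.
pose c := (2 * A) ^+ n + 1; have c0 : 0 < c by rewrite ltr_wpDl // exprn_ge0 // mulr_ge0.
have [|h [hb h0] hg] := happ (`|integral_rV g| / 2 / c); first by rewrite !divr_gt0.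
have := IB _ _ (box_lin (-1) hb gb) (fun x => _ : `|-1 * h x + g x| <= `|integral_rV g| / 2 / c).
rewrite (IL (-1) _ _ hb gb) h0 mulr0 add0r => hh.
have : `|integral_rV g| <= c * (`|integral_rV g| / 2 / c).
  apply: le_trans (hh _) _; first by move=> x; rewrite mulN1r addrC; exact: hg.
  by rewrite ler_wpM2r ?lerDl // !divr_ge0 // ltW.
by rewrite mulrC divfK ?gt_eqF //; lra.
Qed.

(** * The weak formulation *)

(** Space-time points are row vectors [(t, x)] of length [1 + N], so that the
    outer time integral is one more iterated integral. *)
Definition time_of N (z : 'rV[R]_(1 + N)) : R := z 0 (lshift N ord0).
Definition space_of N (z : 'rV[R]_(1 + N)) : 'rV[R]_N := rsubmx z.
Definition on_spacetime N (g : R -> 'rV[R]_N -> R) (z : 'rV[R]_(1 + N)) : R := g (time_of z) (space_of z).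

Lemma space_of_continuous N : continuous (@space_of N).
Proof.
move=> z s /= /(nbhs_ballP (space_of z)) [e e0 es].
apply/nbhs_ballP; exists e => //= z' [_ zz]; apply: es; split => // i j.
by rewrite /space_of !mxE; exact: zz.
Qed.

Lemma continuous_on_spacetime N (g : R -> 'rV[R]_N -> R) : jcontinuous g -> continuous (on_spacetime g).
Proof.
move=> gc z; apply: (@continuous_comp _ _ _ (fun z : 'rV[R]_(1 + N) => (time_of z, space_of z))
   (fun p => g p.1 p.2)); last exact: gc.
have h1 : @time_of N @ z --> time_of z by exact: coord_continuous.
have h2 : @space_of N @ z --> space_of z by exact: space_of_continuous.
exact: (cvg_pair h1 h2).
Qed.

Lemma time_upd_time N (z : 'rV[R]_(1 + N)) y : time_of (upd z (lshift N ord0) y) = y.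
Proof. by rewrite /time_of upd_coord. Qed.
Lemma space_upd_time N (z : 'rV[R]_(1 + N)) y : space_of (upd z (lshift N ord0) y) = space_of z.
Proof. by apply/rowP => i; rewrite !mxE; case: eqP => // /eqP; rewrite eq_sym eq_lrshift. Qed.
Lemma time_upd_space N (z : 'rV[R]_(1 + N)) i y : time_of (upd z (rshift 1 i) y) = time_of z.
Proof. by rewrite /time_of mxE; case: eqP => // /eqP; rewrite eq_lrshift. Qed.
Lemma space_upd_space N (z : 'rV[R]_(1 + N)) i y : space_of (upd z (rshift 1 i) y) = upd (space_of z) i y.
Proof. by apply/rowP => l; rewrite !mxE eq_rshift. Qed.

(** Partial derivatives and derivatives along coordinate lines are limits of the
    same difference quotients. *)
Lemma line_quotient N (h : 'rV[R]_N -> R) i (x : 'rV[R]_N) y :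
  (fun s : R => s^-1 *: ((h \o shift (upd x i y)) (s *: delta_mx 0 i) - h (upd x i y))) =
  (fun s : R => s^-1 *: (((fun y => h (upd x i y)) \o shift y) (s *: 1) - h (upd x i y))).
Proof.
apply/funext => s /=; congr (_ *: (h _ - _)); apply/rowP => l; rewrite !mxE eqxx /=.
by case: (l == i); rewrite /= ?mulr0 ?add0r // /GRing.scale /= !mulr1.
Qed.

Lemma line_partial N (h : 'rV[R]_N -> R) i (x : 'rV[R]_N) y : derivable h (upd x i y) (delta_mx 0 i) ->
  isD (fun y => h (upd x i y)) y (partial i h (upd x i y)).
Proof.
rewrite /derivable line_quotient => hd.
apply: isD_eq (derivable_isD hd) _.
by rewrite derive1E /partial /derive line_quotient.
Qed.

Lemma partial_line N (h : 'rV[R]_N -> R) i (x : 'rV[R]_N) d : isD (fun y => h (upd x i y)) (x 0 i) d ->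
  derivable h x (delta_mx 0 i) /\ partial i h x = d.
Proof.
move=> hd.
suff : derivable h (upd x i (x 0 i)) (delta_mx 0 i) /\ partial i h (upd x i (x 0 i)) = d by rewrite upd_same.
rewrite /derivable /partial /derive line_quotient; split; first exact: isD_derivable hd.
by rewrite -(isD_derive1 hd) derive1E.
Qed.

Lemma jcontinuousM N (g h : R -> 'rV[R]_N -> R) : jcontinuous g -> jcontinuous h ->
  jcontinuous (fun t x => g t x * h t x).
Proof. by move=> gc hc p; apply: continuousM; [exact: gc|exact: hc]. Qed.
Lemma jcontinuousD N (g h : R -> 'rV[R]_N -> R) : jcontinuous g -> jcontinuous h ->
  jcontinuous (fun t x => g t x + h t x).
Proof. by move=> gc hc p; apply: continuousD; [exact: gc|exact: hc]. Qed.
Lemma jcontinuous_comp N (f : R -> R) (g : R -> 'rV[R]_N -> R) : continuous f -> jcontinuous g ->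
  jcontinuous (fun t x => f (g t x)).
Proof. by move=> fc gc p; apply: (@continuous_comp _ _ _ (fun p => g p.1 p.2) f); [exact: gc|exact: fc]. Qed.
Lemma jcontinuousN N (g : R -> 'rV[R]_N -> R) : jcontinuous g -> jcontinuous (fun t x => - g t x).
Proof. by apply: jcontinuous_comp => y; exact: isD_cont (isD_opp (isD_id y)). Qed.
Lemma jcontinuous_time N (f : R -> R) : continuous f -> jcontinuous (fun t (_ : 'rV[R]_N) => f t).
Proof. by move=> fc p; apply: (@continuous_comp _ _ _ fst f); [exact: cvg_fst|exact: fc]. Qed.
Lemma jcontinuous_coord N i : jcontinuous (fun _ (x : 'rV[R]_N) => x 0 i).
Proof. by move=> p; apply: (@continuous_comp _ _ _ snd (fun x : 'rV[R]_N => x 0 i)); [exact: cvg_snd|exact: coord_continuous]. Qed.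
Lemma jcontinuous_sum N (I : Type) (r : seq I) (g : I -> R -> 'rV[R]_N -> R) : (forall i, jcontinuous (g i)) ->
  jcontinuous (fun t x => \sum_(i <- r) g i t x).
Proof. by move=> gc; apply: (@continuous_sum _ _ r (fun i p => g i p.1 p.2)). Qed.
Lemma jcontinuous_cst N (c : R) : jcontinuous (fun _ (_ : 'rV[R]_N) => c).
Proof. by move=> p; exact: cvg_cst. Qed.

Definition normsq N (x : 'rV[R]_N) : R := \sum_(i < N) x 0 i ^+ 2.

Lemma normsq_ge0 N (x : 'rV[R]_N) : 0 <= normsq x.
Proof. by apply: sumr_ge0 => i _; exact: sqr_ge0. Qed.

Lemma coord_le_enorm N (x : 'rV[R]_N) i : `|x 0 i| <= enorm x.
Proof.
rewrite /enorm -sqrtr_sqr; apply: ler_wsqrtr.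
by rewrite (bigD1 i) //= lerDl; apply: sumr_ge0 => l _; exact: sqr_ge0.
Qed.

Lemma normsq_upd N (x : 'rV[R]_N) i y : normsq (upd x i y) = y ^+ 2 + \sum_(l < N | l != i) x 0 l ^+ 2.
Proof.
rewrite /normsq (bigD1 i) //= upd_coord; congr (_ + _).
by apply: eq_bigr => l li; rewrite mxE (negbTE li).
Qed.

Section TestFunction.
Variables (N : nat) (phi : R -> 'rV[R]_N -> R).
Hypothesis hphi : test_function phi.

Lemma test_box : exists2 A : R, 0 <= A & forall z : 'rV[R]_(1 + N), on_spacetime phi z != 0 -> forall i, `|z 0 i| <= A.
Proof.
have [A hA] := test_compact_support hphi; exists (Num.max A 0); first by rewrite le_max lexx orbT.
move=> z /hA [tA xA] i; rewrite le_max; apply/orP; left.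
case: (split_ordP i) => j ->; first by rewrite (ord1 j).
by apply: le_trans xA; have := coord_le_enorm (space_of z) j; rewrite /space_of mxE.
Qed.

(** Integration by parts: the function is a derivative of the compactly supported
    [c phi]. *)
Lemma null_space A i (c c' : R -> 'rV[R]_N -> R) : 0 <= A ->
  (forall z : 'rV[R]_(1 + N), on_spacetime phi z != 0 -> forall i, `|z 0 i| <= A) ->
  jcontinuous c -> jcontinuous c' ->
  (forall t x y, isD (fun y => c t (upd x i y)) y (c' t (upd x i y))) ->
  null A (on_spacetime (fun t x => c' t x * phi t x + c t x * partial i (phi t) x)).
Proof.
move=> A0 hA cc cc' cD; have [pD pc] := test_C1_x hphi i.
apply: (@null_partial _ A (rshift 1 i) (on_spacetime (fun t x => c t x * phi t x))) => //.
- by apply/continuous_on_spacetime/jcontinuousM => //; exact: test_continuous hphi.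
- apply/continuous_on_spacetime/jcontinuousD; first by apply: jcontinuousM => //; exact: test_continuous hphi.
  exact: jcontinuousM.
- by move=> z; rewrite /on_spacetime mulf_eq0 negb_or => /andP[_]; exact: hA.
move=> z y; rewrite /on_spacetime time_upd_space space_upd_space.
under eq_fun do rewrite time_upd_space space_upd_space.
by apply: isD_mul; [exact: cD|exact/line_partial/pD].
Qed.

Lemma null_time A (c c' : R -> 'rV[R]_N -> R) : 0 <= A ->
  (forall z : 'rV[R]_(1 + N), on_spacetime phi z != 0 -> forall i, `|z 0 i| <= A) ->
  jcontinuous c -> jcontinuous c' ->
  (forall t x, isD (fun t => c t x) t (c' t x)) ->
  null A (on_spacetime (fun t x => c' t x * phi t x + c t x * derive1 (phi ^~ x) t)).
Proof.
move=> A0 hA cc cc' cD.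
apply: (@null_partial _ A (lshift N ord0) (on_spacetime (fun t x => c t x * phi t x))) => //.
- by apply/continuous_on_spacetime/jcontinuousM => //; exact: test_continuous hphi.
- apply/continuous_on_spacetime/jcontinuousD; first by apply: jcontinuousM => //; exact: test_continuous hphi.
  by apply: jcontinuousM => //; exact: test_C1_t hphi.
- by move=> z; rewrite /on_spacetime mulf_eq0 negb_or => /andP[_]; exact: hA.
move=> z y; rewrite /on_spacetime time_upd_time space_upd_time.
under eq_fun do rewrite time_upd_time space_upd_time.
by apply: isD_mul; [exact: cD|exact/derivable_isD/(test_derivable_t hphi)].
Qed.

Lemma test_time_support A : (forall z : 'rV[R]_(1 + N), on_spacetime phi z != 0 -> forall i, `|z 0 i| <= A) ->
  forall z : 'rV[R]_(1 + N), derive1 (phi ^~ (space_of z)) (time_of z) != 0 -> forall i, `|z 0 i| <= A.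
Proof.
move=> hA; apply: (@support_partial _ (lshift N ord0) A (on_spacetime phi)
  (on_spacetime (fun t x => derive1 (phi ^~ x) t))) => // z y.
rewrite /on_spacetime time_upd_time space_upd_time.
under eq_fun do rewrite time_upd_time space_upd_time.
exact/derivable_isD/(test_derivable_t hphi).
Qed.

Lemma test_space_support A i : (forall z : 'rV[R]_(1 + N), on_spacetime phi z != 0 -> forall i, `|z 0 i| <= A) ->
  forall z : 'rV[R]_(1 + N), partial i (phi (time_of z)) (space_of z) != 0 -> forall i, `|z 0 i| <= A.
Proof.
move=> hA; have [pD _] := test_C1_x hphi i.
apply: (@support_partial _ (rshift 1 i) A (on_spacetime phi)
  (on_spacetime (fun t => partial i (phi t)))) => // z y.
rewrite /on_spacetime time_upd_space space_upd_space.
under eq_fun do rewrite time_upd_space space_upd_space.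
exact/line_partial/pD.
Qed.

End TestFunction.

(** Self-similar functions [e^(-a t) f(s)], [s = |x|^2 e^(2 b t)]: using the
    square of the radius keeps everything differentiable at the origin. *)
Section SelfSimilar.
Variables (N : nat) (a b : R).
Implicit Types (f : R -> R) (t : R) (x : 'rV[R]_N).

Definition similarity t x := normsq x * expR (2 * b * t).
Definition selfsim f t x := expR (- a * t) * f (similarity t x).

Lemma similarity_continuous : jcontinuous similarity.
Proof.
apply: jcontinuousM.
  by apply: jcontinuous_sum => i; apply: jcontinuousM; exact: jcontinuous_coord.
apply: (@jcontinuous_time N (fun t => expR (2 * b * t))) => t.
apply: (@continuous_comp _ _ _ (fun t => 2 * b * t) expR); last exact: continuous_expR.
by apply: continuousM; [exact: cvg_cst|exact: cvg_id].
Qed.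

Lemma selfsim_continuous f : continuous f -> jcontinuous (selfsim f).
Proof.
move=> fc; apply: jcontinuousM; last by apply: jcontinuous_comp => //; exact: similarity_continuous.
apply: (@jcontinuous_time N (fun t => expR (- a * t))) => t.
apply: (@continuous_comp _ _ _ (fun t => - a * t) expR); last exact: continuous_expR.
by apply: continuousM; [exact: cvg_cst|exact: cvg_id].
Qed.

Lemma similarity_time t x : isD (fun t => similarity t x) t (2 * b * similarity t x).
Proof.
apply: isD_eq; first exact: isD_mul (isD_cst t (normsq x)) (isD_expR (isD_mul (isD_cst t (2 * b)) (isD_id t))).
by rewrite /similarity /=; ring.
Qed.

Lemma similarity_space t x i y : isD (fun y => similarity t (upd x i y)) y (2 * y * expR (2 * b * t)).
Proof.
rewrite /similarity; under eq_fun do rewrite normsq_upd.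
apply: isD_eq; first exact: isD_mul (isD_add (isD_sqr (isD_id y)) (isD_cst y _)) (isD_cst y _).
by rewrite /=; ring.
Qed.

Variables (f f' : R -> R).
Hypothesis fD : forall s, isD f s (f' s).

Lemma selfsim_time t x : isD (fun t => selfsim f t x) t
  (- a * selfsim f t x + 2 * b * (similarity t x * selfsim f' t x)).
Proof.
apply: isD_eq.
  exact: isD_mul (isD_expR (isD_mul (isD_cst t (- a)) (isD_id t))) (isD_comp (fD _) (similarity_time t x)).
by rewrite /selfsim /=; ring.
Qed.

Lemma selfsim_space t x i y : isD (fun y => selfsim f t (upd x i y)) y
  (2 * y * expR (2 * b * t) * selfsim f' t (upd x i y)).
Proof.
apply: isD_eq; first exact: isD_mul (isD_cst y _) (isD_comp (fD _) (similarity_space t x i y)).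
by rewrite /selfsim /=; ring.
Qed.

(** Summed over [i] this is the divergence of the field [x u]. *)
Lemma selfsim_field t x i y : isD (fun y => upd x i y 0 i * selfsim f t (upd x i y)) y
  (selfsim f t (upd x i y) + 2 * (upd x i y 0 i ^+ 2 * expR (2 * b * t)) * selfsim f' t (upd x i y)).
Proof.
under eq_fun do rewrite upd_coord.
apply: isD_eq; first exact: isD_mul (isD_id y) (selfsim_space t x i y).
by rewrite upd_coord; ring.
Qed.

End SelfSimilar.

(** * Self-similar weak solutions *)

Lemma powR_superadd (p x y : R) : 1 <= p -> 0 <= x -> 0 <= y -> x `^ p + y `^ p <= (x + y) `^ p.
Proof.
move=> p1 x0 y0; have p0 : p != 0 by rewrite gt_eqF //; lra.
have split_pow z : 0 <= z -> z `^ p = z * z `^ (p - 1).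
  rewrite le_eqVlt => /orP[/eqP <-|z0]; first by rewrite powR0 // mul0r.
  by rewrite -{2}(powRr1 (ltW z0)) -pwD // addrC subrK.
have xy : 0 <= x + y by exact: addr_ge0.
rewrite !split_pow // mulrDl; apply: lerD.
  by rewrite ler_wpM2l // pw_le ?lerDl //; lra.
by rewrite ler_wpM2l // pw_le ?lerDr //; lra.
Qed.

(** [(f ^ p + e ^ p) ^ (1 / p)] is differentiable where [f ^ p] is; [f] need not be,
    where it vanishes. *)
Lemma root_regularization (p e : R) (f f1 : R -> R) : 1 < p -> 0 < e -> (forall s, 0 <= f s) ->
  (forall s, isD (fun s => f s `^ p) s (f1 s)) -> continuous f1 -> exists g g1 : R -> R,
  [/\ (forall s, isD g s (g1 s)), continuous g1 & forall s, `|f s - g s| <= e].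
Proof.
move=> p1 e0 f0 fD f1c; have p0 : 0 < p by lra.
have h0 s : 0 < f s `^ p + e `^ p by rewrite ltr_wpDl ?powR_ge0 // powR_gt0.
have hD s : isD (fun s => f s `^ p + e `^ p) s (f1 s).
  by apply: isD_eq; [exact: isD_add (fD s) (isD_cst s _)|rewrite addr0].
exists (fun s => (f s `^ p + e `^ p) `^ p^-1), (fun s => p^-1 * (f s `^ p + e `^ p) `^ (p^-1 - 1) * f1 s); split.
- by move=> s; exact: (@isD_powR _ (fun s => f s `^ p + e `^ p) s _ p^-1 (h0 s) (hD s)).
- apply: cont_mul f1c; apply: cont_mul; first exact: cont_cst.
  by move=> s; exact: isD_cont (@isD_powR _ (fun s => f s `^ p + e `^ p) s _ (p^-1 - 1) (h0 s) (hD s)).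
move=> s; have root z : 0 <= z -> (z `^ p) `^ p^-1 = z.
  by move=> z0; rewrite -powRrM mulfV ?gt_eqF // powRr1.
have p0' : 0 <= p^-1 by rewrite invr_ge0 ltW.
have lo : f s <= (f s `^ p + e `^ p) `^ p^-1.
  by rewrite -{1}(root (f s)) // pw_le ?powR_ge0 // lerDl powR_ge0.
have hi : (f s `^ p + e `^ p) `^ p^-1 <= f s + e.
  rewrite -(root (f s + e)) ?addr_ge0 ?(ltW e0) //.
  by rewrite pw_le ?(ltW (h0 s)) // powR_superadd ?(ltW e0) // ltW.
by rewrite distrC ger0_norm ?subr_ge0 // lerBlDl.
Qed.

Section Weak.
Variables (N : nat) (m q sigma a b : R) (F Gp Lp : R -> R).
Hypotheses (hm : 1 < m) (hab : (m - 1) * a = 2 * b) (hsb : sigma * b = (1 - q) * a).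
Hypotheses (F0 : forall s, 0 <= F s) (Fc : continuous F)
  (GD : forall s, isD (fun s => F s `^ m) s (Gp s)) (Gpc : continuous Gp).
(** The flux [grad u ^ m - b x u] is [x] times the self-similar function built from
    [Lam]. By [rel], the profile equation, [Lam] has a derivative even at the edges
    of the support. *)
Let Lam s := 2 * Gp s - b * F s.
Hypotheses (LD : forall s, isD Lam s (Lp s)) (Lpc : continuous Lp)
  (rel : forall s, 0 <= s ->
    N%:R * Lam s + 2 * s * Lp s = s `^ (sigma / 2) * F s `^ q - (a + N%:R * b) * F s).
Let U := selfsim (N := N) a b F.
Implicit Types (t : R) (x : 'rV[R]_N).

Lemma similarity_ge0 t x : 0 <= similarity b t x.
Proof. by rewrite mulr_ge0 ?normsq_ge0 ?expR_ge0. Qed.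

Lemma power_selfsim t x : U t x `^ m = selfsim (m * a) b (fun s => F s `^ m) t x.
Proof.
rewrite /U /selfsim powRM ?expR_ge0 // -expRM; congr (expR _ * _); ring.
Qed.

Lemma power_partial i t x : derivable (fun y : 'rV[R]_N => U t y `^ m) x (delta_mx 0 i) /\
  partial i (fun y : 'rV[R]_N => U t y `^ m) x = 2 * (x 0 i * selfsim a b Gp t x).
Proof.
apply: partial_line.
have e : (fun y => U t (upd x i y) `^ m) = (fun y => selfsim (m * a) b (fun s => F s `^ m) t (upd x i y)).
  by apply/funext => y; exact: power_selfsim.
rewrite e; apply: isD_eq; first exact: (selfsim_space (m * a) b GD t x i (x 0 i)).
rewrite upd_same /selfsim.
have -> : expR (- a * t) = expR (2 * b * t) * expR (- (m * a) * t).
  by rewrite -expRD -hab; congr expR; ring.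
by ring.
Qed.

Let Src s := N%:R * Lam s + 2 * s * Lp s + (a + N%:R * b) * F s.

Lemma source_selfsim t x : enorm x `^ sigma * U t x `^ q = selfsim a b Src t x.
Proof.
rewrite /selfsim /Src rel ?similarity_ge0 // subrK.
rewrite /U /selfsim powRM ?expR_ge0 // -expRM.
have -> : enorm x `^ sigma = normsq x `^ (sigma / 2).
  rewrite /enorm -/(normsq x) -powR12_sqrt ?normsq_ge0 // -powRrM; congr (_ `^ _).
  by rewrite mulrC.
rewrite /similarity powRM ?normsq_ge0 ?expR_ge0 // -expRM.
have -> : expR (- a * t * q) = expR (- a * t) * expR (2 * b * t * (sigma / 2)).
  rewrite -expRD; congr expR.
  have -> : 2 * b * t * (sigma / 2) = sigma * b * t by field.
  by rewrite hsb; ring.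
by ring.
Qed.

Lemma Src_continuous : continuous Src.
Proof.
have Lc : continuous Lam by move=> s; exact: isD_cont (LD s).
apply: cont_add; last by apply: cont_mul => //; exact: cont_cst.
apply: cont_add; first by apply: cont_mul => //; exact: cont_cst.
by apply: cont_mul => //; apply: cont_mul; [exact: cont_cst|exact: cont_id].
Qed.

Lemma field_sum (x : 'rV[R]_N) (E u r ph : R) (dph : 'I_N -> R) :
  \sum_(i < N) ((u + 2 * (x 0 i ^+ 2 * E) * r) * ph + x 0 i * u * dph i) =
  (N%:R * u + 2 * (normsq x * E) * r) * ph + u * \sum_(i < N) x 0 i * dph i.
Proof.
rewrite big_split /= -mulr_suml big_split /= sumr_const card_ord mulr_natl.
have -> : \sum_(i < N) 2 * (x 0 i ^+ 2 * E) * r = 2 * (normsq x * E) * r.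
  by rewrite /normsq mulr_suml mulr_sumr mulr_suml.
congr (_ + _).
by rewrite mulr_sumr; apply: eq_bigr => i _; ring.
Qed.

(** Integrating the flux by parts leaves the integral of [- u dphi/dt + b x u . grad phi
    + (a + N b) u phi], the function [u psi] of the proof. If [u] is replaced by a
    self-similar function with the same [a], [b] and a differentiable profile, this
    is a sum of derivatives of compactly supported functions. By
    [root_regularization] such functions approach [u] uniformly. *)
Lemma weak_identity_selfsim (phi : R -> 'rV[R]_N -> R) : 0 <= a -> test_function phi ->
  \int[@lebesgue_measure R]_(t in setT)
      integral_rV (fun x : 'rV[R]_N =>
        - U t x * derive1 (phi ^~ x) t
        + \sum_(i < N)
            partial i (fun y : 'rV[R]_N => U t y `^ m) x * partial i (phi t) x
        + enorm x `^ sigma * U t x `^ q * phi t x) = 0.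
Proof.
move=> a0 hphi; have [A A0 hA] := test_box hphi.
pose D t x := \sum_(i < N) x 0 i * partial i (phi t) x.
pose G t x := - U t x * derive1 (phi ^~ x) t + 2 * selfsim a b Gp t x * D t x + selfsim a b Src t x * phi t x.
pose psi t x := expR (- a * t) * ((a + N%:R * b) * phi t x + b * D t x - derive1 (phi ^~ x) t).
have phc := test_continuous hphi; have phtc := test_C1_t hphi.
have pxc i := (test_C1_x hphi i).2.
have Dc : jcontinuous D.
  by apply: jcontinuous_sum => i; apply: jcontinuousM; [exact: jcontinuous_coord|exact: pxc].
have cst c : jcontinuous (fun _ (_ : 'rV[R]_N) => c) by exact: jcontinuous_cst.
have Gc : jcontinuous G.
  apply: jcontinuousD; last by apply: jcontinuousM => //; exact/selfsim_continuous/Src_continuous.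
  apply: jcontinuousD.
    by apply: jcontinuousM => //; exact/jcontinuousN/selfsim_continuous.
  by apply: jcontinuousM => //; apply: jcontinuousM => //; exact: selfsim_continuous.
have psic : jcontinuous psi.
  apply: jcontinuousM.
    apply: (@jcontinuous_time N (fun t => expR (- a * t))) => t.
    apply: (@continuous_comp _ _ _ (fun t => - a * t) expR); last exact: continuous_expR.
    by apply: continuousM; [exact: cvg_cst|exact: cvg_id].
  apply: jcontinuousD; last exact: jcontinuousN.
  by apply: jcontinuousD; apply: jcontinuousM.
have out (z : 'rV[R]_(1 + N)) : ~ (forall i, `|z 0 i| <= A) ->
    [/\ phi (time_of z) (space_of z) = 0, D (time_of z) (space_of z) = 0 & derive1 (phi ^~ (space_of z)) (time_of z) = 0].
  move=> hz; split.
  - by apply/eqP/negPn/negP => /hA.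
  - apply: big1 => i _; have [->|/(test_space_support hphi hA) //] := eqVneq (partial i (phi (time_of z)) (space_of z)) 0.
    by rewrite mulr0.
  - by apply/eqP/negPn/negP => /(test_time_support hphi hA).
have Gs (z : 'rV[R]_(1 + N)) : on_spacetime G z != 0 -> forall i, `|z 0 i| <= A.
  move=> hz; apply: contrapT => /out[h1 h2 h3]; move/eqP: hz; apply.
  by rewrite /on_spacetime /G h1 h2 h3 !mulr0 !addr0.
have ps (z : 'rV[R]_(1 + N)) : on_spacetime psi z != 0 -> forall i, `|z 0 i| <= A.
  move=> hz; apply: contrapT => /out[h1 h2 h3]; move/eqP: hz; apply.
  by rewrite /on_spacetime /psi h1 h2 h3 !mulr0 subr0 addr0 mulr0.
have -> : (fun t => integral_rV (fun x : 'rV[R]_N => - U t x * derive1 (phi ^~ x) t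
        + \sum_(i < N) partial i (fun y : 'rV[R]_N => U t y `^ m) x * partial i (phi t) x
        + enorm x `^ sigma * U t x `^ q * phi t x)) = (fun t => integral_rV (slice (on_spacetime G) t)).
  apply/funext => t; congr integral_rV; apply/funext => x.
  rewrite /slice /on_spacetime /time_of /space_of row_mx_lshift row_mxKr /G source_selfsim.
  congr (_ + _ + _); rewrite /D mulr_sumr; apply: eq_bigr => i _.
  by rewrite (power_partial i t x).2; ring.
change (integral_rV (N := N.+1) (on_spacetime G) = 0).
have Gb := continuous_box (continuous_on_spacetime Gc) Gs.
apply: (null_limit A0 Gb) => e e0.
have [M M0 hM] := box_bounded (continuous_on_spacetime psic) ps.
have eM : 0 < e / M by rewrite divr_gt0.
have [Phi [Phi1 [PhiD Phi1c PhiF]]] := root_regularization hm eM F0 GD Gpc.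
pose n1 i t x := (selfsim a b Lam t x + 2 * (x 0 i ^+ 2 * expR (2 * b * t)) * selfsim a b Lp t x) * phi t x +
   x 0 i * selfsim a b Lam t x * partial i (phi t) x.
pose n2 t x := (- a * selfsim a b Phi t x + 2 * b * (similarity b t x * selfsim a b Phi1 t x)) * phi t x +
   selfsim a b Phi t x * derive1 (phi ^~ x) t.
pose n3 i t x := (selfsim a b Phi t x + 2 * (x 0 i ^+ 2 * expR (2 * b * t)) * selfsim a b Phi1 t x) * phi t x +
   x 0 i * selfsim a b Phi t x * partial i (phi t) x.
have Phic : continuous Phi by move=> s; exact: isD_cont (PhiD s).
have Lamc : continuous Lam by move=> s; exact: isD_cont (LD s).
have field_null (f f1 : R -> R) i : (forall s, isD f s (f1 s)) -> continuous f1 ->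
    null A (on_spacetime (fun t x => (selfsim a b f t x + 2 * (x 0 i ^+ 2 * expR (2 * b * t)) * selfsim a b f1 t x) * phi t x +
      x 0 i * selfsim a b f t x * partial i (phi t) x)).
  move=> fD f1c; have fc : continuous f by move=> s; exact: isD_cont (fD s).
  apply: (null_space (c := fun t x => x 0 i * selfsim a b f t x)
    (c' := fun t x => selfsim a b f t x + 2 * (x 0 i ^+ 2 * expR (2 * b * t)) * selfsim a b f1 t x) hphi A0 hA).
  - by apply: jcontinuousM; [exact: jcontinuous_coord|exact: selfsim_continuous].
  - apply: jcontinuousD; first exact: selfsim_continuous.
    apply: jcontinuousM; last exact: selfsim_continuous.
    apply: jcontinuousM => //; apply: jcontinuousM.
      by apply: jcontinuousM; exact: jcontinuous_coord.
    apply: (@jcontinuous_time N (fun t => expR (2 * b * t))) => t.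
    apply: (@continuous_comp _ _ _ (fun t => 2 * b * t) expR); last exact: continuous_expR.
    by apply: continuousM; [exact: cvg_cst|exact: cvg_id].
  by move=> t x y; exact: selfsim_field.
have null1 i : null A (on_spacetime (n1 i)) by exact: field_null.
have null3 i : null A (on_spacetime (n3 i)) by exact: field_null.
have null2 : null A (on_spacetime n2).
  apply: (null_time (c := selfsim a b Phi)
    (c' := fun t x => - a * selfsim a b Phi t x + 2 * b * (similarity b t x * selfsim a b Phi1 t x)) hphi A0 hA).
  - exact: selfsim_continuous.
  - apply: jcontinuousD; first by apply: jcontinuousM => //; exact: selfsim_continuous.
    apply: jcontinuousM => //; apply: jcontinuousM; [exact: similarity_continuous|exact: selfsim_continuous].
  by move=> t x; exact: selfsim_time.
have hsum := null_lin (- 1) A0 null2 (null_lin b A0 (null_sum (index_enum 'I_N) A0 null3) (null_sum (index_enum 'I_N) A0 null1)).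
exists (fun z => -1 * on_spacetime n2 z + (b * (\sum_(i < N) on_spacetime (n3 i) z) + \sum_(i < N) on_spacetime (n1 i) z)) => //.
move=> z; rewrite /on_spacetime /n1 /n3 !field_sum -/(similarity b _ _) -/(D _ _).
set t := time_of z; set x := space_of z.
have -> : G t x - (-1 * n2 t x + (b * ((N%:R * selfsim a b Phi t x + 2 * similarity b t x * selfsim a b Phi1 t x) * phi t x +
      selfsim a b Phi t x * D t x) + ((N%:R * selfsim a b Lam t x + 2 * similarity b t x * selfsim a b Lp t x) * phi t x +
      selfsim a b Lam t x * D t x))) = (F (similarity b t x) - Phi (similarity b t x)) * psi t x.
  by rewrite /G /n2 /psi /U /selfsim /Src /Lam; ring.
rewrite normrM; apply: (@le_trans _ _ (e / M * M)); last by rewrite divfK // gt_eqF.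
by apply: ler_pM => //; exact: (hM z).
Qed.

Theorem weak_solution_selfsim : 0 <= a -> weak_solution m q sigma U.
Proof.
move=> a0; split.
- by move=> t x; rewrite mulr_ge0 ?expR_ge0 // F0.
- exact: selfsim_continuous.
- move=> i; split; first by move=> t x; exact: (power_partial i t x).1.
  have -> : (fun t : R => partial i (fun x => U t x `^ m)) = (fun t x => 2 * (x 0 i * selfsim a b Gp t x)).
    by apply/funext => t; apply/funext => x; exact: (power_partial i t x).2.
  apply: jcontinuousM; first exact: jcontinuous_cst.
  by apply: jcontinuousM; [exact: jcontinuous_coord|exact: selfsim_continuous].
by move=> phi; exact: weak_identity_selfsim.
Qed.

End Weak.

End IteratedIntegral.

(** * Profiles give weak solutions *)

Section ProfileWeak.
Context {R : realType}.
Variables (N : nat) (m q sigma : R).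
Hypotheses (hm : 1 < m) (hq0 : 0 < q) (hq1 : q < 1) (hsigma : sigma = 2 * (1 - q) / (m - 1)).
Variables (b xi0 : R) (f : R -> R).
Hypotheses (b0 : 0 < b) (x1 : 1 < xi0)
  (HP : profile_with_support N m q sigma (alpha_of m b) b 1 xi0 f).
Implicit Types (s r t e : R).

Let m0 : 0 < m. Proof. by apply: lt_trans hm. Qed.
Let m1 : 0 < m - 1. Proof. by rewrite subr_gt0. Qed.
Let fm := fun z : R => f z `^ m.
Let dfm := derive1 fm.
Let out r : 0 <= r -> r <= 1 \/ xi0 <= r -> f r = 0.
Proof.
move=> r0 hr; apply: (profile_out HP) => //; apply/nandP; rewrite -!leNgt.
by case: hr => h; [left|right].
Qed.
Let fc r : 0 < r -> {for r, continuous f} := halfline_cont (profile_continuous HP).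
Let fmD r : 0 < r -> isD fm r (dfm r).
Proof.
move=> r0; have [_ [dg _ hd]] := profile_C1 HP.
by rewrite /dfm (isD_derive1 (hd r r0)); exact: hd.
Qed.
Let dfmc r : 0 < r -> {for r, continuous dfm}.
Proof.
move=> r0; have [_ [dg dgc hd]] := profile_C1 HP; apply/cont_epsP => e e0.
have [d d0 hdd] := (cont_epsP dg r).1 (halfline_cont dgc r0) e e0.
exists (Num.min d r); first by rewrite lt_min d0.
move=> y; rewrite lt_min => /andP[y1 y2].
have y0 : 0 < y by move: y2; rewrite ltr_norml; lra.
rewrite /dfm (isD_derive1 (hd r r0)) (isD_derive1 (hd y y0)); exact: hdd.
Qed.
Let dfm_out r : 0 < r -> r <= 1 \/ xi0 <= r -> dfm r = 0.
Proof.
move=> r0 hr.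
have x0 : 0 < xi0 := lt_trans ltr01 x1.
have [->|r1] := eqVneq r 1; first exact: profile_contact_core HP.
have [->|r2] := eqVneq r xi0; first exact: profile_contact_interface HP.
apply: (isD_unique (fmD r0)); apply: isD_near (isD_cst r 0) _.
have z y : 0 <= y -> y <= 1 \/ xi0 <= y -> 0 = fm y.
  by move=> y0 hy; rewrite /fm out // powR0 // gt_eqF.
case: hr => hr.
  have r1' : r < 1 by rewrite lt_neqAle r1.
  exists (Num.min r (1 - r)); first by rewrite lt_min r0 subr_gt0.
  by move=> y; rewrite lt_min !ltr_norml => /andP[/andP[? ?] /andP[? ?]]; apply: z; [|left]; lra.
have r2' : xi0 < r by rewrite lt_neqAle eq_sym r2.
exists (r - xi0); first by rewrite subr_gt0.
by move=> y; rewrite !ltr_norml => /andP[? ?]; apply: z; [|right]; lra.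
Qed.

Lemma isD_sqrt s : 0 < s -> isD (@Num.sqrt R) s (2 * Num.sqrt s)^-1.
Proof.
move=> s0; have r0 : 0 < Num.sqrt s by rewrite sqrtr_gt0.
have := @inv_isD _ (fun t => t ^+ 2) (@Num.sqrt R) (Num.sqrt s) (2 * Num.sqrt s) (Num.sqrt s) r0.
rewrite sqr_sqrtr ?(ltW s0) //; apply.
- move=> t ht; rewrite sqrtr_sqr gtr0_norm //; move: ht; rewrite ltr_norml; lra.
- by move=> t _; exact: isD_cont (isD_sqr (isD_id t)).
- by apply: isD_eq; [exact: isD_sqr (isD_id _)|rewrite mulr1].
by rewrite gt_eqF // mulr_gt0.
Qed.

(** For non-negative arguments this is [t ^ p]; the absolute value makes it
    continuous on the whole line. *)
Lemma cont_abs_powR (p : R) : 0 < p -> continuous (fun t : R => `|t| `^ p).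
Proof.
move=> p0 t; have [->|t0] := eqVneq t 0.
  apply/cont_epsP => e e0; have e20 : 0 < e / 2 by rewrite divr_gt0.
  have [d d0 hd] := pw_small p0 e20; exists d => // y; rewrite subr0 normr0 powR0 ?gt_eqF // subr0 => /ltW /(hd _ (normr_ge0 _)) h.
    by rewrite ger0_norm ?powR_ge0 //; apply: (le_lt_trans h); lra.
apply: (@continuous_comp _ _ _ (fun t : R => `|t|) (fun t => t `^ p)); first exact: norm_continuous.
by apply: pw_cont; rewrite normr_gt0.
Qed.

Definition sq_profile s := f (Num.sqrt s).
Local Notation F := sq_profile.
Let Gp s := if 0 < s then dfm (Num.sqrt s) / (2 * Num.sqrt s) else 0.
Let Lam s := 2 * Gp s - b * F s.
Let Src s := s `^ (sigma / 2) * F s `^ q - (alpha_of m b + N%:R * b) * F s - N%:R * Lam s.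
Let Lp s := if 0 < s then Src s / (2 * s) else 0.
Let c := xi0 ^+ 2.

Let c1 : 1 < c. Proof. by rewrite /c expr2 -[1]mulr1 ltr_pM. Qed.
Let sqrt_out s : s <= 1 \/ c <= s -> Num.sqrt s <= 1 \/ xi0 <= Num.sqrt s.
Proof.
have x0 : 0 < xi0 := lt_trans ltr01 x1.
case=> hs; [left|right]; first by rewrite -[1]sqrtr1 ler_wsqrtr.
by rewrite -[xi0]gtr0_norm // -sqrtr_sqr ler_wsqrtr.
Qed.
Let F_out s : s <= 1 \/ c <= s -> F s = 0.
Proof. by move=> /sqrt_out; apply: out; exact: sqrtr_ge0. Qed.
Let Gp_out s : s <= 1 \/ c <= s -> Gp s = 0.
Proof.
move=> hs; rewrite /Gp; case: ifP => // s0.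
by rewrite dfm_out ?mul0r ?sqrtr_gt0 //; exact: sqrt_out.
Qed.
Let Lam_out s : s <= 1 \/ c <= s -> Lam s = 0.
Proof. by move=> hs; rewrite /Lam Gp_out // F_out // !mulr0 subr0. Qed.
Let Lp_out s : s <= 1 \/ c <= s -> Lp s = 0.
Proof.
move=> hs; rewrite /Lp /Src Lam_out // F_out // powR0 ?gt_eqF // !mulr0 !subr0 mul0r.
by case: ifP.
Qed.

(** All functions of [s] below vanish near [0], where the square root is not
    differentiable. *)
Let flat_below (h : R -> R) s : (forall s, s <= 1 \/ c <= s -> h s = 0) -> s < 1 \/ c < s -> isD h s 0.
Proof.
move=> hout hs; apply: isD_near (isD_cst s 0) _; case: hs => hs.
  exists (1 - s); first by rewrite subr_gt0.
  by move=> y; rewrite ltr_norml => /andP[? ?]; rewrite hout //; left; lra.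
exists (s - c); first by rewrite subr_gt0.
by move=> y; rewrite ltr_norml => /andP[? ?]; rewrite hout //; right; lra.
Qed.
Let cont_from_pos (h : R -> R) : (forall s, s <= 1 \/ c <= s -> h s = 0) ->
  (forall s, 0 < s -> {for s, continuous h}) -> continuous h.
Proof.
move=> hout hc s; case: (ltrP s 1) => s1; last by apply: hc; exact: lt_le_trans s1.
by apply: (@isD_cont _ h s 0); apply: flat_below => //; left.
Qed.
Let near_pos (h h' : R -> R) s : 0 < s -> (forall s, 0 < s -> h' s = h s) ->
  {for s, continuous h} -> {for s, continuous h'}.
Proof.
move=> s0 E hc; apply/cont_epsP => e e0.
have [d d0 hd] := (cont_epsP h s).1 hc e e0.
exists (Num.min d s); first by rewrite lt_min d0.
move=> y; rewrite lt_min => /andP[y1 y2].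
have y0 : 0 < y by move: y2; rewrite ltr_norml; lra.
by rewrite !E //; exact: hd.
Qed.

Let sqrtc s : {for s, continuous (@Num.sqrt R)}. Proof. exact: sqrt_continuous. Qed.
Let Fc : continuous F.
Proof.
apply: (cont_from_pos F_out) => s s0.
by apply: (@continuous_comp _ _ _ (@Num.sqrt R) f); [exact: sqrtc|apply: fc; rewrite sqrtr_gt0].
Qed.
Let Gpc : continuous Gp.
Proof.
apply: (cont_from_pos Gp_out) => s s0.
apply: (near_pos (h := fun s => dfm (Num.sqrt s) / (2 * Num.sqrt s))) => //.
  by move=> t t0; rewrite /Gp t0.
have r0 : 0 < Num.sqrt s by rewrite sqrtr_gt0.
apply: continuousM.
  by apply: (@continuous_comp _ _ _ (@Num.sqrt R) dfm); [exact: sqrtc|exact: dfmc].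
apply: continuousV; first by rewrite gt_eqF // mulr_gt0.
by apply: continuousM; [exact: cvg_cst|exact: sqrtc].
Qed.
Let Lamc : continuous Lam.
Proof.
apply: cont_add; first by apply: cont_mul => //; exact: cont_cst.
by apply: cont_opp; apply: cont_mul => //; exact: cont_cst.
Qed.
Let Lpc : continuous Lp.
Proof.
apply: (cont_from_pos Lp_out) => s s0.
apply: (near_pos (h := fun s => Src s / (2 * s))) => //.
  by move=> t t0; rewrite /Lp t0.
apply: continuousM; last first.
  by apply: continuousV; [rewrite gt_eqF // mulr_gt0|apply: continuousM; [exact: cvg_cst|exact: cvg_id]].
apply: continuousB; last by apply: continuousM; [exact: cvg_cst|exact: Lamc].
apply: continuousB; last by apply: continuousM; [exact: cvg_cst|exact: Fc].
apply: continuousM; first exact: pw_cont.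
have -> : (fun s => F s `^ q) = (fun s => `|F s| `^ q).
  by apply/funext => t; rewrite ger0_norm // (profile_ge0 HP) ?sqrtr_ge0.
by apply: (@continuous_comp _ _ _ F (fun t : R => `|t| `^ q)); [exact: Fc|exact: cont_abs_powR].
Qed.

Let GD s : isD (fun s => F s `^ m) s (Gp s).
Proof.
case: (ltrP s 1) => s1.
  rewrite Gp_out; last by left; exact: ltW.
  apply: flat_below; last by left.
  by move=> t ht; rewrite F_out // powR0 // gt_eqF.
have s0 : 0 < s by apply: lt_le_trans s1.
have r0 : 0 < Num.sqrt s by rewrite sqrtr_gt0.
by rewrite /Gp s0; exact: (isD_comp (fmD r0) (isD_sqrt s0)).
Qed.

Let LD_inside s : 1 < s < c -> isD Lam s (Lp s).
Proof.
move=> /andP[s1 sc]; have s0 : 0 < s by apply: lt_trans s1.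
pose r := Num.sqrt s; have r0 : 0 < r by rewrite sqrtr_gt0.
have rs : s = r ^+ 2 by rewrite sqr_sqrtr // ltW.
have hr : 1 < r < xi0.
  have x0 : 0 < xi0 := lt_trans ltr01 x1.
  rewrite -[1]sqrtr1 -[xi0]gtr0_norm // -sqrtr_sqr !ltr_sqrt ?s1 //.
  exact: exprn_gt0.
have [h1 _ h3 ode] := profile_eq HP hr; rewrite -/fm -/dfm in h3 ode.
have f0 : 0 < f r := profile_gt0 HP hr.
set F1 := derive1 f r in ode; set D2 := derive1 dfm r in ode.
have rD : isD (@Num.sqrt R) s (2 * r)^-1 := isD_sqrt s0.
apply: isD_near (_ : isD (fun s => 2 * (dfm (Num.sqrt s) / (2 * Num.sqrt s)) - b * f (Num.sqrt s)) s _) _; last first.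
  exists s => // y hy; have y0 : 0 < y by move: hy; rewrite ltr_norml; lra.
  by rewrite /Lam /Gp y0.
have r2 : 2 * r != 0 by rewrite gt_eqF // mulr_gt0.
apply: isD_eq.
  apply: isD_sub (isD_mul (isD_cst s b) (isD_comp (derivable_isD h1) rD)).
  apply: isD_mul (isD_cst s 2) (isD_mul (isD_comp (derivable_isD h3) rD) _).
  exact: (@isD_inv _ (fun s => 2 * Num.sqrt s) s _ r2 (isD_mul (isD_cst s 2) rD)).
have D2E : D2 = - ((N%:R - 1) / r * dfm r) - alpha_of m b * f r + b * r * F1 + r `^ sigma * f r `^ q.
  by move: ode; move: (_ / r * _) => v; lra.
have ss : s `^ (sigma / 2) = r `^ sigma.
  rewrite rs -powR_mulrn ?(ltW r0) // -powRrM; congr (_ `^ _).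
  by rewrite mulrC divfK // pnatr_eq0.
rewrite /Lp s0 /Src /Lam /Gp s0 /F -/r -/D2 -/F1 ss D2E rs.
by field; rewrite gt_eqF.
Qed.

(** Inside the support this is the profile equation, in which all second derivatives
    are contained in the derivative of the flux; the edges are dealt with by
    [flat_ends]. *)
Let LD s : isD Lam s (Lp s).
Proof.
have e1 : (1 : R) <= 1 \/ c <= 1 by left.
have e2 : c <= 1 \/ c <= c by right.
apply: (flat_ends c1); [|exact: Lp_out|exact: Lp_out|exact: Lamc|exact: Lamc|exact: Lpc|exact: Lpc].
move=> t t1 tc; case: (ltgtP t 1) t1 => // t1 _.
  by rewrite Lp_out; [apply: flat_below => //; left|left; exact: ltW].
case: (ltgtP t c) tc => // tc _; first by apply: LD_inside; rewrite t1.
by rewrite Lp_out; [apply: flat_below => //; right|right; exact: ltW].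
Qed.

Let rel s : 0 <= s -> N%:R * Lam s + 2 * s * Lp s =
  s `^ (sigma / 2) * F s `^ q - (alpha_of m b + N%:R * b) * F s.
Proof.
rewrite le_eqVlt => /orP[/eqP <-|s0].
  have z : (0 : R) <= 1 \/ c <= 0 by left.
  by rewrite Lam_out // F_out // powR0 ?gt_eqF // !mulr0 mul0r subr0 addr0.
by rewrite /Lp s0 /Src; field; rewrite gt_eqF.
Qed.

Lemma selfsim_profile t (x : 'rV[R]_N) :
  exp_selfsimilar (alpha_of m b) b f t x = selfsim (alpha_of m b) b F t x.
Proof.
rewrite /exp_selfsimilar /selfsim /sq_profile /similarity; congr (_ * f _).
rewrite /enorm -/(normsq x) [RHS]sqrtrM ?normsq_ge0 //; congr (_ * _).
have -> : 2 * b * t = b * t + b * t by ring.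
by rewrite expRD -expr2 sqrtr_sqr gtr0_norm // expR_gt0.
Qed.

Theorem profile_weak : weak_solution m q sigma (fun t (x : 'rV[R]_N) => exp_selfsimilar (alpha_of m b) b f t x).
Proof.
have -> : (fun t (x : 'rV[R]_N) => exp_selfsimilar (alpha_of m b) b f t x) = selfsim (alpha_of m b) b F.
  by apply/funext => t; apply/funext => x; exact: selfsim_profile.
have a0 : 0 <= alpha_of m b by rewrite /alpha_of mulr_ge0 ?divr_ge0 ?(ltW b0) ?(ltW m1).
apply: (weak_solution_selfsim hm _ _ _ Fc GD Gpc LD Lpc rel a0).
- by rewrite /alpha_of; field; rewrite gt_eqF.
- by rewrite hsigma /alpha_of; field; rewrite gt_eqF.
by move=> s; apply: (profile_ge0 HP); exact: sqrtr_ge0.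
Qed.

End ProfileWeak.

(** * Existence and uniqueness of the solution *)

Theorem theorem1p1 (R : realType) (N : nat) (m q sigma : R)
    (hN : (1 <= N)%N) (hm : 1 < m) (hq0 : 0 < q) (hq1 : q < 1)
    (hsigma : sigma = 2 * (1 - q) / (m - 1)) (hmq : 2 < m + q) :
  exists (betas : R) (fs : R -> R) (Us : R -> 'rV[R]_N -> R),
    [/\ 0 < betas,
        (exists xi0 : R, 1 < xi0 /\
          profile_with_support N m q sigma (alpha_of m betas) betas 1 xi0 fs),
        (forall (t : R) (x : 'rV[R]_N),
          Us t x = exp_selfsimilar (alpha_of m betas) betas fs t x),
        weak_solution m q sigma Us &
        forall (beta : R) (f : R -> R) (U : R -> 'rV[R]_N -> R),
          0 < beta ->
          (exists xi0 : R, 1 < xi0 /\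
            profile_with_support N m q sigma (alpha_of m beta) beta 1 xi0 f) ->
          (forall (t : R) (x : 'rV[R]_N),
            U t x = exp_selfsimilar (alpha_of m beta) beta f t x) ->
          [/\ beta = betas,
              (forall xi : R, 0 <= xi -> f xi = fs xi) &
              (forall (t : R) (x : 'rV[R]_N), U t x = Us t x)]].
Proof.
have [b [xi0 [f [b0 x1 HP]]]] := profile_exists hN hm hq0 hq1 hsigma hmq.
exists b, f, (exp_selfsimilar (alpha_of m b) b f); split => //.
- by exists xi0.
- exact: (profile_weak hm hq0 hsigma b0 x1 HP).
move=> b' f' U b'0 [xi' [x1' HP']] UE.
have [bb ff] := profile_unique hN hm hq0 hq1 hsigma hmq x1' x1 HP' HP.
split => // t x; rewrite UE bb /exp_selfsimilar ff //.
by rewrite mulr_ge0 ?sqrtr_ge0 ?expR_ge0.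
Qed.
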